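(* Let $\sigma\in(0,2)$, $T>0$. Assume $F:\mathbb{R}\to\mathbb{R}$ satisfies $F(l_1)-F(l_2)\le L_F(l_1-l_2)^+$ for all $l_1,l_2\in\mathbb{R}$, with a constant $L_F>0$, and that $f\in C_b(\mathbb{R}^N\times[0,T])$ and $u_0\in C_b(\mathbb{R}^N)$. For each $h>0$ let $\tau=\tau(h)=T/M$ with $M=M(h)\in\mathbb{N}$, where $\tau\to0$ as $h\to0$ and the CFL condition $$\tau\le\frac{1}{L_FC_\sigma}h^\sigma$$ holds. Let $u$ be the bounded viscosity solution of $$u_t-F\big(-(-\Delta)^{\sigma/2}u\big)=f(x,t)\ \text{ in }\mathbb{R}^N\times(0,T],\qquad u(x,0)=u_0(x)\ \text{ in }\mathbb{R}^N,$$ and let $U_h:\mathbb{R}^N\times[0,T]\to\mathbb{R}$ be the bounded function defined by $U_h(x,t)=u_0(x)$ for $t\in[0,\tau)$ and $$U_h(x,t)=U_h(x,t-\tau)+\tau\Big[F\big(-(-\Delta_h)^{\sigma/2}U_h(x,t-\tau)\big)+f(x,t-\tau)\Big],\qquad t\in[\tau,T].$$ Then $U_h\to u$ locally uniformly on $\mathbb{R}^N\times[0,T]$ as $h\to0$.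
   Context: $(\cdot)^+=\max\{0,\cdot\}$; $C_b$ denotes bounded continuous functions. Fractional Laplacian: for $\phi\in C^2\cap C_b(\mathbb{R}^N)$, $-(-\Delta)^{\sigma/2}\phi(x)=\lim_{r\to0}\int_{|z|>r}(\phi(x+z)-\phi(x))\frac{c}{|z|^{N+\sigma}}dz$ with $c=\frac{2^\sigma\Gamma(\frac{N+\sigma}{2})}{\pi^{N/2}|\Gamma(-\frac\sigma2)|}$. For functions of $(x,t)$ it acts in $x$. Discrete operator: with $e_k$ the standard basis vectors, $\Delta_h\phi(x)=\sum_{k=1}^N\frac{\phi(x+he_k)-2\phi(x)+\phi(x-he_k)}{h^2}$, and for bounded $\phi$, $-(-\Delta_h)^{\sigma/2}\phi(x)=\frac{1}{|\Gamma(-\sigma/2)|}\int_0^\infty(e^{t\Delta_h}\phi(x)-\phi(x))\frac{dt}{t^{1+\sigma/2}}$, where $e^{t\Delta_h}\phi$ is the bounded solution of $\partial_tU=\Delta_hU$, $U(\cdot,0)=\phi$. Equivalently, $-(-\Delta_h)^{\sigma/2}\phi(x)=\sum_{\mathbf j\in\mathbb{Z}^N\setminus\{0\}}(\phi(x+h\mathbf j)-\phi(x))\kappa_{\sigma,h,\mathbf j}$ with $\kappa_{\sigma,h,\mathbf j}=\frac{1}{h^\sigma}\frac{1}{|\Gamma(-\sigma/2)|}\int_0^\infty e^{-2Nt}\prod_{i=1}^NI_{|\mathbf j_i|}(2t)\frac{dt}{t^{1+\sigma/2}}\ge0$, $I_m$ being the modified Bessel function of the first kind of order $m$. The constant $C_\sigma>0$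 (independent of $h$) is defined by $\sum_{\mathbf j\ne0}\kappa_{\sigma,h,\mathbf j}=C_\sigma h^{-\sigma}$. Viscosity solutions: a bounded upper semicontinuous $u$ on $\mathbb{R}^N\times[0,T]$ is a viscosity subsolution if $u(\cdot,0)\le u_0$ and, whenever $\phi\in C^2\cap C_b(\mathbb{R}^N\times[0,T])$ and $u-\phi$ has a global maximum over $\mathbb{R}^N\times[0,T]$ at $(x_0,t_0)$ with $t_0\in(0,T]$, then $\phi_t-F(-(-\Delta)^{\sigma/2}\phi)\le f$ at $(x_0,t_0)$. Supersolutions are bounded lower semicontinuous functions satisfying the analogous conditions with reversed inequalities and minima. A viscosity solution is both a sub- and a supersolution. (A unique bounded continuous viscosity solution exists.) *)

(* Defs.v *)
From HB Require Import structures.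
From mathcomp Require Import all_boot all_order all_algebra.
From mathcomp Require Import all_classical all_reals all_analysis.

Set Implicit Arguments.
Unset Strict Implicit.
Unset Printing Implicit Defensive.
Import Order.TTheory GRing.Theory Num.Theory.
Import numFieldNormedType.Exports.

Local Open Scope classical_set_scope.
Local Open Scope ring_scope.

(** The Lebesgue measure on R^n lives on n-tuples, which the library equips
    with the product of the Borel sigma-algebras; it is built by adding one
    coordinate at a time with the product measure. *)

Section cons_measure.
Context (R : realType) (n : nat).
Variable m : {sigma_finite_measure set (n.-tuple (measurableTypeR R)) -> \bar R}.

Definition cons_pair (p : measurableTypeR R * n.-tuple (measurableTypeR R)) :
  n.+1.-tuple (measurableTypeR R) := [the n.+1.-tuple _ of p.1 :: p.2].

Lemma measurable_cons_pair : measurable_fun [set: _] cons_pair.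
Proof. exact: (measurable_cons measurable_fst measurable_snd). Qed.

Definition cons_measure : set (n.+1.-tuple (measurableTypeR R)) -> \bar R :=
  pushforward (lebesgue_measure \x m)%E cons_pair.

Let cons_measure0 : cons_measure set0 = 0%E.
Proof. by rewrite /cons_measure /pushforward preimage_set0 measure0. Qed.

Let cons_measure_ge0 A : (0 <= cons_measure A)%E.
Proof. by rewrite /cons_measure /pushforward; exact: measure_ge0. Qed.

Let cons_measure_sigma_additive : semi_sigma_additive cons_measure.
Proof.
move=> F mF tF mUF; rewrite /cons_measure /pushforward preimage_bigcup.
have mpre A : measurable A -> measurable (cons_pair @^-1` A).
  by move=> mA; rewrite -[X in measurable X]setTI; exact: measurable_cons_pair.
apply: measure_semi_sigma_additive.
- by move=> k; exact: mpre.
- apply/trivIsetP => i j _ _ ij; rewrite -preimage_setI.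
  by move/trivIsetP : tF => /(_ _ _ _ _ ij) ->//; rewrite preimage_set0.
- by rewrite -preimage_bigcup; exact: mpre.
Qed.

HB.instance Definition _ := isMeasure.Build _ _ _ cons_measure
  cons_measure0 cons_measure_ge0 cons_measure_sigma_additive.

Let cons_measure_sigma_finite : sigma_finite setT cons_measure.
Proof.
have /sigma_finiteP[F [TF ndF Foo]] := sigma_finiteT (@lebesgue_measure R).
have /sigma_finiteP[G [TG ndG Goo]] := sigma_finiteT m.
pose hd (z : n.+1.-tuple (measurableTypeR R)) := tnth z ord0.
pose tl (z : n.+1.-tuple (measurableTypeR R)) : n.-tuple (measurableTypeR R) :=
  [tuple of behead z].
exists (fun k => hd @^-1` F k `&` tl @^-1` G k).
  apply/esym; rewrite -subTset => z _.
  have [i _ Fi] : (\bigcup_i F i) (hd z) by rewrite -TF.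
  have [j _ Gj] : (\bigcup_j G j) (tl z) by rewrite -TG.
  exists (maxn i j) => //; split => /=.
    by move: (hd z) Fi; exact/subsetPset/ndF/leq_maxl.
  by move: (tl z) Gj; exact/subsetPset/ndG/leq_maxr.
move=> k; have [mF Fk] := Foo k; have [mG Gk] := Goo k; split.
  apply: measurableI; rewrite -[X in measurable X]setTI.
    exact: measurable_tnth.
  exact: measurable_behead.
rewrite /cons_measure /pushforward.
rewrite (_ : _ @^-1` _ = F k `*` G k); last first.
  apply/seteqP; split => -[a z] /=;
    by rewrite /hd /tl /cons_pair /= (_ : [tuple of _] = z)//; apply: val_inj.
by rewrite product_measure1E// lte_mul_pinfty// ge0_fin_numE.
Qed.

HB.instance Definition _ := Measure_isSigmaFinite.Build _ _ _ cons_measure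
  cons_measure_sigma_finite.

End cons_measure.

Fixpoint lebesgueN (R : realType) (n : nat) :
    {sigma_finite_measure set (n.-tuple (measurableTypeR R)) -> \bar R} :=
  match n with
  | 0%N => \d_([tuple] : 0.-tuple (measurableTypeR R))
  | m.+1 => cons_measure (lebesgueN R m)
  end.

Section special_functions.
Context {R : realType}.
Implicit Types x t : R.

(** Euler's integral for [0 < x]; for [x <= 0] the recurrence
    [Gamma x = Gamma (x + n) / (x (x + 1) ... (x + n - 1))], with the least
    [n] such that [0 < x + n] (junk value [0] at the poles). *)
Definition Gamma_pos x : R :=
  \int[lebesgue_measure]_(t in `]0, +oo[) (t `^ (x - 1) * expR (- t)).

Definition Gamma x : R :=
  if 0 < x then Gamma_pos x
  else let n := (Num.truncn (- x)).+1 in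
       Gamma_pos (x + n%:R) / \prod_(i < n) (x + i%:R).

(** Modified Bessel function of the first kind of integer order [m]. *)
Definition besselI (m : nat) x : R :=
  limn (series (fun k : nat =>
    (x / 2) ^+ (2 * k + m) / (k`!%:R * (k + m)`!%:R))).

Definition fracLap_const (N : nat) (sigma : R) : R :=
  2 `^ sigma * Gamma ((N%:R + sigma) / 2) /
  (pi `^ (N%:R / 2) * `|Gamma (- (sigma / 2))|).

End special_functions.

Section operators.
Context {R : realType} {N : nat}.
Local Notation V := 'rV[R]_N.
Implicit Types (sigma h : R) (phi : V -> R) (x : V).

(** The norm [`| _ |] of the library on ['rV_N] is the sup norm. *)
Definition enorm x : R := Num.sqrt (\sum_(i < N) x 0 i ^+ 2).

Definition vec (z : N.-tuple (measurableTypeR R)) : V := \row_i tnth z i.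

(** [fracLap sigma] is the operator [- (- Laplacian)^(sigma/2)]: the minus sign
    is part of it, and likewise for [dfracLap] below. *)
Definition fracLap sigma phi x : R :=
  lim ((\int[lebesgueN R N]_(z in [set z | r < enorm (vec z)])
          ((phi (x + vec z) - phi x) *
           (fracLap_const N sigma / enorm (vec z) `^ (N%:R + sigma))))
       @[r --> 0^'+]).

Definition dLap h phi x : R :=
  \sum_(k < N) (phi (x + h *: delta_mx 0 k) - 2 * phi x
                + phi (x - h *: delta_mx 0 k)) / h ^+ 2.

Definition is_heat_solution h phi (U : R -> V -> R) : Prop :=
  [/\ [bounded U p.1 p.2 | p in [set p : R * V | 0 <= p.1]],
      U 0 = phi,
      forall x, {within `[0, +oo[, continuous (U ^~ x)} &
      forall (t : R) x, 0 < t -> is_derive t 1 (U ^~ x) (dLap h (U t) x)].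

(** [heat h t phi] is [e^(t dLap h) phi]; for bounded [phi] and [0 < h] the
    bounded solution exists, and its values at times [0 <= t] are unique. *)
Definition heat h t phi : V -> R :=
  xget (fun _ => phi) [set U | is_heat_solution h phi U] t.

Definition dfracLap sigma h phi x : R :=
  `|Gamma (- (sigma / 2))|^-1 *
  \int[lebesgue_measure]_(t in `]0, +oo[)
    ((heat h t phi x - phi x) / t `^ (1 + sigma / 2)).

End operators.

Section kernel_weights.
Context {R : realType}.

Definition kappa (N : nat) (sigma h : R) (j : 'rV[int]_N) : R :=
  (h `^ sigma)^-1 * `|Gamma (- (sigma / 2))|^-1 *
  \int[lebesgue_measure]_(t in `]0, +oo[)
    (expR (- (2 * N%:R * t)) * \prod_(i < N) besselI `|j ord0 i|%N (2 * t)
     / t `^ (1 + sigma / 2)).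

(** The sum of [kappa sigma h j] over nonzero [j] is [C_sigma h^-sigma] because
    [h] enters [kappa] only through the factor [h^-sigma]; [Csigma] is that sum
    at [h = 1]. *)
Definition Csigma (N : nat) (sigma : R) : R :=
  fine (\esum_(j in [set j : 'rV[int]_N | j != 0]) (kappa sigma 1 j)%:E).

End kernel_weights.

Section viscosity.
Context {R : realType} {N : nat}.
Local Notation V := 'rV[R]_N.

Definition strip (T : R) : set (V * R) := [set p | 0 <= p.2 <= T].

(** On a finite-dimensional space, C^k amounts to the existence and continuity
    of all iterated directional derivatives up to order [k]. *)
Fixpoint Ck (W : normedModType R) (k : nat) (phi : W -> R) : Prop :=
  continuous phi /\
  if k is m.+1 then
    forall v, (forall x, derivable phi x v) /\ Ck m ('D_v phi)
  else True.

(** Test functions on R^N x [0, T] are restrictions of functions that are C^2 on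
    R^N x R, so that [phi_t] makes sense at [t = T]; they are bounded only on
    R^N x [0, T]. *)
Definition test_function (T : R) (phi : V * R -> R) : Prop :=
  Ck 2 phi /\ [bounded phi p | p in strip T].

Definition lsc_on (A : set (V * R)) (u : V * R -> R) : Prop :=
  lower_semicontinuous (fun p : subspace A => (u p)%:E).

Definition usc_on (A : set (V * R)) (u : V * R -> R) : Prop :=
  lsc_on A (fun p => - u p).

Definition dt (phi : V * R -> R) : V * R -> R := 'D_((0, 1) : V * R) phi.

Variables (sigma T : R) (F : R -> R) (f : V * R -> R) (u0 : V -> R).

Definition viscosity_subsolution (u : V * R -> R) : Prop :=
  [/\ [bounded u p | p in strip T], usc_on (strip T) u,
      forall x, u (x, 0) <= u0 x &
      forall phi x t, test_function T phi -> 0 < t <= T ->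
        (forall p, strip T p -> u p - phi p <= u (x, t) - phi (x, t)) ->
        dt phi (x, t) - F (fracLap sigma (fun y => phi (y, t)) x) <= f (x, t)].

Definition viscosity_supersolution (u : V * R -> R) : Prop :=
  [/\ [bounded u p | p in strip T], lsc_on (strip T) u,
      forall x, u0 x <= u (x, 0) &
      forall phi x t, test_function T phi -> 0 < t <= T ->
        (forall p, strip T p -> u (x, t) - phi (x, t) <= u p - phi p) ->
        f (x, t) <= dt phi (x, t) - F (fracLap sigma (fun y => phi (y, t)) x)].

Definition viscosity_solution (u : V * R -> R) : Prop :=
  viscosity_subsolution u /\ viscosity_supersolution u.

Definition explicit_scheme (h tau : R) (U : V * R -> R) : Prop :=
  [/\ [bounded U p | p in strip T],
      forall x t, 0 <= t < tau -> U (x, t) = u0 x &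
      forall x t, tau <= t <= T ->
        U (x, t) = U (x, t - tau) +
          tau * (F (dfracLap sigma h (fun y => U (y, t - tau)) x)
                 + f (x, t - tau))].

End viscosity.

(* Main.v *)
Require Import Defs.
From HB Require Import structures.
From mathcomp Require Import all_boot all_order all_algebra.
From mathcomp Require Import all_classical all_reals all_analysis.
From mathcomp Require Import measurable_realfun lra ring zify.
Set Implicit Arguments.
Unset Strict Implicit.
Unset Printing Implicit Defensive.
Import Order.TTheory GRing.Theory Num.Theory.
Import numFieldNormedType.Exports.
Local Open Scope classical_set_scope.
Local Open Scope ring_scope.

(** Both [U_h] and [u] are compared with the same smooth approximate solutions,
    so that no comparison principle between viscosity sub- and supersolutions is
    needed. For every box and every number of time steps of length [lam] there
    are trigonometric polynomials [w_0, ..., w_n] in the space variable with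
    [(w_k - w_(k-1)) / lam = F (L w_k) + f (., t_k)] on the box, up to a small
    error, where [L] is the fractional Laplacian. They are Fejer averages over a
    periodic grid of the solutions of an implicit Euler scheme, in which [L] is
    replaced by the discrete operator on that grid and [F] by [F + eta id]. The
    averages commute with the discrete operator; they commute with [F] up to a
    small error, because strict monotonicity of [F + eta id] turns the Lipschitz
    bound of the increments of the scheme into one for the discrete Laplacian of
    its solution, with a constant which does not depend on the grid.

    A near-maximum of [v (x, s) - w_k x - (s - t_k)^2 / delta - psi x - eta s],
    with [v] either [u] or [U_h] and [psi] a penalization at infinity, gives two
    opposite inequalities: the equation of [w_k] in the discrete time [k], and the
    equation of [v] in the continuous time [s]. For [u] the functions [w_k] and
    [psi] are part of an admissible test function; for [U_h] the time step is
    monotone by the CFL condition, since [1 - p_t(0)], with [p] the heat kernel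
    of the lattice, has the integral [C_sigma] against the stable measure in [t].
    The lower bounds follow from the same argument for [-u], [-U_h], [-w_k] and
    [l |-> - F (- l)].

    A cosine is an eigenfunction of [L] and of its discretization, so that the
    consistency on trigonometric polynomials is the convergence of the symbols.
    The symbol of [L] is computed by writing [|z|^(-N-sigma)] as a superposition
    of Gaussians. *)

(** * Integrals on the half line and the Gamma function *)

(** What shapes the proof is the order in which the parameters are chosen. The error [e] and the
    size [P] of the box come first, then the initial profile [w0]. Its constant [C] controls the
    drift of every run of the implicit scheme, whatever the number of steps; hence the initial layer
    [rho] and the time penalty [delta] are fixed before that number. For a given number of steps the
    regularization [eta] is chosen against a bound on the discrete operator applied to the solution,
    a bound which involves neither [eta] nor the grid; then the degree of the Fejer kernel is chosen
    against Lipschitz constants which do not involve the grid; only then is the grid refined. A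
    Fejer kernel of fixed degree is one fixed trigonometric polynomial, and the consistency error of
    an average is at most the supremum of the averaged values times the error on this kernel. The
    step [h] of the explicit scheme comes last. Since the [w_k] are smooth in space, only the time
    variable is doubled, and the two equations are compared at the same point [x]. *)

Section half_line.
Context {R : realType}.
Implicit Types (f g F : R -> R) (r x : R).
Local Notation mu := (@lebesgue_measure R).
Local Notation pos := (`]0, +oo[%classic : set R).

Definition cts_pos f := forall x, 0 < x -> {for x, continuous f}.

(** A compact exhaustion of the half line suited to two substitutions: scaling by [r] maps [exh 1 n]
    onto [exh r n], and inversion maps [exh 1 n] onto itself. *)
Definition exh r (n : nat) : set R := `[r / n.+2%:R, r * n.+2%:R]%classic.

Lemma cts_pos_measurable f : cts_pos f -> measurable_fun pos f.
Proof.
move=> cf; apply: open_continuous_measurable_fun; first exact: interval_open.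
by move=> x /[!inE]/= /[!in_itv]/= /[!andbT] x0; exact: cf.
Qed.

Lemma exh_pos r n : 0 < r -> exh r n `<=` pos.
Proof.
move=> r0 x; rewrite /exh/= !in_itv/= andbT => /andP[+ _].
by apply: lt_le_trans; rewrite divr_gt0.
Qed.

Lemma cts_pos_exh f r n : 0 < r -> cts_pos f -> {within exh r n, continuous f}.
Proof.
move=> r0 cf; apply: continuous_in_subspaceT => x /[!inE] /(exh_pos r0).
by rewrite /= in_itv/= andbT => x0; exact: cf.
Qed.

Lemma exh_bigcup r : 0 < r -> \bigcup_n exh r n = pos.
Proof.
move=> r0; apply/seteqP; split=> [x [n _]|x /=]; first exact: exh_pos.
rewrite in_itv/= andbT => x0.
exists (Num.truncn (Num.max (x / r) (r / x))) => //; rewrite /exh/= in_itv/=.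
set m := Num.max _ _; have : m < (Num.truncn m).+2%:R.
  by rewrite (lt_trans (truncnS_gt _))// ltr_nat.
rewrite /m gt_max => /andP[h1 h2]; apply/andP; split.
  by rewrite ler_pdivrMr// -ler_pdivrMl// mulrC ltW.
by rewrite -ler_pdivrMl// mulrC ltW.
Qed.

Lemma exh_nd r : 0 < r -> nondecreasing_seq (exh r).
Proof.
move=> r0 m n mn; rewrite subsetEset => x; rewrite /exh/= !in_itv/= => /andP[h1 h2].
apply/andP; split.
  by rewrite (le_trans _ h1)// ler_pM2l// lef_pV2 ?posrE// ler_nat.
by rewrite (le_trans h2)// ler_pM2l// ler_nat.
Qed.

Lemma cvg_integral_exh f r : 0 < r -> (forall x, 0 < x -> 0 <= f x) -> cts_pos f ->
  (\int[mu]_(x in exh r n) (f x)%:E)%E @[n --> \oo] -->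
  (\int[mu]_(x in pos) (f x)%:E)%E.
Proof.
move=> r0 f0 cf; rewrite -(exh_bigcup r0).
apply: ge0_nondecreasing_set_cvg_integral => //.
- exact: exh_nd.
- by move=> n; exact: measurable_itv.
- move=> n; apply/measurable_EFinP.
  by apply: measurable_funS (cts_pos_measurable cf) => //; exact: exh_pos.
- move=> n x /(exh_pos r0); rewrite /= in_itv/= andbT => x0.
by rewrite lee_fin f0.
Qed.

Lemma derivable_LR (F dF : R -> R) a b : a < b ->
  (forall x, a <= x <= b -> is_derive x 1 F (dF x)) ->
  derivable_oo_LRcontinuous F a b.
Proof.
move=> ab dFE.
have cF x : a <= x <= b -> {for x, continuous F}.
  move=> xab; apply/differentiable_continuous/derivable1_diffP.
  exact: (@ex_derive _ _ _ _ _ _ _ (dFE _ xab)).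
split.
- move=> x; rewrite in_itv/= => /andP[ax xb].
  by apply: (@ex_derive _ _ _ _ _ _ _ (dFE _ _)); rewrite !ltW.
- by apply: cvg_at_right_filter; apply: cF; rewrite lexx ltW.
- by apply: cvg_at_left_filter; apply: cF; rewrite lexx ltW.
Qed.

Lemma exh_lt r n : 0 < r -> r / n.+2%:R < r * n.+2%:R.
Proof.
by move=> r0; rewrite ltr_pM2l// -div1r ltr_pdivrMr// -natrM ltr1n.
Qed.

Lemma cvg_deriv_continuous (F dF : R -> R) a b : a < b ->
  (forall x, a <= x <= b -> is_derive x 1 F (dF x)) ->
  (forall x, a <= x <= b -> {for x, continuous dF}) ->
  [/\ {in `]a, b[, continuous F^`()%classic}, cvg (F^`()%classic x @[x --> a^'+]) &
    cvg (F^`()%classic x @[x --> b^'-])].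
Proof.
move=> ab dFE cdF.
have E x : a <= x <= b -> F^`()%classic x = dF x.
  by move=> xab; rewrite derive1E (@derive_val _ _ _ _ _ _ _ (dFE _ xab)).
split.
- move=> x; rewrite in_itv/= => /andP[ax xb].
  have cx : {for x, continuous dF} by apply: cdF; rewrite !ltW.
  rewrite /prop_for /continuous_at E ?ltW//; apply: cvg_trans cx.
  apply: near_eq_cvg; near=> y; rewrite E//; apply/andP; split.
    by near: y; apply: (cvgr_ge x) => //; exact: cvg_id.
  by near: y; apply: (cvgr_le x) => //; exact: cvg_id.
- apply/cvg_ex; exists (dF a).
  have : dF x @[x --> a^'+] --> dF a.
    by apply: cvg_at_right_filter; apply: cdF; rewrite lexx ltW.
  apply: cvg_trans; apply: near_eq_cvg; near=> y; rewrite E//; apply/andP; split.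
    by near: y; exact: nbhs_right_ge.
  by near: y; exact: nbhs_right_le.
- apply/cvg_ex; exists (dF b).
  have : dF x @[x --> b^'-] --> dF b.
    by apply: cvg_at_left_filter; apply: cdF; rewrite lexx ltW.
  apply: cvg_trans; apply: near_eq_cvg; near=> y; rewrite E//; apply/andP; split.
    by near: y; exact: nbhs_left_ge.
  by near: y; exact: nbhs_left_le.
Unshelve. all: by end_near. Qed.

Lemma integral_pos_scale f r : 0 < r -> (forall x, 0 < x -> 0 <= f x) -> cts_pos f ->
  (\int[mu]_(x in pos) (f x)%:E = \int[mu]_(x in pos) (f (r * x) * r)%:E)%E.
Proof.
move=> r0 f0 cf.
pose F x := r * x.
have dF x : is_derive x 1 F r.
  have := @is_deriveZ _ _ _ (@id R) r x 1 1 (is_derive_id _ _).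
  by rewrite -[r *: 1]/(r * 1) mulr1.
have dF1 : F^`()%classic = cst r.
  by apply/funext => x; rewrite derive1E (@derive_val _ _ _ _ _ _ _ (dF x)).
have c1 := cvg_integral_exh r0 f0 cf.
have c2 : (\int[mu]_(x in exh 1 n) (f (r * x) * r)%:E)%E @[n --> \oo] -->
    (\int[mu]_(x in pos) (f (r * x) * r)%:E)%E.
  apply: cvg_integral_exh => //.
    by move=> x x0; rewrite mulr_ge0 ?(ltW r0)// f0// mulr_gt0.
  move=> x x0; apply: cvgM; last exact: cvg_cst.
  apply: (@continuous_comp _ _ _ F f); last by apply: cf; exact: mulr_gt0.
  exact/differentiable_continuous/derivable1_diffP.
apply: (cvg_unique _ c1) => //; rewrite (_ : (fun n => _) = fun n =>
  (\int[mu]_(x in exh 1 n) (f (r * x) * r)%:E)%E)//.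
apply/funext => n; have nn := exh_lt n (@ltr01 R).
have := @integration_by_substitution_increasing _ F f _ _ (ltW nn).
rewrite dF1 /F mulrA mulr1 mulrA mulr1; apply => //.
- by move=> x y _ _ xy; rewrite ltr_pM2l.
- by move=> x _; exact: cvg_cst.
- exact: is_cvg_cst.
- exact: is_cvg_cst.
- exact: (@derivable_LR _ (cst r)).
- exact: cts_pos_exh.
Qed.

Lemma is_derive_inv x : 0 < x -> is_derive x 1 (fun y : R => y^-1) (- x ^- 2).
Proof.
move=> x0; have := @is_deriveV _ id x 1 1 (lt0r_neq0 x0) (is_derive_id _ _).
by rewrite -[_ *: 1]/(_ * 1) mulr1.
Qed.

Lemma cts_pos_inv : cts_pos (fun x => x^-1).
Proof. by move=> x x0; apply: inv_continuous; rewrite gt_eqF. Qed.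

Lemma cts_posM f g : cts_pos f -> cts_pos g -> cts_pos (fun x => f x * g x).
Proof. by move=> cf cg x x0; apply: cvgM; [exact: cf|exact: cg]. Qed.

Lemma cts_pos_comp f g : (forall x, 0 < x -> 0 < g x) -> cts_pos f -> cts_pos g ->
  cts_pos (f \o g).
Proof.
by move=> g0 cf cg x x0; apply: continuous_comp; [exact: cg|apply: cf; exact: g0].
Qed.

Lemma cts_pos_invX2 : cts_pos (fun x => x ^- 2).
Proof.
by move=> x x0; apply: cvgV; [rewrite expf_neq0// gt_eqF|exact: exprn_continuous].
Qed.

Lemma integral_itv_inv f (a b : R) : 0 < a -> a < b -> cts_pos f ->
  (\int[mu]_(x in `[b^-1%R, a^-1%R]) (f x)%:E =
   \int[mu]_(x in `[a, b]) (f x^-1 * x ^- 2)%:E)%E.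
Proof.
move=> a0 ab cf; pose F x : R := x^-1.
have pab x : a <= x <= b -> 0 < x by case/andP => + _; exact: lt_le_trans.
have dFE x : a <= x <= b -> is_derive x 1 F (- x ^- 2).
  by move/pab; exact: is_derive_inv.
have cdF x : a <= x <= b -> {for x, continuous (fun x : R => - x ^- 2)}.
  by move/pab => x0; apply: cvgN; exact: cts_pos_invX2.
have [d1 d2 d3] := cvg_deriv_continuous ab dFE cdF.
have dLR := derivable_LR ab dFE.
have hF : {in `[a, b] &, {homo F : x y /~ (x < y)%R}}.
  by move=> x y; rewrite !in_itv/= => /pab x0 /pab y0 xy; rewrite /F ltf_pV2// posrE.
have cfF : {within `[F b, F a], continuous f}.
  apply: continuous_in_subspaceT => x /[!inE]/=; rewrite in_itv/= => /andP[h _].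
  by apply: cf; rewrite (lt_le_trans _ h)// invr_gt0 (lt_trans a0).
rewrite -[X in `[X, _]]/(F b) -[X in `[_, X]]/(F a).
rewrite (integration_by_substitution_decreasing (ltW ab) hF d1 d2 d3 dLR cfF).
apply: eq_integral => x; rewrite inE/= in_itv/= => /dFE dFx; congr EFin.
by rewrite -[LHS]/((f (F x) * - F^`()%classic x)) derive1E derive_val opprK.
Qed.

Lemma integral_pos_inv f : (forall x, 0 < x -> 0 <= f x) -> cts_pos f ->
  (\int[mu]_(x in pos) (f x)%:E = \int[mu]_(x in pos) (f x^-1 * x ^- 2)%:E)%E.
Proof.
move=> f0 cf.
have c1 := cvg_integral_exh ltr01 f0 cf.
have c2 : (\int[mu]_(x in exh 1 n) (f x^-1 * x ^- 2)%:E)%E @[n --> \oo] -->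
    (\int[mu]_(x in pos) (f x^-1 * x ^- 2)%:E)%E.
  apply: cvg_integral_exh => //.
    by move=> x x0; rewrite mulr_ge0 ?invr_ge0 ?exprn_ge0 ?(ltW x0)// f0// invr_gt0.
  apply: cts_posM; last exact: cts_pos_invX2.
  apply: (@cts_pos_comp f (fun x => x^-1)) => //.
    by move=> x; rewrite invr_gt0.
  exact: cts_pos_inv.
apply: (cvg_unique _ c1) => //; rewrite (_ : (fun n => _) = fun n =>
  (\int[mu]_(x in exh 1 n) (f x^-1 * x ^- 2)%:E)%E)//.
apply/funext => n; have nn := exh_lt n (@ltr01 R).
have a0 : 0 < 1 / n.+2%:R :> R by rewrite divr_gt0.
have E1 : (1 * n.+2%:R)^-1 = 1 / n.+2%:R :> R by rewrite !mul1r.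
have E2 : (1 / n.+2%:R)^-1 = 1 * n.+2%:R :> R by rewrite !mul1r invrK.
by have := integral_itv_inv a0 nn cf; rewrite E1 E2.
Qed.

Lemma integral_itv_FTC (f g F : R -> R) (a b : R) : 0 < a -> a < b ->
  cts_pos f -> cts_pos g ->
  (forall x, 0 < x -> is_derive x 1 F (f x - g x)) ->
  (\int[mu]_(x in `[a, b]) (f x)%:E =
   \int[mu]_(x in `[a, b]) (g x)%:E + (F b - F a)%:E)%E.
Proof.
move=> a0 ab cf cg dF.
have pab x : a <= x <= b -> 0 < x by case/andP => + _; exact: lt_le_trans.
have ct h : cts_pos h -> {within `[a, b], continuous h}.
  move=> ch; apply: continuous_in_subspaceT => x /[!inE]/=.
  by rewrite in_itv/= => /pab; exact: ch.
have ig h : cts_pos h -> mu.-integrable `[a, b] (EFin \o h).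
  by move=> ch; apply: continuous_compact_integrable; [exact: segment_compact|exact: ct].
have cfg : cts_pos (fun x => f x - g x).
  by move=> x x0; apply: cvgB; [exact: cf|exact: cg].
have dLR : derivable_oo_LRcontinuous F a b.
  by apply: (@derivable_LR _ _ _ _ ab) => x /pab; exact: dF.
have E : {in `]a, b[, F^`()%classic =1 (fun x => f x - g x)}.
  move=> x; rewrite in_itv/= => /andP[ax xb].
  have dFx := dF x (lt_trans a0 ax).
  by rewrite derive1E derive_val.
have := continuous_FTC2 ab (ct _ cfg) dLR E.
under eq_integral do rewrite EFinB.
rewrite integralB//; [|exact: ig..].
rewrite -EFinB => <-; rewrite addeC subeK//.
exact: integrable_fin_num (ig _ cg).
Qed.

Lemma cvg_exh_lo (T : topologicalType) (F : R -> T) (l : T) :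
  F x @[x --> 0^'+] --> l -> F (1 / n.+2%:R) @[n --> \oo] --> l.
Proof.
apply: cvg_comp; have : (1 / n.+2%:R : R) @[n --> \oo] --> 0.
  under eq_fun do rewrite div1r.
  have := @cvg_harmonic R; rewrite /harmonic -(cvg_shiftn 1).
  by under eq_fun do rewrite addn1.
move=> h A [e/= e0 eA].
move/cvgrPdist_lt : h => /(_ _ e0); apply: filterS => n /= hn.
by apply: eA => //; rewrite divr_gt0.
Qed.

Lemma cvg_exh_hi (T : topologicalType) (F : R -> T) (l : T) :
  F x @[x --> +oo] --> l -> F (1 * n.+2%:R) @[n --> \oo] --> l.
Proof.
apply: cvg_comp; under eq_fun do rewrite mul1r.
have := @cvgr_idn R; rewrite -(cvg_shiftn 2).
by under eq_fun do rewrite addn2.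
Qed.

(** The derivative is split into two nonnegative parts, so that the formula makes sense in the
    extended reals before either integral is known to be finite. *)
Lemma integral_pos_FTC (f g F : R -> R) (l0 l1 : R) :
  (forall x, 0 < x -> 0 <= f x) -> (forall x, 0 < x -> 0 <= g x) ->
  cts_pos f -> cts_pos g ->
  (forall x, 0 < x -> is_derive x 1 F (f x - g x)) ->
  F x @[x --> 0^'+] --> l0 -> F x @[x --> +oo] --> l1 ->
  (\int[mu]_(x in pos) (f x)%:E = \int[mu]_(x in pos) (g x)%:E + (l1 - l0)%:E)%E.
Proof.
move=> f0 g0 cf cg dF F0 F1.
have c1 := cvg_integral_exh ltr01 f0 cf.
have c2 := cvg_integral_exh ltr01 g0 cg.
apply: (cvg_unique _ c1) => //.
rewrite (_ : (fun n => _) = fun n =>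
  (\int[mu]_(x in exh 1 n) (g x)%:E + (F (1 * n.+2%:R) - F (1 / n.+2%:R))%:E)%E).
  apply: cvgeD => //; first by rewrite fin_num_adde_defl.
  apply: cvg_EFin; first exact: nearW.
  by apply: cvgB; [exact: cvg_exh_hi|exact: cvg_exh_lo].
apply/funext => n; apply: integral_itv_FTC => //; last exact: exh_lt.
Qed.
End half_line.

(** * Euler's integral and the stable measure on the half line *)

Section gamma.
Context {R : realType}.
Implicit Types (a b x t : R).
Local Notation mu := (@lebesgue_measure R).
Local Notation pos := (`]0, +oo[%classic : set R).

Lemma is_derive_continuous (F : R -> R) x d : is_derive x 1 F d ->
  {for x, continuous F}.
Proof. by move=> dF; apply/differentiable_continuous/derivable1_diffP. Qed.

Lemma cts_pos_powR a : cts_pos (fun x : R => x `^ a).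
Proof. by move=> x x0; apply: is_derive_continuous; exact: is_derive1_powR. Qed.

Lemma is_derive_expRM b x : is_derive x 1 (fun x => expR (b * x)) (b * expR (b * x)).
Proof.
have h : is_derive x 1 ( *%R b) b.
  have := @is_deriveZ _ _ _ (@id R) b x 1 1 (is_derive_id _ _).
  by rewrite -[b *: 1]/(b * 1) mulr1.
by rewrite mulrC; exact: (@is_derive1_comp _ expR ( *%R b) x _ _ (is_derive_expR _) h).
Qed.

Lemma cts_expRM b : continuous (fun x => expR (b * x)).
Proof. by move=> x; exact: is_derive_continuous (is_derive_expRM _ _). Qed.

Lemma is_derive_expN x : is_derive x 1 (fun x : R => expR (- x)) (- expR (- x)).
Proof.
have -> : (fun x : R => expR (- x)) = fun x => expR (-1 * x).
  by apply/funext => y; rewrite mulN1r.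
by have := is_derive_expRM (-1) x; rewrite !mulN1r.
Qed.

Definition gammaI a : \bar R := (\int[mu]_(t in pos) (t `^ (a - 1) * expR (- t))%:E)%E.

Lemma gammaI_cts a : cts_pos (fun t : R => t `^ (a - 1) * expR (- t)).
Proof.
apply: cts_posM; first exact: cts_pos_powR.
by move=> x _; exact: is_derive_continuous (is_derive_expN x).
Qed.

Lemma gammaI_ge0 a t : 0 <= t `^ (a - 1) * expR (- t).
Proof. by rewrite mulr_ge0 ?powR_ge0 ?expR_ge0. Qed.

Lemma powR_expN_cvg0 a : t `^ a * expR (- t) @[t --> +oo] --> 0.
Proof.
pose n := (Num.truncn a).+1; have an : a <= n%:R by rewrite ltW// truncnS_gt.
have cV : (t^-1 : R) @[t --> +oo] --> 0.
  apply: (gtr0_cvgV0 _).2; last exact: cvg_id.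
  by exists 0; split.
have c0 : n.+1`!%:R * t^-1 @[t --> +oo] --> (0:R).
  by rewrite -[X in _ --> X](mulr0 n.+1`!%:R); apply: cvgM; [exact: cvg_cst|].
apply: (@squeeze_cvgr _ _ _ _ (fun=> 0) (fun t => n.+1`!%:R * t^-1)); [|exact: cvg_cst|exact: c0].
(* The term of order [n.+1] in the series of [expR t] absorbs [t ^+ n] and leaves one power of [t]
   to spare. *)
near=> t; have t1 : 1 <= t by near: t; exact: nbhs_pinfty_ge.
have t0 : 0 < t by exact: lt_le_trans t1.
rewrite mulr_ge0 ?powR_ge0 ?expR_ge0//= expRN ler_pdivrMr ?expR_gt0//.
rewrite mulrAC ler_pdivlMr//; apply: (@le_trans _ _ (t ^+ n * t)).
  by rewrite ler_pM2r//; have := ler_powR t1 an; rewrite powR_mulrn// ltW.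
rewrite -exprSr mulrC -ler_pdivrMr ?ltr0n ?fact_gt0//.
by apply: le_trans (expR_ge1Dxn n (ltW t0)); rewrite lerDr.
Unshelve. all: by end_near. Qed.

Lemma expN_cvg0 : expR (- t) @[t --> +oo] --> (0:R).
Proof. exact: cvgr_expR. Qed.

Lemma integral_posZ (f : R -> R) (k : R) : 0 <= k -> (forall x, 0 < x -> 0 <= f x) ->
  measurable_fun pos f ->
  (\int[mu]_(x in pos) (k * f x)%:E = k%:E * \int[mu]_(x in pos) (f x)%:E)%E.
Proof.
move=> k0 f0 mf; under eq_integral do rewrite EFinM.
rewrite ge0_integralZl//; first exact/measurable_EFinP.
by move=> x; rewrite /= in_itv/= andbT => /f0; rewrite lee_fin.
Qed.

Lemma gammaI_rec a : 0 < a -> gammaI (a + 1) = (a%:E * gammaI a)%E.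
Proof.
move=> a0; rewrite /gammaI -(@integral_posZ _ _ (ltW a0) (fun t _ => gammaI_ge0 a t)
  (cts_pos_measurable (@gammaI_cts a))).
have cg : cts_pos (fun t => a * (t `^ (a - 1) * expR (- t))).
  by apply: cts_posM; [move=> x _; exact: cvg_cst|exact: gammaI_cts].
have dF x : 0 < x -> is_derive x 1 (fun t => - (t `^ a * expR (- t)))
    (x `^ (a + 1 - 1) * expR (- x) - a * (x `^ (a - 1) * expR (- x))).
  move=> x0; have h1 := is_derive1_powR a x0; have h2 := is_derive_expN x.
  have h := is_deriveN (is_deriveM h1 h2); rewrite addrK.
  apply: (is_derive_eq h); rewrite -[_ *: _]/(_ * _) -[X in - (_ + X)]/(_ * _); ring.
have l0 : - (t `^ a * expR (- t)) @[t --> 0^'+] --> 0.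
  have h : t `^ a * expR (- t) @[t --> 0^'+] --> 0 * expR (- 0).
    apply: cvgM; first exact: powR_cvg0.
    by apply: cvg_at_right_filter; exact: is_derive_continuous (is_derive_expN 0).
  by have := cvgN h; rewrite mul0r !oppr0; apply.
have l1 : - (t `^ a * expR (- t)) @[t --> +oo] --> 0.
  by have := cvgN (powR_expN_cvg0 a); rewrite oppr0; apply.
have g0 x : 0 < x -> 0 <= a * (x `^ (a - 1) * expR (- x)).
  by move=> _; rewrite mulr_ge0 ?gammaI_ge0// ltW.
rewrite (integral_pos_FTC (fun x _ => gammaI_ge0 (a + 1) x) g0 (@gammaI_cts (a + 1)) cg dF l0 l1).
by rewrite subrr adde0.
Qed.

Lemma gammaI1 : gammaI 1 = 1%E.
Proof.
rewrite /gammaI.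
have dF x : 0 < x -> is_derive x 1 (fun t => - expR (- t))
    (x `^ (1 - 1) * expR (- x) - 0).
  move=> x0; have := is_deriveN (is_derive_expN x).
  by rewrite subrr powRr0 mul1r subr0 opprK.
have l0 : - expR (- t) @[t --> 0^'+] --> (- 1 : R).
  have h : expR (- t) @[t --> 0^'+] --> (expR (- 0) : R).
    by apply: cvg_at_right_filter; exact: is_derive_continuous (is_derive_expN 0).
  by have := cvgN h; rewrite oppr0 expR0; apply.
have l1 : - expR (- t) @[t --> +oo] --> (0 : R).
  by have := cvgN expN_cvg0; rewrite oppr0; apply.
rewrite (integral_pos_FTC (fun x _ => gammaI_ge0 1 x) (fun _ _ => lexx _) (@gammaI_cts 1)
  (fun x _ => cvg_cst _) dF l0 l1).
by rewrite integral0 add0e sub0r opprK.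
Qed.

Lemma le_integral_pos (f g : R -> R) : (forall x : R, 0 < x -> 0 <= f x <= g x) ->
  measurable_fun pos f -> measurable_fun pos g ->
  (\int[mu]_(x in pos) (f x)%:E <= \int[mu]_(x in pos) (g x)%:E)%E.
Proof.
move=> fg mf mg; apply: ge0_le_integral => //.
- by move=> x; rewrite /= in_itv/= andbT lee_fin => /fg/andP[].
- exact/measurable_EFinP.
- exact/measurable_EFinP.
- by move=> x; rewrite /= in_itv/= andbT lee_fin => /fg/andP[].
Qed.

(** For an order between 1 and 2 the integrand is below the sum of those of orders 1 and 2, which
    are known. The recurrence carries finiteness upwards to all larger orders and, read backwards,
    down to every positive one. *)
Lemma gammaI_lt_pinfty a : 0 < a -> (gammaI a < +oo)%E.
Proof.
have base b : 1 <= b <= 2 -> (gammaI b < +oo)%E.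
  move=> /andP[b1 b2].
  apply: (@le_lt_trans _ _ (gammaI 1 + gammaI 2)%E); last first.
    by rewrite -[2]/(1 + 1) gammaI_rec// gammaI1 mule1 ltry.
  have mg c : measurable_fun pos (EFin \o (fun t : R => t `^ (c - 1) * expR (- t))).
    apply/measurable_EFinP; exact: cts_pos_measurable (@gammaI_cts _).
  have gg c (x : R) : pos x -> (0 <= (x `^ (c - 1) * expR (- x))%:E)%E.
    by move=> _; rewrite lee_fin gammaI_ge0.
  have -> : (gammaI 1 + gammaI 2 = \int[mu]_(t in pos)
      (t `^ (1 - 1) * expR (- t) + t `^ (2 - 1) * expR (- t))%:E)%E.
    under [RHS]eq_integral do rewrite EFinD.
    by rewrite ge0_integralD//; [exact: gg|exact: mg|exact: gg|exact: mg].
  apply: le_integral_pos; last 2 first.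
  - exact: cts_pos_measurable (@gammaI_cts _).
  - by apply: measurable_funD; exact: cts_pos_measurable (@gammaI_cts _).
  move=> x x0; rewrite gammaI_ge0/= -mulrDl ler_pM2r ?expR_gt0//.
  rewrite subrr powRr0 (_ : 2 - 1 = 1); last by ring.
  rewrite powRr1 ?(ltW x0)//.
  have [x1|x1] := lerP x 1.
    rewrite (@le_trans _ _ 1)// ?lerDl ?(ltW x0)//.
    rewrite -[leRHS](powRr0 x); apply: ger_powR; rewrite ?x0 ?subr_ge0//.
  rewrite (@le_trans _ _ x)// ?lerDr//.
  rewrite -{2}(powRr1 (ltW x0)); apply: ler_powR; first exact: ltW.
  by rewrite lerBlDr (le_trans b2).
have step n : forall b, 1 <= b <= n.+2%:R -> (gammaI b < +oo)%E.
  elim: n => [//|n IH] b /andP[b1 bn].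
  have [b2|b2] := lerP b 2; first by apply: base; rewrite b1.
  rewrite -(subrK 1 b) gammaI_rec ?subr_gt0 ?(lt_trans _ b2) ?ltr1n//.
  rewrite lte_mul_pinfty ?lee_fin ?subr_ge0//; apply: IH.
  rewrite lerBrDr ltW//= lerBlDr (le_trans bn)//.
  by rewrite -natr1.
move=> a0; have : (gammaI (a + 1) < +oo)%E.
  apply: (step (Num.truncn a)); rewrite lerDr ltW//= -natr1 lerD2r.
  by rewrite ltW// truncnS_gt.
rewrite gammaI_rec//; apply: contraTT; rewrite -!leNgt !leye_eq => /eqP ->.
by rewrite gt0_muley.
Qed.

Lemma gammaI_gt0 a : 0 < a -> (0 < gammaI a)%E.
Proof.
move=> a0; rewrite lt0e integral_ge0 ?andbT; last first.
  by move=> x _; rewrite lee_fin gammaI_ge0.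
apply/eqP => g0.
pose c : R := expR (- 2) * 2 `^ (- `|a - 1|).
have c0 : 0 < c by rewrite mulr_gt0 ?expR_gt0 ?powR_gt0.
have : (\int[mu]_(x in `[1%R, 2%R]) c%:E <= gammaI a)%E.
  apply: (@le_trans _ _ (\int[mu]_(x in `[1%R, 2%R]) (x `^ (a - 1) * expR (- x))%:E)%E).
    apply: ge0_le_integral => //.
    - by move=> x _; rewrite lee_fin ltW.
    - apply/measurable_EFinP; apply: measurable_funS (cts_pos_measurable (@gammaI_cts a)) => //.
      by move=> x /=; rewrite !in_itv/= andbT => /andP[+ _]; apply: lt_le_trans.
    - move=> x; rewrite /= in_itv/= => /andP[x1 x2].
      rewrite lee_fin /c mulrC ler_pM ?powR_ge0 ?expR_ge0 ?ler_expR ?lerN2//.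
      rewrite (@le_trans _ _ (x `^ (- `|a - 1|)))//.
        by rewrite !powRN lef_pV2 ?posrE ?powR_gt0 ?(lt_le_trans _ x1)// ge0_ler_powR ?nnegrE// (le_trans _ x1).
      by apply: ler_powR => //; rewrite lerNnormlW.
  apply: ge0_subset_integral => //.
  - apply/measurable_EFinP; exact: cts_pos_measurable (@gammaI_cts _).
  - by move=> x _; rewrite lee_fin gammaI_ge0.
  - by move=> x /=; rewrite !in_itv/= andbT => /andP[+ _]; apply: lt_le_trans.
rewrite g0 integral_cst//= lebesgue_measure_itv/= lte_fin ltr1n -EFinB -EFinM lee_fin.
by rewrite leNgt mulr_gt0// subr_gt0 ltr1n.
Qed.

Lemma Gamma_posE a : 0 < a -> gammaI a = (Gamma_pos a)%:E.
Proof.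
move=> a0; rewrite /Gamma_pos /Rintegral fineK//.
by rewrite ge0_fin_numE ?gammaI_lt_pinfty// ltW// gammaI_gt0.
Qed.

Lemma Gamma_pos_gt0 a : 0 < a -> 0 < Gamma_pos a.
Proof. by move=> a0; rewrite -lte_fin -Gamma_posE// gammaI_gt0. Qed.

(** The argument lies in [(-1, 0)], so that the recurrence in [Gamma] is unfolded exactly once. *)
Lemma GammaN a : 0 < a < 1 -> `|Gamma (- a)| = Gamma_pos (1 - a) / a.
Proof.
move=> /andP[a0 a1]; rewrite /Gamma ltNge oppr_le0 (ltW a0)/= opprK.
rewrite (_ : Num.truncn a = 0%N); last by apply/truncn0Pn; rewrite -ltNge.
rewrite big_ord1 addr0 addrC normrM (gtr0_norm (Gamma_pos_gt0 _)) ?subr_gt0//.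
by rewrite normfV normrN gtr0_norm.
Qed.

Lemma integral_powR_exp a r : 0 < a -> 0 < r ->
  (\int[mu]_(t in pos) (t `^ (a - 1) * expR (- (r * t)))%:E = (Gamma_pos a * r `^ (- a))%:E)%E.
Proof.
move=> a0 r0; pose f t : R := t `^ (a - 1) * expR (- (r * t)).
have f0 x : 0 < x -> 0 <= f x by move=> _; rewrite mulr_ge0 ?powR_ge0 ?expR_ge0.
have cf : cts_pos f.
  apply: cts_posM; first exact: cts_pos_powR.
  move=> x _; apply: (@continuous_comp _ _ _ ( *%R r) (fun x => expR (- x))).
    exact: mulrl_continuous.
  exact: is_derive_continuous (is_derive_expN _).
have r10 : 0 < r^-1 by rewrite invr_gt0.
rewrite (integral_pos_scale r10 f0 cf).
transitivity (\int[mu]_(t in pos) (r `^ (- a) * (t `^ (a - 1) * expR (- t)))%:E)%E.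
  apply: eq_integral => t; rewrite inE/= in_itv/= andbT => t0; congr EFin.
  have e1 : r * (r^-1 * t) = t by rewrite mulrA mulfV ?mul1r ?gt_eqF.
  have e2 : (r^-1) `^ (a - 1) * r^-1 = r `^ (- a).
    rewrite -powR_inv1 ?(ltW r0)// -powRrM -powRD ?(gt_eqF r0) ?implybT//.
    by congr (_ `^ _); ring.
  by rewrite /f e1 powRM ?(ltW t0) ?(ltW r10)// -e2; ring.
rewrite integral_posZ ?powR_ge0//; last 2 first.
- by move=> t _; exact: gammaI_ge0.
- exact: cts_pos_measurable (@gammaI_cts _).
by rewrite -[X in (_ * X)%E]/(gammaI a) Gamma_posE// -EFinM mulrC.
Qed.

Lemma expN_ge1Bx (y : R) : 1 - expR (- y) <= y.
Proof. by rewrite lerBlDr -lerBlDl; exact: expR_ge1Dx. Qed.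

(** Subordination of the power [b ^ a] to exponentials, the source of all fractional powers below.
    Integration by parts, with [- t ^ (- a) / a] as a primitive of [t ^ (- 1 - a)], reduces it to
    Euler's integral of order [1 - a]. *)
Lemma integral_stable_exp a b : 0 < a < 1 -> 0 <= b ->
  (\int[mu]_(t in pos) ((1 - expR (- (b * t))) / t `^ (1 + a))%:E =
   (`|Gamma (- a)| * b `^ a)%:E)%E.
Proof.
move=> a01; have /andP[a0 a1] := a01; rewrite le_eqVlt => /predU1P[<-|b0].
  rewrite powR0 ?gt_eqF// mulr0 integral0_eq// => t _.
  by rewrite mul0r oppr0 expR0 subrr mul0r.
pose f t : R := (1 - expR (- (b * t))) / t `^ (1 + a).
pose g t : R := b / a * (t `^ (1 - a - 1) * expR (- (b * t))).
pose F t : R := - (a^-1 * ((1 - expR (- (b * t))) * t `^ (- a))).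
have dE x : is_derive x 1 (fun t => expR (- (b * t))) (- b * expR (- (b * x))).
  have -> : (fun t => expR (- (b * t))) = fun t => expR (- b * t).
    by apply/funext => t; rewrite mulNr.
  by have := is_derive_expRM (- b) x; rewrite [X in _ * expR X]mulNr.
have dF x : 0 < x -> is_derive x 1 F (f x - g x).
  move=> x0.
  have h1 := is_deriveB (is_derive_cst (1:R) x 1) (dE x).
  have h2 := is_derive1_powR (- a) x0.
  have h := is_deriveN (is_deriveZ a^-1 (is_deriveM h1 h2)).
  apply: (is_derive_eq h); rewrite /f /g.
  rewrite -![_ *: _]/(_ * _) /cst sub0r.
  rewrite (_ : 1 - a - 1 = - a); last by ring.
  rewrite (_ : - a - 1 = - (1 + a)); last by ring.
  rewrite [x `^ (- (1 + a))]powRN. rewrite ?fctE /=.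
  by field; rewrite !gt_eqF ?powR_gt0.
have f0 x : 0 < x -> 0 <= f x.
  move=> x0; rewrite divr_ge0 ?powR_ge0// subr_ge0 expR_le1 oppr_le0 mulr_ge0 ?ltW//.
have g0 x : 0 < x -> 0 <= g x.
  by move=> x0; rewrite !mulr_ge0 ?powR_ge0 ?expR_ge0 ?invr_ge0 ?ltW.
have cf : cts_pos f.
  apply: cts_posM.
    by move=> x _; apply: cvgB; [exact: cvg_cst|exact: is_derive_continuous (dE x)].
  by move=> x x0; apply: cvgV; [rewrite gt_eqF// powR_gt0|exact: cts_pos_powR].
have ch : cts_pos (fun t => t `^ (1 - a - 1) * expR (- (b * t))).
  apply: cts_posM; first exact: cts_pos_powR.
  by move=> x _; exact: is_derive_continuous (dE x).
have cg : cts_pos g by apply: cts_posM => // x _; exact: cvg_cst.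
have l0 : F t @[t --> 0^'+] --> 0.
  have h : b / a * t `^ (1 - a) @[t --> 0^'+] --> b / a * 0.
    by apply: cvgM; [exact: cvg_cst|apply: powR_cvg0; rewrite subr_gt0].
  rewrite mulr0 in h.
  have hN := cvgN h; rewrite oppr0 in hN.
  apply: (@squeeze_cvgr _ _ _ _ (fun t => - (b / a * t `^ (1 - a))) (fun=> 0)); [|exact: hN|exact: cvg_cst].
  near=> t; have t0 : 0 < t by near: t; exact: nbhs_right_gt.
  have e0 : 0 <= 1 - expR (- (b * t)).
    by rewrite subr_ge0 expR_le1 oppr_le0 mulr_ge0 ?ltW.
  rewrite /F lerN2 oppr_le0 !mulr_ge0 ?invr_ge0 ?powR_ge0 ?(ltW a0)// andbT.
  rewrite [b / a]mulrC -mulrA ler_pM2l ?invr_gt0//.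
  rewrite powRD ?(gt_eqF t0) ?implybT// powRr1 ?(ltW t0)// mulrA.
  by rewrite ler_wpM2r ?powR_ge0// expN_ge1Bx.
have l1 : F t @[t --> +oo] --> 0.
  have hy : (t `^ a)^-1 @[t --> +oo] --> (0 : R).
    apply: (gtr0_cvgV0 _).2.
      by near=> t; apply: powR_gt0; near: t; exact: nbhs_pinfty_gt.
    apply/cvgryPge => A.
    near=> t; have t0 : 0 < t by near: t; exact: nbhs_pinfty_gt.
    have : (Num.max A 1) `^ a^-1 <= t by near: t; exact: nbhs_pinfty_ge.
    move=> /(@ge0_ler_powR _ a (ltW a0)); rewrite !nnegrE powR_ge0 ltW// => /(_ isT isT).
    rewrite -powRrM mulVf ?gt_eqF// powRr1 ?(le_trans ler01) ?le_max ?lexx ?orbT//.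
    by move=> /(le_trans _); apply; rewrite le_max lexx.
  have h : - (a^-1 * (t `^ a)^-1) @[t --> +oo] --> - (a^-1 * 0).
    by apply: cvgN; apply: cvgM => //; exact: cvg_cst.
  rewrite mulr0 oppr0 in h.
  apply: (@squeeze_cvgr _ _ _ _ (fun t => - (a^-1 * (t `^ a)^-1)) (fun=> 0)); [|exact: h|exact: cvg_cst].
  near=> t; have t0 : 0 < t by near: t; exact: nbhs_pinfty_gt.
  have e0 : 0 <= 1 - expR (- (b * t)).
    by rewrite subr_ge0 expR_le1 oppr_le0 mulr_ge0 ?ltW.
  rewrite /F lerN2 oppr_le0 !mulr_ge0 ?invr_ge0 ?powR_ge0 ?(ltW a0)// andbT.
  rewrite ler_pM2l ?invr_gt0// powRN ler_piMl ?invr_ge0 ?powR_ge0//.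
rewrite (integral_pos_FTC f0 g0 cf cg dF l0 l1) subrr adde0.
rewrite integral_posZ ?divr_ge0 ?(ltW a0) ?(ltW b0)//; last 2 first.
- by move=> t _; rewrite mulr_ge0 ?powR_ge0 ?expR_ge0.
- exact: cts_pos_measurable ch.
rewrite integral_powR_exp ?subr_gt0// -EFinM GammaN//; congr EFin.
rewrite opprB addrC powRD ?(gt_eqF b0) ?implybT// powRN powRr1 ?(ltW b0)//.
by field; rewrite !gt_eqF.
Unshelve. all: by end_near. Qed.

End gamma.

(** * Gaussian integrals and the symbol of the Levy measure *)

Section gauss_fourier.
Context {R : realType}.
Implicit Types (a b x t xi : R).
Local Notation mu := (@lebesgue_measure R).
Local Notation pos := (`]0, +oo[%classic : set R).

Lemma is_derive_scale b x : is_derive x 1 ( *%R b) b.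
Proof.
have := @is_deriveZ _ _ _ (@id R) b x 1 1 (is_derive_id _ _).
by rewrite -[b *: 1]/(b * 1) mulr1.
Qed.

Lemma is_derive_scaler b x : is_derive x 1 (fun y => y * b) b.
Proof.
have -> : (fun y => y * b) = *%R b by apply/funext => y; rewrite mulrC.
exact: is_derive_scale.
Qed.

Lemma is_derive_sqr x : is_derive x 1 (fun y : R => y ^+ 2) (2 * x).
Proof.
have h := is_deriveM (is_derive_id x (1:R)) (is_derive_id x (1:R)).
by apply: (is_derive_eq h); rewrite -![_ *: _]/(_ * _); ring.
Qed.

Lemma is_derive_gauss x : is_derive x 1 (@gauss_fun R) (- (2 * x * gauss_fun x)).
Proof.
have h1 : is_derive x 1 (fun y : R => - y ^+ 2) (- (2 * x)).
  exact: is_deriveN (is_derive_sqr x).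
have h := @is_derive1_comp _ expR (fun y : R => - y ^+ 2) x _ _ (is_derive_expR _) h1.
by apply: (is_derive_eq h); rewrite /gauss_fun; ring.
Qed.

Lemma is_derive_cosM b x : is_derive x 1 (fun y => cos (b * y)) (- (b * sin (b * x))).
Proof.
have h := @is_derive1_comp _ cos ( *%R b) x _ _ (is_derive_cos _) (is_derive_scale b x).
by apply: (is_derive_eq h); ring.
Qed.

Lemma is_derive_sinM b x : is_derive x 1 (fun y => sin (b * y)) (b * cos (b * x)).
Proof.
have h := @is_derive1_comp _ sin ( *%R b) x _ _ (is_derive_sin _) (is_derive_scale b x).
by apply: (is_derive_eq h); ring.
Qed.

Lemma is_derive_cosMl b x : is_derive x 1 (fun y => cos (y * b)) (- (b * sin (x * b))).
Proof.
have h := @is_derive1_comp _ cos (fun y => y * b) x _ _ (is_derive_cos _) (is_derive_scaler b x).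
by apply: (is_derive_eq h); ring.
Qed.

Lemma gauss_fun_cvg0 : gauss_fun x @[x --> +oo] --> (0 : R).
Proof. exact: cvg_gauss_fun. Qed.

Lemma integrable_pos (f : R -> R) : (forall x, 0 < x -> 0 <= f x) -> measurable_fun pos f ->
  (\int[mu]_(x in pos) (f x)%:E < +oo)%E -> mu.-integrable pos (EFin \o f).
Proof.
move=> f0 mf fy; apply/integrableP; split; first exact/measurable_EFinP.
under eq_integral => x.
  rewrite inE/= in_itv/= andbT => x0; rewrite /= ger0_norm ?f0//.
  over.
exact: fy.
Qed.

Lemma integral_pos_lin_gauss : (\int[mu]_(x in pos) (2 * x * gauss_fun x)%:E = 1)%E.
Proof.
have dF x : 0 < x -> is_derive x 1 (fun y => - gauss_fun y) (2 * x * gauss_fun x - 0).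
  by move=> x0; have h := is_deriveN (is_derive_gauss x); apply: (is_derive_eq h); ring.
have l0 : - gauss_fun t @[t --> 0^'+] --> (- 1 : R).
  have h : gauss_fun t @[t --> 0^'+] --> (1 : R).
    have -> : 1 = gauss_fun (0 : R) by rewrite /gauss_fun expr0n oppr0 expR0.
    by apply: cvg_at_right_filter; exact: is_derive_continuous (is_derive_gauss 0).
  by have := cvgN h; apply.
have l1 : - gauss_fun t @[t --> +oo] --> (0 : R).
  by have := cvgN gauss_fun_cvg0; rewrite oppr0; apply.
have f0 x : 0 < x -> 0 <= 2 * x * gauss_fun x.
  by move=> x0; rewrite !mulr_ge0 ?gauss_fun_ge0// ltW.
have cf : cts_pos (fun x : R => 2 * x * gauss_fun x).
  apply: cts_posM; last by move=> x _; exact: continuous_gauss_fun.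
  by move=> x _; exact: is_derive_continuous (is_derive_scale _ _).
rewrite (integral_pos_FTC f0 (fun _ _ => lexx _) cf (fun x _ => cvg_cst _) dF l0 l1).
by rewrite integral0 add0e sub0r opprK.
Qed.

Lemma integral_pos_gauss : (\int[mu]_(x in pos) (gauss_fun x)%:E = (Num.sqrt pi / 2)%:E)%E.
Proof.
rewrite -integral0y_gauss integral_itv_obnd_cbnd//.
by apply/measurable_EFinP; apply: measurable_funTS; exact: measurable_gauss_fun.
Qed.

Lemma integrable_lin_gauss : mu.-integrable pos (EFin \o (fun x : R => 2 * x * gauss_fun x)).
Proof.
apply: integrable_pos; last by rewrite integral_pos_lin_gauss ltry.
  by move=> x x0; rewrite !mulr_ge0 ?gauss_fun_ge0// ltW.
apply: cts_pos_measurable; apply: cts_posM; last by move=> x _; exact: continuous_gauss_fun.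
by move=> x _; exact: is_derive_continuous (is_derive_scale _ _).
Qed.

Lemma integrable_pos_gauss : mu.-integrable pos (EFin \o (@gauss_fun R)).
Proof. by apply: integrableS (@integrableT_gauss R). Qed.

Lemma integrable_le_pos (f g : R -> R) : measurable_fun pos f ->
  (forall x, 0 < x -> `|f x| <= g x) -> mu.-integrable pos (EFin \o g) ->
  mu.-integrable pos (EFin \o f).
Proof.
move=> mf fg; apply: le_integrable => //; first exact/measurable_EFinP.
move=> x /=; rewrite in_itv/= andbT => x0; rewrite lee_fin.
by rewrite (le_trans (fg _ x0))// ler_norm.
Qed.

Definition gfour xi : R := \int[mu]_(x in pos) (cos (xi * x) * gauss_fun x).

Lemma normr_cos_le1 (x : R) : `|cos x| <= 1.
Proof. by rewrite ler_norml cos_geN1 cos_le1. Qed.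

Lemma normr_sin_le1 (x : R) : `|sin x| <= 1.
Proof. by rewrite ler_norml sin_geN1 sin_le1. Qed.

Lemma cts_pos_of (f df : R -> R) : (forall x, is_derive x 1 f (df x)) -> cts_pos f.
Proof. by move=> h x _; exact: is_derive_continuous (h x). Qed.

Let ccos xi : cts_pos (fun x => cos (xi * x)) := cts_pos_of (is_derive_cosM xi).
Let csin xi : cts_pos (fun x => sin (xi * x)) := cts_pos_of (is_derive_sinM xi).
Let cgauss : cts_pos (@gauss_fun R) := cts_pos_of is_derive_gauss.
Let cid b : cts_pos ( *%R b) := cts_pos_of (is_derive_scale b).

Lemma integrable_cos_gauss xi :
  mu.-integrable pos (EFin \o (fun x => cos (xi * x) * gauss_fun x)).
Proof.
apply: integrable_le_pos integrable_pos_gauss.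
  by apply: cts_pos_measurable; apply: cts_posM; [exact: ccos|exact: cgauss].
by move=> x _; rewrite normrM (ger0_norm (gauss_fun_ge0 _)) ler_piMl ?gauss_fun_ge0 ?normr_cos_le1.
Qed.

Lemma integrable_sin_lin_gauss xi :
  mu.-integrable pos (EFin \o (fun x => 2 * x * gauss_fun x * sin (xi * x))).
Proof.
apply: integrable_le_pos integrable_lin_gauss.
  apply: cts_pos_measurable; apply: cts_posM; last exact: csin.
  by apply: cts_posM; [exact: cid|exact: cgauss].
move=> x x0; rewrite normrM; have h : 0 <= 2 * x * gauss_fun x.
  by rewrite !mulr_ge0 ?gauss_fun_ge0// ltW.
by rewrite ger0_norm// ler_piMr// normr_sin_le1.
Qed.

Lemma gauss_by_parts xi :
  \int[mu]_(x in pos) (2 * x * gauss_fun x * sin (xi * x)) = xi * gfour xi.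
Proof.
(* [k] is the derivative of [gauss_fun x * sin (xi * x)]. The majorant [g] of its absolute value is
   added and subtracted to get the two nonnegative parts that [integral_pos_FTC] demands. *)
pose g x := (2 * x + `|xi|) * gauss_fun x.
pose k x := xi * (cos (xi * x) * gauss_fun x) - 2 * x * gauss_fun x * sin (xi * x).
have g0 x : 0 < x -> 0 <= g x.
  by move=> x0; rewrite mulr_ge0 ?gauss_fun_ge0// addr_ge0// mulr_ge0// ltW.
have kg x : 0 < x -> `|k x| <= g x.
  move=> x0; rewrite /k /g [leRHS]mulrDl [leRHS]addrC (le_trans (ler_normB _ _))//.
  have G0 := gauss_fun_ge0 x.
  apply: lerD; rewrite !normrM !(ger0_norm G0).
    by rewrite mulrA ler_wpM2r// ler_piMr// normr_cos_le1.
  rewrite (ger0_norm (ltW x0)) (ger0_norm (ler0n _ _)) ler_piMr ?normr_sin_le1//.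
  by rewrite !mulr_ge0// ltW.
have ck : cts_pos k.
  move=> x x0; apply: cvgB.
    by apply: cts_posM x0; [move=> y _; exact: cvg_cst|apply: cts_posM; [exact: ccos|exact: cgauss]].
  by apply: cts_posM x0; [apply: cts_posM; [exact: cid|exact: cgauss]|exact: csin].
have cg : cts_pos g.
  apply: cts_posM; last exact: cgauss.
  by move=> x x0; apply: cvgD; [exact: cid|exact: cvg_cst].
have dF x : 0 < x -> is_derive x 1 (fun y => gauss_fun y * sin (xi * y)) (k x + g x - g x).
  move=> x0; have h := is_deriveM (is_derive_gauss x) (is_derive_sinM xi x).
  by apply: (is_derive_eq h); rewrite addrK /k -![_ *: _]/(_ * _); ring.
have l0 : gauss_fun t * sin (xi * t) @[t --> 0^'+] --> (0 : R).
  have h : gauss_fun t * sin (xi * t) @[t --> 0^'+] --> gauss_fun (0 : R) * sin (xi * 0).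
    apply: cvg_at_right_filter; apply: cvgM.
      exact: is_derive_continuous (is_derive_gauss 0).
    exact: is_derive_continuous (is_derive_sinM xi 0).
  by rewrite mulr0 sin0 mulr0 in h.
have l1 : gauss_fun t * sin (xi * t) @[t --> +oo] --> (0 : R).
  have hN : - gauss_fun t @[t --> +oo] --> (0 : R).
    by have := cvgN gauss_fun_cvg0; rewrite oppr0; apply.
  apply: (@squeeze_cvgr _ _ _ _ (fun t => - gauss_fun t) (fun t => gauss_fun t)); [|exact: hN|exact: gauss_fun_cvg0].
  near=> t; rewrite -ler_norml normrM ger0_norm ?gauss_fun_ge0//.
  by rewrite ler_piMr ?gauss_fun_ge0// normr_sin_le1.
have f0 x : 0 < x -> 0 <= k x + g x.
  by move=> /kg; rewrite ler_norml => /andP[h _]; rewrite -lerBlDr sub0r.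
have cf : cts_pos (fun x => k x + g x).
  by move=> x x0; apply: cvgD; [exact: ck|exact: cg].
have ig : mu.-integrable pos (EFin \o g).
  have : mu.-integrable pos (fun x => ((2 * x * gauss_fun x)%:E + `|xi|%:E * (gauss_fun x)%:E)%E).
    apply: integrableD => //; first exact: integrable_lin_gauss.
    by apply: integrableZl => //; exact: integrable_pos_gauss.
  by apply: eq_integrable => // x _; rewrite -EFinM -EFinD; congr EFin; rewrite /g; ring.
have ik : mu.-integrable pos (EFin \o k) by apply: integrable_le_pos ig => //; exact: cts_pos_measurable.
have := integral_pos_FTC f0 g0 cf cg dF l0 l1.
rewrite subrr adde0 => E.
have K0 : \int[mu]_(x in pos) k x = 0.
  have := congr1 fine E; rewrite -/(Rintegral mu pos (fun x => k x + g x)).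
  rewrite RintegralD// => /eqP; rewrite -[X in _ == X]add0r => /eqP/addIr; exact.
move: K0; rewrite RintegralB//; last 2 first.
- have : mu.-integrable pos (fun x => (xi%:E * (cos (xi * x) * gauss_fun x)%:E)%E).
    by apply: integrableZl => //; exact: integrable_cos_gauss.
  by apply: eq_integrable => // x _; rewrite EFinM.
- exact: integrable_sin_lin_gauss.
rewrite RintegralZl//; last exact: integrable_cos_gauss.
by move/eqP; rewrite subr_eq0 => /eqP <-.
Unshelve. all: by end_near. Qed.

Lemma is_derive_gfour xi : is_derive xi 1 gfour (- (xi / 2) * gfour xi).
Proof.
pose f xi x : R := cos (xi * x) * gauss_fun x.
have dE (u x : R) : is_derive u 1 (f ^~ x) (- (x * sin (u * x)) * gauss_fun x).
  have h := is_deriveM (is_derive_cosMl x u) (is_derive_cst (gauss_fun x) u (1:R)).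
  by apply: (is_derive_eq h); rewrite -![_ *: _]/(_ * _) /cst; ring.
have d1 u x : partial1of2 f u x = - (x * sin (u * x)) * gauss_fun x.
  by rewrite partial1of2E (@derive_val _ _ _ _ _ _ _ (dE u x)).
have Ixi : `]xi - 1, xi + 1[%classic xi.
  by rewrite /= in_itv/= ltrDl ltr01 ltrBlDr ltrDl ltr01.
have intf u : `]xi - 1, xi + 1[%classic u -> mu.-integrable pos (EFin \o f u).
  by move=> _; exact: integrable_cos_gauss.
have derf u y : `]xi - 1, xi + 1[%classic u -> pos y -> derivable (f ^~ y) u 1.
  by move=> _ _; exact: (@ex_derive _ _ _ _ _ _ _ (dE u y)).
pose G y : R := 2 * `|y| * gauss_fun y.
have G0 y : 0 <= G y by rewrite !mulr_ge0 ?gauss_fun_ge0.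
have iG : mu.-integrable pos (EFin \o G).
  apply: eq_integrable integrable_lin_gauss => // x; rewrite inE/= in_itv/= andbT => x0.
  by rewrite /G gtr0_norm.
have Gub u y : `]xi - 1, xi + 1[%classic u -> pos y -> `|partial1of2 f u y| <= G y.
  move=> _ _; rewrite d1 /G !normrM normrN normrM (ger0_norm (gauss_fun_ge0 y)).
  rewrite ler_wpM2r ?gauss_fun_ge0// (@le_trans _ _ `|y|)//.
    by rewrite ler_piMr ?normr_sin_le1.
  by rewrite ler_peMl// ler1n.
have mpos : measurable pos by exact: measurable_itv.
have E := @differentiation_under_integral R _ _ mu f pos mpos xi (xi - 1) (xi + 1) Ixi intf derf G G0 iG Gub.
have D := @derivable_under_integral R _ _ mu f pos mpos xi (xi - 1) (xi + 1) Ixi intf derf G G0 iG Gub.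
apply: DeriveDef; first exact: D.
rewrite -derive1E; rewrite /gfour -/(f _) in E *; rewrite E.
transitivity (\int[mu]_(y in pos) (- 2^-1 * (2 * y * gauss_fun y * sin (xi * y)))).
  by apply: eq_Rintegral => y _; rewrite d1; field.
rewrite RintegralZl//; last exact: integrable_sin_lin_gauss.
by rewrite gauss_by_parts /gfour; ring.
Qed.

Lemma gfourE xi : gfour xi = Num.sqrt pi / 2 * expR (- (xi ^+ 2 / 4)).
Proof.
pose D x := gfour x * expR (x ^+ 2 / 4).
have dD x : is_derive x 1 D 0.
  have h1 : is_derive x 1 (fun y : R => y ^+ 2 / 4) (x / 2).
    have -> : (fun y : R => y ^+ 2 / 4) = 4^-1 \*: (fun y : R => y ^+ 2).
      by apply/funext => y; rewrite mulrC.
    have h := is_deriveZ 4^-1 (is_derive_sqr x).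
    by apply: (is_derive_eq h); rewrite -![_ *: _]/(_ * _); field.
  have h2 := @is_derive1_comp _ expR (fun y : R => y ^+ 2 / 4) x _ _ (is_derive_expR _) h1.
  have h := is_deriveM (is_derive_gfour x) h2.
  by apply: (is_derive_eq h); rewrite /= -![_ *: _]/(_ * _); field.
have -> : gfour xi = D xi * expR (- (xi ^+ 2 / 4)).
  by rewrite /D -mulrA -expRD subrr expR0 mulr1.
rewrite (is_derive_0_is_cst xi 0 dD) /D expr0n mul0r expR0 mulr1; congr (_ * _).
rewrite /gfour; under eq_Rintegral do rewrite mul0r cos0 mul1r.
by rewrite /Rintegral integral_pos_gauss.
Qed.

Lemma ge0_integralN (f : R -> \bar R) : measurable_fun setT f -> (forall x, 0 <= f x)%E ->
  (\int[mu]_x f (- x)%R = \int[mu]_x f x)%E.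
Proof.
move=> mf f0; transitivity (\int[pushforward mu (-%R : _ -> measurableTypeR R)]_x f x)%E.
  by rewrite ge0_integral_pushforward.
by apply: eq_measure_integral => A mA _; exact: lebesgue_measureN.
Qed.

Lemma integralT_half (f : R -> R) : continuous f -> (forall x, 0 <= f x) ->
  (\int[mu]_x (f x)%:E = \int[mu]_(x in pos) (f x + f (- x)%R)%:E)%E.
Proof.
move=> cf f0; pose g x := f x + f (- x).
have cfN : continuous (fun x => f (- x)).
  by move=> x; apply: (@continuous_comp _ _ _ -%R f); [exact: opp_continuous|exact: cf].
have cg : continuous g by move=> x; apply: cvgD; [exact: cf|exact: cfN].
have g0 x : 0 <= g x by rewrite addr_ge0.
have gN : g =1 g \o -%R by move=> x; rewrite /g/= opprK addrC.
have mf h : continuous h -> measurable_fun setT (EFin \o h : R -> \bar R).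
  by move=> ch; apply/measurable_EFinP; exact: continuous_measurable_fun.
have := ge0_symfun_integralT g0 cg gN.
rewrite (_ : [set x | (0 <= x)%R] = `[0, +oo[%classic); last first.
  by apply/seteqP; split => x/=; rewrite in_itv/= andbT.
rewrite -integral_itv_obnd_cbnd; last by apply: measurable_funTS; exact: mf.
under eq_integral do rewrite /g EFinD.
rewrite ge0_integralD//; [|by move=> x _; rewrite lee_fin|exact: mf|by move=> x _; rewrite lee_fin|exact: mf].
rewrite (@ge0_integralN (EFin \o f)); [|exact: mf|by move=> x; rewrite lee_fin].
rewrite -mule2n => h.
have : forall y z : \bar R, (2%:E * y = 2%:E * z)%E -> y = z.
  move=> y z e; rewrite -[y]mul1e -[z]mul1e -(mulVf (_ : 2 != 0 :> R))//.
  by rewrite EFinM -!muleA e.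
by apply; rewrite mule_natl h.
Qed.

(** The summand [1] keeps the integrand nonnegative, so that Tonelli's theorem applies without prior
    integrability. The phase [th] will carry the remaining coordinates in the induction on the
    dimension. *)
Lemma integral_gauss_cos th xi :
  (\int[mu]_x ((1 + cos (th + xi * x)) * gauss_fun x)%:E =
   (Num.sqrt pi * (1 + cos th * expR (- (xi ^+ 2 / 4))))%:E)%E.
Proof.
have cc x : {for x, continuous (fun x => cos (th + xi * x))}.
  apply: (@continuous_comp _ _ _ (fun x => th + xi * x) cos); last exact: continuous_cos.
  by apply: cvgD; [exact: cvg_cst|exact: mulrl_continuous].
rewrite integralT_half; last 2 first.
- by move=> x; apply: cvgM; [apply: cvgD; [exact: cvg_cst|exact: cc]|exact: continuous_gauss_fun].
- by move=> x; rewrite mulr_ge0 ?gauss_fun_ge0// -lerBlDl sub0r cos_geN1.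
transitivity (\int[mu]_(x in pos) (2%:E * (gauss_fun x)%:E + (2 * cos th)%:E * (cos (xi * x) * gauss_fun x)%:E))%E.
  apply: eq_integral => x _; rewrite -EFinM -EFinM -EFinD; congr EFin.
  rewrite mulrN cosB cosD /gauss_fun sqrrN; ring.
rewrite integralD//; last 2 first.
- by apply: integrableZl => //; exact: integrable_pos_gauss.
- by apply: integrableZl => //; exact: integrable_cos_gauss.
rewrite integralZl//; last exact: integrable_pos_gauss.
rewrite integralZl//; last exact: integrable_cos_gauss.
have -> : (\int[mu]_(x in pos) (cos (xi * x) * gauss_fun x)%:E = (gfour xi)%:E)%E.
  by rewrite /gfour /Rintegral fineK//; exact: integrable_fin_num (integrable_cos_gauss xi).
rewrite integral_pos_gauss gfourE -!EFinM -EFinD; congr EFin; by field.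
Qed.

Lemma integralT_scale (f : R -> R) r : 0 < r -> continuous f -> (forall x, 0 <= f x) ->
  (\int[mu]_x (f x)%:E = \int[mu]_x (f (r * x) * r)%:E)%E.
Proof.
move=> r0 cf f0.
have crf : continuous (fun x => f (r * x) * r).
  move=> x; apply: cvgM; last exact: cvg_cst.
  by apply: (@continuous_comp _ _ _ ( *%R r) f); [exact: mulrl_continuous|exact: cf].
rewrite (integralT_half cf f0) (integralT_half crf); last first.
  by move=> x; rewrite mulr_ge0// ltW.
rewrite (@integral_pos_scale _ (fun x => f x + f (- x)) r)//.
- by apply: eq_integral => x _; rewrite mulrDl mulrN.
- by move=> x _; rewrite addr_ge0.
- move=> x _; apply: cvgD; first exact: cf.
  by apply: (@continuous_comp _ _ _ -%R f); [exact: opp_continuous|exact: cf].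
Qed.

Lemma integral_gauss_cos_scaled s th xi : 0 < s ->
  (\int[mu]_x ((1 + cos (th + xi * x)) * expR (- (s * x ^+ 2)))%:E =
   (Num.sqrt (pi / s) * (1 + cos th * expR (- (xi ^+ 2 / (4 * s)))))%:E)%E.
Proof.
move=> s0; have q0 : 0 < Num.sqrt s by rewrite sqrtr_gt0.
pose f x := (1 + cos (th + xi * x)) * expR (- (s * x ^+ 2)).
have cf : continuous f.
  move=> x; apply: cvgM.
    apply: cvgD; first exact: cvg_cst.
    apply: (@continuous_comp _ _ _ (fun x => th + xi * x) cos); last exact: continuous_cos.
    by apply: cvgD; [exact: cvg_cst|exact: mulrl_continuous].
  apply: (@continuous_comp _ _ _ (fun x => - (s * x ^+ 2)) expR); last exact: continuous_expR.
  by apply: cvgN; apply: cvgM; [exact: cvg_cst|exact: exprn_continuous].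
have f0 x : 0 <= f x.
  by rewrite mulr_ge0 ?expR_ge0// -lerBlDl sub0r cos_geN1.
have qi0 : 0 < (Num.sqrt s)^-1 by rewrite invr_gt0.
rewrite (integralT_scale qi0 cf f0).
transitivity (\int[mu]_x ((Num.sqrt s)^-1%:E * ((1 + cos (th + (xi / Num.sqrt s) * x)) * gauss_fun x)%:E))%E.
  apply: eq_integral => x _; rewrite -EFinM; congr EFin.
  have e : s * ((Num.sqrt s)^-1 * x) ^+ 2 = x ^+ 2.
    by rewrite exprMn exprVn sqr_sqrtr ?(ltW s0)// mulrA mulfV ?(gt_eqF s0)// mul1r.
  by rewrite /f /gauss_fun e [xi * _]mulrA; ring.
pose g x := (1 + cos (th + xi / Num.sqrt s * x)) * gauss_fun x.
have mg : measurable_fun setT (EFin \o g).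
  apply/measurable_EFinP; apply: continuous_measurable_fun => x.
  apply: cvgM; last exact: continuous_gauss_fun.
  apply: cvgD; first exact: cvg_cst.
  apply: (@continuous_comp _ _ _ (fun x => th + xi / Num.sqrt s * x) cos); last exact: continuous_cos.
  by apply: cvgD; [exact: cvg_cst|exact: mulrl_continuous].
have g0 x : (0 <= (g x)%:E)%E.
  by rewrite lee_fin mulr_ge0 ?gauss_fun_ge0// -lerBlDl sub0r cos_geN1.
transitivity ((Num.sqrt s)^-1%:E * \int[mu]_x (g x)%:E)%E.
  have k0 : (0 <= (Num.sqrt s)^-1%:E)%E by rewrite lee_fin ltW.
  by apply: ge0_integralZl => // x _; exact: g0.
rewrite /g integral_gauss_cos -EFinM; congr EFin.
rewrite mulrA sqrtrM ?pi_ge0// sqrtrV ?(ltW s0)//; congr (_ * (1 + _ * expR (- _))).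
  by rewrite mulrC.
by rewrite exprMn exprVn sqr_sqrtr ?(ltW s0)//; field; rewrite gt_eqF.
Qed.

End gauss_fourier.

(** * Gaussian integrals in several variables *)

Section tuple_measure.
Context {R : realType}.
Local Notation mu := (@lebesgue_measure R).
Local Notation pos := (`]0, +oo[%classic : set R).
Local Notation TR n := (n.-tuple (measurableTypeR R)).

Lemma integral_lebesgueN_cons n (f : TR n.+1 -> \bar R) :
  measurable_fun setT f -> (forall z, 0 <= f z)%E ->
  (\int[lebesgueN R n.+1]_z f z =
   \int[mu]_a \int[lebesgueN R n]_z f (cons_pair (a, z)))%E.
Proof.
move=> mf f0.
transitivity (\int[mu \x lebesgueN R n]_p (f \o @cons_pair R n) p)%E.
  rewrite -[in RHS](preimage_setT (@cons_pair R n)).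
  by apply: ge0_integral_pushforward => //; exact: measurable_cons_pair.
rewrite fubini_tonelli1//; first exact: (measurableT_comp mf (@measurable_cons_pair R n)).
by move=> p; exact: f0.
Qed.

Lemma integral_lebesgueN_cons_swap n (f : TR n.+1 -> \bar R) :
  measurable_fun setT f -> (forall z, 0 <= f z)%E ->
  (\int[lebesgueN R n.+1]_z f z =
   \int[lebesgueN R n]_z \int[mu]_a f (cons_pair (a, z)))%E.
Proof.
move=> mf f0; rewrite integral_lebesgueN_cons//.
have mfc : measurable_fun setT (f \o @cons_pair R n).
  exact: (measurableT_comp mf (@measurable_cons_pair R n)).
exact: (@fubini_tonelli _ _ _ _ _ mu (lebesgueN R n) _ mfc (fun p => f0 _)).
Qed.

Definition sqnorm n (z : TR n) : R := \sum_(i < n) tnth z i ^+ 2.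
Definition lin n (c : 'I_n -> R) (z : TR n) : R := \sum_(i < n) c i * tnth z i.

Lemma tnth_cons_pair0 n a (z : TR n) : tnth (cons_pair (a, z)) ord0 = a.
Proof. by []. Qed.

Lemma tnth_cons_pairS n a (z : TR n) i : tnth (cons_pair (a, z)) (lift ord0 i) = tnth z i.
Proof. by rewrite !(tnth_nth 0). Qed.

Lemma measurable_tnthR n (i : 'I_n) : measurable_fun setT (fun z : TR n => tnth z i : R).
Proof. exact: measurable_tnth. Qed.

Lemma measurable_lin n (c : 'I_n -> R) : measurable_fun setT (lin c).
Proof.
apply: measurable_sum => i; apply: measurable_funM => //; exact: measurable_tnthR.
Qed.

Lemma measurable_quad n (c : 'I_n -> R) :
  measurable_fun setT (fun z : TR n => \sum_(i < n) c i * tnth z i ^+ 2).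
Proof.
apply: measurable_sum => i; apply: measurable_funM => //.
by apply: measurable_funX; exact: measurable_tnthR.
Qed.

Lemma measurable_cosT : measurable_fun setT (@cos R).
Proof. exact: continuous_measurable_fun (@continuous_cos R). Qed.

Lemma measurable_gauss_cosN n (s c : 'I_n -> R) th : measurable_fun setT
  (fun z : TR n => (1 + cos (th + lin c z)) * expR (- \sum_(i < n) s i * tnth z i ^+ 2)).
Proof.
apply: measurable_funM.
  apply: measurable_funD => //; apply: measurableT_comp; first exact: measurable_cosT.
  by apply: measurable_funD => //; exact: measurable_lin.
apply: measurableT_comp => //; apply: measurableT_comp => //; exact: measurable_quad.
Qed.

Lemma cos_ge_N1 (x : R) : 0 <= 1 + cos x.
Proof. by rewrite -lerBlDl sub0r cos_geN1. Qed.

(** Integrating out one coordinate multiplies the cosine by some [q] in [[0, 1]], and [1 + q cos] is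
    a convex combination of [1] and [1 + cos]; nonnegativity thus survives the induction. *)
Lemma integral_gauss_cosN n (s c : 'I_n -> R) th : (forall i, 0 < s i) ->
  (\int[lebesgueN R n]_z ((1 + cos (th + lin c z)) *
      expR (- \sum_(i < n) s i * tnth z i ^+ 2))%:E =
   (\prod_(i < n) Num.sqrt (pi / s i) *
    (1 + cos th * expR (- \sum_(i < n) c i ^+ 2 / (4 * s i))))%:E)%E.
Proof.
elim: n s c th => [|n IH] s c th s0.
  rewrite integral_dirac//; first by rewrite diracT mul1e /lin !big_ord0 oppr0 expR0 addr0 !mulr1 mul1r.
  by apply/measurable_EFinP; exact: measurable_gauss_cosN.
pose q := expR (- (c ord0 ^+ 2 / (4 * s ord0))).
pose c' i := c (lift ord0 i); pose s' i := s (lift ord0 i).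
have s'0 i : 0 < s' i by exact: s0.
have q01 : 0 <= q <= 1.
  rewrite expR_ge0 expR_le1 oppr_le0 divr_ge0 ?sqr_ge0// mulr_ge0//; exact: ltW.
have /andP[q0 q1] := q01.
rewrite integral_lebesgueN_cons_swap; last 2 first.
- by apply/measurable_EFinP; exact: measurable_gauss_cosN.
- by move=> z; rewrite lee_fin mulr_ge0 ?expR_ge0 ?cos_ge_N1.
pose g := Num.sqrt (pi / s ord0).
pose E z := expR (- \sum_(i < n) s' i * tnth z i ^+ 2) : R.
(* The constant part is written as [1 + cos (pi / 2 + 0)], so that the induction hypothesis covers
   it too. *)
transitivity (\int[lebesgueN R n]_z
   ((g * (1 - q))%:E * ((1 + cos (pi / 2 + lin (fun=> 0) z)) * E z)%:E +
    (g * q)%:E * ((1 + cos (th + lin c' z)) * E z)%:E))%E.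
  apply: eq_integral => z _.
  transitivity (\int[mu]_a ((E z)%:E * ((1 + cos ((th + lin c' z) + c ord0 * a)) *
      expR (- (s ord0 * a ^+ 2)))%:E))%E.
    apply: eq_integral => a _; rewrite -EFinM; congr EFin.
    rewrite /lin !big_ord_recl tnth_cons_pair0.
    under eq_bigr do rewrite tnth_cons_pairS.
    under [X in expR (- (_ + X))]eq_bigr do rewrite tnth_cons_pairS.
    rewrite opprD expRD -/(E z) -[in RHS]addrA [in RHS](addrC _ (c ord0 * a)).
    by rewrite mulrA [RHS]mulrC.
  have cg : measurable_fun setT (fun a : R => ((1 + cos ((th + lin c' z) + c ord0 * a)) *
      expR (- (s ord0 * a ^+ 2)))%:E).
    apply/measurable_EFinP; apply: measurable_funM.
      apply: measurable_funD => //; apply: measurableT_comp; first exact: measurable_cosT.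
      by apply: measurable_funD => //; exact: measurable_funM.
    apply: measurableT_comp => //; apply: measurableT_comp => //.
    by apply: measurable_funM => //; exact: measurable_funX.
  have cg0 (a : R) : (0 <= ((1 + cos ((th + lin c' z) + c ord0 * a)) *
      expR (- (s ord0 * a ^+ 2)))%:E)%E.
    by rewrite lee_fin mulr_ge0 ?expR_ge0 ?cos_ge_N1.
  have Ez0 : (0 <= (E z)%:E)%E by rewrite lee_fin expR_ge0.
  rewrite ge0_integralZl//.
  rewrite integral_gauss_cos_scaled// -!EFinM -EFinD; congr EFin.
  have -> : lin (fun=> 0) z = 0 by rewrite /lin big1// => i _; rewrite mul0r.
  by rewrite addr0 cos_pihalf -/g -/q; ring.
have mE (th' : R) (d : 'I_n -> R) : measurable_fun setT (fun z => ((1 + cos (th' + lin d z)) * E z)%:E).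
  by apply/measurable_EFinP; exact: measurable_gauss_cosN.
have E0 (th' : R) (d : 'I_n -> R) z : (0 <= ((1 + cos (th' + lin d z)) * E z)%:E)%E.
  by rewrite lee_fin mulr_ge0 ?expR_ge0 ?cos_ge_N1.
have g0 : 0 <= g by exact: sqrtr_ge0.
have k1 : (0 <= (g * (1 - q))%:E)%E by rewrite lee_fin mulr_ge0// subr_ge0.
have k2 : (0 <= (g * q)%:E)%E by rewrite lee_fin mulr_ge0.
rewrite ge0_integralD//; last 4 first.
- by move=> z _; exact: mule_ge0.
- by apply: measurable_funeM; exact: mE.
- by move=> z _; exact: mule_ge0.
- by apply: measurable_funeM; exact: mE.
rewrite !ge0_integralZl//.
rewrite !IH// cos_pihalf -!EFinM -EFinD; congr EFin.
rewrite !big_ord_recl opprD expRD -/q -/g; ring.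
Qed.

Lemma expR_sqnorm n (s : R) (z : TR n) :
  expR (- (s * sqnorm z)) = expR (- \sum_(i < n) s * tnth z i ^+ 2).
Proof. by rewrite /sqnorm mulr_sumr. Qed.

Lemma integral_gaussN n (s : 'I_n -> R) : (forall i, 0 < s i) ->
  (\int[lebesgueN R n]_z (expR (- \sum_(i < n) s i * tnth z i ^+ 2))%:E =
   (\prod_(i < n) Num.sqrt (pi / s i))%:E)%E.
Proof.
move=> s0; have := @integral_gauss_cosN n s (fun=> 0) (pi / 2) s0.
rewrite cos_pihalf mul0r addr0 mulr1 => <-; apply: eq_integral => z _; congr EFin.
have -> : lin (fun=> 0) z = 0 by rewrite /lin big1// => i _; rewrite mul0r.
by rewrite addr0 cos_pihalf addr0 mul1r.
Qed.

Lemma integral_gauss_1Bcos n (c : 'I_n -> R) s : 0 < s ->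
  (\int[lebesgueN R n]_z ((1 - cos (lin c z)) * expR (- (s * sqnorm z)))%:E =
   (Num.sqrt (pi / s) ^+ n * (1 - expR (- ((\sum_(i < n) c i ^+ 2) / 4 / s))))%:E)%E.
Proof.
move=> s0; have := @integral_gauss_cosN n (fun=> s) c pi (fun=> s0).
rewrite cospi mulN1r prodr_const card_ord => e.
transitivity (\int[lebesgueN R n]_z ((1 + cos (pi + lin c z)) *
  expR (- \sum_(i < n) s * tnth z i ^+ 2))%:E)%E.
  by apply: eq_integral => z _; rewrite expR_sqnorm (addrC pi) cosDpi.
rewrite e; congr (_ * (1 - expR (- _)))%:E.
by rewrite mulr_suml mulr_suml; apply: eq_bigr => i _; field; rewrite gt_eqF.
Qed.

Lemma sqrt_quot_bound (s b : R) : 0 < s -> 0 <= b ->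
  1 - Num.sqrt (s / (s + b)) <= 1 - expR (- (b / s)).
Proof.
move=> s0 b0; have sb0 : 0 < s + b by rewrite ltr_wpDr.
rewrite lerB//; apply: (@le_trans _ _ (s / (s + b))).
  rewrite expRN -[leRHS]invrK lef_pV2 ?posrE ?expR_gt0 ?invr_gt0 ?divr_gt0//.
  rewrite invf_div (le_trans _ (expR_ge1Dx _))//.
  by rewrite mulrDl mulfV ?gt_eqF.
have h0 : 0 <= s / (s + b) by rewrite divr_ge0// ltW.
rewrite -[leLHS](sqr_sqrtr h0) expr2 ler_piMr ?sqrtr_ge0//.
rewrite -sqrtr1 ler_wsqrtr// ler_pdivrMr// mul1r lerDl//.
Qed.

(** The extra exponential only raises the Gaussian exponent of coordinate [k] from [s] to [s + b].
    The integral is therefore a difference of two explicit products, estimated by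
    [sqrt_quot_bound]. *)
Lemma integral_gauss_1Bexp n (k : 'I_n) (b s : R) : 0 < s -> 0 <= b ->
  (\int[lebesgueN R n]_z ((1 - expR (- (b * tnth z k ^+ 2))) * expR (- (s * sqnorm z)))%:E <=
   (Num.sqrt (pi / s) ^+ n * (1 - expR (- (b / s))))%:E)%E.
Proof.
move=> s0 b0; pose t (i : 'I_n) := if i == k then s + b else s.
have t0 i : 0 < t i by rewrite /t; case: ifP => // _; rewrite ltr_wpDr.
have e1 := @integral_gaussN n (fun=> s) (fun=> s0).
have e2 := @integral_gaussN n t t0.
have E z : expR (- \sum_(i < n) t i * tnth z i ^+ 2) =
    expR (- (b * tnth z k ^+ 2)) * expR (- (s * sqnorm z)) :> R.
  rewrite -expRD -opprD; congr (expR (- _)).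
  rewrite /sqnorm mulr_sumr (bigD1 k)//= [in RHS](bigD1 k)//= /t eqxx.
  rewrite mulrDl addrA [b * _ + _]addrC; congr (_ + _).
  by apply: eq_bigr => i /negPf ->.
have mE (u : 'I_n -> R) : measurable_fun setT (fun z : TR n => (expR (- \sum_(i < n) u i * tnth z i ^+ 2))%:E).
  apply/measurable_EFinP; apply: measurableT_comp => //; apply: measurableT_comp => //.
  exact: measurable_quad.
have E0 (x : R) : (0 <= (expR x)%:E)%E by rewrite lee_fin expR_ge0.
have I2 : (\int[lebesgueN R n]_z (expR (- \sum_(i < n) t i * tnth z i ^+ 2))%:E \is a fin_num)%E.
  by rewrite e2.
have m1 : measurable_fun setT (fun z : TR n =>
    ((1 - expR (- (b * tnth z k ^+ 2))) * expR (- (s * sqnorm z)))%:E).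
  apply/measurable_EFinP; apply: measurable_funM.
    apply: measurable_funB => //; apply: measurableT_comp => //; apply: measurableT_comp => //.
    by apply: measurable_funM => //; apply: measurable_funX; exact: measurable_tnthR.
  by under eq_fun do rewrite expR_sqnorm; apply/measurable_EFinP; exact: (mE (fun=> s)).
have p0 z : (0 <= ((1 - expR (- (b * tnth z k ^+ 2))) * expR (- (s * sqnorm z)) : R)%:E)%E.
  by rewrite lee_fin mulr_ge0 ?expR_ge0// subr_ge0 expR_le1 oppr_le0 mulr_ge0 ?sqr_ge0.
have sum : (\int[lebesgueN R n]_z ((1 - expR (- (b * tnth z k ^+ 2))) * expR (- (s * sqnorm z)))%:E +
   \int[lebesgueN R n]_z (expR (- \sum_(i < n) t i * tnth z i ^+ 2))%:E =
   \int[lebesgueN R n]_z (expR (- \sum_(i < n) s * tnth z i ^+ 2))%:E)%E.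
  rewrite -ge0_integralD//.
  apply: eq_integral => z _; rewrite -EFinD E; congr EFin; rewrite -expR_sqnorm; ring.
have -> : (\int[lebesgueN R n]_z ((1 - expR (- (b * tnth z k ^+ 2))) * expR (- (s * sqnorm z)))%:E =
  (Num.sqrt (pi / s) ^+ n - \prod_(i < n) Num.sqrt (pi / t i))%:E)%E.
  move: sum; rewrite e1 e2 prodr_const card_ord => h.
  by rewrite EFinB -h addeK.
rewrite lee_fin mulrBr mulr1 lerB//.
have sb0 : 0 < s + b by rewrite ltr_wpDr.
have -> : \prod_(i < n) Num.sqrt (pi / t i) = Num.sqrt (pi / s) ^+ n * Num.sqrt (s / (s + b)).
  rewrite (bigD1 k)//= {1}/t eqxx.
  under eq_bigr => i /negPf ik do rewrite /t ik.
  have -> : Num.sqrt (pi / s) ^+ n = \prod_(i < n) Num.sqrt (pi / s) :> R.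
    by rewrite prodr_const card_ord.
  rewrite [in RHS](bigD1 k)//= mulrAC; congr (_ * _).
  rewrite -sqrtrM ?divr_ge0 ?pi_ge0 ?(ltW s0)//; congr Num.sqrt; field.
  by rewrite !gt_eqF.
rewrite ler_wpM2l ?exprn_ge0 ?sqrtr_ge0//.
by have := sqrt_quot_bound s0 b0; rewrite lerD2l lerN2.
Qed.

Definition opp_tuple n (z : TR n) : TR n := [tuple - tnth z i | i < n].

Lemma measurable_opp_tuple n : measurable_fun setT (@opp_tuple n).
Proof.
apply/measurable_fun_tnthP => i.
rewrite (_ : _ \o _ = (fun z : TR n => (- (tnth z i : R)) : R)).
  by apply: measurableT_comp => //; exact: measurable_tnthR.
by apply/funext => z /=; rewrite tnth_mktuple.
Qed.

Lemma integral_lebesgueN_opp n (f : TR n -> \bar R) :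
  measurable_fun setT f -> (forall z, 0 <= f z)%E ->
  (\int[lebesgueN R n]_z f (opp_tuple z) = \int[lebesgueN R n]_z f z)%E.
Proof.
elim: n f => [|n IH] f mf f0.
  apply: eq_integral => z _; congr f; apply: eq_from_tnth; by case.
have mfo := measurableT_comp mf (@measurable_opp_tuple n.+1).
rewrite (integral_lebesgueN_cons mfo (fun z => f0 _)) (integral_lebesgueN_cons mf f0).
have oc a z : opp_tuple (cons_pair (a, z)) = cons_pair (- a : R, opp_tuple z).
  apply: eq_from_tnth => i; rewrite tnth_mktuple.
  case: (unliftP ord0 i) => [j ->|->]; first by rewrite !tnth_cons_pairS tnth_mktuple.
  by rewrite !tnth_cons_pair0.
have msec a : measurable_fun setT (fun z => f (cons_pair (a, z))).
  apply: (measurableT_comp mf); apply: (measurableT_comp (@measurable_cons_pair R n)).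
  exact: measurable_pair1.
transitivity (\int[mu]_a \int[lebesgueN R n]_z f (cons_pair ((- a)%R, z)))%E.
  apply: eq_integral => a _.
  transitivity (\int[lebesgueN R n]_z f (cons_pair ((- a)%R, opp_tuple z)))%E.
    by apply: eq_integral => z _; congr f; exact: oc.
  by apply: (IH (fun z => f (cons_pair (- a, z)))).
apply: (@ge0_integralN R (fun a => \int[lebesgueN R n]_z f (cons_pair (a, z)))%E).
  apply: (@measurable_fun_fubini_tonelli_F _ _ _ _ _ (lebesgueN R n) (f \o @cons_pair R n)) => //.
  exact: (measurableT_comp mf (@measurable_cons_pair R n)).
  by move=> p; exact: f0.
by move=> a; apply: integral_ge0 => z _; exact: f0.
Qed.

End tuple_measure.

(** * The Levy density as a superposition of Gaussians *)

Section levy_measure.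
Context {R : realType}.
Local Notation mu := (@lebesgue_measure R).
Local Notation pos := (`]0, +oo[%classic : set R).
Local Notation TR n := (n.-tuple (measurableTypeR R)).

Lemma cts_pos_expNM (b : R) : cts_pos (fun t => expR (- (b * t))).
Proof.
have -> : (fun t => expR (- (b * t))) = fun t => expR (- b * t).
  by apply/funext => t; rewrite mulNr.
by move=> x _; exact: cts_expRM.
Qed.

Lemma cts_pos_expN_div (r : R) : cts_pos (fun s => expR (- (r / s))).
Proof.
apply: (@cts_pos_comp _ (fun t => expR (- (r * t))) (fun s => s^-1)).
- by move=> x; rewrite invr_gt0.
- exact: cts_pos_expNM.
- exact: cts_pos_inv.
Qed.

Lemma cts_pos_stable_inv (a r : R) :
  cts_pos (fun s => s `^ (a - 1) * (1 - expR (- (r / s)))).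
Proof.
apply: cts_posM; first exact: cts_pos_powR.
by move=> s s0; apply: cvgB; [exact: cvg_cst|exact: cts_pos_expN_div].
Qed.

Lemma integral_stable_inv (a r : R) : 0 < a < 1 -> 0 <= r ->
  (\int[mu]_(s in pos) (s `^ (a - 1) * (1 - expR (- (r / s))))%:E =
   (`|Gamma (- a)| * r `^ a)%:E)%E.
Proof.
move=> a01 r0; have e0 (t : R) : 0 < t -> 0 <= 1 - expR (- (r / t)).
  by move=> t0; rewrite subr_ge0 expR_le1 oppr_le0 divr_ge0// ltW.
rewrite (@integral_pos_inv _ (fun s => s `^ (a - 1) * (1 - expR (- (r / s))))).
- rewrite -(integral_stable_exp a01 r0); apply: eq_integral => t.
  rewrite inE/= in_itv/= andbT => t0; congr EFin; rewrite invrK mulrAC mulrC.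
  congr (_ * _); rewrite -powR_inv1 ?(ltW t0)// -powRrM.
  rewrite -(powR_mulrn 2 (ltW t0)) -!powRN -powRD ?(gt_eqF t0) ?implybT//.
  by congr (_ `^ _); ring.
- by move=> s s0; rewrite mulr_ge0 ?powR_ge0 ?e0.
- exact: cts_pos_stable_inv.
Qed.

Context {N : nat}.
Variable sigma : R.
Hypothesis s02 : 0 < sigma < 2.
Hypothesis N0 : (0 < N)%N.

Definition levy (z : TR N) : R := fracLap_const N sigma / enorm (vec z) `^ (N%:R + sigma).

(** [fracLap_const] without its factor [Gamma ((N + sigma) / 2)], which Euler's integral supplies in
    the superposition of Gaussians. *)
Definition gauss_const : R := 2 `^ sigma / (pi `^ (N%:R / 2) * `|Gamma (- (sigma / 2))|).

Let sig0 : 0 < sigma. Proof. by have /andP[] := s02. Qed.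

Let a01 : 0 < sigma / 2 < 1.
Proof. by have /andP[h1 h2] := s02; rewrite divr_gt0//= ltr_pdivrMr// mul1r. Qed.

Lemma normGamma_gt0 : 0 < `|Gamma (- (sigma / 2))|.
Proof.
rewrite GammaN// divr_gt0//; have /andP[h1 h2] := a01 => //.
by rewrite Gamma_pos_gt0// subr_gt0.
Qed.

Lemma gauss_const_ge0 : 0 <= gauss_const.
Proof. by rewrite divr_ge0 ?powR_ge0// mulr_ge0 ?powR_ge0. Qed.

Lemma enorm_vec (z : TR N) : enorm (vec z) = Num.sqrt (sqnorm z).
Proof. by rewrite /enorm; congr Num.sqrt; apply: eq_bigr => i _; rewrite mxE. Qed.

Lemma sqnorm_ge0 (z : TR N) : 0 <= sqnorm z.
Proof. by apply: sumr_ge0 => i _; exact: sqr_ge0. Qed.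

Let be : R := (N%:R + sigma) / 2.

Let be0 : 0 < be. Proof. by rewrite divr_gt0// addr_gt0// ltr0n. Qed.

Lemma levyE (z : TR N) : sqnorm z != 0 ->
  levy z = gauss_const * (Gamma_pos be * (sqnorm z) `^ (- be)).
Proof.
move=> z0; have zp : 0 < sqnorm z by rewrite lt_def z0 sqnorm_ge0.
rewrite /levy enorm_vec -powR12_sqrt ?(ltW zp)// -powRrM.
rewrite (_ : 2^-1 * (N%:R + sigma) = be); last by rewrite mulrC.
rewrite powRN mulrA; congr (_ / _).
rewrite /fracLap_const /gauss_const /Gamma -/be be0.
rewrite mulrAC; congr (_ * _); rewrite mulrC mulrA -mulrA; congr (_ * _).
Qed.

Lemma levy_ge0 z : 0 <= levy z.
Proof.
have [z0|z0] := eqVneq (sqnorm z) 0; last first.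
  by rewrite levyE// mulr_ge0 ?gauss_const_ge0// mulr_ge0 ?powR_ge0// ltW// Gamma_pos_gt0.
rewrite /levy enorm_vec z0 sqrtr0 powR0 ?invr0 ?mulr0//.
by rewrite gt_eqF// addr_gt0// ltr0n.
Qed.

Lemma measurable_sqnorm : measurable_fun setT (@sqnorm R N).
Proof.
apply: measurable_sum => i; apply: measurable_funX; exact: measurable_tnthR.
Qed.

Lemma measurable_enorm_vec : measurable_fun setT (fun z : TR N => enorm (vec z)).
Proof.
under eq_fun do rewrite enorm_vec -powR12_sqrt ?sqnorm_ge0//.
apply: (measurableT_comp (f := fun x : R => x `^ 2^-1)); last exact: measurable_sqnorm.
exact: measurable_powR.
Qed.

Lemma measurable_levy : measurable_fun setT levy.
Proof.
apply: measurable_funM => //; under eq_fun do rewrite -powRN.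
apply: (measurableT_comp (f := fun x : R => x `^ (- (N%:R + sigma)))).
  exact: measurable_powR.
exact: measurable_enorm_vec.
Qed.

(** By Euler's integral [|z| ^ (- 2 be)] is a superposition of the Gaussians [exp (- s |z| ^ 2)];
    Tonelli's theorem exchanges the order. At the origin [levy] is 0 by the convention on division
    by 0 while the superposition diverges, and the vanishing of [h] there reconciles the two. *)
Lemma integral_levy (h : TR N -> R) : measurable_fun setT h -> (forall z, 0 <= h z) ->
  (forall z, sqnorm z = 0 -> h z = 0) ->
  (\int[lebesgueN R N]_z (h z * levy z)%:E =
   \int[mu]_(s in pos) ((gauss_const * s `^ (be - 1))%:E *
      \int[lebesgueN R N]_z (h z * expR (- (s * sqnorm z)))%:E))%E.
Proof.
move=> mh h0 hz.
pose w (s : R) := gauss_const * s `^ (be - 1).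
have w0 s : 0 <= w s by rewrite mulr_ge0 ?gauss_const_ge0 ?powR_ge0.
have mw : measurable_fun setT w by apply: measurable_funM => //; exact: measurable_powR.
pose k (p : TR N * measurableTypeR R) : R := \1_pos p.2 * (w p.2 * (h p.1 * expR (- (p.2 * sqnorm p.1)))).
have k0 p : 0 <= k p by rewrite mulr_ge0// mulr_ge0// mulr_ge0 ?expR_ge0.
have mk : measurable_fun setT (EFin \o k).
  apply/measurable_EFinP; apply: measurable_funM.
    apply: (measurableT_comp (f := \1_pos : R -> R)); last exact: measurable_snd.
    by apply: measurable_indic; exact: measurable_itv.
  apply: measurable_funM; first exact: measurableT_comp measurable_snd.
  apply: measurable_funM; first exact: measurableT_comp measurable_fst.
  apply: measurableT_comp => //; apply: measurableT_comp => //; apply: measurable_funM.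
    exact: measurable_snd.
  by apply: measurableT_comp measurable_fst; exact: measurable_sqnorm.
have cutoff (g : R -> R) : (\int[mu]_s (\1_pos s * g s)%:E = \int[mu]_(s in pos) (g s)%:E)%E.
  rewrite [RHS]integral_mkcond; apply: eq_integral => s _; rewrite patchE indicE.
  by case: ifPn => _; rewrite ?mul1r ?mul0r.
transitivity (\int[lebesgueN R N]_z \int[mu]_s (k (z, s))%:E)%E.
  apply: eq_integral => z _; rewrite /k/= cutoff.
  have [z0|z0] := eqVneq (sqnorm z) 0.
    by rewrite hz// mul0r integral0_eq// => s _; rewrite mul0r mulr0.
  have zp : 0 < sqnorm z by rewrite lt_def z0 sqnorm_ge0.
  transitivity (\int[mu]_(s in pos) ((gauss_const * h z) * (s `^ (be - 1) * expR (- (sqnorm z * s))))%:E)%E.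
    rewrite integral_posZ; last 3 first.
    - by rewrite mulr_ge0 ?gauss_const_ge0.
    - by move=> s _; rewrite mulr_ge0 ?powR_ge0 ?expR_ge0.
    - apply: cts_pos_measurable; apply: cts_posM; first exact: cts_pos_powR.
      exact: cts_pos_expNM.
    by rewrite integral_powR_exp// -EFinM levyE//; congr EFin; ring.
  by apply: eq_integral => s _; congr EFin; rewrite /w (mulrC (sqnorm z)); ring.
rewrite (@fubini_tonelli _ _ _ _ _ (lebesgueN R N) mu _ mk); last first.
  by move=> p; rewrite lee_fin.
rewrite [RHS]integral_mkcond; apply: eq_integral => s _; rewrite patchE.
case: ifPn => sp; last first.
  by rewrite integral0_eq// => z _; rewrite /= /k/= indicE (negbTE sp) mul0r.
have mhe : measurable_fun setT (fun z => (h z * expR (- (s * sqnorm z)))%:E).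
  apply/measurable_EFinP; apply: measurable_funM => //.
  apply: measurableT_comp => //; apply: measurableT_comp => //.
  by apply: measurable_funM => //; exact: measurable_sqnorm.
have he0 z : (0 <= (h z * expR (- (s * sqnorm z)))%:E)%E by rewrite lee_fin mulr_ge0 ?expR_ge0.
transitivity (\int[lebesgueN R N]_z ((w s)%:E * (h z * expR (- (s * sqnorm z)))%:E))%E.
  by apply: eq_integral => z _; rewrite /= /k/= indicE sp mul1r EFinM.
by rewrite ge0_integralZl// lee_fin.
Qed.

Lemma gauss_weight (s : R) : 0 < s ->
  gauss_const * s `^ (be - 1) * Num.sqrt (pi / s) ^+ N =
  2 `^ sigma / `|Gamma (- (sigma / 2))| * s `^ (sigma / 2 - 1).
Proof.
move=> s0; have p0 := @pi_gt0 R.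
rewrite -powR_mulrn ?sqrtr_ge0// -powR12_sqrt ?divr_ge0 ?(ltW p0) ?(ltW s0)//.
rewrite -powRrM powRM ?invr_ge0 ?(ltW p0) ?(ltW s0)//.
rewrite [s^-1](_ : _ = s `^ (-1)); last by rewrite powR_inv1// ltW.
rewrite -powRrM.
rewrite (_ : s `^ (sigma / 2 - 1) = s `^ (be - 1) * s `^ (-1 * (2^-1 * N%:R))); last first.
  rewrite -powRD ?(gt_eqF s0) ?implybT//; congr (_ `^ _); rewrite /be; by field.
rewrite /gauss_const [2^-1 * _]mulrC.
have pp : 0 < pi `^ (N%:R / 2) :> R by rewrite powR_gt0.
by field; rewrite !gt_eqF// normGamma_gt0.
Qed.

Lemma sum_sqr_sqnorm0 (z : TR N) i : sqnorm z = 0 -> tnth z i = 0 :> R.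
Proof.
move/eqP; rewrite psumr_eq0; last by move=> j _; exact: sqr_ge0.
by move/allP/(_ i (mem_index_enum _)); rewrite sqrf_eq0 => /eqP.
Qed.

(** The Gaussian integrals lead to [integral_stable_inv] at a quarter of the squared frequency. The
    factor [2 ^ sigma] in the normalization cancels the resulting [4 ^ (- sigma / 2)], and so the
    symbol has constant 1. *)
Lemma integral_1Bcos_levy (c : 'I_N -> R) :
  (\int[lebesgueN R N]_z ((1 - cos (lin c z)) * levy z)%:E =
   ((\sum_i c i ^+ 2) `^ (sigma / 2))%:E)%E.
Proof.
have G0 := normGamma_gt0.
rewrite (@integral_levy (fun z => 1 - cos (lin c z))); last 3 first.
- apply: measurable_funB => //; apply: measurableT_comp; first exact: measurable_cosT.
  exact: measurable_lin.
- by move=> z; rewrite subr_ge0 cos_le1.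
- move=> z z0; have -> : lin c z = 0.
    by rewrite /lin big1// => i _; rewrite (sum_sqr_sqnorm0 i z0) mulr0.
  by rewrite cos0 subrr.
set r := \sum_i _.
have r0 : 0 <= r / 4 by rewrite divr_ge0// sumr_ge0// => i _; exact: sqr_ge0.
transitivity (\int[mu]_(s in pos) (2 `^ sigma / `|Gamma (- (sigma / 2))| *
    (s `^ (sigma / 2 - 1) * (1 - expR (- (r / 4 / s)))))%:E)%E.
  apply: eq_integral => s; rewrite inE/= in_itv/= andbT => s0.
  rewrite integral_gauss_1Bcos// -EFinM -/r; congr EFin.
  by rewrite [LHS]mulrA gauss_weight// mulrA.
rewrite integral_posZ; last 3 first.
- by rewrite divr_ge0 ?powR_ge0.
- by move=> s s0; rewrite mulr_ge0 ?powR_ge0// subr_ge0 expR_le1 oppr_le0 divr_ge0// ltW.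
- by apply: cts_pos_measurable; exact: cts_pos_stable_inv.
rewrite integral_stable_inv// -EFinM; congr EFin.
rewrite mulrA divfK ?gt_eqF// powRM//; last by rewrite sumr_ge0// => i _; exact: sqr_ge0.
rewrite mulrCA -[RHS]mulr1; congr (_ * _).
rewrite (_ : 4^-1 = 2^-1 `^ 2); last by rewrite powR_mulrn// exprVn expr2 -natrM.
rewrite -powRrM mulrC mulrCA divff// mulr1 -powRM// mulVf//.
by rewrite powR1.
Qed.

(** It serves twice: at fixed [b] for the integrability of second differences, and through its
    dependence on [b] for the smallness of the operator on the penalization. *)
Lemma integral_1Bexp_levy (k : 'I_N) (b : R) : 0 <= b ->
  (\int[lebesgueN R N]_z ((1 - expR (- (b * tnth z k ^+ 2))) * levy z)%:E <=
   (2 `^ sigma * b `^ (sigma / 2))%:E)%E.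
Proof.
move=> b0; have G0 := normGamma_gt0.
rewrite (@integral_levy (fun z => 1 - expR (- (b * tnth z k ^+ 2)))); last 3 first.
- apply: measurable_funB => //; apply: measurableT_comp => //; apply: measurableT_comp => //.
  by apply: measurable_funM => //; apply: measurable_funX; exact: measurable_tnthR.
- by move=> z; rewrite subr_ge0 expR_le1 oppr_le0 mulr_ge0 ?sqr_ge0.
- by move=> z z0; rewrite (sum_sqr_sqnorm0 k z0) expr0n mulr0 oppr0 expR0 subrr.
have m1 : measurable_fun pos (fun s => s `^ (sigma / 2 - 1) * (1 - expR (- (b / s)))).
  by apply: cts_pos_measurable; exact: cts_pos_stable_inv.
apply: (@le_trans _ _ (\int[mu]_(s in pos) (2 `^ sigma / `|Gamma (- (sigma / 2))| *
    (s `^ (sigma / 2 - 1) * (1 - expR (- (b / s)))))%:E)%E).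
  apply: ge0_le_integral => //.
  - move=> s _; apply: mule_ge0; first by rewrite lee_fin mulr_ge0 ?gauss_const_ge0 ?powR_ge0.
    apply: integral_ge0 => z _.
    by rewrite lee_fin mulr_ge0 ?expR_ge0// subr_ge0 expR_le1 oppr_le0 mulr_ge0 ?sqr_ge0.
  - apply: emeasurable_funM.
      apply/measurable_EFinP; apply: cts_pos_measurable.
      apply: (@cts_posM _ (fun=> gauss_const)); last exact: cts_pos_powR.
      by move=> s _; exact: cvg_cst.
    apply: measurable_funTS.
    apply: (@measurable_fun_fubini_tonelli_G _ _ _ _ _ (lebesgueN R N)
      (fun p : TR N * measurableTypeR R => ((1 - expR (- (b * tnth p.1 k ^+ 2))) * expR (- (p.2 * sqnorm p.1)))%:E)).
      apply/measurable_EFinP; apply: measurable_funM.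
        apply: measurable_funB => //; apply: measurableT_comp => //; apply: measurableT_comp => //.
        apply: measurable_funM => //; apply: measurable_funX.
        apply: (measurableT_comp (f := fun z : TR N => tnth z k : R)); first exact: measurable_tnthR.
        exact: measurable_fst.
      apply: measurableT_comp => //; apply: measurableT_comp => //; apply: measurable_funM.
        exact: measurable_snd.
      by apply: measurableT_comp measurable_fst; exact: measurable_sqnorm.
    by move=> p; rewrite lee_fin mulr_ge0 ?expR_ge0// subr_ge0 expR_le1 oppr_le0 mulr_ge0 ?sqr_ge0.
  - by apply/measurable_EFinP; apply: measurable_funM.
  - move=> s; rewrite /= in_itv/= andbT => s0.
    apply: (@le_trans _ _ ((gauss_const * s `^ (be - 1))%:E *
       (Num.sqrt (pi / s) ^+ N * (1 - expR (- (b / s))))%:E)%E).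
      rewrite lee_wpmul2l ?integral_gauss_1Bexp//.
      by rewrite lee_fin mulr_ge0 ?gauss_const_ge0 ?powR_ge0.
    by rewrite -EFinM lee_fin [leLHS]mulrA gauss_weight// mulrA.
have e0 s : 0 < s -> 0 <= s `^ (sigma / 2 - 1) * (1 - expR (- (b / s))).
  by move=> s0; rewrite mulr_ge0 ?powR_ge0// subr_ge0 expR_le1 oppr_le0 divr_ge0// ltW.
have C0 : 0 <= 2 `^ sigma / `|Gamma (- (sigma / 2))| by rewrite divr_ge0 ?powR_ge0.
rewrite (integral_posZ C0 e0 m1).
by rewrite integral_stable_inv// -EFinM lee_fin mulrA divfK ?gt_eqF.
Qed.

End levy_measure.

(** * The fractional Laplacian as an integral of second differences *)

Section nice_functions.
Context {R : realType} {N : nat}.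
Variable sigma : R.
Hypothesis s02 : 0 < sigma < 2.
Hypothesis N0 : (0 < N)%N.
Local Notation V := 'rV[R]_N.
Local Notation TR n := (n.-tuple (measurableTypeR R)).
Local Notation leb := (lebesgueN R N).
Local Notation nu := (@levy R N sigma).
Implicit Types (phi psi : V -> R) (x : V).

Definition diff2 phi x (z : TR N) : R := phi (x + vec z) + phi (x - vec z) - 2 * phi x.

(** Comparable to [min (1, |z| ^ 2)], the usual weight for which a Levy density is integrable; each
    summand has the integral bound of [integral_1Bexp_levy]. *)
Definition domin (z : TR N) : R := \sum_(i < N) (1 - expR (- (tnth z i ^+ 2))).

(* Under these conditions at [x] the truncated integrals that define [fracLap] converge
   to an absolutely convergent integral of second differences. *)
Record nice phi x : Prop := Nice {
  nice_meas : measurable_fun setT (fun z : TR N => phi (x + vec z));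
  nice_bnd : exists B, forall y, `|phi y| <= B;
  nice_diff2 : exists C, forall z, `|diff2 phi x z| <= C * domin z }.

(** A union bound: one minus a product of numbers in [[0, 1]] is at most the sum of their
    complements. *)
Lemma domin_lb z : 1 - expR (- sqnorm z) <= domin z.
Proof.
rewrite /sqnorm /domin.
suff : 0 <= \sum_(i < N) tnth z i ^+ 2 /\
    1 - expR (- \sum_(i < N) tnth z i ^+ 2) <= \sum_(i < N) (1 - expR (- (tnth z i ^+ 2))) by case.
elim/big_rec2: _ => [|i a b _ [h0 h]]; first by rewrite oppr0 expR0 subrr.
set y := tnth z i ^+ 2 in h *.
have y0 : 0 <= y by exact: sqr_ge0.
split; first by rewrite addr_ge0.
have e1 : 0 <= 1 - expR (- y) by rewrite subr_ge0 expR_le1 oppr_le0.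
apply: (@le_trans _ _ (1 - expR (- y) + (1 - expR (- b)))); last by rewrite lerD2l.
rewrite opprD expRD -subr_ge0.
have -> : 1 - expR (- y) + (1 - expR (- b)) - (1 - expR (- y) * expR (- b)) =
  (1 - expR (- y)) * (1 - expR (- b)) by ring.
by rewrite mulr_ge0// subr_ge0 expR_le1 oppr_le0.
Qed.

Let mnu : measurable_fun setT nu := measurable_levy sigma.
Let nu0 z : 0 <= nu z := levy_ge0 s02 N0 z.

Lemma integrable_dom (D : set (TR N)) (h g : TR N -> R) : measurable D -> measurable_fun D h ->
  (forall z, D z -> `|h z| <= g z) -> leb.-integrable D (EFin \o g) ->
  leb.-integrable D (EFin \o h).
Proof.
move=> mD mh hg; apply: le_integrable => //; first exact/measurable_EFinP.
by move=> z Dz; rewrite /= lee_fin (le_trans (hg _ Dz))// ler_norm.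
Qed.

Lemma integrable_1Bexp_levy (i : 'I_N) (b : R) : 0 <= b ->
  leb.-integrable setT (EFin \o (fun z => (1 - expR (- (b * tnth z i ^+ 2))) * nu z)).
Proof.
move=> b0.
have m1 : measurable_fun setT (fun z : TR N => (1 - expR (- (b * tnth z i ^+ 2))) * nu z).
  apply: measurable_funM => //; apply: measurable_funB => //; apply: measurableT_comp => //.
  apply: measurableT_comp => //; apply: measurable_funM => //.
  by apply: measurable_funX; exact: measurable_tnthR.
have p1 (z : TR N) : 0 <= (1 - expR (- (b * tnth z i ^+ 2))) * nu z.
  by rewrite mulr_ge0// subr_ge0 expR_le1 oppr_le0 mulr_ge0 ?sqr_ge0.
apply/integrableP; split; first exact/measurable_EFinP.
under eq_integral do rewrite /= ger0_norm//.
by apply: (le_lt_trans (integral_1Bexp_levy s02 N0 i b0)); rewrite ltry.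
Qed.

Lemma integrable_domin_levy : leb.-integrable setT (fun z => (domin z * nu z)%:E).
Proof.
have i1 (i : 'I_N) : leb.-integrable setT (fun z => ((1 - expR (- (tnth z i ^+ 2))) * nu z)%:E).
  by apply: eq_integrable (integrable_1Bexp_levy i ler01) => // z _; rewrite /= mul1r.
have : leb.-integrable setT (fun z => \sum_(i < N) ((1 - expR (- (tnth z i ^+ 2))) * nu z)%:E)%E.
  by apply: integrable_sum => // i _; exact: i1.
by apply: eq_integrable => // z _; rewrite sumEFin /domin mulr_suml.
Qed.

Lemma vec_opp (z : TR N) : vec (opp_tuple z) = - vec z :> V.
Proof. by apply/rowP => i; rewrite !mxE tnth_mktuple. Qed.

Lemma sqnorm_opp (z : TR N) : sqnorm (opp_tuple z) = sqnorm z.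
Proof. by apply: eq_bigr => i _; rewrite tnth_mktuple sqrrN. Qed.

Lemma levy_opp (z : TR N) : nu (opp_tuple z) = nu z.
Proof. by rewrite /levy !enorm_vec sqnorm_opp. Qed.

Lemma measurable_nice_opp phi x : nice phi x ->
  measurable_fun setT (fun z : TR N => phi (x - vec z)).
Proof.
move=> [m _ _]; have := measurableT_comp m (@measurable_opp_tuple R N).
by congr (measurable_fun _ _); apply/funext => z /=; rewrite vec_opp.
Qed.

Lemma measurable_diff2 phi x : nice phi x -> measurable_fun setT (diff2 phi x).
Proof.
move=> n; apply: measurable_funB => //; apply: measurable_funD; last exact: measurable_nice_opp.
by case: n.
Qed.

Lemma integrable_diff2 phi x : nice phi x ->
  leb.-integrable setT (fun z => (diff2 phi x z / 2 * nu z)%:E).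
Proof.
move=> n; have [_ _ [C hC]] := n.
have i2 : leb.-integrable setT (EFin \o (fun z => (C / 2) * (domin z * nu z))).
  have : leb.-integrable setT (fun z => (C / 2)%:E * (domin z * nu z)%:E)%E.
    by apply: integrableZl => //; exact: integrable_domin_levy.
  by apply: eq_integrable => // z _; rewrite EFinM.
apply: integrable_dom i2 => //.
  by apply: measurable_funM => //; apply: measurable_funM => //; exact: measurable_diff2.
move=> z _; rewrite [leLHS]normrM (ger0_norm (nu0 _)) [leRHS]mulrA ler_wpM2r//.
rewrite normrM (_ : `|2^-1| = 2^-1 :> R); last by rewrite gtr0_norm.
by rewrite [leRHS]mulrAC ler_wpM2r.
Qed.

Definition trunc_set (r : R) : set (TR N) := [set z | r < enorm (vec z)].

Lemma measurable_trunc_set r : measurable (trunc_set r).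
Proof.
rewrite (_ : trunc_set r = setT `&` (fun z : TR N => enorm (vec z)) @^-1` `]r, +oo[%classic).
  apply: (@measurable_enorm_vec R N) => //; exact: measurable_itv.
by apply/seteqP; split => z /=; rewrite in_itv/= andbT => // -[].
Qed.

Lemma integrable_trunc phi x (r : R) (h : TR N -> R) : 0 < r -> measurable_fun setT h ->
  (exists B, forall z, `|h z| <= B) ->
  leb.-integrable (trunc_set r) (fun z => (h z * nu z)%:E).
Proof.
(* Outside the ball of radius [r] the weight [domin] is at least [q], which turns the constant bound
   [B] into a multiple of [domin]. *)
move=> r0 mh [B hB]; pose q := 1 - expR (- (r ^+ 2)).
have q0 : 0 < q by rewrite subr_gt0 expR_lt1 oppr_lt0 exprn_gt0.
have B0 : 0 <= B.
  by apply: le_trans (hB [tuple of nseq N 0]); exact: normr_ge0.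
have iB : leb.-integrable (trunc_set r) (EFin \o (fun z => (B / q) * (domin z * nu z))).
  apply: (@integrableS _ _ _ _ setT) => //; first exact: measurable_trunc_set.
  have : leb.-integrable setT (fun z => (B / q)%:E * (domin z * nu z)%:E)%E.
    by apply: integrableZl => //; exact: integrable_domin_levy.
  by apply: eq_integrable => // z _; rewrite EFinM.
apply: integrable_dom iB => //; first exact: measurable_trunc_set.
  by apply: measurable_funTS; exact: measurable_funM.
move=> z; rewrite /trunc_set/= => rz.
rewrite [leLHS]normrM (ger0_norm (nu0 _)) [leRHS]mulrA ler_wpM2r//.
apply: (le_trans (hB z)); rewrite -mulrA ler_peMr// mulrC ler_pdivlMr// mul1r.
apply: le_trans (domin_lb z); rewrite /q lerD2l lerN2 ler_expR lerN2.
rewrite enorm_vec in rz.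
have hs : r ^+ 2 <= Num.sqrt (sqnorm z) ^+ 2.
  by rewrite ler_pXn2r ?nnegrE ?sqrtr_ge0 ?(ltW r0) ?(ltW rz).
by rewrite sqr_sqrtr ?sqnorm_ge0 in hs.
Qed.

Lemma integral_leb_opp (f : TR N -> \bar R) : measurable_fun setT f ->
  (\int[leb]_z f (opp_tuple z) = \int[leb]_z f z)%E.
Proof.
move=> mf; rewrite integralE [RHS]integralE; congr (_ - _)%E.
  rewrite -(@integral_lebesgueN_opp _ _ (f^\+)%E)//; first by apply: eq_integral => z _; rewrite !funeposE.
  exact: measurable_funepos.
rewrite -(@integral_lebesgueN_opp _ _ (f^\-)%E)//; first by apply: eq_integral => z _; rewrite !funenegE.
exact: measurable_funeneg.
Qed.

Lemma Rintegral_trunc_opp (r : R) (h : TR N -> R) : measurable_fun setT h ->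
  \int[leb]_(z in trunc_set r) h (opp_tuple z) = \int[leb]_(z in trunc_set r) h z.
Proof.
move=> mh; rewrite /Rintegral; congr fine.
rewrite integral_mkcond [RHS]integral_mkcond.
rewrite -[RHS]integral_leb_opp; last first.
  rewrite -(measurable_restrictT _ (measurable_trunc_set r)).
  by apply/measurable_EFinP; exact: measurable_funTS.
apply: eq_integral => z _; rewrite !patchE.
have -> : (opp_tuple z \in trunc_set r) = (z \in trunc_set r); last by [].
by apply/idP/idP; rewrite !inE /trunc_set/= !enorm_vec sqnorm_opp.
Qed.

(** The density is even and the truncation set symmetric, so that first differences can be averaged
    with their reflections. This removes the first-order term, which is not integrable near the
    origin when [1 <= sigma]. *)
Lemma trunc_diff2 phi x (r : R) : nice phi x -> 0 < r ->
  \int[leb]_(z in trunc_set r) ((phi (x + vec z) - phi x) * nu z) =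
  \int[leb]_(z in trunc_set r) (diff2 phi x z / 2 * nu z).
Proof.
move=> n r0; have [m [B hB] _] := n.
pose g z := (phi (x + vec z) - phi x) * nu z.
pose g' z := (phi (x - vec z) - phi x) * nu z.
have mg : measurable_fun setT g by apply: measurable_funM => //; exact: measurable_funB.
have bd y : `|phi y - phi x| <= B + B by rewrite (le_trans (ler_normB _ _))// lerD.
have ig : leb.-integrable (trunc_set r) (EFin \o g).
  apply: (integrable_trunc phi x r0 (h := fun z => phi (x + vec z) - phi x)).
    exact: measurable_funB.
  by exists (B + B) => z.
have ig' : leb.-integrable (trunc_set r) (EFin \o g').
  apply: (integrable_trunc phi x r0 (h := fun z => phi (x - vec z) - phi x)).
    by apply: measurable_funB => //; exact: measurable_nice_opp.
  by exists (B + B) => z.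
have e : \int[leb]_(z in trunc_set r) g' z = \int[leb]_(z in trunc_set r) g z.
  rewrite -(Rintegral_trunc_opp r mg); apply: eq_Rintegral => z _.
  by rewrite /g /g' levy_opp vec_opp.
have mT := measurable_trunc_set r.
have : \int[leb]_(z in trunc_set r) (g z + g' z) = 2 * \int[leb]_(z in trunc_set r) g z.
  by rewrite RintegralD// e mulrDl mul1r.
move=> e2; rewrite -[LHS]/(\int[leb]_(z in trunc_set r) g z).
have i2 : leb.-integrable (trunc_set r) (EFin \o (fun z => diff2 phi x z / 2 * nu z)).
  by apply: integrableS (integrable_diff2 n).
have e3 : \int[leb]_(z in trunc_set r) (g z + g' z) =
   2 * \int[leb]_(z in trunc_set r) (diff2 phi x z / 2 * nu z).
  rewrite -RintegralZl//; apply: eq_Rintegral => z _; rewrite /g /g' /diff2; by field.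
have two : (2 : R) != 0 by [].
by have := e2; rewrite e3 => /(mulfI two) ->.
Qed.

Lemma fracLap_cvg phi x : nice phi x ->
  \int[leb]_(z in trunc_set r) ((phi (x + vec z) - phi x) * nu z) @[r --> 0^'+] -->
  \int[leb]_z (diff2 phi x z / 2 * nu z).
Proof.
move=> n; apply/cvg_at_rightP => u [u0 ucv].
pose f z := diff2 phi x z / 2 * nu z.
pose fn k := (fun z => (f z)%:E) \_ (trunc_set (u k)).
have mf : measurable_fun setT (fun z => (f z)%:E).
  apply/measurable_EFinP; apply: measurable_funM => //; apply: measurable_funM => //.
  exact: measurable_diff2.
have mfn k : measurable_fun setT (fn k).
  rewrite /fn -(measurable_restrictT _ (measurable_trunc_set (u k))).
  exact: measurable_funTS.
have iabs : leb.-integrable setT (fun z => `|(f z)%:E|)%E.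
  by apply: integrable_abse; exact: integrable_diff2.
have cvf : {ae leb, forall z, [set: TR N] z -> fn k z @[k --> \oo] --> (f z)%:E}.
  apply: aeW => z _.
  (* No truncation set contains the origin, but the second difference vanishes there. *)
  have [z0|z0] := eqVneq (sqnorm z) 0.
    have v0 : vec z = 0 :> V.
      by apply/rowP => i; rewrite !mxE (sum_sqr_sqnorm0 i z0).
    have f0 : f z = 0 by rewrite /f /diff2 v0 addr0 subr0; ring.
    rewrite f0; apply: cvg_near_cst; near=> k; rewrite /fn patchE.
    by case: ifPn => // _; rewrite f0.
  apply: cvg_near_cst; near=> k; rewrite /fn patchE ifT// inE /trunc_set/=.
  near: k; apply: (cvgr_lt 0) => //.
  by rewrite enorm_vec sqrtr_gt0 lt_def z0 sqnorm_ge0.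
have dom : {ae leb, forall z k, [set: TR N] z -> (`|fn k z| <= `|(f z)%:E|)%E}.
  apply: aeW => z k _; rewrite /fn patchE; case: ifPn => // _.
  by rewrite abse0 abse_ge0.
have [_ _ h] := dominated_convergence measurableT mfn mf cvf iabs dom.
have h2 : fine (\int[leb]_z fn k z)%E @[k --> \oo] --> fine (\int[leb]_z (f z)%:E)%E.
  apply: fine_cvg; rewrite fineK//.
  by apply: integrable_fin_num => //; exact: integrable_diff2.
move: h2; rewrite -[fine (\int[leb]_z (f z)%:E)%E]/(\int[leb]_z f z).
apply: cvg_trans; apply: near_eq_cvg; near=> k.
rewrite (trunc_diff2 n (u0 k)).
by rewrite /fn -integral_mkcond.
Unshelve. all: by end_near. Qed.

Lemma fracLapE phi x : nice phi x ->
  fracLap sigma phi x = \int[leb]_z (diff2 phi x z / 2 * nu z).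
Proof. by move=> n; apply/cvg_lim; [exact: Rhausdorff|exact: fracLap_cvg]. Qed.

Lemma niceD phi psi x : nice phi x -> nice psi x -> nice (fun y => phi y + psi y) x.
Proof.
move=> [m1 [B1 b1] [C1 c1]] [m2 [B2 b2] [C2 c2]]; split.
- exact: measurable_funD.
- by exists (B1 + B2) => y; rewrite (le_trans (ler_normD _ _))// lerD.
- exists (C1 + C2) => z; rewrite mulrDl.
  have -> : diff2 (fun y => phi y + psi y) x z = diff2 phi x z + diff2 psi x z.
    by rewrite /diff2; ring.
  by rewrite (le_trans (ler_normD _ _))// lerD.
Qed.

Lemma niceZ k phi x : nice phi x -> nice (fun y => k * phi y) x.
Proof.
move=> [m1 [B1 b1] [C1 c1]]; split.
- exact: measurable_funM.
- by exists (`|k| * B1) => y; rewrite normrM ler_wpM2l.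
- exists (`|k| * C1) => z; have -> : diff2 (fun y => k * phi y) x z = k * diff2 phi x z.
    by rewrite /diff2; ring.
  by rewrite normrM -mulrA ler_wpM2l.
Qed.

Lemma nice_cst (k : R) x : nice (fun=> k) x.
Proof.
split=> //; first by exists `|k|.
by exists 0 => z; rewrite /diff2 mul0r (_ : k + k - 2 * k = 0) ?normr0//; ring.
Qed.

Lemma fracLapD phi psi x : nice phi x -> nice psi x ->
  fracLap sigma (fun y => phi y + psi y) x = fracLap sigma phi x + fracLap sigma psi x.
Proof.
move=> n1 n2; rewrite !fracLapE//; last exact: niceD.
rewrite -RintegralD//; [|exact: integrable_diff2|exact: integrable_diff2].
by apply: eq_Rintegral => z _; rewrite /diff2; field.
Qed.

Lemma fracLapZ k phi x : nice phi x ->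
  fracLap sigma (fun y => k * phi y) x = k * fracLap sigma phi x.
Proof.
move=> n1; rewrite !fracLapE//; last exact: niceZ.
rewrite -RintegralZl//; last exact: integrable_diff2.
by apply: eq_Rintegral => z _; rewrite /diff2; field.
Qed.

Lemma fracLap_cst (k : R) x : fracLap sigma (fun=> k) x = 0.
Proof.
rewrite fracLapE; last exact: nice_cst.
rewrite /Rintegral integral0_eq// => z _.
by rewrite /diff2 (_ : k + k - 2 * k = 0) ?mul0r//; ring.
Qed.

Lemma fracLap_ub phi x (b : R) : nice phi x -> 0 <= b ->
  (forall z, diff2 phi x z <= 2 * \sum_(i < N) (1 - expR (- (b * tnth z i ^+ 2)))) ->
  fracLap sigma phi x <= N%:R * (2 `^ sigma * b `^ (sigma / 2)).
Proof.
move=> n b0 h; rewrite fracLapE//.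
have i1 (i : 'I_N) := integrable_1Bexp_levy i b0.
have iS : leb.-integrable setT (fun z => \sum_(i < N) ((1 - expR (- (b * tnth z i ^+ 2))) * nu z)%:E)%E.
  by apply: integrable_sum => // i _; exact: i1.
have iS' : leb.-integrable setT (EFin \o (fun z => \sum_(i < N) ((1 - expR (- (b * tnth z i ^+ 2))) * nu z))).
  by apply: eq_integrable iS => // z _; rewrite sumEFin.
apply: (@le_trans _ _ (\int[leb]_z (\sum_(i < N) ((1 - expR (- (b * tnth z i ^+ 2))) * nu z)))).
  apply: le_Rintegral => //; first exact: integrable_diff2.
  move=> z _; rewrite -mulr_suml ler_wpM2r// ler_pdivrMr// mulrC; exact: h.
rewrite /Rintegral; under eq_integral do rewrite -sumEFin.
rewrite integral_sum//.
pose c : R := 2 `^ sigma * b `^ (sigma / 2).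
have hS : (\sum_(i < N) \int[leb]_z ((1 - expR (- (b * tnth z i ^+ 2))) * nu z)%:E <= (N%:R * c)%:E)%E.
  rewrite (_ : (N%:R * c)%:E = \sum_(i < N) c%:E)%E; last first.
    by rewrite sumEFin sumr_const card_ord mulr_natl.
  by apply: lee_sum => i _; exact: integral_1Bexp_levy.
rewrite -lee_fin fineK// ge0_fin_numE ?(le_lt_trans hS) ?ltry//.
apply: sume_ge0 => i _; apply: integral_ge0 => z _.
by rewrite lee_fin mulr_ge0// subr_ge0 expR_le1 oppr_le0 mulr_ge0 ?sqr_ge0.
Qed.

Lemma second_diff_bound (g g1 g2 : R -> R) (K : R) :
  (forall y : R, is_derive y 1 g (g1 y)) -> (forall y : R, is_derive y 1 g1 (g2 y)) ->
  (forall y, `|g2 y| <= K) -> forall y z, `|g (y + z) + g (y - z) - 2 * g y| <= 2 * K * z ^+ 2.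
Proof.
move=> d1 d2 hK y z.
have lip1 u v : u <= v -> `|g1 v - g1 u| <= K * (v - u).
  move=> uv; have cg1 : {within `[u, v], continuous g1}.
    apply: continuous_subspaceT => t; exact: is_derive_continuous (d2 t).
  have [t _ ->] := MVT_segment uv (fun t _ => d2 t) cg1.
  by rewrite normrM (ger0_norm (_ : 0 <= v - u)) ?subr_ge0// ler_wpM2r// subr_ge0.
wlog z0 : z / 0 <= z.
  move=> h; have [/h//|z0] := leP 0 z.
  have := h (- z); rewrite oppr_ge0 opprK sqrrN => /(_ (ltW z0)).
  by rewrite [g (y - z) + _]addrC.
pose p t := g (y + t) + g (y - t) - 2 * g y.
have dp (t : R) : is_derive t 1 p (g1 (y + t) - g1 (y - t)).
  have e1 : is_derive t 1 (fun t => y + t) 1.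
    have h := is_deriveD (is_derive_cst y t (1:R)) (is_derive_id t (1:R)).
    by apply: (is_derive_eq h); rewrite add0r.
  have e2 : is_derive t 1 (fun t => y - t) (- 1).
    have h := is_deriveB (is_derive_cst y t (1:R)) (is_derive_id t (1:R)).
    by apply: (is_derive_eq h); rewrite sub0r.
  have c1 := @is_derive1_comp _ g (fun t => y + t) t _ _ (d1 _) e1.
  have c2 := @is_derive1_comp _ g (fun t => y - t) t _ _ (d1 _) e2.
  have h := is_deriveB (is_deriveD c1 c2) (is_derive_cst (2 * g y) t (1:R)).
  by apply: (is_derive_eq h); rewrite mulr1 mulrN1 subr0.
have cp : {within `[0, z], continuous p}.
  by apply: continuous_subspaceT => t; exact: is_derive_continuous (dp t).
have [t tz] := MVT_segment z0 (fun t _ => dp t) cp.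
rewrite {1}/p => e; move: tz; rewrite in_itv/= => /andP[t0 tz].
have -> : g (y + z) + g (y - z) - 2 * g y = (g1 (y + t) - g1 (y - t)) * z.
  by move: e; rewrite /p addr0 !subr0 => <-; ring.
rewrite normrM (ger0_norm z0) expr2 mulrA ler_wpM2r//.
have K0 : 0 <= K by exact: le_trans (hK 0).
apply: (le_trans (lip1 _ _ _)); first by rewrite lerD2l ge0_cp.
rewrite (_ : y + t - (y - t) = 2 * t); last by ring.
by rewrite mulrA [K * 2]mulrC ler_wpM2l// mulr_ge0.
Qed.

(** A bound for large arguments and a linear bound for small ones merge into a multiple of
    [1 - expR (- y)], because the latter is at least [y / (1 + y)]. In this form the integrals
    against the Levy and stable measures are explicit. *)
Lemma le_1Bexp (d A K y : R) : 0 <= y -> 0 <= A -> 0 <= K -> d <= A -> d <= K * y ->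
  d <= 2 * (A + K) * (1 - expR (- y)).
Proof.
move=> y0 A0 K0 dA dK; have h : y / (1 + y) <= 1 - expR (- y).
  have p : 0 < 1 + y by rewrite ltr_pwDl.
  rewrite (_ : y / (1 + y) = 1 - (1 + y)^-1); last by field; rewrite gt_eqF.
  by rewrite lerD2l lerN2 expRN lef_pV2 ?posrE ?expR_gt0// expR_ge1Dx.
have AK : 0 <= 2 * (A + K) by rewrite mulr_ge0// addr_ge0.
apply: (@le_trans _ _ (2 * (A + K) * (y / (1 + y)))); last by rewrite ler_wpM2l.
have p : 0 < 1 + y by rewrite ltr_pwDl.
rewrite mulrA ler_pdivlMr//.
have [y1|y1] := leP y 1.
  apply: (@le_trans _ _ (K * y * 2)).
    apply: (@le_trans _ _ (K * y * (1 + y))); first by rewrite ler_wpM2r// ltW.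
    by rewrite ler_wpM2l ?mulr_ge0//; lra.
  have : 0 <= A * y by rewrite mulr_ge0.
  nra.
have h1 : d * (1 + y) <= A * (1 + y) by rewrite ler_wpM2r// ltW.
have h2 : 0 <= K * y by rewrite mulr_ge0.
have h3 : A * 1 <= A * y by rewrite ler_wpM2l// ltW.
nra.
Qed.

Definition linf (c : 'I_N -> R) (y : V) : R := \sum_i c i * y 0 i.

Lemma linfD c y (z : TR N) : linf c (y + vec z) = linf c y + lin c z.
Proof.
by rewrite /linf /lin -big_split/=; apply: eq_bigr => i _; rewrite !mxE mulrDr.
Qed.

Lemma linfB c y (z : TR N) : linf c (y - vec z) = linf c y - lin c z.
Proof.
by rewrite /linf /lin -sumrB; apply: eq_bigr => i _; rewrite !mxE mulrBr.
Qed.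

Lemma lin_sqr_le c (z : TR N) : lin c z ^+ 2 <= (\sum_i `|c i|) ^+ 2 * sqnorm z.
Proof.
have q0 := sqnorm_ge0 z.
have e i : `|tnth z i : R| <= Num.sqrt (sqnorm z).
  rewrite -sqrtr_sqr ler_wsqrtr// /sqnorm (bigD1 i)//= lerDl.
  by apply: sumr_ge0 => j _; exact: sqr_ge0.
have h : `|lin c z| <= (\sum_i `|c i|) * Num.sqrt (sqnorm z).
  apply: (le_trans (ler_norm_sum _ _ _)); rewrite mulr_suml; apply: ler_sum => i _.
  by rewrite normrM ler_wpM2l.
rewrite -[leRHS](_ : ((\sum_i `|c i|) * Num.sqrt (sqnorm z)) ^+ 2 = _); last first.
  by rewrite exprMn sqr_sqrtr.
rewrite -[leLHS]real_normK ?num_real// ler_pXn2r// nnegrE// mulr_ge0 ?sqrtr_ge0//.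
exact: sumr_ge0.
Qed.

Lemma nice_comp_lin (g g1 g2 : R -> R) (A K : R) c (th : R) x :
  (forall y : R, is_derive y 1 g (g1 y)) -> (forall y : R, is_derive y 1 g1 (g2 y)) ->
  (forall y, `|g y| <= A) -> (forall y, `|g2 y| <= K) ->
  nice (fun y => g (linf c y + th)) x.
Proof.
move=> d1 d2 hA hK.
have A0 : 0 <= A by exact: le_trans (hA 0).
have K0 : 0 <= K by exact: le_trans (hK 0).
have mg : measurable_fun setT g.
  by apply: continuous_measurable_fun => y; exact: is_derive_continuous (d1 y).
split.
- apply: (measurableT_comp mg); apply: measurable_funD => //.
  by under eq_fun do rewrite linfD; apply: measurable_funD => //; exact: measurable_lin.
- by exists A => y; exact: hA.
- pose L := (\sum_i `|c i|) ^+ 2.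
  exists (2 * (4 * A + 2 * K * L)) => z.
  have L0 : 0 <= L by exact: sqr_ge0.
  have -> : diff2 (fun y => g (linf c y + th)) x z =
      g ((linf c x + th) + lin c z) + g ((linf c x + th) - lin c z) - 2 * g (linf c x + th).
    by rewrite /diff2 linfD linfB; congr (g _ + g _ - _); ring.
  apply: (@le_trans _ _ (2 * (4 * A + 2 * K * L) * (1 - expR (- sqnorm z)))); last first.
    rewrite ler_wpM2l ?domin_lb//.
    by have := mulr_ge0 K0 L0; lra.
  apply: le_1Bexp; first exact: sqnorm_ge0.
  - by lra.
  - by have := mulr_ge0 K0 L0; lra.
  - have h1 := hA (linf c x + th + lin c z); have h2 := hA (linf c x + th - lin c z).
    have h3 := hA (linf c x + th); move: h1 h2 h3; rewrite !ler_norml => /andP[? ?] /andP[? ?] /andP[? ?].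
    by apply/andP; split; lra.
  - apply: (le_trans (second_diff_bound d1 d2 hK _ _)).
    by rewrite -[leRHS]mulrA ler_wpM2l//; [lra|exact: lin_sqr_le].
Qed.

Lemma is_derive_Nsin (y : R) : is_derive y 1 (fun y => - sin y) (- cos y).
Proof. exact: is_deriveN (is_derive_sin y). Qed.

Lemma nice_cos c (th : R) x : nice (fun y => cos (linf c y + th)) x.
Proof.
apply: (@nice_comp_lin cos (fun y => - sin y) (fun y => - cos y) 1 1).
- exact: normr_cos_le1.
- by move=> y; rewrite normrN normr_cos_le1.
Qed.

Lemma fracLap_cos c (th : R) x :
  fracLap sigma (fun y => cos (linf c y + th)) x =
  - (\sum_i c i ^+ 2) `^ (sigma / 2) * cos (linf c x + th).
Proof.
rewrite fracLapE; last exact: nice_cos.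
have i1 : leb.-integrable setT (EFin \o (fun z => (1 - cos (lin c z)) * nu z)).
  have p z : 0 <= (1 - cos (lin c z)) * nu z by rewrite mulr_ge0// subr_ge0 cos_le1.
  apply/integrableP; split.
    apply/measurable_EFinP; apply: measurable_funM => //; apply: measurable_funB => //.
    by apply: measurableT_comp; [exact: measurable_cosT|exact: measurable_lin].
  under eq_integral do rewrite /= ger0_norm//.
  by rewrite integral_1Bcos_levy// ltry.
transitivity (\int[leb]_z (- cos (linf c x + th) * ((1 - cos (lin c z)) * nu z))).
  apply: eq_Rintegral => z _; rewrite /diff2 linfD linfB.
  rewrite (_ : linf c x + lin c z + th = (linf c x + th) + lin c z); last by ring.
  rewrite (_ : linf c x - lin c z + th = (linf c x + th) - lin c z); last by ring.
  by rewrite cosD cosB; field.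
rewrite RintegralZl// /Rintegral integral_1Bcos_levy//=; ring.
Qed.

Definition gbump (b y : R) : R := 1 - expR (- (b * y ^+ 2)).
Definition gbump1 (b y : R) : R := 2 * b * y * expR (- (b * y ^+ 2)).
Definition gbump2 (b y : R) : R := (2 * b - 4 * b ^+ 2 * y ^+ 2) * expR (- (b * y ^+ 2)).

Lemma is_derive_expsq (b y : R) :
  is_derive y 1 (fun y => expR (- (b * y ^+ 2))) (- (2 * b * y) * expR (- (b * y ^+ 2))).
Proof.
have h1 := is_deriveN (is_deriveZ b (is_derive_sqr y)).
have h := @is_derive1_comp _ expR (fun y : R => - (b * y ^+ 2)) y _ _ (is_derive_expR _) h1.
by apply: (is_derive_eq h); rewrite -[_ *: _]/(_ * _); ring.
Qed.

Lemma is_derive_gbump (b y : R) : is_derive y 1 (gbump b) (gbump1 b y).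
Proof.
have h := is_deriveB (is_derive_cst (1:R) y (1:R)) (is_derive_expsq b y).
by apply: (is_derive_eq h); rewrite /gbump1; ring.
Qed.

Lemma is_derive_gbump1 (b y : R) : is_derive y 1 (gbump1 b) (gbump2 b y).
Proof.
have h := is_deriveM (is_derive_scale (2 * b) y) (is_derive_expsq b y).
by apply: (is_derive_eq h); rewrite /gbump2 -![_ *: _]/(_ * _); ring.
Qed.

Lemma gbump_ge0 (b y : R) : 0 <= b -> 0 <= gbump b y.
Proof. by move=> b0; rewrite subr_ge0 expR_le1 oppr_le0 mulr_ge0 ?sqr_ge0. Qed.

Lemma gbump_le1 (b y : R) : gbump b y <= 1.
Proof. by rewrite gerBl expR_ge0. Qed.

Lemma gbump2_bound (b y : R) : 0 <= b -> `|gbump2 b y| <= 6 * b.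
Proof.
move=> b0; rewrite /gbump2 normrM (ger0_norm (expR_ge0 _)).
set w := b * y ^+ 2; have w0 : 0 <= w by rewrite mulr_ge0 ?sqr_ge0.
have e1 : expR (- w) <= 1 by rewrite expR_le1 oppr_le0.
have e2 : w * expR (- w) <= 1.
  rewrite expRN ler_pdivrMr ?expR_gt0// mul1r (le_trans _ (expR_ge1Dx _))//.
  by rewrite lerDr.
have e0 := expR_ge0 (- w).
have h : `|2 * b - 4 * b ^+ 2 * y ^+ 2| <= 2 * b + 4 * b * w.
  rewrite (_ : 4 * b ^+ 2 * y ^+ 2 = 4 * b * w); last by rewrite /w; ring.
  have p : 0 <= 4 * b * w by have := mulr_ge0 b0 w0; lra.
  have q : 0 <= 2 * b by rewrite mulr_ge0.
  by rewrite ler_norml; lra.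
have h2 := ler_wpM2r e0 h; apply: (le_trans h2).
have h3 : 2 * b * expR (- w) <= 2 * b * 1 by rewrite ler_wpM2l ?mulr_ge0.
have h4 : 4 * b * (w * expR (- w)) <= 4 * b * 1 by rewrite ler_wpM2l ?mulr_ge0.
rewrite mulrDl -(mulrA (4 * b)); lra.
Qed.

(** Expanding the squares gives [exp (- b (y + z) ^ 2) = p q u] and the same with [v = 1 / u]; since
    [u + v] is at least 2, the bound is uniform in [y]. *)
Lemma gbump_diff2_le (b y z : R) : 0 <= b ->
  gbump b (y + z) + gbump b (y - z) - 2 * gbump b y <= 2 * (1 - expR (- (b * z ^+ 2))).
Proof.
move=> b0; rewrite /gbump.
set p := expR (- (b * y ^+ 2)); set q := expR (- (b * z ^+ 2)).
pose u := expR (- (2 * b * y * z)); pose v := expR (2 * b * y * z).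
have -> : expR (- (b * (y + z) ^+ 2)) = p * q * u.
  by rewrite -!expRD; congr expR; ring.
have -> : expR (- (b * (y - z) ^+ 2)) = p * q * v.
  by rewrite -!expRD; congr expR; ring.
have uv : 2 <= u + v.
  have h1 := expR_ge1Dx (- (2 * b * y * z)).
  have h2 := expR_ge1Dx (2 * b * y * z).
  rewrite /u /v; lra.
have p0 : 0 <= p := expR_ge0 _.
have q0 : 0 <= q := expR_ge0 _.
have p1 : p <= 1 by rewrite expR_le1 oppr_le0 mulr_ge0 ?sqr_ge0.
have q1 : q <= 1 by rewrite expR_le1 oppr_le0 mulr_ge0 ?sqr_ge0.
have h1 : p * q * 2 <= p * q * (u + v) by rewrite ler_wpM2l ?mulr_ge0.
have h2 : p * (1 - q) <= 1 * (1 - q) by rewrite ler_wpM2r// subr_ge0.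
rewrite mulrDr in h1; lra.
Qed.

(** A bounded replacement for [b |y| ^ 2]: it is admissible in test functions and in the discrete
    operator, it is small on compact sets when [b] is small, and both operators applied to it are at
    most of order [b ^ (sigma / 2)]. *)
Definition penal (b : R) (y : V) : R := \sum_(i < N) gbump b (y 0 i).

Lemma linf_delta (i : 'I_N) y : linf (fun j => (j == i)%:R) y + 0 = y 0 i.
Proof.
rewrite addr0 /linf (bigD1 i)//= eqxx mul1r big1 ?addr0// => j /negPf ->.
by rewrite mul0r.
Qed.

Lemma nice_gbump (b : R) (i : 'I_N) x : 0 <= b -> nice (fun y => gbump b (y 0 i)) x.
Proof.
move=> b0; rewrite (_ : (fun y : V => gbump b (y 0 i)) =
    fun y => gbump b (linf (fun j => (j == i)%:R) y + 0)).
  apply: (@nice_comp_lin (gbump b) (gbump1 b) (gbump2 b) 1 (6 * b)).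
  - exact: is_derive_gbump.
  - exact: is_derive_gbump1.
  - by move=> y; rewrite ger0_norm ?gbump_ge0 ?gbump_le1.
  - by move=> y; exact: gbump2_bound.
by apply/funext => y; rewrite linf_delta.
Qed.

Lemma nice_sum (I : Type) (s : seq I) (f : I -> V -> R) x :
  (forall i, nice (f i) x) -> nice (fun y => \sum_(i <- s) f i y) x.
Proof.
move=> h; elim: s => [|i s IH].
  by under eq_fun do rewrite big_nil; exact: nice_cst.
by under eq_fun do rewrite big_cons; apply: niceD.
Qed.

Lemma nice_penal (b : R) x : 0 <= b -> nice (penal b) x.
Proof. by move=> b0; apply: nice_sum => i; exact: nice_gbump. Qed.

Lemma fracLap_penal (b : R) x : 0 <= b ->
  fracLap sigma (penal b) x <= N%:R * (2 `^ sigma * b `^ (sigma / 2)).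
Proof.
move=> b0; apply: fracLap_ub => //; first exact: nice_penal.
move=> z; rewrite /diff2 /penal !mulr_sumr -big_split/= -sumrB; apply: ler_sum => i _.
by rewrite !mxE; exact: gbump_diff2_le.
Qed.

End nice_functions.

Lemma bounded_onP (R : realType) (T : Type) (A : set T) (f : T -> R) :
  [bounded f x | x in A] <-> exists B, forall x, A x -> `|f x| <= B.
Proof.
split=> [|[B hB]].
  move=> [M [_ hM]]; exists (M + 1) => x Ax; apply: (hM (M + 1)) => //.
  by rewrite ltrDl.
exists B; split; first exact: num_real.
by move=> M BM x Ax; rewrite /= (le_trans (hB _ Ax))// ltW.
Qed.

(** * The discrete heat semigroup *)

Section exponential_series.
Context {R : realType}.
Implicit Types (d : R^nat) (B r x K : R).

(** Coefficients of entire functions of exponential type. The class is stable under [pseries_diffs],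
    which makes termwise differentiation available. *)
Definition exp_bounded d := exists B r, [/\ 0 <= B, 0 <= r & forall n, `|d n| <= B * r ^+ n / n`!%:R].

Lemma exp_bounded_diffs d : exp_bounded d -> exp_bounded (pseries_diffs d).
Proof.
move=> [B [r [B0 r0 h]]]; exists (B * r), r; split => //; first exact: mulr_ge0.
move=> n; rewrite /pseries_diffs normrM (ger0_norm (ler0n _ _)).
apply: (@le_trans _ _ (n.+1%:R * (B * r ^+ n.+1 / n.+1`!%:R))); first by rewrite ler_wpM2l.
rewrite factS natrM exprS le_eqVlt; apply/orP; left; apply/eqP.
have f0 : n`!%:R != 0 :> R by rewrite pnatr_eq0 -lt0n fact_gt0.
have s0 : n.+1%:R != 0 :> R by rewrite pnatr_eq0.
by field; rewrite f0 nat1r s0.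
Qed.

Lemma exp_bounded_term d x : exp_bounded d -> exists B r,
  [/\ 0 <= B, 0 <= r & forall n, `|d n * x ^+ n| <= B * exp_coeff (r * `|x|) n].
Proof.
move=> [B [r [B0 r0 h]]]; exists B, r; split=> // n.
rewrite normrM normrX /exp_coeff/= exprMn (le_trans (ler_wpM2r _ (h n))) ?exprn_ge0//.
by rewrite mulrAC -!mulrA.
Qed.

Lemma exp_bounded_cvg d x : exp_bounded d -> cvgn (pseries d x).
Proof.
move=> /(exp_bounded_term x) [B [r [B0 r0 h]]].
apply: normed_cvg; apply: (@series_le_cvg _ _ (fun n => B * exp_coeff (r * `|x|) n)).
- by move=> n; rewrite /=.
- by move=> n; rewrite mulr_ge0// exp_coeff_ge0// mulr_ge0.
- exact: h.
- by apply: is_cvg_seriesZ; exact: is_cvg_series_exp_coeff.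
Qed.

Definition psum d x : R := limn (pseries d x).

Lemma is_derive_psum d x : exp_bounded d -> is_derive x 1 (psum d) (psum (pseries_diffs d) x).
Proof.
move=> h; apply: (@pseries_snd_diffs _ _ (`|x| + 1)).
- exact: exp_bounded_cvg.
- by apply: exp_bounded_cvg; exact: exp_bounded_diffs.
- by apply: exp_bounded_cvg; do 2 apply: exp_bounded_diffs.
- by rewrite [ltRHS]ger0_norm ?addr_ge0// ltrDl.
Qed.

Lemma psum0 d : psum d 0 = d 0%N.
Proof.
apply/cvg_lim; first exact: Rhausdorff.
rewrite -(cvg_shiftS (pseries d 0)); apply: cvg_near_cst; near=> n.
rewrite /pseries /series/= big_nat_recl//= expr0 mulr1 big1 ?addr0// => i _.
by rewrite expr0n mulr0.
Unshelve. all: by end_near. Qed.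

Lemma norm_psum_le d B r x : 0 <= B -> 0 <= r ->
  (forall n, `|d n| <= B * r ^+ n / n`!%:R) -> `|psum d x| <= B * expR (r * `|x|).
Proof.
move=> B0 r0 h; have hd : exp_bounded d by exists B, r.
have hc : cvgn (pseries d x) by exact: exp_bounded_cvg.
have hn n : `|pseries d x n| <= B * expR (r * `|x|).
  rewrite /pseries /series/= (le_trans (ler_norm_sum _ _ _))//.
  apply: (@le_trans _ _ (B * series (exp_coeff (r * `|x|)) n)).
    rewrite /series/= mulr_sumr; apply: ler_sum => i _.
    rewrite normrM normrX /exp_coeff/= exprMn (le_trans (ler_wpM2r _ (h i))) ?exprn_ge0//.
    by rewrite mulrAC -!mulrA.
  rewrite ler_wpM2l// /expR; apply: nondecreasing_cvgn_le.
    apply: nondecreasing_series => k _ _; apply: exp_coeff_ge0; exact: mulr_ge0.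
  exact: is_cvg_series_exp_coeff.
rewrite ler_norml; apply/andP; split.
  apply: limr_ge => //; apply: nearW => n.
  by have := hn n; rewrite ler_norml => /andP[].
apply: limr_le => //; apply: nearW => n.
by have := hn n; rewrite ler_norml => /andP[].
Qed.

Lemma psum_ge0 d x : exp_bounded d -> (forall n, 0 <= d n) -> 0 <= x -> 0 <= psum d x.
Proof.
move=> hd d0 x0; apply: limr_ge; first exact: exp_bounded_cvg.
by apply: nearW => n; rewrite /pseries /series/= sumr_ge0// => i _; rewrite mulr_ge0 ?exprn_ge0.
Qed.

Lemma psumD d1 d2 x : exp_bounded d1 -> exp_bounded d2 ->
  psum (fun n => d1 n + d2 n) x = psum d1 x + psum d2 x.
Proof.
move=> h1 h2; apply/cvg_lim; first exact: Rhausdorff.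
rewrite (_ : pseries _ x = fun n => pseries d1 x n + pseries d2 x n).
  by apply: cvgD; exact: exp_bounded_cvg.
apply/funext => n; rewrite /pseries /series/= -big_split/=.
by apply: eq_bigr => i _; rewrite mulrDl.
Qed.

Lemma psumZ k d x : exp_bounded d -> psum (fun n => k * d n) x = k * psum d x.
Proof.
move=> h; apply/cvg_lim; first exact: Rhausdorff.
rewrite (_ : pseries _ x = fun n => k * pseries d x n).
  by apply: cvgM; [exact: cvg_cst|exact: exp_bounded_cvg].
apply/funext => n; rewrite /pseries /series/= mulr_sumr.
by apply: eq_bigr => i _; rewrite mulrA.
Qed.

Lemma exp_boundedD d1 d2 : exp_bounded d1 -> exp_bounded d2 ->
  exp_bounded (fun n => d1 n + d2 n).
Proof.
move=> [B1 [r1 [B10 r10 h1]]] [B2 [r2 [B20 r20 h2]]].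
exists (B1 + B2), (Num.max r1 r2); split; rewrite ?addr_ge0 ?le_max ?r10// => n.
rewrite (le_trans (ler_normD _ _))// mulrDl mulrDl; apply: lerD.
  apply: (le_trans (h1 n)); rewrite ler_wpM2r ?invr_ge0// ler_wpM2l// lerXn2r ?nnegrE ?le_max ?r10 ?lexx//.
apply: (le_trans (h2 n)); rewrite ler_wpM2r ?invr_ge0// ler_wpM2l// lerXn2r ?nnegrE ?le_max ?r20 ?lexx ?orbT//.
Qed.

Lemma exp_boundedZ k d : exp_bounded d -> exp_bounded (fun n => k * d n).
Proof.
move=> [B [r [B0 r0 h]]]; exists (`|k| * B), r; split; rewrite ?mulr_ge0// => n.
by rewrite normrM -!mulrA ler_wpM2l// mulrA.
Qed.

Lemma exp_bounded_sum (I : finType) (d : I -> R^nat) : (forall i, exp_bounded (d i)) ->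
  exp_bounded (fun n => \sum_i d i n) /\
  forall x, psum (fun n => \sum_i d i n) x = \sum_i psum (d i) x.
Proof.
move=> h; elim: (index_enum I) => [|i s [IH1 IH2]].
  under eq_fun do rewrite big_nil; split.
    by exists 0, 0; split => // n; rewrite normr0 !mul0r.
  move=> x; rewrite big_nil /psum (_ : pseries _ x = fun=> 0) ?lim_cst//.
  by apply/funext => n; rewrite /pseries /series/= big1// => k _; rewrite mul0r.
under eq_fun do rewrite big_cons; split; first exact: exp_boundedD.
by move=> x; rewrite psumD// IH2 big_cons.
Qed.

Lemma cvg_exp_coeff0 (x : R) : exp_coeff x n @[n --> \oo] --> (0 : R).
Proof. by apply: cvg_series_cvg_0; exact: is_cvg_series_exp_coeff. Qed.

End exponential_series.

(** * The semigroup of the discrete Laplacian: existence, comparison, uniqueness *)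

Section discrete_heat.
Context {R : realType} {N : nat}.
Local Notation V := 'rV[R]_N.
Variable h : R.
Hypothesis h0 : 0 < h.
Implicit Types (phi psi : V -> R) (x : V) (U D : R -> V -> R).

Definition bdd phi := exists B, forall x, `|phi x| <= B.

(** The off-diagonal part of the discrete Laplacian: an order-preserving operator whose value on the
    constant 1 is [rate], which is also the diagonal coefficient. *)
Definition nbr phi x : R :=
  (\sum_(k < N) (phi (x + h *: delta_mx 0 k) + phi (x - h *: delta_mx 0 k))) / h ^+ 2.

Definition rate : R := 2 * N%:R / h ^+ 2.

Lemma h2_gt0 : 0 < h ^+ 2. Proof. exact: exprn_gt0. Qed.
Lemma rate_ge0 : 0 <= rate.
Proof. by rewrite divr_ge0 ?mulr_ge0// ltW// h2_gt0. Qed.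

Lemma dLapE phi x : dLap h phi x = nbr phi x - rate * phi x.
Proof.
rewrite /dLap /nbr /rate mulr_suml.
rewrite (_ : 2 * N%:R / h ^+ 2 * phi x = \sum_(k < N) (2 * phi x / h ^+ 2)); last first.
  by rewrite sumr_const card_ord -[RHS]mulr_natl; ring.
by rewrite -sumrB; apply: eq_bigr => k _; ring.
Qed.

Lemma nbr_le phi psi x : (forall y, phi y <= psi y) -> nbr phi x <= nbr psi x.
Proof.
move=> le; rewrite ler_wpM2r ?invr_ge0 ?(ltW h2_gt0)//.
by apply: ler_sum => k _; exact: lerD.
Qed.

Lemma nbr_cst (c : R) x : nbr (fun=> c) x = rate * c.
Proof. by rewrite /nbr /rate sumr_const card_ord -mulr_natl; ring. Qed.

Lemma nbrZ (c : R) phi x : nbr (fun y => c * phi y) x = c * nbr phi x.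
Proof.
rewrite /nbr mulrA mulr_sumr; congr (_ / _); apply: eq_bigr => k _; ring.
Qed.

Lemma nbrD phi psi x : nbr (fun y => phi y + psi y) x = nbr phi x + nbr psi x.
Proof.
rewrite /nbr -mulrDl -big_split/=; congr (_ / _); apply: eq_bigr => k _; ring.
Qed.

Lemma dLapD phi psi x : dLap h (fun y => phi y + psi y) x = dLap h phi x + dLap h psi x.
Proof. by rewrite !dLapE nbrD; ring. Qed.

Lemma dLapZ c phi x : dLap h (fun y => c * phi y) x = c * dLap h phi x.
Proof. by rewrite !dLapE nbrZ; ring. Qed.

Lemma dLap_cst c x : dLap h (fun=> c) x = 0.
Proof. by rewrite dLapE nbr_cst subrr. Qed.

Lemma norm_nbr_le phi B x : (forall y, `|phi y| <= B) -> `|nbr phi x| <= rate * B.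
Proof.
move=> hB; rewrite ler_norml -mulrN -!(nbr_cst _ x); apply/andP; split; apply: nbr_le => y.
  by have := hB y; rewrite ler_norml => /andP[].
by have := hB y; rewrite ler_norml => /andP[].
Qed.

(** The infimum over space may not be attained, so no minimum point is used. Instead
    [E = e ^ (c t) D] satisfies [E' >= nbr E], and the lower bound of order [n] integrates to one of
    order [n + 1]: [E >= - B' (c t) ^ n / n!] for every [n], and the right-hand side tends to 0. *)
Lemma heat_max_principle T D (dD : R -> V -> R) (B : R) :
  (forall t x, 0 <= t <= T -> - B <= D t x) ->
  (forall x, 0 <= D 0 x) ->
  (forall x, {within `[0, T], continuous (D ^~ x)}) ->
  (forall t x, 0 < t < T -> is_derive t 1 (D ^~ x) (dD t x)) ->
  (forall t x, 0 < t < T -> dLap h (D t) x <= dD t x) ->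
  forall t x, 0 <= t <= T -> 0 <= D t x.
Proof.
move=> hB D0 cD dDE sup t x tT.
pose c := rate; have c0 : 0 <= c := rate_ge0.
wlog B0 : B hB / 0 <= B.
  move=> hw; apply: (hw `|B|) => // s y sT.
  by rewrite (le_trans _ (hB s y sT))// lerN2 ler_norm.
pose E s y := expR (c * s) * D s y.
pose B' := B * expR (c * T).
have T0 : 0 <= T by have /andP[] := tT; exact: le_trans.
have main n : forall s y, 0 <= s <= T -> - (B' * ((c * s) ^+ n / n`!%:R)) <= E s y.
  elim: n => [|n IH] s y sT.
    rewrite expr0 fact0 divr1 mulr1 /E /B'.
    have /andP[s0 sT'] := sT.
    have e1 : expR (c * s) <= expR (c * T) by rewrite ler_expR ler_wpM2l.
    have e2 := hB s y sT; have e3 := expR_ge0 (c * s).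
    have e4 : expR (c * s) * (- B) <= expR (c * s) * D s y by rewrite ler_wpM2l.
    have e5 : B * expR (c * s) <= B * expR (c * T) by rewrite ler_wpM2l.
    apply: le_trans e4; rewrite mulrN lerN2 mulrC//.
  have /andP[s0 sT'] := sT.
  pose G r := E r y + B' * ((c * r) ^+ n.+1 / n.+1`!%:R).
  have dP (r : R) : is_derive r 1 (fun r => B' * ((c * r) ^+ n.+1 / n.+1`!%:R))
      (B' * (c * ((c * r) ^+ n / n`!%:R))).
    have e1 := @is_deriveX R R ( *%R c) n.+1 r 1 _ (is_derive_scale c r).
    have e2 := is_deriveZ (B' / n.+1`!%:R) e1.
    rewrite (_ : (fun r => B' * ((c * r) ^+ n.+1 / n.+1`!%:R)) =
      (B' / n.+1`!%:R) \*: ( *%R c) ^+ n.+1); last first.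
      by apply/funext => v; rewrite exprfctE -[RHS]/(_ * _); ring.
    apply: (is_derive_eq e2); rewrite -![_ *: _]/(_ * _) /= factS natrM.
    have f0 : n`!%:R != 0 :> R by rewrite pnatr_eq0 -lt0n fact_gt0.
    have sn0 : n.+1%:R != 0 :> R by rewrite pnatr_eq0.
    by field; rewrite f0 nat1r sn0.
  pose dG r := expR (c * r) * dD r y + D r y * (c * expR (c * r)) +
    B' * (c * ((c * r) ^+ n / n`!%:R)).
  have dGE (r : R) : 0 < r < T -> is_derive r 1 G (dG r).
    move=> rT; have e1 := is_deriveM (is_derive_expRM c r) (dDE r y rT).
    exact: (is_deriveD e1 (dP r)).
  have cG : {within `[0, s], continuous G}.
    have cs : {within `[0, s], continuous (D ^~ y)}.
      apply: continuous_subspaceW (cD y) => r /=; rewrite !in_itv/= => /andP[-> rs].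
      exact: le_trans rs sT'.
    move=> r; apply: cvgD; last first.
      apply: (@continuous_subspaceT _ _ `[0, s] (fun r => B' * ((c * r) ^+ n.+1 / n.+1`!%:R))).
      by move=> v; exact: is_derive_continuous (dP v).
    apply: cvgM; last exact: cs.
    apply: (@continuous_subspaceT _ _ `[0, s] (fun r => expR (c * r))).
    exact: cts_expRM.
  have dGs (r : R) : r \in `]0, s[ -> is_derive r 1 G (dG r).
    by rewrite in_itv/= => /andP[r0 rs]; apply: dGE; rewrite r0 (lt_le_trans rs).
  have G0 : 0 <= G 0 by rewrite /G /E !mulr0 expR0 mul1r expr0n mul0r mulr0 addr0.
  suff : G 0 <= G s by rewrite /G => /(le_trans G0); rewrite -lerBlDr sub0r.
  move: s0; rewrite le_eqVlt => /predU1P[<-//|s0].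
  have [r rs] := MVT s0 dGs cG; rewrite subr0 => e.
  rewrite -subr_ge0 e mulr_ge0 ?(ltW s0)//.
  move: rs; rewrite in_itv/= => /andP[r0 rs].
  have rT : 0 < r < T by rewrite r0 (lt_le_trans rs).
  have rT' : 0 <= r <= T by have /andP[? ?] := rT; rewrite !ltW.
  have e1 := sup r y rT; rewrite dLapE -/c in e1.
  have e2 : - (B' * ((c * r) ^+ n / n`!%:R)) * c <= expR (c * r) * nbr (D r) y.
    rewrite mulrC -(nbr_cst _ y) -nbrZ; apply: nbr_le => v; exact: IH.
  have e3 : expR (c * r) * (nbr (D r) y - c * D r y) <= expR (c * r) * dD r y.
    by rewrite ler_wpM2l ?expR_ge0.
  rewrite /dG; move: e2 e3; set w := _ / n`!%:R; set nb := nbr _ _.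
  set ee := expR _ => e2 e3.
  have -> : ee * dD r y + D r y * (c * ee) + B' * (c * w) =
    (ee * dD r y - ee * (nb - c * D r y)) + (ee * nb - - (B' * w) * c) by ring.
  by rewrite addr_ge0// subr_ge0.
have lim0 : - (B' * exp_coeff (c * t) n) @[n --> \oo] --> (0 : R).
  rewrite -oppr0 -(mulr0 B'); apply: cvgN; apply: cvgM; first exact: cvg_cst.
  exact: cvg_exp_coeff0.
have : 0 <= E t x.
  rewrite -(cvg_lim (@Rhausdorff R) lim0); apply: limr_le.
    by apply/cvg_ex; exists 0.
  by apply: nearW => n; exact: main.
by rewrite /E pmulr_rge0// expR_gt0.
Qed.

Definition heat_coeff phi x (n : nat) : R := iter n nbr phi x / n`!%:R.

Lemma heat_coeff_bound phi B x n : (forall y, `|phi y| <= B) ->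
  `|heat_coeff phi x n| <= B * rate ^+ n / n`!%:R.
Proof.
move=> hB; rewrite /heat_coeff normrM normfV (ger0_norm (ler0n _ _)) ler_wpM2r ?invr_ge0//.
elim: n x => [|n IH] x; first by rewrite expr0 mulr1.
by rewrite iterS exprS (le_trans (norm_nbr_le x IH))// mulrCA.
Qed.

Lemma heat_coeff_exp phi x : bdd phi -> exp_bounded (heat_coeff phi x).
Proof.
move=> [B hB]; exists B, rate; split; first exact: le_trans (hB 0).
  exact: rate_ge0.
by move=> n; exact: heat_coeff_bound.
Qed.

(** Since [dLap] is [nbr] minus [rate] times the identity, the semigroup is [e ^ (- rate t)] times
    the exponential series of [nbr]. *)
Definition heat_sol phi (t : R) x : R := expR (- rate * t) * psum (heat_coeff phi x) t.

Lemma psum_diffs_heat phi x t : bdd phi ->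
  psum (pseries_diffs (heat_coeff phi x)) t = nbr (fun y => psum (heat_coeff phi y) t) x.
Proof.
move=> hphi.
have e : pseries_diffs (heat_coeff phi x) =
  fun n => (h ^+ 2)^-1 * \sum_(k < N) (heat_coeff phi (x + h *: delta_mx 0 k) n +
     heat_coeff phi (x - h *: delta_mx 0 k) n).
  apply/funext => n; rewrite /pseries_diffs /heat_coeff iterS /nbr factS natrM.
  under [in RHS]eq_bigr do rewrite -mulrDl.
  rewrite -mulr_suml.
  have f0 : n`!%:R != 0 :> R by rewrite pnatr_eq0 -lt0n fact_gt0.
  have sn0 : n.+1%:R != 0 :> R by rewrite pnatr_eq0.
  by field; rewrite f0 nat1r sn0 (gt_eqF h0).
pose d (k : 'I_N) n := heat_coeff phi (x + h *: delta_mx 0 k) n +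
     heat_coeff phi (x - h *: delta_mx 0 k) n.
have hd k : exp_bounded (d k).
  by apply: exp_boundedD; exact: heat_coeff_exp.
have [s1 s2] := exp_bounded_sum hd.
rewrite e psumZ// s2 /nbr mulrC; congr (_ / _); apply: eq_bigr => k _.
by rewrite psumD//; exact: heat_coeff_exp.
Qed.

Lemma is_derive_heat_sol phi x (t : R) : bdd phi ->
  is_derive t 1 (heat_sol phi ^~ x) (dLap h (heat_sol phi t) x).
Proof.
move=> hphi.
have e1 := is_derive_psum t (heat_coeff_exp x hphi).
have e2 := is_deriveM (is_derive_expRM (- rate) t) e1.
apply: (is_derive_eq e2); rewrite psum_diffs_heat// dLapE /heat_sol nbrZ.
by rewrite -![_ *: _]/(_ * _); ring.
Qed.

Lemma heat_solP phi : bdd phi -> is_heat_solution h phi (heat_sol phi).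
Proof.
move=> hphi; split.
- have [B hB] := hphi; apply/bounded_onP; exists B => -[t x]/= t0.
  rewrite /heat_sol normrM (ger0_norm (expR_ge0 _)) mulNr expRN ler_pdivrMl ?expR_gt0//.
  rewrite mulrC -{2}(ger0_norm t0); apply: norm_psum_le; last by move=> n; exact: heat_coeff_bound.
    exact: le_trans (hB 0).
  exact: rate_ge0.
- by apply/funext => x; rewrite /heat_sol psum0 /heat_coeff/= fact0 divr1 mulr0 expR0 mul1r.
- move=> x; apply: continuous_subspaceT => t.
  exact: is_derive_continuous (is_derive_heat_sol x t hphi).
- by move=> t x t0; exact: is_derive_heat_sol.
Qed.

Lemma heatP phi : bdd phi -> is_heat_solution h phi (fun t => heat h t phi).
Proof.
move=> hphi; have := @xgetPex _ (fun _ => phi) [set U | is_heat_solution h phi U].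
by apply; exists (heat_sol phi); exact: heat_solP.
Qed.

Lemma heat_ge phi (z dz : R -> V -> R) T : bdd phi ->
  (exists B, forall t x, 0 <= t <= T -> z t x <= B) ->
  (forall x, z 0 x <= phi x) ->
  (forall x, {within `[0, T], continuous (z ^~ x)}) ->
  (forall t x, 0 < t < T -> is_derive t 1 (z ^~ x) (dz t x)) ->
  (forall t x, 0 < t < T -> dz t x <= dLap h (z t) x) ->
  forall t x, 0 <= t <= T -> z t x <= heat h t phi x.
Proof.
move=> hphi [B hB] z0 cz dzE sub t x tT.
have [/bounded_onP[B' hB'] e0 cu du] := heatP hphi.
rewrite -subr_ge0.
apply: (@heat_max_principle T (fun t x => heat h t phi x - z t x)
  (fun t x => dLap h (heat h t phi) x - dz t x) (B' + B)) => //.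
- move=> s y sT; have /andP[s0 _] := sT.
  have := hB' (s, y) s0; rewrite /= ler_norml => /andP[e _].
  by have := hB s y sT; lra.
- by move=> y; rewrite e0 subr_ge0.
- move=> y s; apply: cvgB; last exact: cz.
  by apply: continuous_subspaceW (cu y) s => r /=; rewrite !in_itv/= => /andP[->].
- by move=> s y sT; apply: is_deriveB; [apply: du; have /andP[] := sT|exact: dzE].
- move=> s y sT; rewrite (_ : (fun y => _) = fun y => heat h s phi y + (-1) * z s y); last first.
    by apply/funext => v; rewrite mulN1r.
  by rewrite dLapD dLapZ mulN1r lerD2l lerN2 sub.
Qed.

Lemma heat_le phi (z dz : R -> V -> R) T : bdd phi ->
  (exists B, forall t x, 0 <= t <= T -> B <= z t x) ->
  (forall x, phi x <= z 0 x) ->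
  (forall x, {within `[0, T], continuous (z ^~ x)}) ->
  (forall t x, 0 < t < T -> is_derive t 1 (z ^~ x) (dz t x)) ->
  (forall t x, 0 < t < T -> dLap h (z t) x <= dz t x) ->
  forall t x, 0 <= t <= T -> heat h t phi x <= z t x.
Proof.
move=> hphi [B hB] z0 cz dzE sup t x tT.
have [/bounded_onP[B' hB'] e0 cu du] := heatP hphi.
rewrite -subr_ge0.
apply: (@heat_max_principle T (fun t x => z t x - heat h t phi x)
  (fun t x => dz t x - dLap h (heat h t phi) x) (B' - B)) => //.
- move=> s y sT; have /andP[s0 _] := sT.
  have := hB' (s, y) s0; rewrite /= ler_norml => /andP[_ e].
  by have := hB s y sT; lra.
- by move=> y; rewrite e0 subr_ge0.
- move=> y s; apply: cvgB; first exact: cz.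
  by apply: continuous_subspaceW (cu y) s => r /=; rewrite !in_itv/= => /andP[->].
- by move=> s y sT; apply: is_deriveB; [exact: dzE|apply: du; have /andP[] := sT].
- move=> s y sT; rewrite (_ : (fun y => _) = fun y => z s y + (-1) * heat h s phi y); last first.
    by apply/funext => v; rewrite mulN1r.
  by rewrite dLapD dLapZ mulN1r lerD2r sup.
Qed.

(** As [heat] is obtained by choice, its linearity, its translation invariance and its explicit
    values are all proved by exhibiting a bounded solution and invoking this uniqueness. *)
Lemma heat_uniq phi U : is_heat_solution h phi U -> forall t x, 0 <= t -> heat h t phi x = U t x.
Proof.
move=> [/bounded_onP[B hB] U0 cU dU] t x t0.
have hphi : bdd phi by exists B => y; rewrite -U0; exact: (hB (0, y) (lexx 0)).
have tt : 0 <= t <= t by rewrite t0 lexx.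
have cU' y : {within `[0, t], continuous (U ^~ y)}.
  by apply: continuous_subspaceW (cU y) => r /=; rewrite !in_itv/= => /andP[->].
have dU' s y : 0 < s < t -> is_derive s 1 (U ^~ y) (dLap h (U s) y).
  by move=> /andP[s0 _]; exact: dU.
apply/eqP; rewrite eq_le; apply/andP; split.
- apply: (heat_le hphi _ _ cU' dU') => //; last by move=> y; rewrite U0.
  by exists (- B) => s y /andP[s0 _]; have := hB (s, y) s0; rewrite ler_norml => /andP[].
- apply: (heat_ge hphi _ _ cU' dU') => //; last by move=> y; rewrite U0.
  by exists B => s y /andP[s0 _]; have := hB (s, y) s0; rewrite ler_norml => /andP[].
Qed.

Lemma bddD phi psi : bdd phi -> bdd psi -> bdd (fun y => phi y + psi y).
Proof.
move=> [A hA] [B hB]; exists (A + B) => x.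
by rewrite (le_trans (ler_normD _ _))// lerD.
Qed.

Lemma bddZ c phi : bdd phi -> bdd (fun y => c * phi y).
Proof. by move=> [A hA]; exists (`|c| * A) => x; rewrite normrM ler_wpM2l. Qed.

Lemma heatD phi psi t x : bdd phi -> bdd psi -> 0 <= t ->
  heat h t (fun y => phi y + psi y) x = heat h t phi x + heat h t psi x.
Proof.
move=> b1 b2 t0.
have [/bounded_onP[B1 hB1] e1 c1 d1] := heatP b1.
have [/bounded_onP[B2 hB2] e2 c2 d2] := heatP b2.
apply: (@heat_uniq _ (fun t x => heat h t phi x + heat h t psi x)) => //; split.
- apply/bounded_onP; exists (B1 + B2) => -[s y]/= s0.
  rewrite (le_trans (ler_normD _ _))// lerD//; first exact: (hB1 (s, y)).
  exact: (hB2 (s, y)).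
- by apply/funext => y; rewrite e1 e2.
- by move=> y s; apply: cvgD; [exact: c1|exact: c2].
- move=> s y s0; rewrite dLapD; apply: is_deriveD; [exact: d1|exact: d2].
Qed.

Lemma heatZ c phi t x : bdd phi -> 0 <= t ->
  heat h t (fun y => c * phi y) x = c * heat h t phi x.
Proof.
move=> b1 t0.
have [/bounded_onP[B1 hB1] e1 c1 d1] := heatP b1.
apply: (@heat_uniq _ (fun t x => c * heat h t phi x)) => //; split.
- apply/bounded_onP; exists (`|c| * B1) => -[s y]/= s0.
  rewrite normrM ler_wpM2l//; exact: (hB1 (s, y)).
- by apply/funext => y; rewrite e1.
- by move=> y s; apply: cvgM; [exact: cvg_cst|exact: c1].
- by move=> s y s0; rewrite dLapZ; apply: is_deriveZ; exact: d1.
Qed.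

Lemma heat_cst c t x : 0 <= t -> heat h t (fun=> c) x = c.
Proof.
move=> t0; apply: (@heat_uniq _ (fun _ _ => c)) => //; split => //.
- by apply/bounded_onP; exists `|c|.
- by move=> y s; exact: cvg_cst.
- by move=> s y s0; rewrite dLap_cst; exact: is_derive_cst.
Qed.

Lemma heat_shift phi v t x : bdd phi -> 0 <= t ->
  heat h t (fun y => phi (y + v)) x = heat h t phi (x + v).
Proof.
move=> b1 t0.
have [/bounded_onP[B1 hB1] e1 c1 d1] := heatP b1.
apply: (@heat_uniq _ (fun t x => heat h t phi (x + v))) => //; split.
- by apply/bounded_onP; exists B1 => -[s y]/= s0; exact: (hB1 (s, y + v)).
- by apply/funext => y; rewrite e1.
- by move=> y; exact: c1.
- move=> s y s0; have := d1 s (y + v) s0; congr (is_derive _ _ _ _).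
  rewrite /dLap; apply: eq_bigr => k _.
  by rewrite (addrAC y v) (addrAC y v).
Qed.

Lemma heat_le_lin phi K t x : bdd phi -> (forall y, dLap h phi y <= K) -> 0 <= t ->
  heat h t phi x <= phi x + K * t.
Proof.
move=> b1 hK t0; have [B hB] := b1.
apply: (@heat_le phi (fun t x => phi x + K * t) (fun _ _ => K) t) => //; last by rewrite t0 lexx.
- exists (- B - `|K| * t) => s y /andP[s0 st].
  have := hB y; rewrite ler_norml => /andP[e _].
  have : - (`|K| * t) <= K * s.
    have : `|K * s| <= `|K| * t by rewrite normrM (ger0_norm s0) ler_wpM2l.
    by rewrite ler_norml => /andP[].
  by lra.
- by move=> y; rewrite mulr0 addr0.
- move=> y; apply: continuous_subspaceT => s; apply: cvgD; first exact: cvg_cst.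
  exact: mulrl_continuous.
- move=> s y _; have e := is_deriveD (is_derive_cst (phi y) s (1:R)) (is_derive_scale K s).
  by apply: (is_derive_eq e); rewrite add0r.
- by move=> s y _; rewrite dLapD dLap_cst addr0.
Qed.

Lemma heat_ub phi B t x : bdd phi -> (forall y, phi y <= B) -> 0 <= t -> heat h t phi x <= B.
Proof.
move=> b1 hB t0.
apply: (@heat_le phi (fun _ _ => B) (fun _ _ => 0) t) => //; last by rewrite t0 lexx.
- by exists B.
- by move=> y s; exact: cvg_cst.
- by move=> s y _; exact: is_derive_cst.
- by move=> s y _; rewrite dLap_cst.
Qed.

Lemma dLap_norm_le phi B x : (forall y, `|phi y| <= B) -> `|dLap h phi x| <= 2 * rate * B.
Proof.
move=> hB; rewrite dLapE (le_trans (ler_normB _ _))//.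
rewrite (_ : 2 * rate * B = rate * B + rate * B); last by ring.
apply: lerD; first exact: norm_nbr_le.
by rewrite normrM (ger0_norm rate_ge0) ler_wpM2l ?rate_ge0.
Qed.

(** The increment is at most linear in [t] for small times and bounded for large ones, hence
    integrable against [dt / t ^ (1 + sigma / 2)]. *)
Lemma heat_bound phi B : (forall y, `|phi y| <= B) ->
  exists2 C, 0 <= C & forall t x, 0 <= t -> `|heat h t phi x - phi x| <= C * (1 - expR (- t)).
Proof.
move=> hB; have B0 : 0 <= B := le_trans (normr_ge0 _) (hB 0).
have r0 := rate_ge0.
have half psi : (forall y, `|psi y| <= B) -> forall t x, 0 <= t ->
    heat h t psi x - psi x <= 2 * (2 * B + 2 * rate * B) * (1 - expR (- t)).
  move=> hp t x t0; have b1 : bdd psi by exists B.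
  have p1 : 0 <= 2 * B by lra.
  have p2 : 0 <= 2 * rate * B by have := mulr_ge0 r0 B0; lra.
  apply: le_1Bexp => //.
    have := hp x; rewrite ler_norml => /andP[e _].
    have : heat h t psi x <= B.
      apply: heat_ub => // y; have := hp y; rewrite ler_norml => /andP[] //.
    lra.
  rewrite lerBlDl; apply: heat_le_lin => // y.
  by have := dLap_norm_le y hp; rewrite ler_norml => /andP[].
exists (2 * (2 * B + 2 * rate * B)); first by have := mulr_ge0 r0 B0; lra.
move=> t x t0; rewrite ler_norml; apply/andP; split; last exact: half.
have hN y : `|-1 * phi y| <= B by rewrite mulN1r normrN.
have := half _ hN t x t0; rewrite heatZ//; last by exists B.
by lra.
Qed.

End discrete_heat.

(** * The discrete fractional Laplacian *)

Section bessel.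
Context {R : realType}.
Implicit Types (t x y : R) (m k n : nat).

(** Coefficients of [t ^ (- m) I_m (2 t)] as a power series in [t ^ 2]. In this variable
    differentiation merely raises the order [m] by one. *)
Definition bcoeff m k : R := (k`!%:R * (k + m)`!%:R)^-1.

Lemma fact_neq0 n : n`!%:R != 0 :> R.
Proof. by rewrite pnatr_eq0 -lt0n fact_gt0. Qed.

Lemma bcoeff_ge0 m k : 0 <= bcoeff m k.
Proof. by rewrite invr_ge0 mulr_ge0. Qed.

Lemma bcoeff_le m k : `|bcoeff m k| <= (m`!%:R)^-1 * 1 ^+ k / k`!%:R.
Proof.
rewrite ger0_norm ?bcoeff_ge0// expr1n mulr1 /bcoeff invfM mulrC ler_wpM2r ?invr_ge0//.
rewrite lef_pV2 ?posrE ?ltr0n ?fact_gt0// ler_nat.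
elim: k => [|k IH]; first by rewrite add0n.
by rewrite addSn factS (leq_trans IH)// leq_pmull.
Qed.

Lemma bcoeff_exp m : exp_bounded (bcoeff m).
Proof.
by exists (m`!%:R)^-1, 1; split => //; exact: bcoeff_le.
Qed.

Lemma bcoeff_diffs m : pseries_diffs (bcoeff m) = bcoeff m.+1.
Proof.
apply/funext => k; rewrite /pseries_diffs /bcoeff addSn addnS.
rewrite (factS k) natrM; have a := fact_neq0 k; have b := fact_neq0 (k + m).+1.
by field; rewrite a b nat1r pnatr_eq0.
Qed.

Definition bpsi m y : R := psum (bcoeff m) y.

Lemma is_derive_bpsi m y : is_derive y 1 (bpsi m) (bpsi m.+1 y).
Proof. by have := is_derive_psum y (bcoeff_exp m); rewrite bcoeff_diffs. Qed.

Lemma psum_recl (d : R^nat) y : exp_bounded d -> exp_bounded (fun n => d n.+1) ->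
  psum d y = d 0%N + y * psum (fun n => d n.+1) y.
Proof.
move=> h1 h2; apply/cvg_lim; first exact: Rhausdorff.
rewrite -(cvg_shiftS (pseries d y)).
rewrite (_ : (fun n => _) = fun n => d 0%N + y * pseries (fun n => d n.+1) y n).
  apply: cvgD; first exact: cvg_cst.
  by apply: cvgM; [exact: cvg_cst|exact: exp_bounded_cvg].
apply/funext => n; rewrite /pseries /series/= big_nat_recl//= expr0 mulr1; congr (_ + _).
by rewrite mulr_sumr; apply: eq_bigr => i _; rewrite exprS; ring.
Qed.

Lemma exp_bounded_shift (d : R^nat) : (forall n, 0 <= d n) -> exp_bounded d ->
  exp_bounded (fun n => d n.+1).
Proof.
move=> d0 /exp_bounded_diffs[B [r [B0 r0 h]]]; exists B, r; split => // n.
apply: le_trans (h n); rewrite /pseries_diffs normrM ger0_norm ?d0//.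
by rewrite ger0_norm// ler_peMl// ler1n.
Qed.

(** The three-term recurrence of the Bessel functions. Together with the derivative of [bpsi] it
    yields [d/dt I_m (2 t) = I_(m-1) (2 t) + I_(m+1) (2 t)], the heat equation on the integers up to
    an exponential factor. *)
Lemma bpsi_rec m y : bpsi m y = m.+1%:R * bpsi m.+1 y + y * bpsi m.+2 y.
Proof.
have s k := exp_bounded_shift (bcoeff_ge0 k) (bcoeff_exp k).
rewrite /bpsi (psum_recl _ (bcoeff_exp m) (s m)) (psum_recl _ (bcoeff_exp m.+1) (s _)).
have -> : psum (fun n => bcoeff m n.+1) y =
    m.+1%:R * psum (fun n => bcoeff m.+1 n.+1) y + psum (bcoeff m.+2) y.
  rewrite -psumZ// -psumD//; last 2 first.
  - by apply: exp_boundedZ; exact: s.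
  - exact: bcoeff_exp.
  congr psum; apply/funext => n; rewrite /bcoeff addSn addnS !addSn.
  rewrite (factS (n + m).+1) (factS n) natrM natrM.
  have a := fact_neq0 n; have b := fact_neq0 (n + m).+1.
  rewrite (_ : (n + m).+2%:R = n.+1%:R + m.+1%:R :> R); last first.
    by rewrite -natrD addnS.
  have c : n.+1%:R + m.+1%:R != 0 :> R by rewrite -natrD pnatr_eq0.
  rewrite !addnS (factS (n + m).+1) natrM (_ : (n + m).+2%:R = n.+1%:R + m.+1%:R :> R); last first.
    by rewrite -natrD addnS.
  have c' : n.+1%:R != 0 :> R by rewrite pnatr_eq0.
  move: c c'; move: (n.+1%:R) (m.+1%:R) (n`!%:R) ((n + m).+1`!%:R) a b => p q u v u0 v0 pq p0.
  by field; rewrite pq p0 u0 v0.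
have -> : bcoeff m 0 = m.+1%:R * bcoeff m.+1 0.
  rewrite /bcoeff !add0n fact0 factS natrM; have a := fact_neq0 m.
  by field; rewrite a nat1r pnatr_eq0.
ring.
Qed.

Definition besJ m t : R := t ^+ m * bpsi m (t ^+ 2).

Lemma besselI_J m t : besselI m (2 * t) = besJ m t.
Proof.
rewrite /besselI /besJ; apply/cvg_lim; first exact: Rhausdorff.
rewrite (_ : series _ = fun n => t ^+ m * pseries (bcoeff m) (t ^+ 2) n).
  by apply: cvgM; [exact: cvg_cst|exact: exp_bounded_cvg (bcoeff_exp m)].
apply/funext => n; rewrite /pseries /series/= mulr_sumr; apply: eq_bigr => k _.
rewrite (_ : 2 * t / 2 = t); last by field.
by rewrite exprD exprM /bcoeff; ring.
Qed.

Lemma is_derive_bpsi_sqr m t : is_derive t 1 (fun t => bpsi m (t ^+ 2)) (2 * t * bpsi m.+1 (t ^+ 2)).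
Proof.
have h := @is_derive1_comp _ (bpsi m) (fun t => t ^+ 2) t _ _ (is_derive_bpsi _ _) (is_derive_sqr t).
by apply: (is_derive_eq h); rewrite mulrC.
Qed.

Lemma is_derive_exprn n t : is_derive t 1 (fun t : R => t ^+ n.+1) (n.+1%:R * t ^+ n).
Proof.
have h := is_deriveX n.+1 (is_derive_id t (1:R)).
rewrite (_ : (fun t : R => t ^+ n.+1) = id ^+ n.+1); last by apply/funext => s; rewrite exprfctE.
by apply: (is_derive_eq h); rewrite -[_ *: _]/(_ * _) mulr1.
Qed.

Lemma is_derive_besJ0 t : is_derive t 1 (besJ 0) (2 * besJ 1 t).
Proof.
have := is_derive_bpsi_sqr 0 t.
rewrite (_ : besJ 0 = fun t => bpsi 0 (t ^+ 2)); last by apply/funext => s; rewrite /besJ expr0 mul1r.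
by rewrite /besJ expr1 mulrA.
Qed.

Lemma is_derive_besJS m t : is_derive t 1 (besJ m.+1) (besJ m t + besJ m.+2 t).
Proof.
have h := is_deriveM (is_derive_exprn m t) (is_derive_bpsi_sqr m.+1 t).
apply: (is_derive_eq h); rewrite -![_ *: _]/(_ * _) /besJ (bpsi_rec m) !exprS; ring.
Qed.

Lemma bpsi_ge0 m y : 0 <= y -> 0 <= bpsi m y.
Proof. by move=> y0; apply: psum_ge0 => //; [exact: bcoeff_exp|exact: bcoeff_ge0]. Qed.

Lemma bpsi_le m y : 0 <= y -> bpsi m y <= (m`!%:R)^-1 * expR y.
Proof.
move=> y0; rewrite -[leLHS](ger0_norm (bpsi_ge0 _ y0)).
have := @norm_psum_le _ (bcoeff m) (m`!%:R)^-1 1 y _ ler01 (bcoeff_le m).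
by rewrite mul1r (ger0_norm y0); apply; rewrite invr_ge0.
Qed.

Lemma bpsi0_ge1 y : 0 <= y -> 1 <= bpsi 0 y.
Proof.
move=> y0; have s k := exp_bounded_shift (bcoeff_ge0 k) (bcoeff_exp k).
rewrite /bpsi (psum_recl _ (bcoeff_exp 0) (s 0%N)) {1}/bcoeff addn0 fact0 mul1r invr1 lerDl.
by rewrite mulr_ge0//; apply: psum_ge0 => // n; exact: bcoeff_ge0.
Qed.

(* The heat kernel of the unit lattice Z at time t and at distance m from the origin. *)
Definition hk m t : R := expR (- 2 * t) * besJ m t.

Lemma hk_ge0 m t : 0 <= t -> 0 <= hk m t.
Proof. by move=> t0; rewrite mulr_ge0 ?expR_ge0// mulr_ge0 ?exprn_ge0// bpsi_ge0// sqr_ge0. Qed.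

Lemma is_derive_hk0 t : is_derive t 1 (hk 0) (2 * hk 1 t - 2 * hk 0 t).
Proof.
have h := is_deriveM (is_derive_expRM (- 2) t) (is_derive_besJ0 t).
by apply: (is_derive_eq h); rewrite -![_ *: _]/(_ * _) /hk; ring.
Qed.

Lemma is_derive_hkS m t : is_derive t 1 (hk m.+1) (hk m t + hk m.+2 t - 2 * hk m.+1 t).
Proof.
have h := is_deriveM (is_derive_expRM (- 2) t) (is_derive_besJS m t).
by apply: (is_derive_eq h); rewrite -![_ *: _]/(_ * _) /hk; ring.
Qed.

Lemma hk_0 m : hk m 0 = (m == 0%N)%:R.
Proof.
rewrite /hk /besJ mulr0 expR0 mul1r; case: m => [|m]; last by rewrite exprS mul0r mul0r.
rewrite expr0 mul1r expr0n /bpsi psum0 /bcoeff addn0 fact0 mul1r invr1//.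
Qed.

(** A crude bound, but at fixed time it decays in [m] like the terms of an exponential series, which
    makes the flux through distant sites vanish. *)
Lemma hk_le m t : 0 <= t -> hk m t <= exp_coeff t m * expR (t ^+ 2).
Proof.
move=> t0; rewrite /hk /besJ /exp_coeff/=.
have e1 : expR (- 2 * t) <= 1 by rewrite expR_le1 mulNr oppr_le0 mulr_ge0.
have e2 := bpsi_le m (sqr_ge0 t).
have e3 : 0 <= t ^+ m * bpsi m (t ^+ 2) by rewrite mulr_ge0 ?exprn_ge0// bpsi_ge0// sqr_ge0.
apply: (@le_trans _ _ (t ^+ m * bpsi m (t ^+ 2))); first by rewrite ler_piMl.
by rewrite -mulrA ler_wpM2l ?exprn_ge0.
Qed.

Lemma cts_hk m : continuous (hk m).
Proof.
case: m => [|m] t; first exact: is_derive_continuous (is_derive_hk0 t).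
exact: is_derive_continuous (is_derive_hkS m t).
Qed.

Definition hkZ (j : int) t : R := hk `|j|%N t.

Lemma is_derive_hkZ (j : int) t :
  is_derive t 1 (hkZ j) (hkZ (j + 1) t + hkZ (j - 1) t - 2 * hkZ j t).
Proof.
case: j => [[|m]|m].
- have := is_derive_hk0 t; rewrite /hkZ (_ : `|(Posz 0 + 1)%R|%N = 1%N)// (_ : `|(Posz 0 - 1)%R|%N = 1%N)//.
  by rewrite (_ : hk 1 t + hk 1 t = 2 * hk 1 t)//; ring.
- have := is_derive_hkS m t; rewrite /hkZ.
  rewrite (_ : `|(m.+1%:Z + 1)%R|%N = m.+2); last by lia.
  by rewrite (_ : `|(m.+1%:Z - 1)%R|%N = m); [rewrite (addrC (hk m.+2 t))|lia].
- have := is_derive_hkS m t; rewrite /hkZ.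
  rewrite (_ : `|(Negz m + 1)%R|%N = m); last by lia.
  rewrite (_ : `|(Negz m - 1)%R|%N = m.+2); last by lia.
  by rewrite (_ : `|Negz m|%N = m.+1).
Qed.

Fixpoint hkS (M : nat) t : R := if M is M'.+1 then hkS M' t + 2 * hk M t else hk 0 t.

(** The heat equation telescopes over the sites [|j| <= M] whose masses add up to [hkS M]: only the
    flux through the two ends remains. *)
Lemma is_derive_hkSum M t : is_derive t 1 (hkS M) (2 * (hk M.+1 t - hk M t)).
Proof.
elim: M => [|M IH].
  by have := is_derive_hk0 t; rewrite -mulrBr.
have h := is_deriveD IH (is_deriveZ 2 (is_derive_hkS M t)).
by apply: (is_derive_eq h); rewrite -![_ *: _]/(_ * _); ring.
Qed.

Lemma hkS_0 M : hkS M 0 = 1.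
Proof. by elim: M => [|M IH] /=; rewrite ?IH !hk_0//= mulr0 addr0. Qed.

(** Conservation of mass: the sum is 1 at time 0, and by the mean value theorem it moves by at most
    [t] times the end flux, which tends to 0. *)
Lemma hkS_cvg t : 0 <= t -> hkS M t @[M --> \oo] --> (1 : R).
Proof.
move=> t0.
pose e M := 2 * t * expR (t ^+ 2) * (exp_coeff t M.+1 + exp_coeff t M).
have ce : e M @[M --> \oo] --> (0 : R).
  rewrite -(mulr0 (2 * t * expR (t ^+ 2))); apply: cvgM; first exact: cvg_cst.
  rewrite -(addr0 0); apply: cvgD; last exact: cvg_exp_coeff0.
  by have := @cvg_exp_coeff0 R t; rewrite -cvg_shiftS.
have bd M : `|hkS M t - 1| <= e M.
  have cS : {within `[0, t], continuous (hkS M)}.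
    by apply: continuous_subspaceT => s; exact: is_derive_continuous (is_derive_hkSum M s).
  have [s] := MVT_segment t0 (fun s _ => is_derive_hkSum M s) cS.
  rewrite in_itv/= => /andP[s0 st]; rewrite hkS_0 subr0 => ->.
  have le m : hk m s <= exp_coeff t m * expR (t ^+ 2).
    apply: (le_trans (hk_le m s0)); apply: ler_pM.
    - exact: exp_coeff_ge0.
    - exact: expR_ge0.
    - by rewrite /exp_coeff/= ler_wpM2r ?invr_ge0// lerXn2r ?nnegrE.
    - by rewrite ler_expR lerXn2r ?nnegrE.
  have h1 := hk_ge0 M s0; have h2 := hk_ge0 M.+1 s0.
  have l1 := le M; have l2 := le M.+1.
  rewrite normrM (ger0_norm t0) mulrC /e.
  have : `|2 * (hk M.+1 s - hk M s)| <= 2 * expR (t ^+ 2) * (exp_coeff t M.+1 + exp_coeff t M).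
    by rewrite ler_norml; apply/andP; split; lra.
  by move=> /(ler_wpM2l t0)/le_trans; apply; rewrite le_eqVlt; apply/orP; left; apply/eqP; ring.
apply/cvgrPdist_le => eps eps0; near=> M.
rewrite distrC (le_trans (bd M))//.
near: M; move/cvgr0Pnorm_le: ce => /(_ _ eps0); apply: filterS => M.
exact: (le_trans (ler_norm _)).
Unshelve. all: by end_near. Qed.

Lemma hkS_nd t : 0 <= t -> nondecreasing_seq (hkS ^~ t).
Proof.
move=> t0; apply/nondecreasing_seqP => M /=.
by rewrite lerDl mulr_ge0// hk_ge0.
Qed.

Lemma hkS_le1 M t : 0 <= t -> hkS M t <= 1.
Proof.
move=> t0; have <- := cvg_lim (@Rhausdorff R) (hkS_cvg t0).
apply: nondecreasing_cvgn_le; first exact: hkS_nd.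
by apply/cvg_ex; exists 1; exact: hkS_cvg.
Qed.

Lemma hkS_ge0 M t : 0 <= t -> 0 <= hkS M t.
Proof.
by move=> t0; elim: M => [|M IH] /=; [exact: hk_ge0|rewrite addr_ge0// mulr_ge0// hk_ge0].
Qed.

Lemma hk_le1 m t : 0 <= t -> hk m t <= 1.
Proof.
move=> t0; case: m => [|m]; first exact: (hkS_le1 0 t0).
have h1 := hkS_le1 m.+1 t0; have h2 := hkS_ge0 m t0; have h3 := hk_ge0 m.+1 t0.
move: h1 => /=; lra.
Qed.

Lemma hk0_ge t : 0 <= t -> expR (- (2 * t)) <= hk 0 t.
Proof.
move=> t0; rewrite /hk /besJ expr0 mul1r mulNr ler_peMr ?expR_ge0//.
by rewrite bpsi0_ge1// sqr_ge0.
Qed.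

Lemma sum_hkZ M t : \sum_(a < M.*2.+1) hkZ (Posz a - Posz M) t = hkS M t.
Proof.
elim: M => [|M IH]; first by rewrite big_ord1 /hkZ subrr.
rewrite doubleS big_ord_recl big_ord_recr.
transitivity (hk M.+1 t + (hkS M t + hk M.+1 t)); last by rewrite /=; ring.
congr (_ + (_ + _)).
- by rewrite /hkZ; congr (hk _ _); rewrite /=; lia.
- rewrite -IH; apply: eq_bigr => a _; rewrite /hkZ; congr (hk _ _).
  by rewrite lift0/=; lia.
- by rewrite /hkZ lift0/=; congr (hk _ _); lia.
Qed.

End bessel.

(** * The product kernel on the lattice as a lower barrier *)

Section product_kernel.
Context {R : realType} {N : nat}.
Local Notation V := 'rV[R]_N.
Implicit Types (t y : R).

(** The kernel of the integers extended by 0 to the real line. The product kernel becomes a function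
    on the whole space, on which [dLap] acts and to which the comparison lemmas apply. *)
Definition hkR t y : R := if y == (Num.floor y)%:~R then hkZ (Num.floor y) t else 0.

Lemma hkR_int t (j : int) : hkR t j%:~R = hkZ j t.
Proof. by rewrite /hkR intrKfloor eqxx. Qed.

Lemma floor1 y : Num.floor (y + 1) = Num.floor y + 1.
Proof. by rewrite floorDrz ?floor1// rpred1. Qed.

Lemma floorN1 y : Num.floor (y - 1) = Num.floor y - 1.
Proof. by have := floor1 (y - 1); rewrite subrK => ->; rewrite addrK. Qed.

Lemma is_derive_hkR t y : is_derive t 1 (hkR ^~ y) (hkR t (y + 1) + hkR t (y - 1) - 2 * hkR t y).
Proof.
rewrite /hkR floor1 floorN1.
have -> : (y + 1 == (Num.floor y + 1)%:~R) = (y == (Num.floor y)%:~R).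
  by rewrite intrD (inj_eq (addIr 1)).
have -> : (y - 1 == (Num.floor y - 1)%:~R) = (y == (Num.floor y)%:~R).
  by rewrite intrB (inj_eq (subIr 1)).
case: ifP => _; first exact: is_derive_hkZ.
by rewrite addr0 mulr0 subr0; exact: is_derive_cst.
Qed.

Lemma hkR_ge0 t y : 0 <= t -> 0 <= hkR t y.
Proof. by move=> t0; rewrite /hkR; case: ifP => // _; exact: hk_ge0. Qed.

Lemma hkR_le1 t y : 0 <= t -> hkR t y <= 1.
Proof. by move=> t0; rewrite /hkR; case: ifP => // _; exact: hk_le1. Qed.

Lemma hkR_0 y : hkR 0 y = (y == 0)%:R.
Proof.
rewrite /hkR /hkZ hk_0 absz_eq0; have [->|y0] := eqVneq y 0.
  by rewrite floor0 mulr0z !eqxx.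
case: ifP => // /eqP e; case: eqP => // f; move: e; rewrite f => e.
by rewrite e eqxx in y0.
Qed.

Lemma is_derive_prod (I : eqType) (s : seq I) (f : I -> R -> R) (df : I -> R) (t : R) :
  uniq s -> (forall i, is_derive t 1 (f i) (df i)) ->
  is_derive t 1 (fun t => \prod_(i <- s) f i t)
    (\sum_(i <- s) df i * \prod_(j <- s | j != i) f j t).
Proof.
move=> us d; elim: s us => [_|i s IH /= /andP[si us]].
  under eq_fun do rewrite big_nil; rewrite big_nil; exact: is_derive_cst.
under eq_fun do rewrite big_cons.
have h := is_deriveM (d i) (IH us).
apply: (is_derive_eq h); rewrite -![_ *: _]/(_ * _) big_cons big_cons eqxx/=.
rewrite addrC; congr (_ + _).
  rewrite mulrC; congr (_ * _); rewrite big_seq [RHS]big_seq_cond; apply: eq_bigl => j.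
  by case: (boolP (j \in s)) => //= js; apply/esym; apply: contraNneq si => <-.
rewrite mulr_sumr; apply: eq_big_seq => j js.
rewrite big_cons; have -> : i != j by apply: contraNneq si => ->.
by rewrite mulrCA.
Qed.

Definition pk t (x : V) : R := \prod_(i < N) hkR t (x 0 i).

Lemma pk_le1 t x : 0 <= t -> pk t x <= 1.
Proof.
move=> t0; suff /andP[] : 0 <= pk t x <= 1 by [].
rewrite /pk; elim/big_ind: _ => [|a b /andP[? ?] /andP[? ?]|i _]; first by rewrite ler01 lexx.
  by rewrite mulr_ge0//= mulr_ile1.
by rewrite hkR_ge0// hkR_le1.
Qed.

Lemma pk_step t (x : V) (k : 'I_N) (s : R) :
  pk t (x + s *: delta_mx 0 k) = hkR t (x 0 k + s) * \prod_(j < N | j != k) hkR t (x 0 j).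
Proof.
rewrite /pk (bigD1 k)//= !mxE !eqxx mulr1; congr (_ * _).
by apply: eq_bigr => j jk; rewrite !mxE eqxx (negPf jk) mulr0 addr0.
Qed.

Lemma is_derive_pk t (x : V) : is_derive t 1 (pk ^~ x) (dLap 1 (pk t) x).
Proof.
have h := is_derive_prod (index_enum_uniq 'I_N) (fun i => is_derive_hkR t (x 0 i)).
apply: (is_derive_eq h); rewrite /dLap; apply: eq_bigr => k _.
have em : x - 1 *: delta_mx 0 k = x + (- 1) *: delta_mx 0 k by rewrite scaleNr.
rewrite expr1n divr1 em !pk_step.
have -> : pk t x = hkR t (x 0 k) * \prod_(j < N | j != k) hkR t (x 0 j).
  by rewrite /pk (bigD1 k).
ring.
Qed.

Variable h : R.
Hypothesis h0 : 0 < h.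

Definition scaled_pk (x0 : V) t (x : V) : R := pk (t / h ^+ 2) (h^-1 *: (x - x0)).

Lemma is_derive_scaled_pk (x0 : V) t (x : V) :
  is_derive t 1 (scaled_pk x0 ^~ x) (dLap h (scaled_pk x0 t) x).
Proof.
have e1 := @is_derive1_comp _ (pk ^~ (h^-1 *: (x - x0))) (fun t => t / h ^+ 2) t _ _
  (is_derive_pk _ _) (is_derive_scaler _ _).
apply: (is_derive_eq e1); rewrite /dLap mulr_suml; apply: eq_bigr => k _.
have e (s : R) : h^-1 *: (x + s *: delta_mx 0 k - x0) = h^-1 *: (x - x0) + (h^-1 * s) *: delta_mx 0 k :> V.
  by rewrite addrAC scalerDr scalerA.
have em : x - h *: delta_mx 0 k = x + (- h) *: delta_mx 0 k by rewrite scaleNr.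
by rewrite /scaled_pk em !e mulrN mulVf ?gt_eqF// scaleNr expr1n divr1.
Qed.

(** The kernel centred at [x] and multiplied by [phi x] solves the heat equation and starts below
    the nonnegative function [phi], with equality at [x]; comparison gives the bound on the
    diagonal. *)
Lemma heat_kernel_lb (phi : V -> R) t (x : V) : bdd phi -> (forall z, 0 <= phi z) -> 0 <= t ->
  hk 0 (t / h ^+ 2) ^+ N * phi x <= heat h t phi x.
Proof.
move=> b p t0.
have tt : 0 <= t <= t by rewrite t0 lexx.
have hh : 0 <= (h ^+ 2)^-1 by rewrite invr_ge0 exprn_ge0// ltW.
have ee : scaled_pk x t x = hk 0 (t / h ^+ 2) ^+ N.
  rewrite /scaled_pk subrr scaler0 /pk.
  under eq_bigr do rewrite mxE (hkR_int _ 0) /hkZ absz0.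
  by rewrite prodr_const card_ord.
have := @heat_ge _ _ h h0 phi (fun s (y : V) => phi x * scaled_pk x s y)
  (fun s (y : V) => phi x * dLap h (scaled_pk x s) y) t b _ _ _ _ _ t x tt.
rewrite ee mulrC; apply.
- exists (phi x) => s y /andP[s0 _]; rewrite ler_piMr// pk_le1// mulr_ge0//.
- move=> y; rewrite /scaled_pk mul0r.
  have [->|yx] := eqVneq y x.
    by rewrite ler_piMr// pk_le1.
  rewrite (_ : pk _ _ = 0) ?mulr0//.
  have [i yi] : exists i, y 0 i != x 0 i.
    apply/existsP; apply: contraNT yx => /existsPn e; apply/eqP/rowP => i.
    by have /negPn/eqP := e i.
  rewrite /pk (bigD1 i)//= hkR_0 !mxE mulf_eq0 invr_eq0 (gt_eqF h0)/= subr_eq0.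
  by rewrite (negPf yi) mul0r.
- move=> y; apply: continuous_subspaceT => s; apply: cvgM; first exact: cvg_cst.
  exact: is_derive_continuous (is_derive_scaled_pk x s y).
- by move=> s y _; apply: is_deriveZ; exact: is_derive_scaled_pk.
- by move=> s y _; rewrite dLapZ.
Qed.

End product_kernel.

(** * The discrete fractional Laplacian: monotonicity, symbol and total jump rate *)

Section discrete_fractional.
Context {R : realType} {N : nat}.
Variable sigma : R.
Hypothesis s02 : 0 < sigma < 2.
Local Notation V := 'rV[R]_N.
Local Notation mu := (@lebesgue_measure R).
Local Notation pos := (`]0, +oo[%classic : set R).
Local Notation G := (`|Gamma (- (sigma / 2))| : R).
Implicit Types (phi psi : V -> R) (x : V) (h : R).

Let a01 : 0 < sigma / 2 < 1.
Proof. by have /andP[h1 h2] := s02; rewrite divr_gt0//= ltr_pdivrMr// mul1r. Qed.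

Let G0 : 0 < G := normGamma_gt0 s02.

Lemma cts_pos_powV (a : R) : cts_pos (fun t : R => (t `^ a)^-1).
Proof. by move=> t t0; apply: cvgV; [rewrite gt_eqF// powR_gt0|exact: cts_pos_powR]. Qed.

Lemma cts_pos_stable (f : R -> R) : cts_pos f -> cts_pos (fun t => f t / t `^ (1 + sigma / 2)).
Proof. by move=> cf; apply: cts_posM => //; exact: cts_pos_powV. Qed.

Lemma cts_pos_1Bexp (b : R) : cts_pos (fun t => 1 - expR (- (b * t))).
Proof. by move=> t t0; apply: cvgB; [exact: cvg_cst|exact: cts_pos_expNM]. Qed.

Lemma integrable_1Bexp_stable b : 0 <= b ->
  mu.-integrable pos (EFin \o (fun t => (1 - expR (- (b * t))) / t `^ (1 + sigma / 2))).
Proof.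
move=> b0; apply: integrable_pos.
- by move=> t t0; rewrite divr_ge0 ?powR_ge0// subr_ge0 expR_le1 oppr_le0 mulr_ge0// ltW.
- have cf : cts_pos (fun t => (1 - expR (- (b * t))) / t `^ (1 + sigma / 2)).
    by apply: cts_pos_stable; exact: cts_pos_1Bexp.
  exact: (@cts_pos_measurable R _ cf).
- by rewrite integral_stable_exp// ltry.
Qed.

Lemma Rintegral_1Bexp_stable b : 0 <= b ->
  \int[mu]_(t in pos) ((1 - expR (- (b * t))) / t `^ (1 + sigma / 2)) = G * b `^ (sigma / 2).
Proof. by move=> b0; rewrite /Rintegral integral_stable_exp. Qed.

Lemma integrable_stable (f : R -> R) (C b : R) : 0 <= b -> cts_pos f ->
  (forall t, 0 < t -> `|f t| <= C * (1 - expR (- (b * t)))) ->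
  mu.-integrable pos (EFin \o (fun t => f t / t `^ (1 + sigma / 2))).
Proof.
move=> b0 cf hf.
apply: (@integrable_le_pos _ _ (fun t => C * ((1 - expR (- (b * t))) / t `^ (1 + sigma / 2)))).
- by apply: cts_pos_measurable; exact: cts_pos_stable.
- move=> t t0; rewrite normrM mulrA [`|_^-1|]ger0_norm; last by rewrite invr_ge0 powR_ge0.
  by rewrite ler_wpM2r ?invr_ge0 ?powR_ge0// hf.
- have : mu.-integrable pos (fun t => C%:E * ((1 - expR (- (b * t))) / t `^ (1 + sigma / 2))%:E)%E.
    by apply: integrableZl => //; exact: integrable_1Bexp_stable.
  by apply: eq_integrable => // t _; rewrite EFinM.
Qed.

Lemma cts_pos_heat h phi x : 0 < h -> bdd phi -> cts_pos (fun t => heat h t phi x - phi x).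
Proof.
move=> h0 b t t0; have [_ _ _ d] := heatP h0 b.
by apply: cvgB; [exact: is_derive_continuous (d t x t0)|exact: cvg_cst].
Qed.

Lemma integrable_dfracLap h phi x : 0 < h -> bdd phi ->
  mu.-integrable pos (EFin \o (fun t => (heat h t phi x - phi x) / t `^ (1 + sigma / 2))).
Proof.
move=> h0 b; have [B hB] := b; have [C C0 hC] := heat_bound h0 hB.
apply: (@integrable_stable _ C 1) => //; first exact: cts_pos_heat.
by move=> t t0; rewrite mul1r hC// ltW.
Qed.

Lemma dfracLapD h phi psi x : 0 < h -> bdd phi -> bdd psi ->
  dfracLap sigma h (fun y => phi y + psi y) x = dfracLap sigma h phi x + dfracLap sigma h psi x.
Proof.
move=> h0 b1 b2; rewrite /dfracLap -mulrDr -RintegralD//; [|exact: integrable_dfracLap|exact: integrable_dfracLap].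
congr (_ * _); apply: eq_Rintegral => t; rewrite inE/= in_itv/= andbT => t0.
by rewrite heatD// ?(ltW t0)//; ring.
Qed.

Lemma dfracLapZ h c phi x : 0 < h -> bdd phi ->
  dfracLap sigma h (fun y => c * phi y) x = c * dfracLap sigma h phi x.
Proof.
move=> h0 b1; rewrite /dfracLap.
transitivity (G^-1 * \int[mu]_(t in pos) (c * ((heat h t phi x - phi x) / t `^ (1 + sigma / 2)))).
  congr (_ * _); apply: eq_Rintegral => t; rewrite inE/= in_itv/= andbT => t0.
  by rewrite heatZ// ?(ltW t0)//; ring.
by rewrite RintegralZl//; [ring|exact: integrable_dfracLap].
Qed.

Lemma dfracLap_cst h (c : R) x : 0 < h -> dfracLap sigma h (fun=> c) x = 0.
Proof.
move=> h0; rewrite /dfracLap (_ : Rintegral _ _ _ = 0) ?mulr0//.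
rewrite /Rintegral integral0_eq// => t; rewrite /= in_itv/= andbT => t0.
by rewrite heat_cst// ?(ltW t0)// subrr mul0r.
Qed.

Lemma dfracLap_shift h phi v x : 0 < h -> bdd phi ->
  dfracLap sigma h (fun y => phi (y + v)) x = dfracLap sigma h phi (x + v).
Proof.
move=> h0 b; rewrite /dfracLap; congr (_ * _); apply: eq_Rintegral => t.
by rewrite inE/= in_itv/= andbT => t0; rewrite heat_shift// ltW.
Qed.

(** The total jump rate on the unit lattice: [hk 0 t ^+ N] is the probability that the lattice walk
    is at its starting point at time [t]. *)
Definition mass : R := G^-1 * \int[mu]_(t in pos) ((1 - hk 0 t ^+ N) / t `^ (1 + sigma / 2)).

Lemma hk0N_bound (t : R) : 0 <= t -> 0 <= 1 - hk 0 t ^+ N <= 1 - expR (- (2 * N%:R * t)).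
Proof.
move=> t0; rewrite subr_ge0 exprn_ile1 ?hk_ge0 ?hk_le1//= lerD2l lerN2.
rewrite (_ : - (2 * N%:R * t) = N%:R * - (2 * t)); last by ring.
rewrite expRM_natl; apply: lerXn2r; rewrite ?nnegrE ?expR_ge0 ?hk_ge0//.
exact: hk0_ge.
Qed.

Lemma cts_pos_hk0N : cts_pos (fun t : R => 1 - hk 0 t ^+ N).
Proof.
move=> t _; apply: cvgB; first exact: cvg_cst.
by apply: (@continuous_comp _ _ _ (hk 0) (fun y => y ^+ N)); [exact: cts_hk|exact: exprn_continuous].
Qed.

Lemma integrable_hk0N :
  mu.-integrable pos (EFin \o (fun t => (1 - hk 0 t ^+ N) / t `^ (1 + sigma / 2))).
Proof.
apply: (@integrable_stable _ 1 (2 * N%:R)); rewrite ?mulr_ge0//.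
  exact: cts_pos_hk0N.
move=> t t0; rewrite mul1r; have /andP[h1 h2] := hk0N_bound (ltW t0).
by rewrite ger0_norm.
Qed.

Lemma scaled_hk0N h : 0 < h ->
  mu.-integrable pos (EFin \o (fun t => (1 - hk 0 (t / h ^+ 2) ^+ N) / t `^ (1 + sigma / 2))) /\
  G^-1 * \int[mu]_(t in pos) ((1 - hk 0 (t / h ^+ 2) ^+ N) / t `^ (1 + sigma / 2)) =
  mass * (h `^ sigma)^-1.
Proof.
move=> h0; have hh : 0 < h ^+ 2 by exact: exprn_gt0.
pose f t : R := (1 - hk 0 (t / h ^+ 2) ^+ N) / t `^ (1 + sigma / 2).
have cf : cts_pos f.
  apply: cts_pos_stable; apply: (@cts_pos_comp _ (fun t => 1 - hk 0 t ^+ N) (fun t => t / h ^+ 2)).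
  - by move=> t t0; rewrite divr_gt0.
  - exact: cts_pos_hk0N.
  - by move=> t _; exact: is_derive_continuous (is_derive_scaler _ _).
have f0 t : 0 < t -> 0 <= f t.
  move=> t0; have th : 0 <= t / h ^+ 2 by rewrite divr_ge0// ltW.
  by have /andP[h1 _] := hk0N_bound th; rewrite divr_ge0 ?powR_ge0.
have e : (\int[mu]_(t in pos) (f t)%:E = ((h `^ sigma)^-1)%:E *
    \int[mu]_(t in pos) ((1 - hk 0 t ^+ N) / t `^ (1 + sigma / 2))%:E)%E.
  rewrite (integral_pos_scale hh f0 cf) -integral_posZ.
  - apply: eq_integral => t; rewrite inE/= in_itv/= andbT => t0; congr EFin.
    rewrite /f (_ : h ^+ 2 * t / h ^+ 2 = t); last by field; rewrite gt_eqF.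
    rewrite powRM ?(ltW hh) ?(ltW t0)// powRD ?(gt_eqF hh) ?implybT//.
    rewrite powRr1 ?(ltW hh)// -(powR_mulrn 2 (ltW h0)) -powRrM.
    rewrite (_ : 2 * (sigma / 2) = sigma); last by field.
    have p1 : 0 < h `^ 2 by exact: powR_gt0.
    have p2 : 0 < h `^ sigma by exact: powR_gt0.
    have p3 : 0 < t `^ (1 + sigma / 2) by exact: powR_gt0.
    by field; rewrite !gt_eqF.
  - by rewrite invr_ge0 powR_ge0.
  - by move=> t t0; rewrite divr_ge0 ?powR_ge0//; have /andP[] := hk0N_bound (ltW t0).
  - by apply: cts_pos_measurable; apply: cts_pos_stable; exact: cts_pos_hk0N.
have fin : (\int[mu]_(t in pos) ((1 - hk 0 t ^+ N) / t `^ (1 + sigma / 2))%:E)%E \is a fin_num.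
  by apply: integrable_fin_num => //; exact: integrable_hk0N.
split.
  apply: integrable_pos => //; first exact: cts_pos_measurable.
  by rewrite e; rewrite -(fineK fin) -EFinM ltry.
rewrite /mass /Rintegral e -{1}(fineK fin) -EFinM/=; ring.
Qed.

Lemma dfracLap_ge h phi x : 0 < h -> bdd phi -> (forall y, 0 <= phi y) ->
  - (mass * (h `^ sigma)^-1 * phi x) <= dfracLap sigma h phi x.
Proof.
move=> h0 b p; have [i1 e] := scaled_hk0N h0.
rewrite -e /dfracLap -mulrA -mulrN ler_wpM2l ?invr_ge0 ?(ltW G0)//.
rewrite mulrC -mulNr.
have i2 : mu.-integrable pos (EFin \o (fun t => - phi x * ((1 - hk 0 (t / h ^+ 2) ^+ N) / t `^ (1 + sigma / 2)))).
  have : mu.-integrable pos (fun t => (- phi x)%:E * ((1 - hk 0 (t / h ^+ 2) ^+ N) / t `^ (1 + sigma / 2))%:E)%E.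
    exact: integrableZl.
  by apply: eq_integrable => // t _; rewrite EFinM.
rewrite -(RintegralZl _ _ i1)//; apply: le_Rintegral => //; first exact: integrable_dfracLap.
move=> t; rewrite /= in_itv/= andbT => t0.
rewrite mulrA ler_wpM2r ?invr_ge0 ?powR_ge0//.
by have := heat_kernel_lb h0 x b p (ltW t0); lra.
Qed.

(** Adding the total jump rate times the identity removes the negative diagonal of the operator.
    This is the form of monotonicity used both for the resolvent and for the explicit step. *)
Lemma dfracLap_mono h phi psi x : 0 < h -> bdd phi -> bdd psi -> (forall y, phi y <= psi y) ->
  dfracLap sigma h phi x + mass * (h `^ sigma)^-1 * phi x <=
  dfracLap sigma h psi x + mass * (h `^ sigma)^-1 * psi x.
Proof.
move=> h0 b1 b2 le.
have bN : bdd (fun y => -1 * phi y) by exact: bddZ.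
have := @dfracLap_ge h (fun y => psi y + -1 * phi y) x h0 (bddD b2 bN) _.
have p y : 0 <= psi y + -1 * phi y by rewrite mulN1r subr_ge0.
move=> /(_ p); rewrite dfracLapD// dfracLapZ//; lra.
Qed.

Lemma mass_ge0 : 0 <= mass.
Proof.
rewrite mulr_ge0 ?invr_ge0//; apply: Rintegral_ge0 => t; rewrite /= in_itv/= andbT => t0.
by rewrite divr_ge0 ?powR_ge0//; have /andP[] := hk0N_bound (ltW t0).
Qed.

Definition dsymbol h (c : 'I_N -> R) : R := \sum_k (2 - 2 * cos (c k * h)) / h ^+ 2.

Lemma linf_step (c : 'I_N -> R) x (s : R) k : linf c (x + s *: delta_mx 0 k) = linf c x + c k * s.
Proof.
rewrite /linf; under eq_bigr do rewrite !mxE mulrDr.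
rewrite big_split/=; congr (_ + _).
rewrite (bigD1 k)//= !eqxx/= mulr1 big1 ?addr0// => j jk.
by rewrite (negPf jk) !mulr0.
Qed.

Lemma dLap_cos h c th x : dLap h (fun y => cos (linf c y + th)) x =
  - dsymbol h c * cos (linf c x + th).
Proof.
rewrite /dLap /dsymbol mulNr mulr_suml -sumrN; apply: eq_bigr => k _.
have em : x - h *: delta_mx 0 k = x + (- h) *: delta_mx 0 k by rewrite scaleNr.
rewrite em !linf_step mulrN.
rewrite (_ : linf c x + c k * h + th = linf c x + th + c k * h); last by ring.
rewrite (_ : linf c x - c k * h + th = linf c x + th - c k * h); last by ring.
by rewrite cosD cosB; ring.
Qed.

Lemma dsymbol_ge0 h c : 0 <= dsymbol h c.
Proof.
apply: sumr_ge0 => k _; by rewrite divr_ge0 ?sqr_ge0// subr_ge0 ler_piMr// cos_le1.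
Qed.

Lemma bdd_cos (c : 'I_N -> R) th : bdd (fun y : V => cos (linf c y + th)).
Proof. by exists 1 => y; exact: normr_cos_le1. Qed.

Lemma heat_cos h c th t x : 0 < h -> 0 <= t ->
  heat h t (fun y => cos (linf c y + th)) x = expR (- (dsymbol h c * t)) * cos (linf c x + th).
Proof.
move=> h0 t0.
pose U t (x : V) := expR (- dsymbol h c * t) * cos (linf c x + th).
have dU (s : R) (y : V) : is_derive s 1 (U ^~ y) (dLap h (U s) y).
  rewrite dLapZ dLap_cos.
  have e := is_deriveM (is_derive_expRM (- dsymbol h c) s) (is_derive_cst (cos (linf c y + th)) s (1:R)).
  by apply: (is_derive_eq e); rewrite -![_ *: _]/(_ * _) /cst; ring.
rewrite (@heat_uniq _ _ _ h0 _ U)//; first by rewrite /U mulNr.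
split.
- apply/bounded_onP; exists 1 => -[s y]/= s0; rewrite normrM ger0_norm ?expR_ge0//.
  rewrite mulr_ile1 ?expR_ge0 ?normr_cos_le1//.
  by rewrite expR_le1 mulNr oppr_le0 mulr_ge0 ?dsymbol_ge0.
- by apply/funext => y; rewrite /U mulr0 expR0 mul1r.
- by move=> y; apply: continuous_subspaceT => s; exact: is_derive_continuous (dU s y).
- by move=> s y _; exact: dU.
Qed.

Lemma dfracLap_cos h c th x : 0 < h ->
  dfracLap sigma h (fun y => cos (linf c y + th)) x =
  - dsymbol h c `^ (sigma / 2) * cos (linf c x + th).
Proof.
move=> h0; rewrite /dfracLap.
transitivity (G^-1 * \int[mu]_(t in pos) (- cos (linf c x + th) *
   ((1 - expR (- (dsymbol h c * t))) / t `^ (1 + sigma / 2)))).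
  congr (_ * _); apply: eq_Rintegral => t; rewrite inE/= in_itv/= andbT => t0.
  by rewrite heat_cos ?(ltW t0)//; ring.
rewrite RintegralZl//; last by apply: integrable_1Bexp_stable; exact: dsymbol_ge0.
rewrite Rintegral_1Bexp_stable ?dsymbol_ge0//.
by field; rewrite gt_eqF.
Qed.

Lemma bdd_penal (b : R) : 0 <= b -> bdd (@penal R N b).
Proof.
move=> b0; exists N%:R => y; rewrite ger0_norm; last first.
  by apply: sumr_ge0 => i _; exact: gbump_ge0.
rewrite -[N in N%:R]card_ord -sumr_const; apply: ler_sum => i _; exact: gbump_le1.
Qed.

Lemma dLap_penal h b x : 0 < h -> 0 <= b -> dLap h (@penal R N b) x <= 2 * N%:R * b.
Proof.
move=> h0 b0; rewrite /dLap.
rewrite (_ : 2 * N%:R * b = \sum_(k < N) 2 * b); last first.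
  by rewrite sumr_const card_ord -mulr_natl; ring.
apply: ler_sum => k _; rewrite ler_pdivrMr ?exprn_gt0//.
have e s : penal b (x + s *: delta_mx 0 k) = gbump b (x 0 k + s) +
    \sum_(i < N | i != k) gbump b (x 0 i).
  rewrite /penal (bigD1 k)//= !mxE !eqxx mulr1; congr (_ + _).
  by apply: eq_bigr => j jk; rewrite !mxE eqxx (negPf jk) mulr0 addr0.
have em : x - h *: delta_mx 0 k = x + (- h) *: delta_mx 0 k by rewrite scaleNr.
rewrite em !e (_ : penal b x = gbump b (x 0 k) + \sum_(i < N | i != k) gbump b (x 0 i)); last first.
  by rewrite /penal (bigD1 k).
have h1 := gbump_diff2_le (x 0 k) h b0.
have h2 := @expN_ge1Bx R (b * h ^+ 2).
have -> : 2 * b * h ^+ 2 = 2 * (b * h ^+ 2) by ring.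
lra.
Qed.

Lemma dfracLap_penal h b x : 0 < h -> 0 <= b ->
  dfracLap sigma h (@penal R N b) x <= 6 * N%:R * b `^ (sigma / 2).
Proof.
move=> h0 b0; have bp := bdd_penal b0.
have nn : 0 <= N%:R :> R by [].
have i1 : mu.-integrable pos (EFin \o (fun t => 6 * N%:R * ((1 - expR (- (b * t))) / t `^ (1 + sigma / 2)))).
  have : mu.-integrable pos (fun t => (6 * N%:R)%:E * ((1 - expR (- (b * t))) / t `^ (1 + sigma / 2))%:E)%E.
    by apply: integrableZl => //; exact: integrable_1Bexp_stable.
  by apply: eq_integrable => // t _; rewrite EFinM.
apply: (@le_trans _ _ (G^-1 * \int[mu]_(t in pos) (6 * N%:R * ((1 - expR (- (b * t))) / t `^ (1 + sigma / 2))))).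
  rewrite ler_wpM2l ?invr_ge0 ?(ltW G0)//; apply: le_Rintegral => //.
    exact: integrable_dfracLap.
  move=> t; rewrite /= in_itv/= andbT => t0.
  rewrite mulrA ler_wpM2r ?invr_ge0 ?powR_ge0//.
  (* The penalization is at most [N] and its discrete Laplacian at most [2 N b], so that [le_1Bexp]
     produces the constant [2 (N + 2 N) = 6 N]. *)
  apply: (@le_trans _ _ (2 * (N%:R + 2 * N%:R) * (1 - expR (- (b * t))))).
    apply: le_1Bexp.
    - by rewrite mulr_ge0// ltW.
    - by [].
    - by rewrite mulr_ge0.
    - have p0 : 0 <= penal b x by apply: sumr_ge0 => i _; exact: gbump_ge0.
      have : heat h t (@penal R N b) x <= N%:R.
        apply: heat_ub => //; last exact: ltW.
        move=> y; rewrite -[N in N%:R]card_ord -sumr_const; apply: ler_sum => i _; exact: gbump_le1.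
      lra.
    - rewrite lerBlDl mulrA; apply: heat_le_lin => //; last exact: ltW.
      by move=> y; exact: dLap_penal.
  rewrite le_eqVlt; apply/orP; left; apply/eqP; ring.
rewrite RintegralZl//; last exact: integrable_1Bexp_stable.
rewrite Rintegral_1Bexp_stable// le_eqVlt; apply/orP; left; apply/eqP.
by field; rewrite gt_eqF.
Qed.

(** By the half-angle formula each term is [4 (sin (c h / 2) / h) ^ 2], and the quotient tends to
    the derivative of the sine at 0. *)
Lemma dsymbol_cvg (c : 'I_N -> R) :
  dsymbol h c @[h --> 0^'+] --> \sum_i c i ^+ 2.
Proof.
rewrite /dsymbol; apply: cvg_big => [|k _]; first by apply: add_continuous.
pose g (y : R) := sin (c k / 2 * y).
have dg : is_derive (0 : R) 1 g (c k / 2).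
  have e := is_derive_sinM (c k / 2) 0.
  by apply: (is_derive_eq e); rewrite mulr0 cos0 mulr1.
have /cvg_ex[l hl] := @ex_derive _ _ _ _ _ _ _ dg.
have ll : l = c k / 2.
  rewrite -(@derive_val _ _ _ _ _ _ _ dg); apply/esym/cvg_lim => //.
rewrite ll in hl.
have hr := cvg_dnbhs_at_right hl.
rewrite (_ : c k ^+ 2 = 4 * ((c k / 2) * (c k / 2))); last by field.
apply: cvg_trans (cvgM (cvg_cst (4 : R)) (cvgM hr hr)); apply: near_eq_cvg.
near=> h; have h0 : 0 < h by near: h; exact: nbhs_right_gt.
rewrite /= /g !mulr0 sin0 subr0 addr0 -![_ *: _]/(_ * _) mulr1.
rewrite (_ : c k * h = (c k / 2 * h) *+ 2); last by rewrite mulr2n; field.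
rewrite cos_mulr2n; have := cos2Dsin2 (c k / 2 * h).
move: (cos _) (sin _) => C S e; have -> : C ^+ 2 = 1 - S ^+ 2 by rewrite -e addrK.
by rewrite mulr2n; field; rewrite gt_eqF.
Unshelve. all: by end_near. Qed.

Lemma dsymbol_pow_cvg (c : 'I_N -> R) :
  dsymbol h c `^ (sigma / 2) @[h --> 0^'+] --> (\sum_i c i ^+ 2) `^ (sigma / 2).
Proof.
(* Continuity of the power is available at positive arguments only; if the limit is 0, every
   frequency vanishes and the symbol is constant. *)
have [s0|s0] := eqVneq (\sum_i c i ^+ 2) 0.
  have c0 i : c i = 0.
    have /psumr_eq0P := s0; move=> /(_ (fun i _ => sqr_ge0 _)) /(_ i isT).
    by move=> /eqP; rewrite sqrf_eq0 => /eqP.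
  rewrite s0 (_ : (fun h => _) = fun=> 0 `^ (sigma / 2)); first exact: cvg_cst.
  apply/funext => h; congr (_ `^ _); rewrite /dsymbol big1// => k _.
  by rewrite c0 mul0r cos0 mulr1 subrr mul0r.
have sp : 0 < \sum_i c i ^+ 2 by rewrite lt_neqAle eq_sym s0 sumr_ge0// => i _; exact: sqr_ge0.
apply: (@cvg_comp _ _ _ (fun h => dsymbol h c) (fun y => y `^ (sigma / 2))); first exact: dsymbol_cvg.
exact: cts_pos_powR.
Qed.

(** Lattice points of a cube indexed by finite functions, so that a product over the coordinates of
    one-dimensional sums expands into a sum over the cube. *)
Definition latt_box (M : nat) (f : {ffun 'I_N -> 'I_(M.*2.+1)}) : 'rV[int]_N :=
  \row_i (Posz (f i) - Posz M).

Definition latt_hk (j : 'rV[int]_N) (t : R) : R := \prod_(i < N) hkZ (j ord0 i) t.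

Lemma latt_box_inj M : injective (@latt_box M).
Proof.
move=> f g /rowP e; apply/ffunP => i; apply: val_inj => /=.
by have := e i; rewrite !mxE => /addIr[].
Qed.

Definition box0 M : {ffun 'I_N -> 'I_(M.*2.+1)} := [ffun=> inord M].

Lemma latt_box0 M : latt_box (box0 M) = 0.
Proof.
apply/rowP => i; rewrite !mxE ffunE inordK ?subrr//.
by rewrite ltnS -addnn leq_addr.
Qed.

Lemma latt_hk_ge0 j t : 0 <= t -> 0 <= latt_hk j t.
Proof. by move=> t0; apply: prodr_ge0 => i _; exact: hk_ge0. Qed.

Lemma latt_hk0 t : latt_hk 0 t = hk 0 t ^+ N.
Proof.
rewrite /latt_hk; under eq_bigr do rewrite mxE /hkZ absz0.
by rewrite prodr_const card_ord.
Qed.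

Lemma sum_latt_hk M t :
  \sum_(f : {ffun 'I_N -> 'I_(M.*2.+1)} | f != box0 M) latt_hk (latt_box f) t =
  hkS M t ^+ N - hk 0 t ^+ N.
Proof.
apply/eqP; rewrite eq_sym subr_eq addrC; apply/eqP.
transitivity (\prod_(i < N) \sum_(a < M.*2.+1) hkZ (Posz a - Posz M) t).
  by under eq_bigr do rewrite sum_hkZ; rewrite prodr_const card_ord.
rewrite bigA_distr_bigA (bigD1 (box0 M))//= -latt_hk0 -(latt_box0 M); congr (_ + _).
  by apply: eq_bigr => i _; rewrite !mxE.
by apply: eq_bigr => f _; apply: eq_bigr => i _; rewrite !mxE.
Qed.

Lemma cts_hkZ (j : int) : continuous (@hkZ R j).
Proof. exact: cts_hk. Qed.

Lemma cts_pos_latt_hk j : cts_pos (latt_hk j).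
Proof.
move=> t _; rewrite /latt_hk; apply: cvg_big => [|i _]; first by apply: mul_continuous.
exact: cts_hkZ.
Qed.

(** The probability of one site other than the origin is at most the probability of having left the
    origin. *)
Lemma latt_hk_le M (f : {ffun 'I_N -> 'I_(M.*2.+1)}) t : f != box0 M -> 0 <= t ->
  latt_hk (latt_box f) t <= 1 - hk 0 t ^+ N.
Proof.
move=> f0 t0; apply: (@le_trans _ _ (hkS M t ^+ N - hk 0 t ^+ N)).
  rewrite -sum_latt_hk (bigD1 f)//= lerDl sumr_ge0// => g _; exact: latt_hk_ge0.
by rewrite lerD2r exprn_ile1 ?hkS_ge0 ?hkS_le1.
Qed.

Lemma integrable_latt_hk M (f : {ffun 'I_N -> 'I_(M.*2.+1)}) : f != box0 M ->
  mu.-integrable pos (EFin \o (fun t => latt_hk (latt_box f) t / t `^ (1 + sigma / 2))).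
Proof.
move=> f0; apply: (@integrable_stable _ 1 (2 * N%:R)); rewrite ?mulr_ge0//.
  exact: cts_pos_latt_hk.
move=> t t0; rewrite mul1r ger0_norm ?latt_hk_ge0 ?(ltW t0)//.
have /andP[_ h2] := hk0N_bound (ltW t0).
exact: le_trans (latt_hk_le f0 (ltW t0)) h2.
Qed.

Lemma kappa_latt_hk (j : 'rV[int]_N) :
  kappa sigma 1 j = G^-1 * \int[mu]_(t in pos) (latt_hk j t / t `^ (1 + sigma / 2)).
Proof.
rewrite /kappa powR1 invr1 mul1r; congr (_ * _); apply: eq_Rintegral => t _.
congr (_ / _); rewrite /latt_hk /hkZ /hk big_split/= prodr_const card_ord -expRM_natl.
congr (expR _ * _); first by ring.
by apply: eq_bigr => i _; rewrite besselI_J.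
Qed.

Lemma kappa_ge0 (j : 'rV[int]_N) : 0 <= kappa sigma 1 j.
Proof.
rewrite kappa_latt_hk mulr_ge0 ?invr_ge0//; apply: Rintegral_ge0 => t.
rewrite /= in_itv/= andbT => t0.
by rewrite divr_ge0 ?powR_ge0// latt_hk_ge0// ltW.
Qed.

Lemma cts_pos_hkSN M : cts_pos (fun t : R => hkS M t ^+ N - hk 0 t ^+ N).
Proof.
move=> t t0; apply: cvgB.
  apply: (@continuous_comp _ _ _ (hkS M) (fun y => y ^+ N)); last exact: exprn_continuous.
  exact: is_derive_continuous (is_derive_hkSum M t).
by apply: (@continuous_comp _ _ _ (hk 0) (fun y => y ^+ N)); [exact: cts_hk|exact: exprn_continuous].
Qed.

Lemma Rintegral_box (I : Type) (s : seq I) (g : I -> R -> R) :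
  (forall i, mu.-integrable pos (EFin \o (g i))) ->
  mu.-integrable pos (EFin \o (fun t => \sum_(i <- s) g i t)) /\
  \int[mu]_(t in pos) (\sum_(i <- s) g i t) = \sum_(i <- s) \int[mu]_(t in pos) (g i t).
Proof.
move=> ig; elim: s => [|i s [IH1 IH2]].
  split.
    have := @integrable0 _ _ R mu pos; apply: eq_integrable => // t _.
    by rewrite /= big_nil.
  rewrite big_nil /Rintegral integral0_eq// => t _; by rewrite big_nil.
split.
  have : mu.-integrable pos (fun t => ((g i t)%:E + (\sum_(i <- s) g i t)%:E)%E).
    by apply: integrableD => //; exact: ig.
  by apply: eq_integrable => // t _; rewrite /= big_cons.
by rewrite big_cons -IH2 -RintegralD//; apply: eq_Rintegral => t _; rewrite big_cons.
Qed.

Lemma integral_box_le_esum M :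
  ((G^-1)%:E * \int[mu]_(t in pos) ((hkS M t ^+ N - hk 0%N t ^+ N) / t `^ (1 + sigma / 2))%:E <=
  \esum_(j in [set j : 'rV[int]_N | j != 0%R]) (kappa sigma 1 j)%:E)%E.
Proof.
pose I := {f : {ffun 'I_N -> 'I_(M.*2.+1)} | f != box0 M}.
pose s : seq 'rV[int]_N := [seq latt_box (val f) | f <- enum {: I}].
have us : uniq s.
  by rewrite map_inj_uniq ?enum_uniq// => f g /latt_box_inj/val_inj.
apply: esum_ge; exists [set` s].
  split; first exact: finite_seq.
  move=> j /=/mapP[f _ ->].
  by rewrite -(latt_box0 M) (inj_eq (@latt_box_inj M)) (valP f).
rewrite -fsbig_seq// /s big_map sumEFin; under eq_bigr do rewrite kappa_latt_hk.
have ig (f : I) : mu.-integrable pos (EFin \o (fun t => latt_hk (latt_box (val f)) t / t `^ (1 + sigma / 2))).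
  by apply: integrable_latt_hk; exact: (valP f).
have [i1 i2] := Rintegral_box (enum {: I}) ig.
rewrite -mulr_sumr -i2 EFinM /Rintegral fineK; last by apply: integrable_fin_num.
rewrite le_eqVlt; apply/orP; left; apply/eqP; congr (_ * _)%E.
apply: eq_integral => t _; congr EFin.
rewrite -mulr_suml -sum_latt_hk; congr (_ / _).
rewrite big_enum/= [LHS](reindex_omap (val : I -> _) insub)/=; last first.
  by move=> f f0; rewrite insubT.
by apply: eq_bigl => f; rewrite (valP f) valK eqxx.
Qed.

(** [fine] sends an infinite sum to 0, so that positivity of [Csigma] certifies its finiteness. The
    sums over cubes are then bounded by it, and by monotone convergence and conservation of mass
    their integrands increase to that of [mass]. *)
Lemma mass_le_Csigma : 0 < Csigma N sigma -> mass <= Csigma N sigma :> R.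
Proof.
rewrite /Csigma; set E := esum _ _ => E0.
have Efin : E \is a fin_num.
  have : (0 <= E)%E by apply: esum_ge0 => j _; rewrite lee_fin kappa_ge0.
  by move: E0; case: E => //=; rewrite ltxx.
pose g M (t : R) := ((hkS M t ^+ N - hk 0 t ^+ N) / t `^ (1 + sigma / 2))%:E.
have hN (M : nat) (t : R) : 0 <= t -> hk 0 t ^+ N <= hkS M t ^+ N.
  move=> t0; apply: lerXn2r; rewrite ?nnegrE ?hk_ge0 ?hkS_ge0//.
  exact: (@hkS_nd _ _ t0 0%N M).
have cg : (\int[mu]_(t in pos) g M t)%E @[M --> \oo] -->
    (\int[mu]_(t in pos) ((1 - hk 0 t ^+ N) / t `^ (1 + sigma / 2))%:E)%E.
  have -> : (\int[mu]_(t in pos) ((1 - hk 0 t ^+ N) / t `^ (1 + sigma / 2))%:E =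
      \int[mu]_(t in pos) limn (g ^~ t))%E.
    apply: eq_integral => t; rewrite inE/= in_itv/= andbT => t0.
    apply/esym/cvg_lim => //; apply: cvg_EFin; first by near=> M.
    rewrite /g/= (_ : _ \o _ = fun M => (hkS M t ^+ N - hk 0 t ^+ N) / t `^ (1 + sigma / 2))//.
    apply: cvgM; last exact: cvg_cst.
    apply: cvgB; last exact: cvg_cst.
    rewrite -[X in _ --> X](expr1n _ N).
    apply: (@cvg_comp _ _ _ (fun M => hkS M t) (fun y => y ^+ N)); first exact: hkS_cvg (ltW t0).
    exact: exprn_continuous.
  apply: cvg_monotone_convergence => //.
  - move=> M; apply/measurable_EFinP.
    by apply: cts_pos_measurable; apply: cts_pos_stable; exact: cts_pos_hkSN.
  - move=> M t; rewrite /= in_itv/= andbT => t0.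
    by rewrite lee_fin divr_ge0 ?powR_ge0// subr_ge0 hN// ltW.
  - move=> t; rewrite /= in_itv/= andbT => t0 a b ab.
    rewrite lee_fin ler_wpM2r ?invr_ge0 ?powR_ge0// lerD2r.
    have st := hkS_nd (ltW t0) ab.
    by apply: lerXn2r; rewrite ?nnegrE ?hkS_ge0 ?(ltW t0).
have le : (\int[mu]_(t in pos) ((1 - hk 0 t ^+ N) / t `^ (1 + sigma / 2))%:E <= (G * fine E)%:E)%E.
  rewrite -(cvg_lim _ cg)//; apply: lime_le; first by apply/cvg_ex; eexists; exact: cg.
  near=> M; have := integral_box_le_esum M; rewrite -/E muleC lee_pdivrMr//.
  by rewrite EFinM (fineK Efin) muleC.
have fin : (\int[mu]_(t in pos) ((1 - hk 0 t ^+ N) / t `^ (1 + sigma / 2))%:E)%E \is a fin_num.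
  by apply: integrable_fin_num => //; exact: integrable_hk0N.
move: le; rewrite -(fineK fin) lee_fin /mass /Rintegral => le.
by rewrite ler_pdivrMl.
Unshelve. all: by end_near. Qed.

End discrete_fractional.

(** * Trigonometric polynomials and Fejer averages *)

Section sine_bounds.
Context {R : realType}.
Implicit Types (x y : R).

Lemma norm_sinD x y : `|sin (x + y)| <= `|sin x| + `|sin y|.
Proof.
rewrite sinD (le_trans (ler_normD _ _))// !normrM; apply: lerD.
  by rewrite ler_piMr// normr_cos_le1.
by rewrite ler_piMl// normr_cos_le1.
Qed.

Lemma norm_sin_sum (I : Type) (s : seq I) (f : I -> R) :
  `|sin (\sum_(i <- s) f i)| <= \sum_(i <- s) `|sin (f i)|.
Proof.
elim: s => [|i s IH]; first by rewrite !big_nil sin0 normr0.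
by rewrite !big_cons (le_trans (norm_sinD _ _))// lerD2l.
Qed.

Lemma norm_sin_natM (n : nat) x : `|sin (n%:R * x)| <= n%:R * `|sin x|.
Proof.
elim: n => [|n IH]; first by rewrite !mul0r sin0 normr0.
by rewrite -nat1r !mulrDl !mul1r (le_trans (norm_sinD _ _))// lerD2l.
Qed.

Lemma norm_sin_intM (k : int) x : `|sin (k%:~R * x)| <= `|k%:~R| * `|sin x|.
Proof.
case: (intP k) => [|n|n]; first by rewrite !mul0r sin0 normr0 mul0r.
  by rewrite -pmulrn normr_nat norm_sin_natM.
by rewrite mulrNz -pmulrn mulNr sinN !normrN normr_nat norm_sin_natM.
Qed.

Lemma cos_diff_le x y : `|cos (x + y) - cos x| <= 2 * `|sin (y / 2)|.
Proof.
have -> : cos (x + y) - cos x = - 2 * (sin (x + y / 2) * sin (y / 2)).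
  have e1 : x + y = (x + y / 2) + y / 2 by field.
  have e2 : x = (x + y / 2) - y / 2 by field.
  rewrite e1 [in X in _ - cos X]e2 cosD cosB; ring.
by rewrite !normrM normrN normr_nat ler_wpM2l// ler_piMl// normr_sin_le1.
Qed.

Lemma sin_half_sqr x : 1 - cos x = 2 * sin (x / 2) ^+ 2.
Proof.
rewrite {1}(_ : x = (x / 2) *+ 2); last by rewrite mulr2n; field.
rewrite cos_mulr2n; have := cos2Dsin2 (x / 2).
move: (cos _) (sin _) => C S e; rewrite mulr2n; have -> : C ^+ 2 = 1 - S ^+ 2 by rewrite -e addrK.
ring.
Qed.

End sine_bounds.

(** * Trigonometric polynomials of a fixed period *)

Section trig_polynomials.
Context {R : realType} {N : nat}.
Variable P : R.
Hypothesis P0 : 0 < P.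
Local Notation V := 'rV[R]_N.
Implicit Types (p q : V -> R) (x y z : V).

Definition freq (k : 'I_N -> int) : 'I_N -> R := fun i => (k i)%:~R / P.

(* Trigonometric polynomials of period 2 pi P in every coordinate. *)
Inductive trig : (V -> R) -> Prop :=
| trig_cos k th : trig (fun y => cos (linf (freq k) y + th))
| trigD p q : trig p -> trig q -> trig (fun y => p y + q y)
| trigZ c p : trig p -> trig (fun y => c * p y).

Lemma trig_cst (c : R) : trig (fun=> c).
Proof.
have := trigZ c (trig_cos (fun=> 0) 0); congr trig; apply/funext => y.
rewrite /linf big1 ?addr0 ?cos0 ?mulr1// => i _.
by rewrite /freq mul0r mul0r.
Qed.

Lemma trig_sum (I : Type) (s : seq I) (f : I -> V -> R) :
  (forall i, trig (f i)) -> trig (fun y => \sum_(i <- s) f i y).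
Proof.
move=> h; elim: s => [|i s IH].
  by under eq_fun do rewrite big_nil; exact: trig_cst.
by under eq_fun do rewrite big_cons; exact: trigD.
Qed.

Lemma linf_freqD k1 k2 y : linf (freq (fun i => k1 i + k2 i)) y = linf (freq k1) y + linf (freq k2) y.
Proof.
rewrite /linf -big_split/=; apply: eq_bigr => i _.
by rewrite /freq intrD mulrDl mulrDl.
Qed.

Lemma linf_freqB k1 k2 y : linf (freq (fun i => k1 i - k2 i)) y = linf (freq k1) y - linf (freq k2) y.
Proof.
rewrite /linf -sumrB/=; apply: eq_bigr => i _.
by rewrite /freq intrB mulrBl mulrBl.
Qed.

Lemma trigM p q : trig p -> trig q -> trig (fun y => p y * q y).
Proof.
move=> tp tq; elim: tp => [k th|p1 p2 _ h1 _ h2|c p1 _ h1].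
- elim: tq => [k2 th2|q1 q2 _ h1 _ h2|c q1 _ h1].
  + have := trigZ (1 / 2) (trigD (trig_cos (fun i => k i + k2 i) (th + th2))
      (trig_cos (fun i => k i - k2 i) (th - th2))).
    congr trig; apply/funext => y; rewrite linf_freqD linf_freqB.
    rewrite (_ : _ + _ + (th + th2) = (linf (freq k) y + th) + (linf (freq k2) y + th2)); last by ring.
    rewrite (_ : _ - _ + (th - th2) = (linf (freq k) y + th) - (linf (freq k2) y + th2)); last by ring.
    by rewrite cosD cosB; field.
  + by under eq_fun do rewrite mulrDr; exact: trigD.
  + by under eq_fun do rewrite mulrCA; exact: trigZ.
- by under eq_fun do rewrite mulrDl; exact: trigD.
- by under eq_fun do rewrite -mulrA; exact: trigZ.
Qed.

Lemma trig_prod (I : Type) (s : seq I) (f : I -> V -> R) :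
  (forall i, trig (f i)) -> trig (fun y => \prod_(i <- s) f i y).
Proof.
move=> h; elim: s => [|i s IH].
  by under eq_fun do rewrite big_nil; exact: trig_cst.
by under eq_fun do rewrite big_cons; exact: trigM.
Qed.

Lemma linf_add c (y v : V) : linf c (y + v) = linf c y + linf c v.
Proof. by rewrite /linf -big_split/=; apply: eq_bigr => i _; rewrite !mxE mulrDr. Qed.

Lemma trig_shift v p : trig p -> trig (fun y => p (y + v)).
Proof.
elim=> [k th|p1 p2 _ h1 _ h2|c p1 _ h1]; [|exact: trigD|exact: trigZ].
have := trig_cos k (linf (freq k) v + th); congr trig; apply/funext => y.
by rewrite linf_add addrA.
Qed.

(** A periodic measure of displacement. A function that is Lipschitz with respect to it is
    automatically periodic, and the squares of its terms are multiples of [1 - cos], whose Fejer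
    averages are explicit. *)
Definition osc (z : V) : R := \sum_i `|sin (z 0 i / (2 * P))|.

Lemma osc_ge0 z : 0 <= osc z. Proof. by apply: sumr_ge0. Qed.

Lemma trig_lip p : trig p -> exists2 L, 0 <= L & forall x z, `|p (x + z) - p x| <= L * osc z.
Proof.
elim=> [k th|p1 p2 _ [L1 l1 h1] _ [L2 l2 h2]|c p1 _ [L1 l1 h1]].
- exists (2 * \sum_i `|(k i)%:~R|); first by rewrite mulr_ge0// sumr_ge0.
  move=> x z; rewrite linf_add addrAC (le_trans (cos_diff_le _ _))// -mulrA ler_wpM2l//.
  rewrite /linf mulr_suml (le_trans (norm_sin_sum _ _))// mulr_suml; apply: ler_sum => i _.
  rewrite (_ : freq k i * z 0 i / 2 = (k i)%:~R * (z 0 i / (2 * P))); last first.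
    by rewrite /freq; field; rewrite gt_eqF.
  rewrite (le_trans (norm_sin_intM _ _))// ler_wpM2l// /osc (bigD1 i)//= lerDl sumr_ge0//.
- exists (L1 + L2); first exact: addr_ge0.
  move=> x z; rewrite mulrDl.
  rewrite (_ : p1 (x + z) + p2 (x + z) - (p1 x + p2 x) = (p1 (x + z) - p1 x) + (p2 (x + z) - p2 x)); last by ring.
  by rewrite (le_trans (ler_normD _ _))// lerD.
- exists (`|c| * L1); first exact: mulr_ge0.
  by move=> x z; rewrite -mulrBr normrM -mulrA ler_wpM2l.
Qed.

Lemma bdd_trig p : trig p -> bdd p.
Proof.
by elim=> [k th|p1 p2 _ h1 _ h2|c p1 _ h1]; [exact: bdd_cos|exact: bddD|exact: bddZ].
Qed.

Section fractional.
Variable sigma : R.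
Hypothesis s02 : 0 < sigma < 2.
Hypothesis N0 : (0 < N)%N.

Lemma nice_trig p x : trig p -> nice p x.
Proof.
by elim=> [k th|p1 p2 _ h1 _ h2|c p1 _ h1]; [exact: nice_cos|exact: niceD|exact: niceZ].
Qed.

Lemma fracLap_trig_bdd p : trig p -> bdd (fracLap sigma p).
Proof.
elim=> [k th|p1 p2 t1 h1 t2 h2|c p1 t1 h1].
- rewrite (_ : fracLap _ _ = fun x => - (\sum_i freq k i ^+ 2) `^ (sigma / 2) * cos (linf (freq k) x + th)).
    by apply: bddZ; exact: bdd_cos.
  by apply/funext => x; rewrite fracLap_cos.
- rewrite (_ : fracLap _ _ = fun x => fracLap sigma p1 x + fracLap sigma p2 x); first exact: bddD.
  by apply/funext => x; rewrite fracLapD//; exact: nice_trig.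
- rewrite (_ : fracLap _ _ = fun x => c * fracLap sigma p1 x); first exact: bddZ.
  by apply/funext => x; rewrite fracLapZ//; exact: nice_trig.
Qed.

Lemma dfracLap_trig p : trig p -> forall e : R, 0 < e -> exists2 d, 0 < d &
  forall h, 0 < h < d -> forall x, `|dfracLap sigma h p x - fracLap sigma p x| <= e.
Proof.
elim=> [k th|p1 p2 t1 h1 t2 h2|c p1 t1 h1] e e0.
- have /cvgrPdist_le/(_ _ e0) := @dsymbol_pow_cvg R N sigma (freq k).
  move=> [d /= d0 hd]; exists d => // h /andP[h0 hhd] x.
  rewrite dfracLap_cos// fracLap_cos// !mulNr opprK addrC -mulrBl normrM.
  have := hd h; rewrite /= sub0r normrN gtr0_norm// => /(_ hhd h0) hh.
  by rewrite (le_trans _ hh)// ler_piMr// normr_cos_le1.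
- have e2 : 0 < e / 2 by rewrite divr_gt0.
  have [d1 d10 g1] := h1 _ e2; have [d2 d20 g2] := h2 _ e2.
  exists (Num.min d1 d2); first by rewrite lt_min d10.
  move=> h; rewrite lt_min => /and3P[h0 hd1 hd2] x.
  rewrite dfracLapD//; [|exact: bdd_trig|exact: bdd_trig].
  rewrite fracLapD//; [|exact: nice_trig|exact: nice_trig].
  have k1 : `|dfracLap sigma h p1 x - fracLap sigma p1 x| <= e / 2 by apply: g1; rewrite h0.
  have k2 : `|dfracLap sigma h p2 x - fracLap sigma p2 x| <= e / 2 by apply: g2; rewrite h0.
  rewrite opprD addrACA (splitr e).
  have tri (a b c1 c2 : R) : `|a| <= c1 -> `|b| <= c2 -> `|a + b| <= c1 + c2.
    by move=> h3 h4; rewrite (le_trans (ler_normD _ _))// lerD.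
  exact: tri k1 k2.
- have c0 : 0 < `|c| + 1 by rewrite ltr_wpDl.
  have e2 : 0 < e / (`|c| + 1) by rewrite divr_gt0.
  have [d1 d10 g1] := h1 _ e2; exists d1 => // h hh x; have /andP[h0 _] := hh.
  rewrite dfracLapZ//; last exact: bdd_trig.
  rewrite fracLapZ//; last exact: nice_trig.
  rewrite -mulrBr normrM (le_trans (ler_wpM2l _ (g1 h hh x)))//.
  by rewrite mulrC mulrAC ler_pdivrMr// ler_wpM2l ?(ltW e0)// lerDl.
Qed.

End fractional.

End trig_polynomials.

(** * The Fejer kernel and its exact quadrature *)

Section fejer.
Context {R : realType}.
Implicit Types (n m l : nat) (s : R).

(** The double sum is the squared modulus of the sum of [exp (i a s)] for [a <= n], whence
    positivity. *)
Definition fejer n s : R :=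
  (n.+1%:R)^-1 * \sum_(a < n.+1) \sum_(b < n.+1) cos ((a%:R - b%:R) * s).

Lemma fejer_ge0 n s : 0 <= fejer n s.
Proof.
rewrite mulr_ge0 ?invr_ge0//.
rewrite (_ : \sum_(a < n.+1) _ = (\sum_(a < n.+1) cos (a%:R * s)) ^+ 2 + (\sum_(a < n.+1) sin (a%:R * s)) ^+ 2).
  by rewrite addr_ge0 ?sqr_ge0.
rewrite !expr2 !mulr_suml -big_split/=; apply: eq_bigr => a _.
rewrite !mulr_sumr -big_split/=; apply: eq_bigr => b _.
by rewrite mulrBl cosB.
Qed.

(* Telescoping: 2 sin (a/2) cos (s - l a) is a difference of consecutive sines. *)
Lemma sum_cos_arith m (s a : R) : sin (a / 2) != 0 -> sin (s + a / 2) = sin (s + a / 2 - m%:R * a) ->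
  \sum_(l < m) cos (s - l%:R * a) = 0.
Proof.
move=> a0 per; apply: (mulfI a0); rewrite mulr0.
apply: (@mulfI _ 2); first by rewrite pnatr_eq0.
rewrite mulr0 mulr_sumr mulr_sumr.
transitivity (\sum_(l < m) (sin (s + a / 2 - l%:R * a) - sin (s + a / 2 - l.+1%:R * a))).
  apply: eq_bigr => l _.
  rewrite (_ : s + a / 2 - l%:R * a = (s - l%:R * a) + a / 2); last by ring.
  rewrite (_ : s + a / 2 - l.+1%:R * a = (s - l%:R * a) - a / 2); last by rewrite -nat1r; field.
  by move: (s - _) (a / 2) => A B; rewrite sinD sinB; ring.
transitivity (sin (s + a / 2 - 0%:R * a) - sin (s + a / 2 - m%:R * a)).
  elim: m {per} => [|m IH]; first by rewrite big_ord0 subrr.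
  by rewrite big_ord_recr/= IH addrA subrK.
by rewrite mul0r subr0 -per subrr.
Qed.

Lemma sin_periodic_int (k : int) s : sin (s + k%:~R * (2 * pi)) = sin s.
Proof.
have h n t : sin (t + n%:R * (2 * pi)) = sin t :> R.
  elim: n => [|n IH]; first by rewrite mul0r addr0.
  rewrite -nat1r mulrDl mul1r (_ : t + _ = (t + n%:R * (2 * pi)) + pi *+ 2); last first.
    by rewrite mulr2n; ring.
  by rewrite sinD2pi.
case: (intP k) => [|n|n]; first by rewrite mul0r addr0.
  by rewrite -pmulrn h.
rewrite mulrNz -pmulrn mulNr; have := h n.+1 (s - n.+1%:R * (2 * pi)).
by rewrite subrK.
Qed.

Lemma sum_cos_grid m (k : int) s : k != 0 -> (`|k| < m)%N ->
  \sum_(l < m) cos (k%:~R * (s - 2 * pi / m%:R * l%:R)) = 0.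
Proof.
move=> k0 km; have m0 : m%:R != 0 :> R by rewrite pnatr_eq0 -lt0n (leq_trans _ km).
pose a : R := k%:~R * (2 * pi / m%:R).
transitivity (\sum_(l < m) cos (k%:~R * s - l%:R * a)).
  by apply: eq_bigr => l _; congr cos; rewrite /a; ring.
apply: sum_cos_arith.
- have e : a / 2 = k%:~R * (pi / m%:R) by rewrite /a; field.
  have s0 : 0 < sin (`|k|%N%:R * (pi / m%:R)) :> R.
    have mp : 0 < m%:R :> R by rewrite ltr0n (leq_trans _ km).
    apply: sin_gt0_pi; apply/andP; split.
      by rewrite mulr_gt0 ?divr_gt0 ?pi_gt0// ltr0n absz_gt0.
    rewrite mulrCA -[ltRHS]mulr1 ltr_pM2l ?pi_gt0// ltr_pdivrMr// mul1r ltr_nat//.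
  have [ek|ek] : k = Posz `|k| \/ k = - Posz `|k| by lia.
    by rewrite e ek -pmulrn gt_eqF.
  by rewrite e ek mulrNz -pmulrn mulNr sinN oppr_eq0 gt_eqF.
- rewrite -[LHS](sin_periodic_int (- k)); congr sin; rewrite /a mulrNz; by field.
Qed.

Definition grid_pt m l : R := 2 * pi / m%:R * l%:R.

Lemma sum_cos_grid_id m (a b : nat) (A s : R) : (0 < m)%N -> (a < m)%N -> (b < m)%N ->
  (m%:R)^-1 * \sum_(l < m) cos ((a%:R - b%:R) * (s - grid_pt m l)) = (a == b)%:R.
Proof.
move=> m0 am bm; have mR : m%:R != 0 :> R by rewrite pnatr_eq0 -lt0n.
have [->|ab] := eqVneq a b.
  under eq_bigr do rewrite subrr mul0r cos0.
  by rewrite sumr_const card_ord mulVf.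
rewrite (_ : \sum_(l < m) _ = 0) ?mulr0//.
have := @sum_cos_grid m (Posz a - Posz b) s; rewrite intrB -!pmulrn; apply; lia.
Qed.

(** Quadrature on [m] points is exact here: the frequencies [a - b] have modulus at most [n < m], so
    none but 0 is aliased to 0. *)
Lemma avg_fejer n m s : (n < m)%N -> (m%:R)^-1 * \sum_(l < m) fejer n (s - grid_pt m l) = 1.
Proof.
move=> nm; have m0 : (0 < m)%N by exact: leq_trans nm.
rewrite /fejer -mulr_sumr mulrCA.
rewrite exchange_big/= mulr_sumr.
rewrite (_ : \sum_(a < n.+1) _ = n.+1%:R); first by rewrite mulVf// pnatr_eq0.
rewrite -[n.+1 in RHS]card_ord -sumr_const; apply: eq_bigr => a _.
rewrite exchange_big/= mulr_sumr (bigD1 a)//= (sum_cos_grid_id 0)// ?eqxx ?(leq_trans (ltn_ord a))//.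
rewrite big1 ?addr0// => b ba; rewrite (sum_cos_grid_id 0) ?(leq_trans (ltn_ord _))//.
by rewrite eq_sym (negPf ba : (b == a :> nat) = false).
Qed.

(* Multiplication by cos shifts the frequency by one; among the pairs (a,b) with
   a, b <= n exactly n have a - b = 1. *)
Lemma avg_fejer_cos n m s : (n.+1 < m)%N ->
  (m%:R)^-1 * \sum_(l < m) fejer n (s - grid_pt m l) * (1 - cos (s - grid_pt m l)) = (n.+1%:R)^-1.
Proof.
move=> nm; have m0 : (0 < m)%N by exact: leq_trans nm.
have nm' : (n < m)%N by exact: ltnW.
under eq_bigr do rewrite mulrBr mulr1.
rewrite sumrB mulrBr avg_fejer//.
rewrite (_ : _ * _ = (n.+1%:R)^-1 * n%:R); last first.
  rewrite /fejer; under eq_bigr do rewrite -mulrA mulr_suml.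
  rewrite -mulr_sumr mulrCA; congr (_ * _).
  rewrite exchange_big/= mulr_sumr.
  transitivity (\sum_(a < n.+1) \sum_(b < n.+1) (1 / 2 * ((a.+1 == b :> nat)%:R + (a == b.+1 :> nat)%:R)) : R).
    apply: eq_bigr => a _.
    under eq_bigr do rewrite mulr_suml.
    rewrite exchange_big/= mulr_sumr; apply: eq_bigr => b _.
    have am := leq_trans (ltn_ord a) nm'; have bm := leq_trans (ltn_ord b) nm'.
    rewrite -(sum_cos_grid_id 0 s m0 (leq_ltn_trans (ltn_ord a) nm) bm).
    rewrite -(sum_cos_grid_id 0 s m0 am (leq_ltn_trans (ltn_ord b) nm)).
    rewrite -mulrDr -big_split/= [RHS]mulrCA; congr (_ * _); rewrite mulr_sumr; apply: eq_bigr => l _.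
    move: (s - _) => t; rewrite (_ : (a.+1%:R - b%:R) * t = (a%:R - b%:R) * t + t); last by rewrite -nat1r; ring.
    rewrite (_ : (a%:R - b.+1%:R) * t = (a%:R - b%:R) * t - t); last by rewrite -nat1r; ring.
    by rewrite cosD cosB; field.
  have c1 : \sum_(a < n.+1) \sum_(b < n.+1) ((a.+1 == b :> nat)%:R : R) = n%:R.
    rewrite big_ord_recr/= [X in _ + X]big1 ?addr0; last first.
      by move=> b _; rewrite gtn_eqF.
    rewrite -[n in RHS]card_ord -sumr_const; apply: eq_bigr => a _.
    rewrite (bigD1 (lift ord0 a))//= eqxx big1 ?addr0// => b ba.
    by rewrite (_ : _ == _ = false)//; apply: contraNF ba => /eqP e; apply/eqP/val_inj; rewrite /= -e.
  under eq_bigr do rewrite -mulr_sumr big_split/=.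
  rewrite -mulr_sumr big_split/= c1 exchange_big/=.
  under [X in _ + X]eq_bigr do under eq_bigr do rewrite eq_sym.
  by rewrite c1; field.
by rewrite -[n.+1%:R]nat1r; field; rewrite nat1r pnatr_eq0.
Qed.

End fejer.

(** * Fejer averages of grid functions *)

Section mollification.
Context {R : realType} {N : nat}.
Variables (P : R) (n m : nat).
Hypothesis P0 : 0 < P.
Hypothesis nm : (n.+1 < m)%N.
Local Notation V := 'rV[R]_N.
Local Notation grid := {ffun 'I_N -> 'I_m}.
Implicit Types (x y z : V) (g : grid -> R) (l : grid) (w : V -> R).

Let m0 : (0 < m)%N. Proof. exact: leq_trans nm. Qed.
Let mR : m%:R != 0 :> R. Proof. by rewrite pnatr_eq0 -lt0n. Qed.

(** The shift by [pi * P] centres the period cell at the origin, so that it contains the box on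
    which approximation is wanted. *)
Definition node l : V := \row_i (P * grid_pt m (l i) - pi * P).

Definition fejN z : R := \prod_i fejer n (z 0 i / P).

Lemma trig_fejN : trig P fejN.
Proof.
apply: trig_prod => i; rewrite /fejer; apply: trigZ; apply: trig_sum => a; apply: trig_sum => b.
have := trig_cos P (fun j : 'I_N => if j == i then Posz a - Posz b else 0) 0.
congr trig; apply/funext => y; rewrite addr0 /linf (bigD1 i)//= big1 ?addr0.
  by congr cos; rewrite /freq eqxx intrB -!pmulrn; ring.
by move=> j /negPf ji; rewrite /freq ji mul0r mul0r.
Qed.

Lemma fejN_ge0 z : 0 <= fejN z.
Proof. by apply: prodr_ge0 => i _; exact: fejer_ge0. Qed.

Definition gcell : R := (m%:R ^+ N)^-1.

Lemma gcell_ge0 : 0 <= gcell. Proof. by rewrite invr_ge0 exprn_ge0. Qed.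

(** The Fejer mean with its integral replaced by quadrature: a trigonometric polynomial in [x] and,
    by positivity and [avg_cst], a weighted mean of the values of [g]. *)
Definition avg g x : R := gcell * \sum_(l : grid) fejN (x - node l) * g l.

Lemma node_arg x l i : (x - node l) 0 i / P = (x 0 i / P + pi) - grid_pt m (l i).
Proof. by rewrite !mxE; field; rewrite gt_eqF. Qed.

Lemma avg_cst (c : R) x : avg (fun=> c) x = c.
Proof.
rewrite /avg -mulr_suml mulrA (_ : gcell * _ = 1) ?mul1r//.
rewrite /fejN; under eq_bigr do under eq_bigr do rewrite node_arg.
rewrite -(bigA_distr_bigA (fun i (a : 'I_m) => fejer n (x 0 i / P + pi - grid_pt m a))).
rewrite /gcell -[in m%:R ^+ N](card_ord N) -prodr_const -prodfV -big_split/= big1// => i _.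
by rewrite avg_fejer// ltnW.
Qed.

(** A periodic substitute for the squared distance to the node; its mean is exactly
    [N / (n + 1)]. *)
Definition far (x : V) l : R := \sum_j (1 - cos ((x - node l) 0 j / P)).

Lemma far_ge0 x l : 0 <= far x l.
Proof. by apply: sumr_ge0 => j _; rewrite subr_ge0 cos_le1. Qed.

Lemma avg_far x : avg (far x) x = N%:R / n.+1%:R.
Proof.
rewrite /avg /far; under eq_bigr do rewrite mulr_sumr.
rewrite exchange_big/= mulr_sumr -[in RHS](card_ord N) mulr_natl -sumr_const.
apply: eq_bigr => j _.
pose G (i : 'I_N) (a : 'I_m) := fejer n (x 0 i / P + pi - grid_pt m a) *
  (if i == j then 1 - cos (x 0 i / P + pi - grid_pt m a) else 1).
transitivity (gcell * \sum_(l : grid) \prod_i G i (l i)).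
  congr (_ * _); apply: eq_bigr => l _; rewrite /G big_split/=; congr (_ * _).
    by apply: eq_bigr => i _; rewrite node_arg.
  by rewrite (bigD1 j)//= eqxx big1 ?mulr1 ?node_arg// => i /negPf ->.
rewrite -(bigA_distr_bigA G) /gcell -[in m%:R ^+ N](card_ord N) -prodr_const -prodfV -big_split/=.
rewrite (bigD1 j)//= [X in _ * X]big1 ?mulr1.
  rewrite -[RHS](avg_fejer_cos (x 0 j / P + pi) nm); congr (_ * _).
  by apply: eq_bigr => a _; rewrite /G eqxx.
move=> i /negPf ij; rewrite /G ij; under eq_bigr do rewrite mulr1.
by rewrite avg_fejer// ltnW.
Qed.

Lemma avgD g1 g2 x : avg (fun l => g1 l + g2 l) x = avg g1 x + avg g2 x.
Proof.
rewrite /avg -mulrDr -big_split/=; congr (_ * _).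
by apply: eq_bigr => l _; rewrite mulrDr.
Qed.

Lemma avgZ (c : R) g x : avg (fun l => c * g l) x = c * avg g x.
Proof.
rewrite /avg mulrCA; congr (_ * _); rewrite mulr_sumr.
by apply: eq_bigr => l _; rewrite mulrCA.
Qed.

Lemma avg_le g1 g2 x : (forall l, g1 l <= g2 l) -> avg g1 x <= avg g2 x.
Proof.
move=> h; rewrite ler_wpM2l ?gcell_ge0//; apply: ler_sum => l _.
by rewrite ler_wpM2l ?fejN_ge0.
Qed.

Lemma norm_avg_le g (B : R) x : (forall l, `|g l| <= B) -> `|avg g x| <= B.
Proof.
move=> h; rewrite ler_norml -{1}(avg_cst (- B) x) -{2}(avg_cst B x).
by apply/andP; split; apply: avg_le => l; have := h l; rewrite ler_norml => /andP[].
Qed.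

(** A quantitative approximate identity in the manner of Chebyshev: distant nodes are paid for by
    [far], whose mean tends to 0 with the degree, whatever the number of nodes. *)
Lemma avg_approx g (c d K : R) x :
  (forall l, `|g l - c| <= d + K * far x l) -> `|avg g x - c| <= d + K * (N%:R / n.+1%:R).
Proof.
move=> h; have e : d + K * (N%:R / n.+1%:R) = avg (fun l => d + K * far x l) x.
  by rewrite avgD avg_cst avgZ avg_far.
have -> : avg g x - c = avg (fun l => g l - c) x by rewrite avgD avg_cst.
rewrite e ler_norml; apply/andP; split.
  rewrite -mulN1r -avgZ; apply: avg_le => l; rewrite mulN1r.
  by have := h l; rewrite ler_norml => /andP[].
by apply: avg_le => l; have := h l; rewrite ler_norml => /andP[].
Qed.

Lemma trig_avg g : trig P (avg g).
Proof.
apply: trigZ; apply: trig_sum => l.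
have := trigZ (g l) (trig_shift (- node l) trig_fejN).
by congr trig; apply/funext => y; rewrite mulrC.
Qed.

Definition mesh : R := 2 * pi * P / m%:R.

Lemma mesh_gt0 : 0 < mesh.
Proof. by rewrite divr_gt0 ?ltr0n// !mulr_gt0// pi_gt0. Qed.

Definition coord_periodic w := forall k y, w (y + (2 * pi * P) *: delta_mx 0 k) = w y.

Lemma osc_period (k : 'I_N) : osc P ((2 * pi * P) *: delta_mx 0 k) = 0.
Proof.
rewrite /osc big1// => i _; rewrite !mxE eqxx/=; case: (i == k).
  by rewrite mulr1 (_ : _ / _ = pi) ?sinpi ?normr0//; field; rewrite gt_eqF.
by rewrite mulr0 mul0r sin0 normr0.
Qed.

Lemma lip_periodic w (L : R) : (forall x z, `|w (x + z) - w x| <= L * osc P z) -> coord_periodic w.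
Proof.
move=> h k y; apply/eqP; rewrite -subr_eq0 -normr_le0.
by rewrite (le_trans (h _ _))// osc_period mulr0.
Qed.

Lemma periodic_fejN : coord_periodic fejN.
Proof. by have [L _ h] := trig_lip P0 trig_fejN; exact: lip_periodic h. Qed.

Definition node_shift (k : 'I_N) l : grid := [ffun i => if i == k then ordS (l i) else l i].

Lemma node_shift_inj k : injective (node_shift k).
Proof.
move=> f g /ffunP e; apply/ffunP => i; have := e i; rewrite !ffunE.
by case: ifP => // _; exact: ordS_inj.
Qed.

(** In the second case the index wraps around and the node jumps back by one period, which periodic
    functions do not notice. *)
Lemma node_shiftE k l : node (node_shift k l) = node l + mesh *: delta_mx 0 k \/
  node (node_shift k l) + (2 * pi * P) *: delta_mx 0 k = node l + mesh *: delta_mx 0 k.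
Proof.
have [e|e] : ((l k).+1 %% m = (l k).+1)%N \/ ((l k).+1 = m /\ (l k).+1 %% m = 0)%N.
  have := ltn_ord (l k); rewrite leq_eqVlt => /orP[/eqP e|lt].
    by right; rewrite e modnn.
  by left; rewrite modn_small.
- left; apply/rowP => i; rewrite !mxE ffunE eqxx/=; case: eqP => [->|_]; last by rewrite mulr0 addr0.
  by rewrite /= e /grid_pt /mesh -nat1r; field.
- right; apply/rowP => i; rewrite !mxE ffunE eqxx/=; case: eqP => [->|_]; last by rewrite !mulr0 !addr0.
  case: e => e1 e2; rewrite /= e2 /grid_pt /mesh.
  have e3 : (l k)%:R = m%:R - 1 :> R.
    by have := congr1 (fun a : nat => a%:R : R) e1; rewrite -nat1r => <-; rewrite addrAC subrr add0r.
  by rewrite e3; field.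
Qed.

Lemma avg_shift w k x : coord_periodic w ->
  avg (fun l => w (node l + mesh *: delta_mx 0 k)) x = avg (fun l => w (node l)) (x + mesh *: delta_mx 0 k).
Proof.
move=> pw; rewrite /avg; congr (_ * _).
rewrite [RHS](reindex_inj (@node_shift_inj k)); apply: eq_bigr => l _.
have [->|e] := node_shiftE k l.
  by congr (fejN _ * _); rewrite opprD addrACA subrr addr0.
rewrite -e pw; congr (_ * _).
rewrite -[LHS](periodic_fejN k) -[in RHS](addrK ((2 * pi * P) *: delta_mx 0 k) (node (node_shift k l))) e.
by congr fejN; apply/rowP => i; rewrite !mxE; ring.
Qed.

Lemma avg_shiftN w k x : coord_periodic w ->
  avg (fun l => w (node l - mesh *: delta_mx 0 k)) x = avg (fun l => w (node l)) (x - mesh *: delta_mx 0 k).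
Proof.
move=> pw; have pw' : coord_periodic (fun y => w (y - mesh *: delta_mx 0 k)).
  by move=> j y; rewrite addrAC pw.
have := avg_shift k (x - mesh *: delta_mx 0 k) pw'; rewrite subrK => <-.
by congr avg; apply/funext => l; rewrite addrK.
Qed.

Lemma avg_sum (I : Type) (s : seq I) (g : I -> grid -> R) x :
  avg (fun l => \sum_(i <- s) g i l) x = \sum_(i <- s) avg (g i) x.
Proof.
elim: s => [|i s IH].
  by rewrite big_nil -[RHS](avg_cst 0 x); congr avg; apply/funext => l; rewrite big_nil.
by rewrite big_cons -IH -avgD; congr avg; apply/funext => l; rewrite big_cons.
Qed.

Lemma dLap_avg w x : coord_periodic w ->
  dLap mesh (avg (fun l => w (node l))) x = avg (fun l => dLap mesh w (node l)) x.
Proof.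
move=> pw; rewrite /dLap avg_sum; apply: eq_bigr => k _.
rewrite -avg_shift// -avg_shiftN// mulrC -mulNr -avgZ -!avgD -avgZ.
by congr avg; apply/funext => l; ring.
Qed.

Lemma heat_periodic w t : bdd w -> coord_periodic w -> 0 <= t -> coord_periodic (heat mesh t w).
Proof.
move=> b pw t0 k y; rewrite -heat_shift//; last exact: mesh_gt0.
by congr heat; apply/funext => z; rewrite pw.
Qed.

(** Averages commute with translations by the mesh, hence with [dLap mesh]. The averaged flow is
    therefore a bounded solution with averaged data, and uniqueness identifies it. *)
Lemma heat_avg w t x : bdd w -> coord_periodic w -> 0 <= t ->
  heat mesh t (avg (fun l => w (node l))) x = avg (fun l => heat mesh t w (node l)) x.
Proof.
move=> b pw t0; have h0 := mesh_gt0.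
have [/bounded_onP[B hB] e c d] := heatP h0 b.
rewrite (@heat_uniq _ _ _ h0 _ (fun t y => avg (fun l => heat mesh t w (node l)) y))//; split.
- apply/bounded_onP; exists B => -[s y]/= s0; apply: norm_avg_le => l; exact: (hB (s, node l) s0).
- by rewrite e.
- move=> y; rewrite /avg => s; apply: cvgM; first exact: cvg_cst.
  apply: cvg_big => [|l _]; first by apply: add_continuous.
  by apply: cvgM; [exact: cvg_cst|exact: c].
- move=> s y s0; rewrite dLap_avg; last exact: heat_periodic (ltW s0).
  apply: is_deriveZ.
  pose f l (s : R) := fejN (y - node l) * heat mesh s w (node l).
  have df l : is_derive s 1 (f l) (fejN (y - node l) * dLap mesh (heat mesh s w) (node l)).
    by apply: is_deriveZ; exact: d.
  elim: (index_enum grid) => [|l r IH].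
    under eq_fun do rewrite big_nil; rewrite big_nil; exact: is_derive_cst.
  under eq_fun do rewrite big_cons; rewrite big_cons; apply: is_deriveD => //; exact: df.
Qed.

Section fractional_avg.
Variable sigma : R.
Hypothesis s02 : 0 < sigma < 2.
Hypothesis N0 : (0 < N)%N.

Lemma dfracLap_avg w x : bdd w -> coord_periodic w ->
  dfracLap sigma mesh (avg (fun l => w (node l))) x = avg (fun l => dfracLap sigma mesh w (node l)) x.
Proof.
move=> b pw; have h0 := mesh_gt0.
rewrite /dfracLap avgZ; congr (_ * _).
pose f l (t : R) := (heat mesh t w (node l) - w (node l)) / t `^ (1 + sigma / 2).
pose g l (t : R) := gcell * fejN (x - node l) * f l t.
have fi l : (@lebesgue_measure R).-integrable `]0, +oo[ (EFin \o f l) by exact: integrable_dfracLap.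
have gi l : (@lebesgue_measure R).-integrable `]0, +oo[ (EFin \o g l).
  have : (@lebesgue_measure R).-integrable `]0, +oo[
      (fun t => ((gcell * fejN (x - node l))%:E * (f l t)%:E)%E).
    by apply: integrableZl => //; exact: fi.
  by apply: eq_integrable => // t _; rewrite /g /= EFinM.
have [_ e] := Rintegral_box (index_enum grid) gi.
transitivity (\int[lebesgue_measure]_(t in `]0%R, +oo[) (\sum_l g l t)).
  apply: eq_Rintegral => t; rewrite inE/= in_itv/= andbT => t0.
  rewrite heat_avg ?(ltW t0)// /avg /g /f -mulrBr -sumrB mulrAC -mulrA mulr_sumr.
  rewrite mulr_sumr; apply: eq_bigr => l _; ring.
rewrite e /avg mulr_sumr; apply: eq_bigr => l _.
by rewrite /g RintegralZl// mulrA.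
Qed.

Lemma fracLap_shift (phi : V -> R) v x :
  fracLap sigma (fun y => phi (y + v)) x = fracLap sigma phi (x + v).
Proof.
rewrite /fracLap; apply: (congr1 (fun f : R -> R => lim (f @ 0^'+))); apply/funext => r; apply: eq_Rintegral => z _.
by rewrite addrAC.
Qed.

Lemma dfracLap_sum h (I : Type) (s : seq I) (f : I -> V -> R) x : 0 < h ->
  (forall i, bdd (f i)) ->
  dfracLap sigma h (fun y => \sum_(i <- s) f i y) x = \sum_(i <- s) dfracLap sigma h (f i) x.
Proof.
move=> h0 bf; suff [] : bdd (fun y => \sum_(i <- s) f i y) /\
  dfracLap sigma h (fun y => \sum_(i <- s) f i y) x = \sum_(i <- s) dfracLap sigma h (f i) x by [].
elim: s => [|i s [b IH]].
  under eq_fun do rewrite big_nil; split; first by exists 0 => y; rewrite normr0.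
  by rewrite big_nil dfracLap_cst.
under eq_fun do rewrite big_cons; split; first exact: bddD.
by rewrite big_cons dfracLapD// IH.
Qed.

Lemma fracLap_sum (I : Type) (s : seq I) (f : I -> V -> R) x :
  (forall i, nice (f i) x) ->
  fracLap sigma (fun y => \sum_(i <- s) f i y) x = \sum_(i <- s) fracLap sigma (f i) x.
Proof.
move=> nf; elim: s => [|i s IH].
  by under eq_fun do rewrite big_nil; rewrite big_nil fracLap_cst.
under eq_fun do rewrite big_cons.
by rewrite big_cons fracLapD// ?IH//; exact: nice_sum.
Qed.

(** The error on the single kernel [fejN], which depends on [P] and [n] but not on the grid,
    controls that of all averages. The degree can thus be fixed before the grid. *)
Lemma avg_consistent g (B e h : R) x : 0 < h -> 0 <= e -> (forall l, `|g l| <= B) ->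
  (forall y, `|dfracLap sigma h fejN y - fracLap sigma fejN y| <= e) ->
  `|dfracLap sigma h (avg g) x - fracLap sigma (avg g) x| <= B * e.
Proof.
move=> h0 e0 hB he.
have tl l : trig P (fun y => fejN (y - node l)) by exact: trig_shift trig_fejN.
have ea : avg g = fun y => gcell * \sum_l (g l * fejN (y - node l)).
  by apply/funext => y; rewrite /avg; congr (_ * _); apply: eq_bigr => l _; rewrite mulrC.
have tg l : trig P (fun y => g l * fejN (y - node l)) by exact: trigZ.
have ts : trig P (fun y => \sum_l g l * fejN (y - node l)) by exact: trig_sum.
rewrite ea dfracLapZ//; last exact: bdd_trig ts.
rewrite fracLapZ//; last exact: nice_trig ts.
rewrite dfracLap_sum//; last by move=> l; exact: bdd_trig (tg l).
rewrite fracLap_sum//; last by move=> l; exact: nice_trig (tg l).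
rewrite -mulrBr -sumrB normrM ger0_norm ?gcell_ge0//.
have -> : B * e = gcell * \sum_(l : grid) (B * e).
  rewrite sumr_const card_ffun !card_ord -[in RHS]mulr_natl natrX mulrA mulVf ?mul1r//.
  by rewrite expf_neq0.
rewrite ler_wpM2l ?gcell_ge0// (le_trans (ler_norm_sum _ _ _))//; apply: ler_sum => l _.
rewrite dfracLapZ//; last exact: bdd_trig (tl l).
rewrite fracLapZ//; last exact: nice_trig (tl l).
rewrite dfracLap_shift//; last exact: bdd_trig trig_fejN.
rewrite fracLap_shift -mulrBr normrM; exact: ler_pM.
Qed.

End fractional_avg.
End mollification.

Lemma compact_unif_cont (R : realType) (W : pseudoMetricType R) (K : set W) (f : W -> R) :
  compact K -> {within K, continuous f} -> forall e, 0 < e ->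
  exists2 r, 0 < r & forall x y, K x -> K y -> ball x r y -> `|f x - f y| <= e.
Proof.
move=> cK /subspace_continuousP cf e e0.
have e2 : 0 < e / 2 by rewrite divr_gt0.
have := (compact_near_coveringP K).1 cK R (0^'+)
  (fun r x => K x -> forall y, K y -> ball x r y -> `|f x - f y| <= e) _.
case.
  move=> x Kx.
  have /cvgrPdist_le/(_ _ e2) := cf x Kx.
  rewrite near_withinE => /nbhs_ballP[r /= r0 hr].
  have r2 : 0 < r / 2 by rewrite divr_gt0.
  exists (ball x (r / 2), [set s | 0 < s < r / 2]) => /=.
    split; first exact: nbhsx_ballx.
    near=> s; apply/andP; split; near: s; [exact: nbhs_right_gt|exact: nbhs_right_lt].
  move=> [z s]/= [bz /andP[s0 sr]] Kz y Ky by_.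
  have h1 := hr z (le_ball _ bz) Kz.
  have h2 : `|f x - f y| <= e / 2.
    apply: hr => //; rewrite [r]splitr; apply: ball_triangle bz _.
    exact: le_ball (ltW sr) _ by_.
  have {}h1 : `|f x - f z| <= e / 2 by apply: h1; rewrite ler_pdivrMr// ler_peMr// ?(ltW r0)// ler1n.
  rewrite (_ : f z - f y = (f x - f y) - (f x - f z)); last by ring.
  by rewrite (le_trans (ler_normB _ _))// (splitr e) lerD.
move=> r /= r0 hr; exists (r / 2); first by rewrite divr_gt0.
move=> x y Kx Ky bxy; apply: (hr (r / 2)) => //=; last by rewrite divr_gt0.
by rewrite sub0r normrN gtr0_norm ?divr_gt0// ltr_pdivrMr// ltr_pMr// ltr1n.
Unshelve. all: by end_near. Qed.

Definition box {R : realType} {N : nat} (r : R) : set 'rV[R]_N := [set x | forall i, `|x 0 i| <= r].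

Lemma compact_box (R : realType) (N : nat) (r : R) : compact (box r : set 'rV[R]_N).
Proof.
have := @rV_compact R N (fun=> `[- r, r]%classic) (fun=> @segment_compact _ _ _).
congr compact; apply/seteqP; split => x /= h i; have := h i; rewrite /= in_itv/= ler_norml//.
Qed.

(** A point of the box and a node differ by at most [P + pi P] in each coordinate, that is by
    [pi + 1] after division by [P]. This is below [2 pi], so that the cosine does not come back to
    1. *)
Lemma cos_lt1_bound (R : realType) (a : R) : 0 < a ->
  exists2 c, 0 < c & forall s, a <= `|s| <= pi + 1 -> c <= 1 - cos s.
Proof.
move=> a0; have [ap|pa] := leP a (pi + 1); last first.
  exists 1 => // s /andP[h1 h2]; exfalso; have := le_trans h1 h2.
  by rewrite leNgt pa.
have cf : {within `[a, pi + 1], continuous (fun s : R => 1 - cos s)}.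
  apply: continuous_subspaceT => s; apply: cvgB; first exact: cvg_cst.
  exact: continuous_cos.
have [c cI hc] := EVT_min ap cf.
exists (1 - cos c); last first.
  move=> s hs; have -> : cos s = cos `|s|.
    by case: (ger0P s) => _ //; rewrite cosN.
  by apply: hc; rewrite in_itv.
rewrite sin_half_sqr mulr_gt0// exprn_gt0//; apply: sin_gt0_pi.
move: cI; rewrite in_itv/= => /andP[c1 c2].
have p2 := @pi_ge2 R.
by apply/andP; split; [rewrite divr_gt0// (lt_le_trans a0 c1)|rewrite ltr_pdivrMr//; lra].
Qed.

Lemma archi_nat (R : realType) (a b : R) : 0 < b -> exists n : nat, a <= b * n.+1%:R.
Proof.
move=> b0; have h := archi_boundP (normr_ge0 (a / b)); exists (Num.bound `|a / b|).
rewrite mulrC -ler_pdivrMr// (le_trans (ler_norm _))// (le_trans (ltW h))// ler_nat//.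
Qed.

(** The bound [B] is kept because averages are weighted means. Closeness holds on the box only,
    since [phi] has no period. *)
Lemma trig_approx (R : realType) (N : nat) (P B : R) (phi : 'rV[R]_N -> R) : 1 <= P ->
  continuous phi -> (forall x, `|phi x| <= B) -> forall e : R, 0 < e ->
  exists p, [/\ trig P p, forall x, `|p x| <= B & forall x, box P x -> `|p x - phi x| <= e].
Proof.
move=> P1 cphi hB e e0; have P0 : 0 < P by exact: lt_le_trans P1.
have B0 : 0 <= B := le_trans (normr_ge0 _) (hB 0).
have e2 : 0 < e / 2 by rewrite divr_gt0.
have cw : {within (box (pi * P) : set 'rV[R]_N), continuous phi} by exact: continuous_subspaceT.
have [r r0 hr] := compact_unif_cont (@compact_box R N (pi * P)) cw e2.
have [c c0 hc] := @cos_lt1_bound R (r / P) (divr_gt0 r0 P0).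
have K0 : 0 <= 2 * B / c by rewrite divr_ge0 ?mulr_ge0// ltW.
have [n hn] : exists n : nat, 2 * B / c * N%:R <= e / 2 * n.+1%:R.
  exact: archi_nat.
have nm : (n.+1 < n.+2)%N by [].
exists (avg P n (fun l : {ffun 'I_N -> 'I_n.+2} => phi (node P l))); split.
- exact: trig_avg.
- by move=> x; apply: norm_avg_le.
move=> x bx; apply: (le_trans (avg_approx P0 nm (d := e / 2) (K := 2 * B / c) _)); last first.
  by rewrite [leRHS]splitr lerD2l mulrA ler_pdivrMr.
move=> l; have pi1 : 1 <= pi :> R by have := @pi_ge2 R; lra.
have fx := far_ge0 P x l.
have nl i : `|node P l 0 i| <= pi * P.
  rewrite mxE ler_norml; have ln : (l i)%:R <= n.+2%:R :> R by rewrite ler_nat ltnW.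
  have ln0 : 0 <= grid_pt n.+2 (l i) :> R by rewrite mulr_ge0// divr_ge0// mulr_ge0// pi_ge0.
  have ln1 : grid_pt n.+2 (l i) <= 2 * pi :> R.
    by rewrite /grid_pt -mulrA ler_piMr ?mulr_ge0 ?pi_ge0// ler_pdivrMl// mulr1.
  have h1 := ler_wpM2l (ltW P0) ln1; have h2 := mulr_ge0 (ltW P0) ln0.
  by apply/andP; split; lra.
(* Nodes near [x] are handled by uniform continuity; for the others [far] is at least [c], and the
   trivial bound [2 B] is charged to it. *)
have [nr|] := pselect (forall i, `|(x - node P l) 0 i| < r).
  apply: (@le_trans _ _ (e / 2)).
    rewrite distrC; apply: hr.
    - by move=> i; apply: (le_trans (bx i)); rewrite ler_peMl// ltW.
    - exact: nl.
    - rewrite /ball/=; split=> // i j; rewrite ord1; have := nr j; rewrite !mxE//.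
  by rewrite lerDl mulr_ge0.
move=> /existsNP[i /negP]; rewrite -leNgt => ri.
have hi : c <= far P x l.
  rewrite /far (bigD1 i)//= -[leLHS]addr0; apply: lerD; last first.
    by apply: sumr_ge0 => j _; rewrite subr_ge0 cos_le1.
  apply: hc; rewrite normrM normfV (gtr0_norm P0) ler_pM2r ?invr_gt0// ri/=.
  have -> : (x - node P l) 0 i = x 0 i - node P l 0 i by rewrite !mxE.
  rewrite ler_pdivrMr// mulrDl mul1r [leRHS]addrC (le_trans (ler_normB _ _))// lerD//.
apply: (@le_trans _ _ (2 * B / c * far P x l)); last by rewrite lerDr ltW.
apply: (@le_trans _ _ (2 * B / c * c)); last by rewrite ler_wpM2l.
rewrite divfK ?gt_eqF// (le_trans (ler_normB _ _))// mulr_natl mulr2n lerD//.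
Qed.

(** * Approximate solutions from a regularized implicit scheme *)

Section resolvent.
Context {R : realType} {N : nat}.
Local Notation X := 'rV[R]_N.
Implicit Types (phi psi w g : X -> R) (x : X).

Definition lipmono (G : R -> R) (L : R) := forall a b, G a - G b <= L * Num.max 0 (a - b).

Lemma lipmono_le G L (a b : R) : 0 <= L -> lipmono G L -> a <= b -> G a <= G b.
Proof.
move=> L0 h ab; have := h a b; rewrite (_ : Num.max 0 (a - b) = 0) ?mulr0 ?subr_le0//.
by apply/max_idPl; rewrite subr_le0.
Qed.

Lemma lipmono_ub G L (a b c : R) : 0 <= L -> lipmono G L -> a - b <= c -> 0 <= c -> G a - G b <= L * c.
Proof.
move=> L0 h abc c0; apply: (le_trans (h a b)); rewrite ler_wpM2l// ge_max c0//.
Qed.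

Lemma lipmono_opp G L : lipmono G L -> lipmono (fun s => - G (- s)) L.
Proof.
move=> h a b; have := h (- b) (- a); rewrite opprK.
by rewrite (_ : - b + a = a - b)//; [lra|exact: addrC].
Qed.

Variables (A : (X -> R) -> X -> R) (m : R).
Hypothesis m0 : 0 <= m.
Hypothesis AD : forall phi psi x, bdd phi -> bdd psi -> A (fun y => phi y + psi y) x = A phi x + A psi x.
Hypothesis AZ : forall c phi x, bdd phi -> A (fun y => c * phi y) x = c * A phi x.
Hypothesis Acst : forall c x, A (fun=> c) x = 0.
Hypothesis Amono : forall phi psi x, bdd phi -> bdd psi -> (forall y, phi y <= psi y) ->
  A phi x + m * phi x <= A psi x + m * psi x.

Lemma bdd_cst (c : R) : bdd (fun _ : X => c).
Proof. by exists `|c|. Qed.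

Lemma A_diff phi psi (c : R) x : bdd phi -> bdd psi -> (forall y, phi y <= psi y + c) ->
  A phi x - A psi x <= m * (psi x + c - phi x).
Proof.
move=> b1 b2 h; have := Amono x b1 (bddD b2 (bdd_cst c)) h.
by rewrite AD//; [rewrite Acst; lra|exact: bdd_cst].
Qed.

Lemma A_ub phi (c : R) x : bdd phi -> (forall y, phi y <= c) -> A phi x <= m * (c - phi x).
Proof.
move=> b h; have := @A_diff phi (fun=> 0) c x b (bdd_cst 0).
by rewrite Acst subr0 add0r; apply.
Qed.

Lemma A_bdd phi : bdd phi -> bdd (A phi).
Proof.
move=> b; have [B hB] := b; exists (m * (2 * B)) => x.
have b' : bdd (fun y => -1 * phi y) by exact: bddZ.
have h1 y : phi y <= B by have := hB y; rewrite ler_norml => /andP[].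
have h2 y : -1 * phi y <= B by have := hB y; rewrite mulN1r ler_norml => /andP[]; lra.
have := A_ub x b' h2; rewrite AZ// => k2; have k1 := A_ub x b h1.
have l1 : m * (B - phi x) <= m * (2 * B) by rewrite ler_wpM2l//; have := h2 x; lra.
have l2 : m * (B - -1 * phi x) <= m * (2 * B) by rewrite ler_wpM2l//; have := h1 x; lra.
by rewrite ler_norml; apply/andP; split; lra.
Qed.

Lemma bdd_sup phi : bdd phi -> exists S, (forall y, phi y <= S) /\
  (forall t, (forall y, phi y <= t) -> S <= t).
Proof.
move=> [B hB]; exists (sup (range phi)).
have ub : has_ubound (range phi).
  by exists B => _ [y _ <-]; have := hB y; rewrite ler_norml => /andP[].
split=> [y|t ht]; first by apply: ub_le_sup => //; exists y.
by apply: ge_sup => [|_ [y _ <-] //]; exists (phi 0), 0.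
Qed.

Variables (G : R -> R) (L lam : R).
Hypothesis L0 : 0 <= L.
Hypothesis hG : lipmono G L.
Hypothesis lam0 : 0 < lam.

Let K := lam * (L * m).
Let K0 : 0 <= K. Proof. by rewrite !mulr_ge0// ltW. Qed.

Lemma GA_diff phi psi (c : R) x : bdd phi -> bdd psi -> (forall y, phi y <= psi y + c) ->
  lam * (G (A phi x) - G (A psi x)) <= K * (psi x + c - phi x).
Proof.
move=> b1 b2 h; rewrite /K -!mulrA ler_wpM2l ?(ltW lam0)//; apply: lipmono_ub => //.
  exact: A_diff.
by rewrite mulr_ge0// subr_ge0.
Qed.

(** A supremum need not be attained on the whole space. The pointwise inequality is instead
    rearranged into one for the supremum [S] of [w1 - w2 - c], namely [S <= K S / (1 + K)], which
    forces [S <= 0]. *)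
Lemma resolvent_comparison w1 w2 (c : R) : bdd w1 -> bdd w2 ->
  (forall x, w1 x - lam * G (A w1 x) <= w2 x - lam * G (A w2 x) + c) ->
  forall x, w1 x <= w2 x + c.
Proof.
move=> b1 b2 h.
have bd : bdd (fun y => w1 y + (-1 * w2 y + - c)).
  by apply: bddD => //; apply: bddD; [exact: bddZ|exact: bdd_cst].
have [S [hS Smin]] := bdd_sup bd.
have le y : w1 y <= w2 y + (c + S) by have := hS y; lra.
have S0 : S <= K * S / (1 + K).
  apply: Smin => y; rewrite ler_pdivlMr; last by rewrite ltr_wpDr.
  have := GA_diff y b1 b2 le; have := h y; rewrite mulN1r; nra.
have {}S0 : S <= 0.
  move: S0; rewrite ler_pdivlMr; last by rewrite ltr_wpDr.
  by rewrite mulrDr mulr1 [S * K]mulrC gerDr.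
by move=> x; have := le x; lra.
Qed.

Section existence.
Variable g : X -> R.
Hypothesis bg : bdd g.

(** A damped iteration with the same fixed points as the equation. The damping is chosen so that
    [theta K = 1 - theta = q]: the negative diagonal of the operator is then absorbed, and the map
    contracts upper bounds on differences by [q]. *)
Let theta := (1 + K)^-1.
Let q := 1 - theta.
Let th0 : 0 < theta. Proof. by rewrite invr_gt0 ltr_wpDr. Qed.
Let th1 : theta <= 1. Proof. by rewrite invf_le1 ?lerDl// ltr_wpDr. Qed.
Let thK : theta * K = q.
Proof. by rewrite /q /theta; field; rewrite gt_eqF// ltr_wpDr. Qed.
Let q0 : 0 <= q. Proof. by rewrite subr_ge0. Qed.
Let q1 : q < 1. Proof. by rewrite gtrBl. Qed.

Let Tr w x := q * w x + theta * (g x + lam * G (A w x)).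

Let bdd_Tr w : bdd w -> bdd (Tr w).
Proof.
move=> b; apply: bddD; first exact: bddZ.
apply: bddZ; apply: bddD => //; apply: bddZ.
have [B hB] := A_bdd b; exists (`|G B| + `|G (- B)|) => x.
have := hB x; rewrite ler_norml => /andP[h1 h2].
have l1 := lipmono_le L0 hG h1; have l2 := lipmono_le L0 hG h2.
have n1 := ler_norm (G B); have n2 := ler_norm (- G (- B)); rewrite normrN in n2.
have p1 := normr_ge0 (G B); have p2 := normr_ge0 (G (- B)).
by rewrite ler_norml; apply/andP; split; lra.
Qed.

Let Tr_le w1 w2 (c : R) : bdd w1 -> bdd w2 -> (forall y, w1 y <= w2 y + c) ->
  forall y, Tr w1 y <= Tr w2 y + q * c.
Proof.
move=> b1 b2 h y; have := GA_diff y b1 b2 h; move=> /(ler_wpM2l (ltW th0)).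
by rewrite (mulrA theta K) thK /Tr; lra.
Qed.

Let it n := iter n Tr (fun=> 0).

Let bdd_it n : bdd (it n).
Proof. by elim: n => [|n IH]; [exact: bdd_cst|exact: bdd_Tr]. Qed.

Lemma resolvent_exists : exists w, bdd w /\ forall x, w x - lam * G (A w x) = g x.
Proof.
have [C0 hC0] := bdd_it 1; pose C := `|C0|.
have hC x : `|it 1 x - it 0 x| <= C by rewrite subr0 (le_trans (hC0 x))// ler_norm.
have C00 : 0 <= C by exact: normr_ge0.
have step n : (forall x, it n.+1 x <= it n x + C * q ^+ n) /\ (forall x, it n x <= it n.+1 x + C * q ^+ n).
  elim: n => [|n [IH1 IH2]].
    by rewrite expr0 mulr1; split => x; have := hC x; rewrite ler_norml => /andP[]; lra.
  split => x; rewrite exprS mulrCA.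
    exact: (Tr_le (bdd_it n.+1) (bdd_it n) IH1).
  exact: (Tr_le (bdd_it n) (bdd_it n.+1) IH2).
(* [C q ^ n / theta] is the tail of the geometric series of the increments. The shifted iterates
   decrease and increase respectively, and the fixed point is the supremum of the lower ones. *)
pose a x n := it n x + C * q ^+ n / theta.
pose b x n := it n x - C * q ^+ n / theta.
have tq : q - 1 = - theta by rewrite /q; ring.
have a_ni x : nonincreasing_seq (a x).
  apply/nonincreasing_seqP => n; rewrite /a; have [h1 _] := step n.
  have -> : C * q ^+ n.+1 / theta = C * q ^+ n / theta + C * q ^+ n * (q - 1) / theta by rewrite exprS; ring.
  rewrite tq mulrN mulNr mulfK ?gt_eqF//; have := h1 x; lra.
have b_nd x : nondecreasing_seq (b x).
  apply/nondecreasing_seqP => n; rewrite /b; have [_ h1] := step n.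
  have -> : C * q ^+ n.+1 / theta = C * q ^+ n / theta + C * q ^+ n * (q - 1) / theta by rewrite exprS; ring.
  rewrite tq mulrN mulNr mulfK ?gt_eqF//; have := h1 x; lra.
have ba x n : b x n <= a x n.
  have : 0 <= C * q ^+ n / theta by rewrite !mulr_ge0 ?exprn_ge0// invr_ge0 ltW.
  by rewrite /a /b; lra.
have ab x n k : b x n <= a x k.
  apply: (@le_trans _ _ (b x (maxn n k))); first by apply: b_nd; exact: leq_maxl.
  apply: (@le_trans _ _ (a x (maxn n k))); first exact: ba.
  by apply: a_ni; exact: leq_maxr.
pose W x := sup (range (b x)).
have Wge x n : b x n <= W x.
  apply: ub_le_sup; last by exists n.
  by exists (a x 0%N) => _ [k _ <-].
have Wle x n : W x <= a x n.
  by apply: ge_sup => [|_ [k _ <-] //]; exists (b x 0%N), 0%N.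
have err n x : `|W x - it n x| <= C * q ^+ n / theta.
  by rewrite ler_norml; apply/andP; split; have := Wge x n; have := Wle x n; rewrite /a /b; lra.
have bW : bdd W.
  by exists (C / theta) => x; have := err 0%N x; rewrite /it/= subr0 expr0 mulr1.
have fix_W x : `|Tr W x - W x| <= 0.
  have lim : (2 * (C * q ^+ n.+1 / theta)) @[n --> \oo] --> (0 : R).
    have h : q ^+ n @[n --> \oo] --> (0 : R) by apply: cvg_expr; rewrite ger0_norm.
    have : q ^+ n.+1 @[n --> \oo] --> (0 : R) by rewrite -(cvg_shiftS (fun n => q ^+ n)) in h.
    move=> h1; rewrite (_ : (fun n => _) = fun n => (2 * C / theta) * q ^+ n.+1).
      by rewrite -[X in _ --> X](mulr0 (2 * C / theta)); apply: cvgM => //; exact: cvg_cst.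
    by apply/funext => n; ring.
  rewrite -(cvg_lim (@Rhausdorff R) lim); apply: limr_ge; first by apply/cvg_ex; exists 0.
  apply: nearW => n.
  have e1 : `|Tr W x - it n.+1 x| <= C * q ^+ n.+1 / theta.
    rewrite exprS mulrCA -mulrA.
    have h1 y : W y <= it n y + C * q ^+ n / theta by have := err n y; rewrite ler_norml => /andP[_]; lra.
    have h2 y : it n y <= W y + C * q ^+ n / theta by have := err n y; rewrite ler_norml => /andP[]; lra.
    have k1 := Tr_le bW (bdd_it n) h1 x; have k2 := Tr_le (bdd_it n) bW h2 x.
    rewrite ler_norml; apply/andP; split; move: k1 k2; rewrite /it /=; lra.
  have e2 := err n.+1 x.
  rewrite (_ : Tr W x - W x = (Tr W x - it n.+1 x) - (W x - it n.+1 x)); last by ring.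
  by rewrite (le_trans (ler_normB _ _))// mulr_natl mulr2n lerD.
exists W; split => // x.
have := fix_W x; rewrite normr_le0 subr_eq0 /Tr => /eqP e.
have : theta * (g x + lam * G (A W x) - W x) = 0 by move: e; rewrite /q; lra.
by move=> /eqP; rewrite mulf_eq0 gt_eqF//= subr_eq0 => /eqP <-; rewrite addrK.
Qed.

End existence.

(** Applying the linear operator to the equation shows that [V = A w] solves
    [V - lam A (G V) = A g]. As [G] is monotone, [G V] is largest where [V] is, so a maximum
    principle holds for [V] itself. *)
Lemma resolvent_A_le w g (C : R) : bdd w -> bdd g ->
  (forall x, w x - lam * G (A w x) = g x) -> (forall x, A g x <= C) ->
  forall x, A w x <= C.
Proof.
move=> bw bg e hC.
have [S [hS Smin]] := bdd_sup (A_bdd bw).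
have bGV : bdd (fun y => lam^-1 * (w y + -1 * g y)) by apply: bddZ; apply: bddD => //; exact: bddZ.
have eG y : lam^-1 * (w y + -1 * g y) = G (A w y).
  by rewrite -e; field; rewrite gt_eqF.
have bGV' : bdd (fun y => -1 * g y) by exact: bddZ.
have h y : A w y <= C + K * (S - A w y).
  have := @A_ub _ (G S) y bGV; rewrite AZ; last by apply: bddD.
  rewrite AD// AZ// eG => h.
  have {}h : lam^-1 * (A w y - A g y) <= m * (G S - G (A w y)).
    rewrite mulN1r in h; apply: h => z; rewrite eG; apply: lipmono_le L0 hG _; exact: hS.
  have h2 : m * (G S - G (A w y)) <= m * (L * (S - A w y)).
    by rewrite ler_wpM2l//; apply: lipmono_ub; rewrite ?subr_ge0.
  have := le_trans h h2; rewrite ler_pdivrMl// => h3.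
  have := hC y; rewrite /K; lra.
have {}h y : A w y <= (C + K * S) / (1 + K).
  by rewrite ler_pdivlMr ?ltr_wpDr//; have := h y; lra.
have := Smin _ h; rewrite ler_pdivlMr ?ltr_wpDr// => h1.
by move=> x; apply: (le_trans (hS x)); lra.
Qed.

End resolvent.

Lemma lipmono_norm (R : realType) (G : R -> R) (L a b : R) : 0 <= L -> lipmono G L ->
  `|G a - G b| <= L * `|a - b|.
Proof.
move=> L0 h; have k (s t : R) : G s - G t <= L * `|s - t|.
  by apply: (lipmono_ub L0 h) => //; exact: ler_norm.
by rewrite ler_norml; apply/andP; split; have := k a b; have := k b a; rewrite (distrC b a); lra.
Qed.

(** * The regularized implicit scheme and its bounds *)

Section implicit_scheme.
Context {R : realType} {N : nat}.
Variables (sigma h : R).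
Hypothesis s02 : 0 < sigma < 2.
Hypothesis h0 : 0 < h.
Local Notation V := 'rV[R]_N.
Local Notation A := (@dfracLap R N sigma h).

Let mA : R := @mass R N sigma * (h `^ sigma)^-1.
Let mA0 : 0 <= mA. Proof. by rewrite mulr_ge0 ?invr_ge0 ?powR_ge0 ?mass_ge0. Qed.
Let AD phi psi (x : V) : bdd phi -> bdd psi -> A (fun y => phi y + psi y) x = A phi x + A psi x.
Proof. exact: dfracLapD. Qed.
Let AZ (c : R) phi (x : V) : bdd phi -> A (fun y => c * phi y) x = c * A phi x.
Proof. exact: dfracLapZ. Qed.
Let Acst (c : R) (x : V) : A (fun=> c) x = 0.
Proof. exact: dfracLap_cst. Qed.
Let Amono phi psi (x : V) : bdd phi -> bdd psi -> (forall y, phi y <= psi y) ->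
  A phi x + mA * phi x <= A psi x + mA * psi x.
Proof. exact: dfracLap_mono. Qed.

Variables (F : R -> R) (LF eta lam : R).
Hypothesis LF0 : 0 <= LF.
Hypothesis hF : lipmono F LF.
Hypothesis eta0 : 0 < eta.
Hypothesis lam0 : 0 < lam.

Definition reg (s : R) : R := F s + eta * s.

Lemma lipmono_reg : lipmono reg (LF + eta).
Proof.
move=> a b; have := hF a b; rewrite /reg mulrDl.
have : eta * (a - b) <= eta * Num.max 0 (a - b) by rewrite ler_wpM2l ?(ltW eta0)// le_max lexx orbT.
lra.
Qed.

Let LG0 : 0 <= LF + eta. Proof. by rewrite addr_ge0// ltW. Qed.

Lemma reg_expand (a b : R) : eta * `|a - b| <= `|reg a - reg b|.
Proof.
wlog ab : a b / a <= b.
  move=> H; have [/H//|/ltW/H] := leP a b.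
  by rewrite distrC [leRHS]distrC.
have := lipmono_le LF0 hF ab => h1; rewrite distrC [leRHS]distrC ger0_norm ?subr_ge0//.
apply: le_trans (ler_norm _); rewrite /reg; lra.
Qed.

Lemma reg_lip (a b : R) : `|reg a - reg b| <= (LF + eta) * `|a - b|.
Proof. exact: lipmono_norm lipmono_reg. Qed.

Let comparison := resolvent_comparison mA0 AD Acst Amono LG0 lipmono_reg lam0.
Let solution := resolvent_exists mA0 AD AZ Acst Amono LG0 lipmono_reg lam0.

Variables (w0 : V -> R) (ft : nat -> V -> R).
Hypothesis bw0 : bdd w0.
Hypothesis bft : forall k, bdd (ft k).

Lemma implicit_exists : exists w : nat -> V -> R, [/\ w 0%N = w0, forall k, bdd (w k) &
  forall k x, w k.+1 x - lam * reg (A (w k.+1) x) = w k x + lam * ft k.+1 x].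
Proof.
have [S hS] := @choice _ _ (fun (g w : V -> R) => bdd g -> bdd w /\
    forall x, w x - lam * reg (A w x) = g x) (fun g => match pselect (bdd g) with
      | left bg => let: ex_intro w hw := solution bg in ex_intro _ w (fun _ => hw)
      | right nb => ex_intro _ g (fun bg => False_ind _ (nb bg)) end).
pose w := fix w (k : nat) : V -> R := if k is k'.+1 then S (fun x => w k' x + lam * ft k x) else w0.
have bw k : bdd (w k).
  elim: k => [//|k IH] /=; apply: (hS _ _).1; apply: bddD => //; exact: bddZ.
exists w; split => // k x /=.
by rewrite (hS _ _).2//; apply: bddD => //; exact: bddZ.
Qed.

Variable w : nat -> V -> R.
Hypothesis w_0 : w 0%N = w0.
Hypothesis bw : forall k, bdd (w k).
Hypothesis we : forall k x, w k.+1 x - lam * reg (A (w k.+1) x) = w k x + lam * ft k.+1 x.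

Lemma scheme_norm (B Bf : R) : (forall x, `|w0 x| <= B) -> (forall k x, `|ft k x| <= Bf) ->
  forall k x, `|w k x| <= B + k%:R * lam * (Bf + `|F 0|).
Proof.
move=> hB hf; elim=> [|k IH] x; first by rewrite w_0 !mul0r addr0.
have bc : bdd (fun _ : V => (0 : R)) by exists 0 => y; rewrite normr0.
have r0 y : reg (A (fun=> 0) y) = F 0 by rewrite Acst /reg mulr0 addr0.
have l1 : lam * F 0 <= lam * `|F 0| by rewrite ler_wpM2l ?(ltW lam0)// ler_norm.
have l2 : - (lam * F 0) <= lam * `|F 0| by rewrite -mulrN ler_wpM2l ?(ltW lam0)// -normrN ler_norm.
have e : B + k.+1%:R * lam * (Bf + `|F 0|) = B + k%:R * lam * (Bf + `|F 0|) + lam * Bf + lam * `|F 0|.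
  by rewrite -nat1r; ring.
have fk y : - (lam * Bf) <= lam * ft k.+1 y <= lam * Bf.
  by rewrite -mulrN !ler_wpM2l ?(ltW lam0)//; have := hf k.+1 y; rewrite ler_norml => /andP[].
rewrite ler_norml; apply/andP; split.
  have := @comparison (fun=> 0) (w k.+1) (B + k.+1%:R * lam * (Bf + `|F 0|)) bc (bw _) _ x.
  rewrite -lerBlDr sub0r; apply => y; rewrite we r0 e.
  have := IH y; have := fk y; rewrite ler_norml => /andP[f1 f2] /andP[g1 g2]; lra.
have := @comparison (w k.+1) (fun=> 0) (B + k.+1%:R * lam * (Bf + `|F 0|)) (bw _) bc _ x.
rewrite add0r; apply => y; rewrite we r0 e.
have := IH y; have := fk y; rewrite ler_norml => /andP[f1 f2] /andP[g1 g2]; lra.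
Qed.

Lemma scheme_near_initial (C Bf : R) : (forall k x, `|ft k x| <= Bf) ->
  (forall x, `|reg (A w0 x)| <= C) ->
  forall k x, `|w k x - w0 x| <= k%:R * lam * (C + Bf).
Proof.
move=> hf hC; elim=> [|k IH] x; first by rewrite w_0 subrr normr0 !mul0r.
have e : k.+1%:R * lam * (C + Bf) = k%:R * lam * (C + Bf) + lam * Bf + lam * C.
  by rewrite -nat1r; ring.
have fk y : - (lam * Bf) <= lam * ft k.+1 y <= lam * Bf.
  by rewrite -mulrN !ler_wpM2l ?(ltW lam0)//; have := hf k.+1 y; rewrite ler_norml => /andP[].
have fr y : - (lam * C) <= lam * reg (A w0 y) <= lam * C.
  by rewrite -mulrN !ler_wpM2l ?(ltW lam0)//; have := hC y; rewrite ler_norml => /andP[].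
rewrite ler_norml; apply/andP; split.
  have := @comparison w0 (w k.+1) (k.+1%:R * lam * (C + Bf)) bw0 (bw _) _ x.
  rewrite lerBrDl -lerBlDr; apply => y; rewrite we e.
  have := IH y; have := fk y; have := fr y; rewrite ler_norml => /andP[f1 f2] /andP[g1 g2] /andP[g3 g4]; lra.
have := @comparison (w k.+1) w0 (k.+1%:R * lam * (C + Bf)) (bw _) bw0 _ x.
rewrite lerBlDl; apply => y; rewrite we e.
have := IH y; have := fk y; have := fr y; rewrite ler_norml => /andP[f1 f2] /andP[g1 g2] /andP[g3 g4]; lra.
Qed.

(** The bound depends only on the operator applied to the data, not on [eta]; this is what later
    allows [eta] times the operator to be made small. *)
Lemma scheme_dfracLap (C0 : R) (Cf : nat -> R) n : (forall x, `|A w0 x| <= C0) ->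
  (forall k, (k <= n)%N -> forall x, `|A (ft k) x| <= Cf k) ->
  forall k, (k <= n)%N -> forall x, `|A (w k) x| <= C0 + \sum_(i < k) lam * Cf i.+1.
Proof.
move=> h1 h2; elim=> [|k IH] kn x; first by rewrite w_0 big_ord0 addr0.
set C := (X in _ <= X).
have bg : bdd (fun y => w k y + lam * ft k.+1 y) by apply: bddD => //; exact: bddZ.
have Ag y : `|A (fun y => w k y + lam * ft k.+1 y) y| <= C.
  rewrite AD//; last exact: bddZ.
  rewrite AZ// (le_trans (ler_normD _ _))// /C big_ord_recr/= addrA lerD ?IH ?(ltnW kn)//.
  by rewrite normrM gtr0_norm// ler_wpM2l ?(ltW lam0)// h2.
have up := @resolvent_A_le _ _ _ _ mA0 AD AZ Acst Amono _ _ _ LG0 lipmono_reg lam0 _ _ C (bw k.+1) bg (we k) _ x.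
have bwN : bdd (fun y => -1 * w k.+1 y) by exact: bddZ.
have bgN : bdd (fun y => -1 * (w k y + lam * ft k.+1 y)) by exact: bddZ.
(* The lower bound is the upper bound for the opposite function, which solves the scheme of the
   reflected nonlinearity. *)
have dn := @resolvent_A_le _ _ _ _ mA0 AD AZ Acst Amono _ _ _ LG0 (lipmono_opp lipmono_reg) lam0 _ _ C bwN bgN _ _ x.
rewrite ler_norml; apply/andP; split; last first.
  by apply: up => y; apply: le_trans (Ag y); exact: ler_norm.
rewrite lerNl -mulN1r -AZ//; apply: dn => y.
  by rewrite AZ// -we !mulN1r opprK; ring.
by rewrite AZ// mulN1r; apply: le_trans (Ag y); rewrite -normrN; exact: ler_norm.
Qed.

(** By translation invariance a translate of the solution solves the scheme with translated data,
    and comparison transfers the Lipschitz bounds of the data. *)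
Lemma scheme_lip (P : R) (L0 : R) (Lf : nat -> R) :
  (forall x z, `|w0 (x + z) - w0 x| <= L0 * osc P z) ->
  (forall k x z, `|ft k (x + z) - ft k x| <= Lf k * osc P z) ->
  forall k x z, `|w k (x + z) - w k x| <= (L0 + \sum_(i < k) lam * Lf i.+1) * osc P z.
Proof.
move=> h1 h2; elim=> [|k IH] x z; first by rewrite w_0 big_ord0 addr0.
rewrite big_ord_recr/= addrA.
set c := (X in _ <= X).
have bs : bdd (fun y => w k.+1 (y + z)) by have [B hB] := bw k.+1; exists B.
have gd y : `|(w k (y + z) + lam * ft k.+1 (y + z)) - (w k y + lam * ft k.+1 y)| <= c.
  rewrite opprD addrACA /c mulrDl (le_trans (ler_normD _ _))// lerD//.
  by rewrite -mulrBr normrM gtr0_norm// -mulrA ler_wpM2l ?(ltW lam0).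
have e y : w k.+1 (y + z) - lam * reg (A (fun y => w k.+1 (y + z)) y) =
    w k (y + z) + lam * ft k.+1 (y + z).
  by rewrite dfracLap_shift// we.
have up := @comparison (fun y => w k.+1 (y + z)) (w k.+1) c bs (bw _) _ x.
have dn := @comparison (w k.+1) (fun y => w k.+1 (y + z)) c (bw _) bs _ x.
rewrite ler_norml; apply/andP; split.
  rewrite lerBrDr addrC lerBlDr; apply: dn => y; rewrite e we.
  by have := gd y; rewrite ler_norml => /andP[]; lra.
rewrite lerBlDl; apply: up => y; rewrite e we.
by have := gd y; rewrite ler_norml => /andP[]; lra.
Qed.

Lemma scheme_dfracLap_lip (P Lw Lw' Lf : R) k :
  (forall x z, `|w k.+1 (x + z) - w k.+1 x| <= Lw * osc P z) ->
  (forall x z, `|w k (x + z) - w k x| <= Lw' * osc P z) ->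
  (forall x z, `|ft k.+1 (x + z) - ft k.+1 x| <= Lf * osc P z) ->
  forall x z, `|A (w k.+1) (x + z) - A (w k.+1) x| <=
    eta^-1 * (lam^-1 * (Lw + Lw') + Lf) * osc P z.
Proof.
move=> h1 h2 h3 x z.
rewrite -mulrA ler_pdivlMl// (le_trans (reg_expand _ _))//.
have e y : reg (A (w k.+1) y) = lam^-1 * (w k.+1 y - w k y) - ft k.+1 y.
  have -> : w k y = w k.+1 y - lam * reg (A (w k.+1) y) - lam * ft k.+1 y by rewrite we addrK.
  by field; rewrite gt_eqF.
rewrite !e (_ : _ - _ = lam^-1 * ((w k.+1 (x + z) - w k.+1 x) - (w k (x + z) - w k x)) -
  (ft k.+1 (x + z) - ft k.+1 x)); last by ring.
rewrite mulrDl (le_trans (ler_normB _ _))// lerD//.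
rewrite normrM gtr0_norm ?invr_gt0// -mulrA ler_wpM2l ?invr_ge0 ?(ltW lam0)//.
by rewrite mulrDl (le_trans (ler_normB _ _))// lerD.
Qed.

End implicit_scheme.

(** Young's inequality [a <= d + a ^ 2 / (4 d)] trades the first power, in which Lipschitz bounds
    are expressed, for [1 - cos], whose average is known. *)
Lemma sin_lin_sqr (R : realType) (d s : R) : 0 < d -> `|sin (s / 2)| <= d + (8 * d)^-1 * (1 - cos s).
Proof.
move=> d0; rewrite sin_half_sqr -(real_normK (num_real (sin (s / 2)))).
set a := `|_|; have := sqr_ge0 (a - 2 * d).
have -> : (8 * d)^-1 * (2 * a ^+ 2) = a ^+ 2 / (4 * d) by field; rewrite gt_eqF.
rewrite -lerBlDl => h; rewrite ler_pdivlMr; last by rewrite mulr_gt0.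
move: h; rewrite !expr2; nra.
Qed.

(** The order of the quantifiers matters: the degree depends only on the Lipschitz constant and the
    tolerance, and serves all grids and all grid functions. *)
Lemma avg_lip (R : realType) (N : nat) (P L e : R) : 0 < P -> 0 <= L -> 0 < e ->
  exists n, forall m (g : {ffun 'I_N -> 'I_m} -> R) (c : R) (x : 'rV[R]_N), (n.+1 < m)%N ->
  (forall l, `|g l - c| <= L * osc P (node P l - x)) -> `|avg P n g x - c| <= e.
Proof.
move=> P0 L0 e0; pose d := e / (2 * (L * N%:R + 1)).
have b0 : 0 < L * N%:R + 1 :> R by rewrite ltr_wpDl ?mulr_ge0.
have d0 : 0 < d by rewrite divr_gt0 ?mulr_gt0.
have e2 : 0 < e / 2 by rewrite divr_gt0.
have [n hn] := archi_nat (L * (8 * d)^-1 * N%:R) e2.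
exists n => m g c x nm hg.
apply: (le_trans (avg_approx P0 nm (d := L * (N%:R * d)) (K := L * (8 * d)^-1) _)); last first.
  rewrite (splitr e) [_ * (8 * d)^-1 * _]mulrA; apply: lerD; last by rewrite ler_pdivrMr.
  have ed : d * (2 * (L * N%:R + 1)) = e by rewrite /d divfK// gt_eqF// mulr_gt0.
  have -> : e / 2 = L * (N%:R * d) + d by rewrite -ed; field.
  by rewrite lerDl ltW.
move=> l; apply: (le_trans (hg l)); rewrite -mulrA -mulrDr ler_wpM2l//.
have -> : N%:R * d = \sum_(i < N) d by rewrite sumr_const card_ord mulr_natl.
rewrite /osc /far mulr_sumr -big_split/=.
apply: ler_sum => i _.
rewrite (_ : (node P l - x) 0 i / (2 * P) = - ((x - node P l) 0 i / P / 2)); last first.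
  by rewrite !mxE; field; rewrite gt_eqF.
by rewrite sinN normrN; exact: sin_lin_sqr.
Qed.

Lemma finite_min (R : realType) (d : nat -> R) n : (forall k, 0 < d k) ->
  exists2 e, 0 < e & forall k, (k <= n)%N -> e <= d k.
Proof.
move=> d0; elim: n => [|n [e e0 IH]].
  by exists (d 0%N) => // k; rewrite leqn0 => /eqP ->.
exists (Num.min e (d n.+1)); first by rewrite lt_min e0/=.
move=> k; rewrite leq_eqVlt => /orP[/eqP ->|]; first by rewrite ge_min lexx orbT.
by rewrite ltnS => /IH h; rewrite ge_min h.
Qed.

Lemma le_bigsum (R : realType) (f : nat -> R) (k n : nat) : (forall i, 0 <= f i) -> (k <= n)%N ->
  \sum_(i < k) f i <= \sum_(i < n) f i.
Proof.
move=> f0 /subnKC <-; elim: (n - k)%N => [|j IH]; first by rewrite addn0.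
by rewrite addnS big_ord_recr/= (le_trans IH)// lerDl.
Qed.

Lemma term_le_bigsum (R : realType) (f : nat -> R) (k n : nat) : (forall i, 0 <= f i) -> (k < n)%N ->
  f k <= \sum_(i < n) f i.
Proof.
move=> f0 kn; apply: le_trans (le_bigsum f0 kn).
by rewrite big_ord_recr/= lerDr sumr_ge0.
Qed.

Lemma residual_le (R : realType) (a b Fc ec f1 Fl gx e e1 LF : R) : e = 6 * e1 + 6 * (LF * e1) ->
  `|a - (Fc + ec)| <= e1 -> `|b - f1| <= e1 -> `|Fc - Fl| <= LF * (2 * e1) -> `|ec| <= e / 3 ->
  `|f1 - gx| <= e / 3 -> `|a + b - Fl - gx| <= e.
Proof.
move=> ee; rewrite !ler_norml.
move=> /andP[? ?] /andP[? ?] /andP[? ?] /andP[? ?] /andP[? ?].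
by apply/andP; split; lra.
Qed.

(** * Smooth approximate solutions of the equation *)

Section approximation.
Context {R : realType} {N : nat}.
Variables (sigma T LF Bf B0 : R) (F : R -> R) (g : R -> 'rV[R]_N -> R) (u0 : 'rV[R]_N -> R).
Hypothesis s02 : 0 < sigma < 2.
Hypothesis N0 : (0 < N)%N.
Hypothesis T0 : 0 < T.
Hypothesis LF0 : 0 < LF.
Hypothesis hF : lipmono F LF.
Hypothesis cg : forall t, 0 <= t <= T -> continuous (g t).
Hypothesis hg : forall t x, 0 <= t <= T -> `|g t x| <= Bf.
Hypothesis cu0 : continuous u0.
Hypothesis hu0 : forall x, `|u0 x| <= B0.
Local Notation V := 'rV[R]_N.

Let Bf0 : 0 <= Bf.
Proof. by apply: le_trans (normr_ge0 _) (hg 0 (t := 0) _); rewrite lexx ltW. Qed.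

Let B1 := B0 + T * (Bf + `|F 0|).

(* One run of the regularized implicit scheme with n steps, mollified by Fejer averages. *)
Lemma approx_run (P e : R) (w0 : V -> R) (C0 : R) (n : nat) : 1 <= P -> 0 < e -> trig P w0 ->
  (forall x, `|w0 x| <= B0) -> (forall x, `|fracLap sigma w0 x| <= C0) -> (0 < n)%N ->
  exists w : nat -> V -> R, forall k, (k <= n)%N -> [/\ trig P (w k),
    forall x, `|w k x| <= B1,
    forall x, `|w k x - w0 x| <= k%:R * (T / n%:R) * (`|F (C0 + 1)| + `|F (- (C0 + 1))| + (C0 + 1) + Bf) + e &
    (0 < k)%N -> forall x, box P x ->
      `|(w k x - w k.-1 x) / (T / n%:R) - F (fracLap sigma (w k) x) - g (k%:R * (T / n%:R)) x| <= e].
Proof.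
move=> P1 e0 tw0 hw0 hC0 n0; have P0 : 0 < P by exact: lt_le_trans P1.
have C00 : 0 <= C0 := le_trans (normr_ge0 _) (hC0 0).
have nR : 0 < n%:R :> R by rewrite ltr0n.
pose lam := T / n%:R; have lam0 : 0 < lam by rewrite divr_gt0.
have lamT k : (k <= n)%N -> k%:R * lam <= T.
  move=> kn; rewrite /lam mulrA ler_pdivrMr// mulrC ler_wpM2l ?(ltW T0)// ler_nat//.
have e3 : 0 < e / 3 by rewrite divr_gt0.
have /choice[ft hft] : forall k : nat, exists p, [/\ trig P p, forall x : V, `|p x| <= Bf &
    (k <= n)%N -> forall x, box P x -> `|p x - g (k%:R * lam) x| <= e / 3].
  move=> k; have [kn|nk] := leqP k n.
    have tk : 0 <= k%:R * lam <= T by rewrite mulr_ge0 ?(ltW lam0)//= lamT.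
    have [p [p1 p2 p3]] := trig_approx P1 (cg tk) (fun x => hg x tk) e3.
    by exists p; split.
  by exists (fun=> 0); split => //; [exact: trig_cst|move=> x; rewrite normr0].
have tft k : trig P (ft k) by have [] := hft k.
have bft k : bdd (ft k) by exact: bdd_trig.
have hBf k x : `|ft k x| <= Bf by have [_ ->] := hft k.
have /choice[Lf hLf] : forall k, exists L, 0 <= L /\ forall x z, `|ft k (x + z) - ft k x| <= L * osc P z.
  by move=> k; have [L l1 l2] := trig_lip P0 (tft k); exists L.
have /choice[Cf hCf] : forall k, exists C, forall x, `|fracLap sigma (ft k) x| <= C.
  by move=> k; exact: fracLap_trig_bdd (tft k).
have Cf0 k : 0 <= Cf k := le_trans (normr_ge0 _) (hCf k 0).
have [L0 L00 hL0] := trig_lip P0 tw0.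
pose CV := (C0 + 1) + \sum_(i < n) lam * (Cf i.+1 + 1).
have CV0 : 0 <= CV.
  by rewrite addr_ge0 ?addr_ge0// sumr_ge0// => i _; rewrite mulr_ge0 ?addr_ge0// ltW.
(* [CV] will bound the discrete operator on every [w k], with no reference to [eta] or to the grid,
   so that the regularizing term is at most [e / 3]. *)
pose eta := Num.min 1 (e / 3 / (CV + 1)).
have CV1 : 0 < CV + 1 by rewrite ltr_wpDl.
have eta0 : 0 < eta by rewrite lt_min ltr01 divr_gt0.
have eta1 : eta <= 1 by rewrite ge_min lexx.
have etaCV : eta * CV <= e / 3.
  apply: (@le_trans _ _ (e / 3 / (CV + 1) * CV)); first by rewrite ler_wpM2r// ge_min lexx orbT.
  by rewrite mulrAC ler_pdivrMr// ler_wpM2l ?(ltW e3)// lerDl.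
pose La := L0 + \sum_(i < n) lam * Lf i.+1.
have Lfp i : 0 <= Lf i by have [] := hLf i.
have La0 : 0 <= La by rewrite addr_ge0// sumr_ge0// => i _; rewrite mulr_ge0// ltW.
pose Lft := \sum_(i < n) Lf i.+1.
have Lft0 : 0 <= Lft by apply: sumr_ge0.
pose LV := eta^-1 * (lam^-1 * (La + La) + Lft).
have LV0 : 0 <= LV.
  by rewrite mulr_ge0 ?invr_ge0 ?(ltW eta0)// addr_ge0// mulr_ge0 ?invr_ge0 ?(ltW lam0)// addr_ge0.
have LG0 : 0 <= LF + eta by rewrite addr_ge0 ?ltW.
(* One Lipschitz constant for everything that gets averaged: [w0], [reg] of the discrete operator,
   the operator itself, and the source. *)
pose Ls := L0 + (LF + eta) * LV + LV + Lft.
have Ls0 : 0 <= Ls by rewrite !addr_ge0// mulr_ge0.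
(* The averaging and consistency errors add up to [2 e1 + 2 LF e1 = e / 3]; the regularization and
   the source take the other two thirds. *)
pose e1 := e / (6 * (1 + LF)).
have LF1 : 0 < 1 + LF by rewrite addr_gt0.
have e10 : 0 < e1 by rewrite divr_gt0// mulr_gt0.
have e1E : e = 6 * e1 + 6 * (LF * e1) by rewrite /e1; field; rewrite gt_eqF.
have e1e : e1 <= e.
  rewrite ler_pdivrMr ?mulr_gt0// ler_peMr ?(ltW e0)//.
  by have := ltW LF0; lra.
have Le1 : 0 <= LF * e1 by rewrite mulr_ge0 ?ltW.
have [n1 hn1] := @avg_lip R N P Ls e1 P0 Ls0 e10.
have B10 : 0 <= B1.
  rewrite addr_ge0 ?(le_trans (normr_ge0 _) (hw0 0))// mulr_ge0 ?(ltW T0)// addr_ge0//.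
have [d0 d00 hd0] := dfracLap_trig s02 N0 tw0 ltr01.
have /choice[df hdf] : forall k, exists d, 0 < d /\ forall h, 0 < h < d -> forall x,
    `|dfracLap sigma h (ft k) x - fracLap sigma (ft k) x| <= 1.
  by move=> k; have [d x1 x2] := dfracLap_trig s02 N0 (tft k) ltr01; exists d.
have [d1 d10 hd1] := finite_min n (fun k => (hdf k).1).
have B11 : 0 < B1 + 1 by rewrite ltr_wpDl.
have eB : 0 < e1 / (B1 + 1) by rewrite divr_gt0.
(* [avg_consistent] multiplies the error on the kernel by the bound [B1] on the grid values, hence
   the division by [B1 + 1]. *)
have [d2 d20 hd2] := dfracLap_trig s02 N0 (@trig_fejN R N P n1) eB.
pose d := Num.min d0 (Num.min d1 d2).
have dd : 0 < d by rewrite !lt_min d00 d10.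
have [n2 hn2] : exists n2 : nat, 2 * pi * P <= d / 2 * n2.+1%:R by apply: archi_nat; rewrite divr_gt0.
pose m := (n2 + n1.+2)%N.
have nm : (n1.+1 < m)%N by rewrite /m addnC leq_addr.
pose h := mesh P m; have h0 : 0 < h by exact: mesh_gt0 P0 nm.
have hd : h < d.
  have mR : 0 < m%:R :> R by rewrite ltr0n (leq_trans _ nm).
  rewrite /h /mesh ltr_pdivrMr// (le_lt_trans hn2)//.
  apply: (@le_lt_trans _ _ (d / 2 * m%:R)).
    by rewrite ler_wpM2l ?divr_ge0 ?(ltW dd)// ler_nat /m addnS ltnS addnS leqW// leq_addr.
  by rewrite ltr_pM2r// ltr_pdivrMr// ltr_pMr// ltr1n.
have [hhd0 hhd1 hhd2] : [/\ h < d0, h < d1 & h < d2].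
  by move: hd; rewrite /d !lt_min => /and3P[].
have [w [w_0 bw we]] := implicit_exists s02 h0 (ltW LF0) hF eta0 lam0 (bdd_trig tw0) bft.
have Aw0 x : `|dfracLap sigma h w0 x| <= C0 + 1.
  have := hd0 h _ x; rewrite h0 hhd0 => /(_ isT) h1.
  rewrite (_ : dfracLap _ _ _ _ = fracLap sigma w0 x + (dfracLap sigma h w0 x - fracLap sigma w0 x)); last by rewrite addrC subrK.
  by rewrite (le_trans (ler_normD _ _))// lerD.
have Aft k : (k <= n)%N -> forall x, `|dfracLap sigma h (ft k) x| <= Cf k + 1.
  move=> kn x; have := (hdf k).2 h _ x; rewrite h0 (lt_le_trans hhd1 (hd1 k kn)) => /(_ isT) h1.
  rewrite (_ : dfracLap _ _ _ _ = fracLap sigma (ft k) x + (dfracLap sigma h (ft k) x - fracLap sigma (ft k) x)); last by rewrite addrC subrK.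
  by rewrite (le_trans (ler_normD _ _))// lerD.
have AV k : (k <= n)%N -> forall x, `|dfracLap sigma h (w k) x| <= CV.
  move=> kn x.
  apply: (le_trans (scheme_dfracLap s02 h0 (ltW LF0) hF eta0 lam0 bft w_0 bw we Aw0 Aft kn x)).
  rewrite lerD2l; apply: (le_bigsum (f := fun i => lam * (Cf i.+1 + 1))) => // i.
  by rewrite mulr_ge0 ?(ltW lam0)// addr_ge0.
have osc0 z : 0 <= osc P z :> R := osc_ge0 P z.
have Lw k : (k <= n)%N -> forall x z, `|w k (x + z) - w k x| <= La * osc P z.
  move=> kn x z.
  have hLf2 i : forall x z, `|ft i (x + z) - ft i x| <= Lf i * osc P z by exact: (hLf i).2.
  have sl := scheme_lip s02 h0 (ltW LF0) hF eta0 lam0 w_0 bw we hL0 hLf2 k x z.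
  apply: (le_trans sl).
  rewrite ler_wpM2r// lerD2l; apply: (le_bigsum (f := fun i => lam * Lf i.+1)) => // i.
  by rewrite mulr_ge0 ?(ltW lam0).
have LAw k : (k < n)%N -> forall x z,
    `|dfracLap sigma h (w k.+1) (x + z) - dfracLap sigma h (w k.+1) x| <= LV * osc P z.
  move=> kn x z.
  have hf y v : `|ft k.+1 (y + v) - ft k.+1 y| <= Lft * osc P v.
    apply: (le_trans ((hLf k.+1).2 y v)); rewrite ler_wpM2r//.
    exact: (term_le_bigsum (f := fun i => Lf i.+1)).
  exact: (scheme_dfracLap_lip (ltW LF0) hF eta0 lam0 we (Lw _ kn) (Lw _ (ltnW kn)) hf x z).
pose W k := avg P n1 (fun l : {ffun 'I_N -> 'I_m} => w k (node P l)).
have bnd k : (k <= n)%N -> forall x, `|w k x| <= B1.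
  move=> kn x; apply: (le_trans (scheme_norm s02 h0 (ltW LF0) hF eta0 lam0 w_0 bw we hw0 hBf k x)).
  by rewrite lerD2l ler_wpM2r ?addr_ge0// lamT.
have nx x (l : {ffun 'I_N -> 'I_m}) : x + (node P l - x) = node P l by rewrite addrC subrK.
have wnode k x (l : {ffun 'I_N -> 'I_m}) : (k <= n)%N -> `|w k (node P l) - w k x| <= La * osc P (node P l - x).
  by move=> kn; have := Lw k kn x (node P l - x); rewrite nx.
exists W => k kn; split.
- exact: trig_avg.
- by move=> x; apply: norm_avg_le => // l; exact: bnd.
- move=> x.
  have Cr y : `|reg F eta (dfracLap sigma h w0 y)| <= `|F (C0 + 1)| + `|F (- (C0 + 1))| + (C0 + 1).
    have := Aw0 y; move: (dfracLap _ _ _ _) => s hs.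
    rewrite /reg (le_trans (ler_normD _ _))// lerD//; last first.
      by rewrite normrM gtr0_norm// (le_trans _ hs)// ler_piMl.
    move: hs; rewrite ler_norml => /andP[s1 s2].
    have f1 := lipmono_le (ltW LF0) hF s1; have f2 := lipmono_le (ltW LF0) hF s2.
    have q1 := ler_norm (F (C0 + 1)); have q2 := ler_norm (- F (- (C0 + 1))); rewrite normrN in q2.
    rewrite ler_norml; apply/andP; split.
      rewrite lerNl (le_trans (_ : - F s <= - F (- (C0 + 1)))) ?lerN2// (le_trans q2)//.
      by rewrite lerDr.
    by rewrite (le_trans f2)// (le_trans q1)// lerDl.
  have near := scheme_near_initial s02 h0 (ltW LF0) hF eta0 lam0 (bdd_trig tw0) w_0 bw we hBf Cr k.
  have -> : W k x - w0 x = avg P n1 (fun l : {ffun 'I_N -> 'I_m} => w k (node P l) + -1 * w0 (node P l)) x +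
      (avg P n1 (fun l : {ffun 'I_N -> 'I_m} => w0 (node P l)) x - w0 x).
    by rewrite avgD avgZ /W; ring.
  rewrite (le_trans (ler_normD _ _))// lerD//.
    by apply: norm_avg_le => // l; rewrite mulN1r.
  apply: (@le_trans _ _ e1) => //.
  apply: hn1 => // l; have := hL0 x (node P l - x); rewrite nx => /le_trans; apply.
  rewrite ler_wpM2r// /Ls -!addrA lerDl !addr_ge0// mulr_ge0//.
case: k kn => // k kn _ x bx.
pose c := dfracLap sigma h (w k.+1) x.
pose fk := ft k.+1.
have Vnode (l : {ffun 'I_N -> 'I_m}) : `|dfracLap sigma h (w k.+1) (node P l) - c| <= LV * osc P (node P l - x).
  by have := LAw k kn x (node P l - x); rewrite nx.
have t1 : `|avg P n1 (fun l : {ffun 'I_N -> 'I_m} => reg F eta (dfracLap sigma h (w k.+1) (node P l))) x - reg F eta c| <= e1.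
  apply: hn1 => // l; apply: (le_trans (reg_lip (ltW LF0) hF eta0 _ _)).
  apply: (@le_trans _ _ ((LF + eta) * (LV * osc P (node P l - x)))); first by rewrite ler_wpM2l.
  by rewrite mulrA ler_wpM2r// /Ls [L0 + _]addrC -!addrA lerDl !addr_ge0.
have t2 : `|avg P n1 (fun l : {ffun 'I_N -> 'I_m} => fk (node P l)) x - fk x| <= e1.
  apply: hn1 => // l; have := (hLf k.+1).2 x (node P l - x); rewrite nx => /le_trans; apply.
  rewrite ler_wpM2r// /Ls (le_trans (term_le_bigsum (f := fun i => Lf i.+1) _ kn))//.
  by rewrite lerDr !addr_ge0// mulr_ge0.
have t3 : `|fracLap sigma (W k.+1) x - c| <= 2 * e1.
  have a1 : `|dfracLap sigma h (W k.+1) x - c| <= e1.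
    have pw : coord_periodic P (w k.+1) := lip_periodic P0 (Lw k.+1 kn).
    rewrite /h dfracLap_avg//.
    apply: hn1 => // l; apply: (le_trans (Vnode l)); rewrite ler_wpM2r//.
    by rewrite /Ls addrAC lerDr !addr_ge0// mulr_ge0.
  have a2 : `|dfracLap sigma h (W k.+1) x - fracLap sigma (W k.+1) x| <= e1.
    apply: (@le_trans _ _ (B1 * (e1 / (B1 + 1)))).
      apply: avg_consistent => //; first exact: ltW.
        by move=> l; exact: bnd.
      by apply: hd2; rewrite h0.
    by rewrite mulrCA ler_piMr ?(ltW e10)// ler_pdivrMr// mul1r lerDl.
  rewrite (_ : _ - c = (dfracLap sigma h (W k.+1) x - c) - (dfracLap sigma h (W k.+1) x - fracLap sigma (W k.+1) x)); last by ring.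
  by rewrite (le_trans (ler_normB _ _))// mulr_natl mulr2n lerD.
have t4 : `|F c - F (fracLap sigma (W k.+1) x)| <= LF * (2 * e1).
  by apply: (le_trans (lipmono_norm _ _ (ltW LF0) hF)); rewrite ler_wpM2l ?(ltW LF0)// distrC.
have t5 : `|eta * c| <= e / 3.
  by rewrite normrM gtr0_norm// (le_trans _ etaCV)// ler_wpM2l ?(ltW eta0)// AV.
have t6 : `|fk x - g (k.+1%:R * lam) x| <= e / 3.
  by have [_ _ hh] := hft k.+1; exact: hh.
have inc : (W k.+1 x - W k x) / lam =
    avg P n1 (fun l : {ffun 'I_N -> 'I_m} => reg F eta (dfracLap sigma h (w k.+1) (node P l))) x +
    avg P n1 (fun l : {ffun 'I_N -> 'I_m} => fk (node P l)) x.
  rewrite -avgD.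
  have -> : W k.+1 x - W k x = avg P n1 (fun l : {ffun 'I_N -> 'I_m} => w k.+1 (node P l) + -1 * w k (node P l)) x.
    by rewrite avgD avgZ mulN1r.
  rewrite mulrC -avgZ; congr avg; apply/funext => l.
  have -> : w k (node P l) = w k.+1 (node P l) - lam * reg F eta (dfracLap sigma h (w k.+1) (node P l)) - lam * fk (node P l).
    by rewrite we addrK.
  by field; rewrite gt_eqF.
rewrite [k.+1.-1]/= inc.
exact: residual_le e1E t1 t2 t4 t5 t6.
Qed.

(** [w0] and [C] are produced before [n]: the distance of [w k] to the initial profile is controlled
    by the elapsed time alone, uniformly over all runs. *)
Lemma approx_family (P e : R) : 1 <= P -> 0 < e ->
  exists w0 C, [/\ trig P w0, forall x, `|w0 x| <= B0, forall x, box P x -> `|w0 x - u0 x| <= e, 0 <= C &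
  forall n, (0 < n)%N ->
  exists w : nat -> V -> R, forall k, (k <= n)%N -> [/\ trig P (w k),
    forall x, `|w k x| <= B1,
    forall x, `|w k x - w0 x| <= k%:R * (T / n%:R) * C + e &
    (0 < k)%N -> forall x, box P x ->
      `|(w k x - w k.-1 x) / (T / n%:R) - F (fracLap sigma (w k) x) - g (k%:R * (T / n%:R)) x| <= e]].
Proof.
move=> P1 e0; have [w0 [tw0 hw0 aw0]] := trig_approx P1 cu0 hu0 e0.
have [C0 hC0] := fracLap_trig_bdd s02 N0 tw0.
exists w0, (`|F (C0 + 1)| + `|F (- (C0 + 1))| + (C0 + 1) + Bf); split => //.
  by rewrite !addr_ge0// (le_trans (normr_ge0 _) (hC0 0)).
by move=> n n0; exact: approx_run.
Qed.

End approximation.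

(** * Comparison by doubling the time variable *)

Section doubling.
Context {R : realType} {X : Type}.
Variables (T lam delta rho eta gam om e e2 E B : R) (n : nat).
Variables (F : R -> R) (f v : X -> R -> R) (w ell : nat -> X -> R) (psi : X -> R) (D : set X).
Hypothesis lam0 : 0 < lam.
Hypothesis delta0 : 0 < delta.
Hypothesis rho0 : 0 < rho.
Hypothesis eta0 : 0 <= eta.
Hypothesis gam0 : 0 <= gam.
Hypothesis E0 : 0 <= E.
Hypothesis lamT : n%:R * lam = T.

(* Doubling of the time variable only: [r] is a continuous time, [k] an index of the grid. *)
Definition gap (k : nat) (y : X) (r : R) : R :=
  v y r - w k y - (r - k%:R * lam) ^+ 2 / delta - psi y - eta * r.

(** If the near-maximum exceeded [E], then [psi] would put its point into [D], the time penalty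
    would bring the two times within [rho], and the initial estimate would exclude [s <= rho]. In
    the remaining case the residual of [w] and the interior inequality for [v] bound the same
    quantity from opposite sides, up to errors whose sum is below [eta]. *)
Lemma doubling :
  (forall y (r : R) k, 0 <= r <= T -> (k <= n)%N -> v y r - w k y <= B) ->
  (forall y, 0 <= psi y) -> (forall y, ~ D y -> B <= psi y) -> delta * B <= rho ^+ 2 ->
  (forall y (r : R) k, 0 <= r <= rho -> r <= T -> (k <= n)%N -> k%:R * lam <= 2 * rho ->
    v y r - w k y - psi y <= E) ->
  (forall k y, (k < n)%N -> D y ->
    F (ell k.+1 y) + f y (k.+1%:R * lam) - e <= (w k.+1 y - w k y) / lam) ->
  (forall k y s, (k < n)%N -> D y -> rho <= s <= T ->
    (forall z (r : R), 0 <= r <= T -> gap k.+1 z r <= gap k.+1 y s + gam) ->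
    2 * (s - k.+1%:R * lam) / delta + eta <= F (ell k.+1 y) + f y s + e2) ->
  (forall y (s t : R), D y -> 0 <= s <= T -> 0 <= t <= T -> `|s - t| <= rho -> f y s - f y t <= om) ->
  e + e2 + om + lam / delta + gam / lam < eta ->
  (exists x (s : R) k, [/\ 0 <= s <= T, (k <= n)%N &
    forall y (r : R) j, 0 <= r <= T -> (j <= n)%N -> gap j y r <= gap k x s + gam]) ->
  forall y (r : R) j, 0 <= r <= T -> (j <= n)%N -> gap j y r <= E + gam.
Proof.
move=> hB psi0 psiD dB hinit hres hint hom heta [x [s [k [sT kn hmax]]]] y r j rT jn.
apply: (le_trans (hmax y r j rT jn)); rewrite lerD2r leNgt; apply/negP => EG; rewrite /gap in EG.
have [s0 sT'] := andP sT; have Ep := E0; have rp := rho0.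
have es0 : 0 <= eta * s by rewrite mulr_ge0.
have q0 : 0 <= (s - k%:R * lam) ^+ 2 / delta by rewrite divr_ge0 ?sqr_ge0// ltW.
have p0 := psi0 x; have vB := hB x s k sT kn.
have Dx : D x.
  by apply: contrapT => nD; have := psiD x nD; lra.
have near : `|s - k%:R * lam| < rho.
  have h : (s - k%:R * lam) ^+ 2 < rho ^+ 2.
    apply: lt_le_trans dB; rewrite [ltRHS]mulrC -ltr_pdivrMr//; lra.
  by rewrite -(ltr_pXn2r (n := 2))// ?nnegrE ?(ltW rho0)// real_normK ?num_real.
have [sr|rs] := leP s rho.
  have kl : k%:R * lam <= 2 * rho by move: near; rewrite ltr_norml => /andP[]; lra.
  have := hinit x s k _ sT' kn kl; rewrite s0 sr => /(_ isT).
  by move=> hi; lra.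
(* Index 0 stands for time 0, which is too far from [s > rho]. *)
case: k => [|k] in kn hmax EG vB near q0 *.
  by move: near; rewrite mul0r subr0 ger0_norm//; lra.
have tk : 0 <= k.+1%:R * lam <= T.
  by rewrite mulr_ge0 ?(ltW lam0)//= -lamT ler_wpM2r ?(ltW lam0)// ler_nat.
have h1 := hres k x kn Dx.
have h2 : 2 * (s - k.+1%:R * lam) / delta + eta <= F (ell k.+1 x) + f x s + e2.
  by apply: hint => //; [rewrite (ltW rs)|move=> z q qT; exact: hmax].
have h3 := hom x s (k.+1%:R * lam) Dx sT tk (ltW near).
(* Comparing the indices [k.+1] and [k] at the same point and time bounds the difference quotient of
   [w] by that of the quadratic penalty, whose second-order part is [lam / delta]. *)
have h4 : (w k.+1 x - w k x) / lam <= 2 * (s - k.+1%:R * lam) / delta + lam / delta + gam / lam.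
  rewrite ler_pdivrMr// mulrDl divfK ?gt_eqF//.
  have := hmax x s k sT (ltnW kn); rewrite /gap.
  have -> : (s - k%:R * lam) ^+ 2 / delta = (s - k.+1%:R * lam) ^+ 2 / delta +
      (2 * (s - k.+1%:R * lam) / delta + lam / delta) * lam.
    by rewrite -[k.+1%:R]nat1r; field; rewrite gt_eqF.
  lra.
lra.
Qed.

End doubling.

(** * Monotonicity and barriers for the explicit scheme *)

Section explicit.
Context {R : realType} {N : nat}.
Local Notation V := 'rV[R]_N.
Variables (sigma T LF h tau : R) (F : R -> R) (f : V * R -> R) (u0 : V -> R) (U : V * R -> R).
Hypothesis s02 : 0 < sigma < 2.
Hypothesis LF0 : 0 < LF.
Hypothesis hF : lipmono F LF.
Hypothesis h0 : 0 < h.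
Hypothesis tau0 : 0 < tau.
Hypothesis cfl : tau <= 1 / (LF * Csigma N sigma) * h `^ sigma.
Hypothesis scheme : explicit_scheme sigma T F f u0 h tau U.
Local Notation A := (@dfracLap R N sigma h).

Lemma scheme_bdd s : 0 <= s <= T -> bdd (fun y => U (y, s)).
Proof.
have [/bounded_onP[B hB] _ _] := scheme => sT.
by exists B => y; apply: hB.
Qed.

(** [F] can lose at most [LF] times the total jump rate times [psi x - phi x], and the CFL condition
    makes [tau] times this loss at most the gain [psi x - phi x]. *)
Lemma explicit_mono phi psi (x : V) : bdd phi -> bdd psi -> (forall y, phi y <= psi y) ->
  phi x + tau * F (A phi x) <= psi x + tau * F (A psi x).
Proof.
move=> b1 b2 le.
have hs : 0 < h `^ sigma by exact: powR_gt0.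
(* Were the constant nonpositive, or infinite and hence 0 after [fine], the CFL bound would be
   nonpositive, against [0 < tau]. *)
have Cs : 0 < Csigma N sigma :> R.
  rewrite ltNge; apply/negP => Cn; have : tau <= 0.
    apply: (le_trans cfl); rewrite mulr_le0_ge0 ?(ltW hs)// div1r invr_le0.
    by rewrite mulr_ge0_le0 ?(ltW LF0).
  by rewrite leNgt tau0.
have mC := mass_le_Csigma s02 Cs.
have d := dfracLap_mono s02 x h0 b1 b2 le.
set mh := mass sigma * _ in d.
have mh0 : 0 <= mh by rewrite mulr_ge0 ?invr_ge0 ?powR_ge0 ?mass_ge0.
have k : tau * (LF * mh) <= 1.
  have : tau * (LF * mh) <= (1 / (LF * Csigma N sigma) * h `^ sigma) * (LF * (Csigma N sigma / h `^ sigma)).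
    apply: ler_pM => //; first exact: ltW.
      by rewrite mulr_ge0// ltW.
    by rewrite ler_wpM2l ?(ltW LF0)// /mh ler_wpM2r// invr_ge0 ltW.
  move=> /le_trans; apply; rewrite le_eqVlt; apply/orP; left; apply/eqP.
  by field; rewrite !gt_eqF.
have gp : 0 <= psi x - phi x by rewrite subr_ge0.
have := @lipmono_ub _ F LF (A phi x) (A psi x) (mh * (psi x - phi x)) (ltW LF0) hF.
have -> : A phi x - A psi x <= mh * (psi x - phi x) by move: d; lra.
rewrite mulr_ge0// => /(_ isT isT) dF.
have : tau * (F (A phi x) - F (A psi x)) <= tau * (LF * (mh * (psi x - phi x))).
  by rewrite ler_wpM2l ?(ltW tau0).
have : tau * (LF * mh) * (psi x - phi x) <= 1 * (psi x - phi x) by rewrite ler_wpM2r.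
lra.
Qed.

Lemma explicit_step_le phi (x : V) s : bdd phi -> tau <= s <= T -> (forall y, U (y, s - tau) <= phi y) ->
  U (x, s) <= phi x + tau * (F (A phi x) + f (x, s - tau)).
Proof.
move=> b sT le; have [_ _ e] := scheme; rewrite e// !mulrDr !addrA lerD2r.
apply: explicit_mono => //; apply: scheme_bdd.
by have /andP[s1 s2] := sT; rewrite subr_ge0 s1/= (le_trans _ s2)// gerBl ltW.
Qed.

(** Used with a constant profile for bounds on the scheme uniform in [h], and with the penalized
    [w0] for the initial layer. *)
Lemma explicit_barrier (phi : V -> R) (K : R) : bdd phi -> 0 <= K -> (forall x, u0 x <= phi x) ->
  (forall x (s : R), 0 <= s <= T -> F (A phi x) + f (x, s) <= K) ->
  forall x (s : R), 0 <= s <= T -> U (x, s) <= phi x + K * s.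
Proof.
move=> b K0 hu hK x s /andP[s0 sT].
have [m hm] := archi_nat s tau0.
elim: m s s0 sT x hm => [|m IH] s s0 sT x hm.
  have [_ e _] := scheme; have [st|ts] := ltP s tau.
    by rewrite e ?s0//; apply: (le_trans (hu x)); rewrite lerDl mulr_ge0.
  (* In the base case only the first update is left, and it reads the initial data at time 0. *)
  have es : s = tau by apply/eqP; rewrite eq_le ts andbT; move: hm; rewrite mulr1.
  have le y : U (y, s - tau) <= phi y.
    by rewrite es subrr e ?lexx.
  have := explicit_step_le x b _ le; rewrite ts sT => /(_ isT)/le_trans; apply.
  rewrite lerD2l mulrC es ler_wpM2r ?(ltW tau0)//; apply: hK.
  by rewrite subrr lexx (le_trans s0 sT).
have [st|ts] := ltP s tau.
  have [_ e _] := scheme.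
  by rewrite e ?s0//; apply: (le_trans (hu x)); rewrite lerDl mulr_ge0.
have bc : bdd (fun y => phi y + K * (s - tau)) by apply: bddD => //; exact: bdd_cst.
have le y : U (y, s - tau) <= phi y + K * (s - tau).
  apply: IH; rewrite ?subr_ge0// ?(le_trans _ sT) ?gerBl ?(ltW tau0)//.
  by rewrite lerBlDr (le_trans hm)// -[m.+2%:R]nat1r mulrDr mulr1 addrC.
have := explicit_step_le x bc _ le; rewrite ts sT => /(_ isT)/le_trans; apply.
rewrite dfracLapD//; last exact: bdd_cst.
rewrite dfracLap_cst// addr0.
have := hK x (s - tau); rewrite subr_ge0 ts (le_trans _ sT) ?gerBl ?(ltW tau0)// => /(_ isT).
move=> /(ler_wpM2l (ltW tau0)); lra.
Qed.

(* The near-maximum is only used through the values at time [s - tau]. *)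
Lemma explicit_interior (w psi : V -> R) (x : V) (s t delta eta gam : R) : bdd w -> bdd psi ->
  0 < delta -> tau <= s <= T ->
  (forall z (r : R), 0 <= r <= T -> U (z, r) - w z - (r - t) ^+ 2 / delta - psi z - eta * r <=
     U (x, s) - w x - (s - t) ^+ 2 / delta - psi x - eta * s + gam) ->
  2 * (s - t) / delta + eta <=
    F (A w x + A psi x) + f (x, s - tau) + tau / delta + gam / tau.
Proof.
move=> bw bp d0 sT hmax; have /andP[s1 s2] := sT.
have st : 0 <= s - tau <= T by rewrite subr_ge0 s1/= (le_trans _ s2)// gerBl ltW.
pose c := U (x, s) - w x - psi x - (2 * (s - t) / delta + eta - tau / delta - gam / tau) * tau.
have bwp : bdd (fun y => w y + psi y) by exact: bddD.
have bphi : bdd (fun y => w y + psi y + c) by apply: bddD => //; exact: bdd_cst.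
have le y : U (y, s - tau) <= w y + psi y + c.
  have := hmax y (s - tau) st.
  have -> : (s - tau - t) ^+ 2 / delta = (s - t) ^+ 2 / delta - (2 * (s - t) / delta - tau / delta) * tau.
    by field; rewrite gt_eqF.
  have -> : gam = gam / tau * tau by rewrite divfK ?gt_eqF.
  rewrite /c; lra.
have := explicit_step_le x bphi sT le.
rewrite dfracLapD//; last exact: bdd_cst.
rewrite dfracLap_cst// addr0 dfracLapD// /c => h1.
have h2 : (2 * (s - t) / delta + eta - tau / delta - gam / tau) * tau <=
    (F (A w x + A psi x) + f (x, s - tau)) * tau by move: h1; lra.
move: h2; rewrite ler_pM2r//; lra.
Qed.

End explicit.

(** * Smoothness of the test functions *)

Section smooth.
Context {R : realType} {W : normedModType R}.
Implicit Types (phi psi : W -> R) (p v : W).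

Lemma is_derive_comp_lin (ell : W -> R) (g : R -> R) (dg : R) p v :
  (forall h, ell (h *: v + p) = h * ell v + ell p) -> is_derive (ell p) 1 g dg ->
  is_derive p v (g \o ell) (ell v * dg).
Proof.
move=> hl dgp.
have h1 : is_derive (0 : R) 1 (fun s => g (s * ell v + ell p)) (ell v * dg).
  have d1 : is_derive (0 : R) 1 (fun s => s * ell v + ell p) (ell v).
    have d2 := is_deriveD (is_derive_scaler (ell v) 0) (is_derive_cst (ell p) (0 : R) (1 : R)).
    by apply: (is_derive_eq d2); rewrite addr0.
  have dgp' : is_derive (0 * ell v + ell p) 1 g dg by rewrite mul0r add0r.
  have h := @is_derive1_comp _ g (fun s => s * ell v + ell p) 0 _ _ dgp' d1.
  by apply: (is_derive_eq h); rewrite mulrC.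
have e : (fun h : R => h^-1 *: (((g \o ell) \o shift p) (h *: v) - (g \o ell) p)) =
    (fun h : R => h^-1 *: (((fun s => g (s * ell v + ell p)) \o shift 0) (h *: 1) - g (0 * ell v + ell p))).
  apply/funext => h; rewrite /= addr0 mul0r add0r hl.
  by rewrite -[h *: 1]/(h * 1) mulr1.
split.
  by rewrite /derivable e; exact: (@ex_derive _ _ _ _ _ _ _ h1).
by rewrite /derive e; exact: (@derive_val _ _ _ _ _ _ _ h1).
Qed.

Lemma CkD k phi psi : Ck k phi -> Ck k psi -> Ck k (fun p => phi p + psi p).
Proof.
elim: k phi psi => [|k IH] phi psi [c1 h1] [c2 h2]; split => //; try by move=> x; apply: cvgD; [exact: c1|exact: c2].
move=> v; have [d1 k1] := h1 v; have [d2 k2] := h2 v; split => [x|].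
  exact: derivableD.
rewrite (_ : derive _ ^~ v = fun p => 'D_v phi p + 'D_v psi p); first exact: IH.
by apply/funext => p; exact: deriveD.
Qed.

Lemma CkZ k (c : R) phi : Ck k phi -> Ck k (fun p => c * phi p).
Proof.
elim: k phi => [|k IH] phi [c1 h1]; split => //; try by move=> x; apply: cvgM; [exact: cvg_cst|exact: c1].
move=> v; have [d1 k1] := h1 v; split => [x|].
  exact: (@derivableZ _ _ _ phi c).
rewrite (_ : derive _ ^~ v = fun p => c * 'D_v phi p); first exact: IH.
by apply/funext => p; exact: deriveZ.
Qed.

(** Every test function below is a linear combination of functions of one linear form: cosines,
    coordinate bumps, and functions of time. *)
Lemma Ck2_comp_lin (ell : W -> R) (g g1 g2 : R -> R) :
  (forall h p v, ell (h *: v + p) = h * ell v + ell p) -> continuous ell ->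
  (forall y : R, is_derive y 1 g (g1 y)) -> (forall y : R, is_derive y 1 g1 (g2 y)) -> continuous g2 ->
  Ck 2 (g \o ell).
Proof.
move=> hl cl d1 d2 c2.
have cg : continuous g by move=> y; exact: is_derive_continuous (d1 y).
have cg1 : continuous g1 by move=> y; exact: is_derive_continuous (d2 y).
have cc (k : R -> R) : continuous k -> continuous (k \o ell).
  by move=> ck x; apply: continuous_comp; [exact: cl|exact: ck].
have e1 v : 'D_v (g \o ell) = fun p => ell v * (g1 \o ell) p.
  by apply/funext => p; exact: (@derive_val _ _ _ _ _ _ _ (is_derive_comp_lin (fun h => hl h p v) (d1 _))).
have e2 v : 'D_v (g1 \o ell) = fun p => ell v * (g2 \o ell) p.
  by apply/funext => p; exact: (@derive_val _ _ _ _ _ _ _ (is_derive_comp_lin (fun h => hl h p v) (d2 _))).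
have k1 : Ck 1 (g1 \o ell).
  split; first exact: cc.
  move=> v; split.
    by move=> p; exact: (@ex_derive _ _ _ _ _ _ _ (is_derive_comp_lin (fun h => hl h p v) (d2 _))).
  rewrite e2; split => // p; apply: cvgM; [exact: cvg_cst|exact: cc].
split; first exact: cc.
move=> v; split.
  by move=> p; exact: (@ex_derive _ _ _ _ _ _ _ (is_derive_comp_lin (fun h => hl h p v) (d1 _))).
by rewrite e1; exact: CkZ.
Qed.

End smooth.

(** * The test functions of the comparison argument *)

Section test_functions.
Context {R : realType} {N : nat}.
Local Notation V := 'rV[R]_N.
Local Notation W := (V * R)%type.

Lemma continuous_linf (c : 'I_N -> R) : continuous (fun y : V => linf c y).
Proof.
move=> y; rewrite /linf; elim: (index_enum 'I_N) => [|i s IH].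
  by under eq_fun do rewrite big_nil; exact: cst_continuous.
under eq_fun do rewrite big_cons.
apply: continuousD IH; apply: (@continuous_comp _ _ _ (fun y : V => y 0 i) (fun a => c i * a)).
  exact: coord_continuous.
by move=> a; apply: cvgM; [exact: cvg_cst|exact: cvg_id].
Qed.

Lemma linf_fst (c : 'I_N -> R) (h : R) (p v : W) :
  linf c (h *: v + p).1 = h * linf c v.1 + linf c p.1.
Proof.
rewrite /linf mulr_sumr -big_split/=; apply: eq_bigr => i _.
by rewrite !mxE mulrDr mulrCA.
Qed.

Lemma continuous_linf_fst (c : 'I_N -> R) : continuous (fun p : W => linf c p.1).
Proof. by move=> p; apply: continuous_comp; [exact: cvg_fst|exact: continuous_linf]. Qed.

Lemma Ck2_linf (c : 'I_N -> R) (g g1 g2 : R -> R) :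
  (forall y : R, is_derive y 1 g (g1 y)) -> (forall y : R, is_derive y 1 g1 (g2 y)) -> continuous g2 ->
  Ck 2 (fun p : W => g (linf c p.1)).
Proof.
move=> d1 d2 c2; exact: (@Ck2_comp_lin _ _ (fun p : W => linf c p.1) g g1 g2 (@linf_fst c) (@continuous_linf_fst c)).
Qed.

Lemma Ck2_snd (g g1 g2 : R -> R) :
  (forall y : R, is_derive y 1 g (g1 y)) -> (forall y : R, is_derive y 1 g1 (g2 y)) -> continuous g2 ->
  Ck 2 (fun p : W => g p.2).
Proof.
move=> d1 d2 c2; apply: (@Ck2_comp_lin _ _ (fun p : W => p.2) g g1 g2) => //.
by move=> p; exact: cvg_snd.
Qed.

Lemma is_derive_shift_arg (g : R -> R) (dg th y : R) : is_derive (y + th) 1 g dg ->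
  is_derive y 1 (fun y => g (y + th)) dg.
Proof.
move=> d; have d1 := is_deriveD (is_derive_id y (1 : R)) (is_derive_cst th y (1 : R)).
have h := @is_derive1_comp _ g (fun s => s + th) y _ _ d d1.
by apply: (is_derive_eq h); rewrite addr0 mulr1.
Qed.

Lemma Ck2_trig P (w : V -> R) : trig P w -> Ck 2 (fun p : W => w p.1).
Proof.
elim=> [k th|p q _ h1 _ h2|c p _ h1]; last 2 first.
- exact: (@CkD _ _ 2 (fun x : W => p x.1) (fun x : W => q x.1) h1 h2).
- exact: (@CkZ _ _ 2 c (fun x : W => p x.1) h1).
apply: (@Ck2_linf (freq P k) (fun y => cos (y + th)) (fun y => - sin (y + th)) (fun y => - cos (y + th))).
- by move=> y; exact: (is_derive_shift_arg (is_derive_cos (y + th))).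
- by move=> y; exact: (is_derive_shift_arg (is_derive_Nsin (y + th))).
- move=> y; apply: cvgN; apply: continuous_comp; last exact: continuous_cos.
  by apply: cvgD; [exact: cvg_id|exact: cvg_cst].
Qed.

Lemma continuous_gbump2 (b : R) : continuous (gbump2 b).
Proof.
move=> y; apply: cvgM.
  apply: cvgB; first exact: cvg_cst.
  by apply: cvgM; [exact: cvg_cst|exact: exprn_continuous].
exact: is_derive_continuous (is_derive_expsq b y).
Qed.

Lemma Ck2_penal (b : R) : Ck 2 (fun p : W => penal b p.1).
Proof.
rewrite /penal; elim: (index_enum 'I_N) => [|i s IH].
  under eq_fun do rewrite big_nil.
  apply: (@Ck2_snd (fun=> 0) (fun=> 0) (fun=> 0)); try by move=> y; exact: is_derive_cst.
  exact: cst_continuous.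
under eq_fun do rewrite big_cons.
have h1 : Ck 2 (fun p : W => gbump b (p.1 0 i)).
  have e : (fun p : W => gbump b (p.1 0 i)) = fun p : W => gbump b (linf (fun j => (j == i)%:R) p.1).
    by apply/funext => p; rewrite -(linf_delta i p.1) addr0.
  rewrite e; apply: (@Ck2_linf _ (gbump b) (gbump1 b) (gbump2 b)).
  - exact: is_derive_gbump.
  - exact: is_derive_gbump1.
  - exact: continuous_gbump2.
exact: (@CkD _ _ 2 _ _ h1 IH).
Qed.

Definition tpart (t d eta s : R) : R := (s - t) ^+ 2 / d + eta * s.

Lemma is_derive_tpart t d eta (s : R) : is_derive s 1 (tpart t d eta) (2 * (s - t) / d + eta).
Proof.
have h1 := is_deriveM (is_derive_shift_arg (is_derive_sqr (s - t))) (is_derive_cst d^-1 s (1 : R)).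
have h := is_deriveD h1 (is_derive_scale eta s).
by apply: (is_derive_eq h); rewrite -![_ *: _]/(_ * _) mulr0 add0r mulrC.
Qed.

Lemma Ck2_tpart t d eta : Ck 2 (fun p : W => tpart t d eta p.2).
Proof.
apply: (@Ck2_snd _ (fun s => 2 * (s - t) / d + eta) (fun=> 2 / d)).
- exact: is_derive_tpart.
- move=> y.
  have h1 := is_deriveD (is_derive_id y (1 : R)) (is_derive_cst (- t) y (1 : R)).
  have h := is_deriveD (is_deriveM (is_deriveZ 2 h1) (is_derive_cst d^-1 y (1 : R))) (is_derive_cst eta y (1 : R)).
  apply: (is_derive_eq h); rewrite -![_ *: _]/(_ * _) /cst; ring.
- exact: cst_continuous.
Qed.

Lemma is_derive_dt_fst (g : V -> R) (p : W) : is_derive p ((0, 1) : W) (fun p : W => g p.1) 0.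
Proof.
have e : (fun h : R => h^-1 *: (((fun p : W => g p.1) \o shift p) (h *: ((0, 1) : W)) - g p.1)) = fun=> 0.
  by apply/funext => h; rewrite /= scaler0 add0r subrr scaler0.
split; first by rewrite /derivable e; exact: is_cvg_cst.
by rewrite /derive e; apply/cvg_lim => //; exact: cvg_cst.
Qed.

Lemma is_derive_dt_snd (g : R -> R) (dg : R) (p : W) : is_derive p.2 1 g dg ->
  is_derive p ((0, 1) : W) (fun p : W => g p.2) dg.
Proof.
move=> d; have := @is_derive_comp_lin _ _ (fun p : W => p.2) g dg p (0, 1) _ d.
by rewrite mul1r; apply => h; rewrite /= -[h *: 1]/(h * 1).
Qed.

(** What [gap] subtracts from [u], read as a function of space and time. *)
Definition tfun (w psi : V -> R) (t d eta : R) (p : W) : R :=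
  (w p.1 + psi p.1) + tpart t d eta p.2.

Lemma dt_tfun w psi t d eta (x : V) (s : R) : dt (tfun w psi t d eta) (x, s) = 2 * (s - t) / d + eta.
Proof.
have h := is_deriveD (is_derive_dt_fst (fun y => w y + psi y) (x, s))
  (@is_derive_dt_snd (tpart t d eta) _ (x, s) (is_derive_tpart t d eta s)).
by rewrite /dt (@derive_val _ _ _ _ _ _ _ h) add0r.
Qed.

Lemma test_tfun (T P c b t d eta : R) w : trig P w -> 0 <= b ->
  test_function T (tfun w (fun y => c * penal b y) t d eta).
Proof.
move=> tw b0; split.
  apply: (@CkD _ _ 2 (fun p : V * R => w p.1 + c * penal b p.1) (fun p : V * R => tpart t d eta p.2)).
    apply: (@CkD _ _ 2 (fun p : V * R => w p.1) (fun p : V * R => c * penal b p.1)).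
      exact: Ck2_trig tw.
    exact: (@CkZ _ _ 2 c (fun p : V * R => penal b p.1) (@Ck2_penal b)).
  exact: Ck2_tpart.
apply/bounded_onP; have [B1 h1] := bdd_trig tw; have [B2 h2] := @bdd_penal R N b b0.
exists (B1 + `|c| * B2 + ((T + `|t|) ^+ 2 * `|d^-1| + `|eta| * T)) => -[x s]/= /andP[s0 sT].
rewrite /tfun/= (le_trans (ler_normD _ _))// lerD//.
  by rewrite (le_trans (ler_normD _ _))// lerD// normrM ler_wpM2l.
rewrite /tpart (le_trans (ler_normD _ _))// lerD//.
  rewrite normrM ler_wpM2r// normrX lerXn2r ?nnegrE ?addr_ge0//; first by rewrite (le_trans s0).
  by rewrite (le_trans (ler_normB _ _))// lerD2r ger0_norm.
by rewrite normrM ler_wpM2l// ger0_norm.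
Qed.

End test_functions.

Lemma finite_argmax (R : realType) (a : nat -> R) n : exists2 k, (k <= n)%N & forall j, (j <= n)%N -> a j <= a k.
Proof.
elim: n => [|n [k kn hk]]; first by exists 0%N => // j; rewrite leqn0 => /eqP ->.
have [le|gt] := leP (a k) (a n.+1).
  exists n.+1 => // j; rewrite leq_eqVlt => /orP[/eqP -> //|].
  by rewrite ltnS => /hk h; exact: le_trans h le.
exists k; first exact: leqW.
by move=> j; rewrite leq_eqVlt => /orP[/eqP ->|/hk//]; exact: ltW.
Qed.

(** * The viscosity inequality at an attained maximum *)

Section viscosity_sub.
Context {R : realType} {N : nat}.
Local Notation V := 'rV[R]_N.
Variables (sigma T : R).
Hypothesis s02 : 0 < sigma < 2.
Hypothesis N0 : (0 < N)%N.
Implicit Types (F : R -> R) (f u : V * R -> R).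

(* The subsolution inequality, tested only where the fractional Laplacian of the test
   function is an absolutely convergent integral, hence odd in the test function. *)
Definition sub_test F f u := forall phi x t, test_function T phi ->
  nice (fun y => phi (y, t)) x -> 0 < t <= T ->
  (forall p, strip T p -> u p - phi p <= u (x, t) - phi (x, t)) ->
  dt phi (x, t) - F (fracLap sigma (fun y => phi (y, t)) x) <= f (x, t).

Lemma sub_test_sub F f (u0 : V -> R) u : viscosity_subsolution sigma T F f u0 u -> sub_test F f u.
Proof. by move=> [_ _ _ h] phi x t tp _; exact: h. Qed.

Lemma sub_test_super F f (u0 : V -> R) u : viscosity_supersolution sigma T F f u0 u ->
  sub_test (fun s => - F (- s)) (fun p => - f p) (fun p => - u p).
Proof.
move=> [_ _ _ h] phi x t [ck /bounded_onP[B hB]] np tT mx.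
have tp' : test_function T (fun p => -1 * phi p).
  split; first exact: (@CkZ _ _ 2 (-1) phi ck).
  by apply/bounded_onP; exists B => p sp; rewrite mulN1r normrN; exact: hB.
have mx' p : strip T p -> u (x, t) - (-1 * phi (x, t)) <= u p - (-1 * phi p).
  by move=> sp; have := mx p sp; lra.
have := h _ x t tp' tT mx'.
have d1 : derivable phi (x, t) ((0, 1) : V * R) by have [_ /(_ (0, 1))[]] := ck.
have -> : dt (fun p => -1 * phi p) (x, t) = - dt phi (x, t).
  by rewrite /dt (@deriveZ _ _ _ phi (-1))// scaleN1r.
rewrite fracLapZ// mulN1r; lra.
Qed.

Lemma viscosity_interior F f u (P c b t d eta s : R) w (x : V) : sub_test F f u -> trig P w -> 0 <= b ->
  0 < s <= T ->
  (forall z (r : R), 0 <= r <= T -> u (z, r) - w z - (r - t) ^+ 2 / d - c * penal b z - eta * r <=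
     u (x, s) - w x - (s - t) ^+ 2 / d - c * penal b x - eta * s) ->
  2 * (s - t) / d + eta <= F (fracLap sigma w x + c * fracLap sigma (penal b) x) + f (x, s).
Proof.
move=> st tw b0 sT mx.
have np : nice (fun y => c * penal b y) x by apply: niceZ; exact: nice_penal.
have nw : nice w x by exact: nice_trig tw.
have nwp : nice (fun y => w y + c * penal b y) x by exact: niceD.
have nt : nice (fun y => tfun w (fun y => c * penal b y) t d eta (y, s)) x.
  exact: niceD nwp (nice_cst (tpart t d eta s) x).
have := st _ x s (test_tfun T c t d eta tw b0) nt sT _; rewrite dt_tfun.
rewrite (_ : fracLap _ _ _ = fracLap sigma w x + c * fracLap sigma (penal b) x); last first.
  have e : fracLap sigma (fun y => (w y + c * penal b y) + tpart t d eta s) x =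
      fracLap sigma (fun y => w y + c * penal b y) x + fracLap sigma (fun=> tpart t d eta s) x.
    by apply: fracLapD => //; exact: (@nice_cst _ _ _ x).
  have np' : nice (penal b) x by exact: nice_penal.
  by rewrite /tfun e fracLap_cst// addr0 (fracLapD s02 N0 nw np) (fracLapZ s02 N0 c np').
rewrite lerBlDl; apply => -[z r] zr.
by have := mx z r zr; rewrite /tfun /tpart/=; lra.
Qed.

Lemma semicontinuous_continuous u : usc_on (strip T) u -> lsc_on (strip T) u ->
  {within strip T, continuous u}.
Proof.
move=> us ls p; apply/cvgrPdist_lt => e e0.
have l1 : ((u p - e)%:E < (u p)%:E)%E by rewrite lte_fin gtrBl.
have l2 : ((- u p - e)%:E < (- u p)%:E)%E by rewrite lte_fin gtrBl.
have [V1 n1 h1] := ls p _ l1; have [V2 n2 h2] := us p _ l2.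
have k (a c : R) : a - e < c -> - a - e < - c -> `|a - c| < e.
  by move=> k1 k2; rewrite ltr_norml; apply/andP; split; lra.
rewrite /=; apply: filterS2 n1 n2 => q /h1 + /h2; rewrite !lte_fin; exact: k.
Qed.

Definition cyl (P : R) : set (V * R) := box P `*` `[0, T]%classic.

Lemma compact_cyl P : compact (cyl P).
Proof. by apply: compact_setX; [exact: compact_box|exact: segment_compact]. Qed.

Lemma cyl_strip P : cyl P `<=` strip T.
Proof. by move=> [x t] [_ /=]; rewrite in_itv. Qed.

(** The definition of viscosity solutions asks for an attained global maximum. On the cylinder it
    comes from compactness, for each of the finitely many indices; outside, the penalty pushes [gap]
    down to [- B], which is at most its value at the origin, time 0 and index 0, where all penalties
    vanish. *)
Lemma viscosity_exact_max u (P B c b lam delta eta : R) w n : 0 <= T -> 0 <= lam -> n%:R * lam = T ->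
  {within strip T, continuous u} ->
  (forall k, (k <= n)%N -> trig P (w k)) -> 0 <= P -> 0 <= b -> 0 <= c -> 0 <= eta -> 0 < delta ->
  (forall (y : V) (r : R) k, 0 <= r <= T -> (k <= n)%N -> `|u (y, r) - w k y| <= B) ->
  (forall y : V, ~ box P y -> 2 * B <= c * penal b y) ->
  exists x (s : R) k, [/\ 0 <= s <= T, (k <= n)%N &
    forall y (r : R) j, 0 <= r <= T -> (j <= n)%N ->
    gap lam delta eta (fun y r => u (y, r)) w (fun y => c * penal b y) j y r <=
    gap lam delta eta (fun y r => u (y, r)) w (fun y => c * penal b y) k x s].
Proof.
move=> T0 lam0 lamT cu tw P0 b0 c0 eta0 d0 hB hout.
pose Phi k (p : V * R) := u p - tfun (w k) (fun y => c * penal b y) (k%:R * lam) delta eta p.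
have gE k y r : gap lam delta eta (fun y r => u (y, r)) w (fun y => c * penal b y) k y r = Phi k (y, r).
  by rewrite /gap /Phi /tfun /tpart /=; ring.
have mx k : (k <= n)%N -> exists2 p, cyl P p & forall q, cyl P q -> Phi k q <= Phi k p.
  move=> kn.
  have cP : {within cyl P, continuous (Phi k)}.
    apply: (continuous_subspaceW (@cyl_strip P)) => p.
    apply: cvgB; first exact: cu.
    have [[cf _] _] := test_tfun T c (k%:R * lam) delta eta (tw k kn) b0.
    exact: continuous_subspaceT cf p.
  have ne : cyl P !=set0.
    exists (0, 0); split => /=; last by rewrite in_itv/= lexx.
    by move=> i; rewrite mxE normr0.
  have [p pA hp] := compact_EVT_max ne (@compact_cyl P) cP.
  by exists p; [exact: set_mem|move=> q qA; apply: hp; exact: mem_set].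
have /choice[p hp] : forall k, exists p, (k <= n)%N -> cyl P p /\ forall q, cyl P q -> Phi k q <= Phi k p.
  move=> k; have [kn|] := boolP (k <= n)%N; last by exists (0, 0).
  by have [p h1 h2] := mx k kn; exists p.
have [k kn hk] := finite_argmax (fun k => Phi k (p k)) n.
have [pc _] := hp k kn.
have best j q : (j <= n)%N -> cyl P q -> Phi j q <= Phi k (p k).
  by move=> jn cq; apply: le_trans (hk j jn); exact: (hp j jn).2.
exists (p k).1, (p k).2, k; split => //.
  by have [_ /=] := pc; rewrite in_itv.
move=> y r j rT jn; rewrite !gE -surjective_pairing.
have [by_|nby] := pselect (box P y); first by apply: best => //; split => //=; rewrite in_itv.
have z0 : cyl P (0, 0).
  by split => /=; [move=> i; rewrite mxE normr0|rewrite in_itv/= lexx].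
apply: (le_trans _ (best 0%N (0, 0) _ z0)) => //.
have h1 := hout y nby; have h2 := hB y r j rT jn.
have h3 := hB 0 0 0%N _ isT; rewrite lexx T0 in h3; have {}h3 := h3 isT.
have p0 : penal b (0 : V) = 0.
  by rewrite /penal big1// => i _; rewrite /gbump mxE expr0n mulr0 oppr0 expR0 subrr.
have q0 : 0 <= (r - j%:R * lam) ^+ 2 / delta by rewrite divr_ge0 ?sqr_ge0// ltW.
have q1 : 0 <= eta * r by rewrite mulr_ge0//; have /andP[] := rT.
rewrite /Phi /tfun /tpart/= p0 !mul0r subrr expr0n mul0r !mulr0.
move: h2 h3; rewrite !ler_norml => /andP[_ h2] /andP[h3 _]; lra.
Qed.

End viscosity_sub.

(** The explicit solution may jump in time, so that its supremum is only approached, with an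
    arbitrary slack [gam]. *)
Lemma near_max_exists (R : realType) (X : Type) (T B gam : R) (Phi : nat -> X -> R -> R) n (x0 : X) :
  0 <= T -> 0 < gam ->
  (forall y (r : R) k, 0 <= r <= T -> (k <= n)%N -> Phi k y r <= B) ->
  exists x (s : R) k, [/\ 0 <= s <= T, (k <= n)%N &
    forall y (r : R) j, 0 <= r <= T -> (j <= n)%N -> Phi j y r <= Phi k x s + gam].
Proof.
move=> T0 g0 hB.
pose S := [set a | exists y (r : R) k, [/\ 0 <= r <= T, (k <= n)%N & a = Phi k y r]].
have hS : has_sup S.
  split; first by exists (Phi 0%N x0 0), x0, 0, 0%N; rewrite lexx.
  by exists B => _ [y [r [k [h1 h2 ->]]]]; exact: hB.
have [_ [x [s [k [h1 h2 ->]]]] hs] := sup_adherent g0 hS.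
exists x, s, k; split => // y r j h3 h4.
rewrite -lerBlDr (le_trans _ (ltW hs))// lerD2r; apply: ub_le_sup; first by case: hS.
by exists y, r, j.
Qed.

(** With this scale a coordinate beyond [P] has exponent at least 1, and [exp a >= 1 + a >= 2]
    leaves at least one half. *)
Lemma penal_out (R : realType) (N : nat) (P : R) (y : 'rV[R]_N) : 0 < P -> ~ box P y ->
  1 / 2 <= penal ((P ^+ 2)^-1) y.
Proof.
move=> P0 /existsNP[i /negP]; rewrite -ltNge => Pi.
have b0 : 0 <= (P ^+ 2)^-1 by rewrite invr_ge0 sqr_ge0.
rewrite /penal (bigD1 i)//= -[leLHS]addr0; apply: lerD; last first.
  by apply: sumr_ge0 => j _; exact: gbump_ge0.
rewrite /gbump.
have y2 : 1 <= (P ^+ 2)^-1 * y 0 i ^+ 2.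
  rewrite mulrC ler_pdivlMr ?exprn_gt0// mul1r -(real_normK (num_real (y 0 i))).
  by rewrite lerXn2r ?nnegrE ?(ltW P0)// ltW.
have := expR_ge1Dx ((P ^+ 2)^-1 * y 0 i ^+ 2); move: y2; set a := _ * _ => a1 ea.
rewrite expRN lerBrDr -lerBrDl; have -> : 1 - 1 / 2 = 2^-1 :> R by field.
by rewrite lef_pV2 ?posrE ?expR_gt0//; lra.
Qed.

Lemma penal_le_sqr (R : realType) (N : nat) (b r : R) (y : 'rV[R]_N) : 0 <= b -> box r y ->
  penal b y <= N%:R * (b * r ^+ 2).
Proof.
move=> b0 hy; rewrite /penal mulr_natl -[N in _ *+ N]card_ord -sumr_const; apply: ler_sum => i _.
apply: (le_trans (expN_ge1Bx _)); rewrite ler_wpM2l// -(real_normK (num_real (y 0 i))).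
by rewrite lerXn2r ?nnegrE// (le_trans _ (hy i)).
Qed.

(** * One-sided comparison with the approximate solutions *)

Section one_sided.
Context {R : realType} {N : nat}.
Local Notation V := 'rV[R]_N.
Variables (sigma T LF P e C rho delta lam B c K C0 : R) (n : nat).
Local Notation b := ((P ^+ 2)^-1).
Local Notation CP := (6 * N%:R * b `^ (sigma / 2)).
Hypothesis s02 : 0 < sigma < 2.
Hypothesis N0 : (0 < N)%N.
Hypothesis T0 : 0 < T.
Hypothesis LF0 : 0 < LF.
Hypothesis P1 : 1 <= P.
Hypothesis e0 : 0 < e.
Hypothesis rho0 : 0 < rho.
Hypothesis delta0 : 0 < delta.
Hypothesis lam0 : 0 < lam.
Hypothesis lamT : n%:R * lam = T.
Hypothesis B0 : 0 <= B.
Hypothesis cB : 4 * B = c.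
Hypothesis C00 : 0 <= C.
Hypothesis hC : 2 * rho * C <= e.
Hypothesis hK : K * rho <= e.
Hypothesis K0 : 0 <= K.
Hypothesis hdelta : delta * B <= rho ^+ 2.
Hypothesis hlam : lam / delta <= e.
Hypothesis hpen : LF * (c * CP) <= e.

(** The halves of the two-sided estimates that enter an upper bound. The same record for the
    reflected data gives the lower bound, so that the argument is carried out once. *)
Record side (F : R -> R) (f : V * R -> R) (u0 w0 : V -> R) (w : nat -> V -> R) : Prop := Side {
  side_lip : lipmono F LF;
  side_trig0 : trig P w0;
  side_trig : forall k, (k <= n)%N -> trig P (w k);
  side_near : forall k x, (k <= n)%N -> w0 x - w k x <= k%:R * lam * C + e;
  side_res : forall k x, (k < n)%N -> box P x ->
    F (fracLap sigma (w k.+1) x) + f (x, k.+1%:R * lam) - e <= (w k.+1 x - w k x) / lam;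
  side_init : forall x, box P x -> u0 x <= w0 x + e;
  side_out : forall x, u0 x - w0 x <= B;
  side_mod : forall x (s t : R), box P x -> 0 <= s <= T -> 0 <= t <= T -> `|s - t| <= rho ->
    f (x, s) - f (x, t) <= e;
  side_growth : forall x (s : R), 0 <= s <= T -> F (C0 + c * CP) + f (x, s) <= K }.

Let b0 : 0 <= b. Proof. by rewrite invr_ge0 sqr_ge0. Qed.
Let P0 : 0 < P. Proof. exact: lt_le_trans P1. Qed.
Let c0 : 0 <= c. Proof. by rewrite -cB mulr_ge0. Qed.
Let pen_ge0 (y : V) : 0 <= c * penal b y.
Proof. by rewrite mulr_ge0//; apply: sumr_ge0 => i _; exact: gbump_ge0. Qed.
(** The origin of [c = 4 B]: outside the box [penal] is at least one half. *)
Let pen_out (y : V) : ~ box P y -> 2 * B <= c * penal b y.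
Proof.
move=> /(penal_out P0)/(ler_wpM2l c0); apply: le_trans.
by rewrite -cB (_ : 4 * B * (1 / 2) = 2 * B)//; field.
Qed.

Let pow_pen : 0 <= b `^ (sigma / 2) := powR_ge0 _ _.

Let fracLap_pen (y : V) : c * fracLap sigma (penal b) y <= c * CP.
Proof.
rewrite ler_wpM2l// (le_trans (fracLap_penal s02 N0 y b0))//.
(* As [2 ^ sigma <= 4 <= 6], the constant of the discrete operator serves the fractional Laplacian
   too. *)
rewrite mulrA ler_wpM2r// mulrC ler_wpM2r//.
have /andP[_ s2] := s02.
rewrite (le_trans (_ : 2 `^ sigma <= 2 `^ 2))//; first by rewrite ler_powR// ?ler1n// ltW.
by rewrite (powR_mulrn 2)// expr2; lra.
Qed.

Let dfracLap_pen h (y : V) : 0 < h -> c * dfracLap sigma h (penal b) y <= c * CP.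
Proof. by move=> h0; rewrite ler_wpM2l// dfracLap_penal. Qed.

Lemma side_both (F : R -> R) (f : V * R -> R) (u0 w0 : V -> R) (w : nat -> V -> R) :
  lipmono F LF -> trig P w0 -> (forall k, (k <= n)%N -> trig P (w k)) ->
  (forall k x, (k <= n)%N -> `|w k x - w0 x| <= k%:R * lam * C + e) ->
  (forall k x, (k < n)%N -> box P x ->
    `|(w k.+1 x - w k x) / lam - F (fracLap sigma (w k.+1) x) - f (x, k.+1%:R * lam)| <= e) ->
  (forall x, box P x -> `|w0 x - u0 x| <= e) -> (forall x, `|u0 x - w0 x| <= B) ->
  (forall x (s t : R), box P x -> 0 <= s <= T -> 0 <= t <= T -> `|s - t| <= rho ->
    `|f (x, s) - f (x, t)| <= e) ->
  (forall x (s : R), 0 <= s <= T ->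
    `|F (C0 + c * CP)| + `|F (- (C0 + c * CP))| + `|f (x, s)| <= K) ->
  side F f u0 w0 w /\
  side (fun s => - F (- s)) (fun p => - f p) (fun x => - u0 x) (fun x => -1 * w0 x)
    (fun k x => -1 * w k x).
Proof.
move=> hF tw0 tw near res init out modu grow; split; split => //.
- by move=> k x /(near k x); rewrite ler_norml => /andP[]; lra.
- by move=> k x kn /(res k x kn); rewrite ler_norml => /andP[]; lra.
- by move=> x /init; rewrite ler_norml => /andP[]; lra.
- by move=> x; exact: le_trans (ler_norm _) (out x).
- by move=> x s t bx sT tT /(modu x s t bx sT tT); apply: le_trans; exact: ler_norm.
- move=> x s /(grow x s); have := ler_norm (f (x, s)); have := ler_norm (F (C0 + c * CP)).
  by have := normr_ge0 (F (- (C0 + c * CP))); lra.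
- exact: lipmono_opp hF.
- exact: trigZ.
- by move=> k kn; apply: trigZ; exact: tw.
- by move=> k x /(near k x); rewrite ler_norml => /andP[]; lra.
- move=> k x kn /(res k x kn); rewrite fracLapZ//; last exact: nice_trig (tw k.+1 kn).
  rewrite !mulN1r opprK (_ : (- w k.+1 x - - w k x) / lam = - ((w k.+1 x - w k x) / lam)); last by ring.
  by rewrite ler_norml => /andP[]; lra.
- by move=> x /init; rewrite ler_norml => /andP[]; lra.
- by move=> x; have := out x; rewrite ler_norml => /andP[]; lra.
- by move=> x s t bx sT tT /(modu x s t bx sT tT); rewrite ler_norml => /andP[]; lra.
- move=> x s /(grow x s); have := ler_norm (- f (x, s)); have := ler_norm (- F (- (C0 + c * CP))).
  by rewrite !normrN; have := normr_ge0 (F (C0 + c * CP)); lra.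
Qed.

Section side_lemmas.
Variables (F : R -> R) (f : V * R -> R) (u0 w0 : V -> R) (w : nat -> V -> R) (v : V * R -> R).
Hypothesis sd : side F f u0 w0 w.
Hypothesis hB : forall y (r : R) k, 0 <= r <= T -> (k <= n)%N -> `|v (y, r) - w k y| <= B.

Local Notation gapv := (gap lam delta (10 * e) (fun y r => v (y, r)) w (fun y => c * penal b y)).

Let F_pen (a p q : R) : p <= q -> LF * q <= e -> 0 <= q -> F (a + p) <= F a + e.
Proof.
move=> pq hq q0; have hF := side_lip sd.
have := @lipmono_ub _ F LF (a + p) a q (ltW LF0) hF.
have -> : a + p - a <= q by rewrite addrAC subrr add0r.
by rewrite q0 => /(_ isT isT); move: hq; lra.
Qed.

Let pcp : 0 <= c * CP. Proof. by rewrite !mulr_ge0. Qed.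

(** The slope [10 * e] in time beats the total error [9 * e]: [5 * e] from the interior inequality
    and one [e] each from the residual, the modulus of [f], [lam / delta] and [gam / lam]. *)
Lemma side_doubling gam : 0 <= gam -> gam / lam <= e ->
  (forall y (r : R) k, 0 <= r <= rho -> r <= T -> (k <= n)%N -> k%:R * lam <= 2 * rho ->
    v (y, r) - w k y - c * penal b y <= 4 * e) ->
  (forall k y (s : R), (k < n)%N -> box P y -> rho <= s <= T ->
    (forall z (r : R), 0 <= r <= T -> gapv k.+1 z r <= gapv k.+1 y s + gam) ->
    2 * (s - k.+1%:R * lam) / delta + 10 * e <= F (fracLap sigma (w k.+1) y) + f (y, s) + 5 * e) ->
  (exists x (s : R) k, [/\ 0 <= s <= T, (k <= n)%N &
    forall y (r : R) j, 0 <= r <= T -> (j <= n)%N -> gapv j y r <= gapv k x s + gam]) ->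
  forall y (r : R) j, 0 <= r <= T -> (j <= n)%N -> gapv j y r <= 4 * e + gam.
Proof.
move=> g0 gl hi hint hmx.
apply: (@doubling R V T lam delta rho (10 * e) gam e e (5 * e) (4 * e) B n F
  (fun y s => f (y, s)) (fun y s => v (y, s)) w (fun k y => fracLap sigma (w k) y)
  (fun y => c * penal b y) (box P)) => //.
- by rewrite mulr_ge0// ltW.
- by rewrite mulr_ge0// ltW.
- by move=> y r k rT kn; apply: le_trans (hB y rT kn); exact: ler_norm.
- by move=> y /pen_out; have := B0; lra.
- by move=> k y kn Dy; exact: (side_res sd).
- by move=> y s t; exact: (side_mod sd).
- by have := e0; have := hlam; lra.
Qed.

Lemma side_viscosity : sub_test sigma T F f v -> {within strip T, continuous v} ->
  (forall x (s : R), box P x -> 0 <= s <= rho -> s <= T -> v (x, s) <= u0 x + e) ->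
  forall y (r : R) j, 0 <= r <= T -> (j <= n)%N -> gapv j y r <= 5 * e.
Proof.
move=> st cv hi y r j rT jn.
have e0' := e0.
have : gapv j y r <= 4 * e + 0.
  apply: side_doubling => //; first by rewrite mul0r ltW.
  - move=> z s k /andP[s0 sr] sT kn kl; have sT' : 0 <= s <= T by rewrite s0.
    have [Dz|nD] := pselect (box P z).
      have h1 := hi z s Dz _ sT; rewrite s0 sr in h1; have {}h1 := h1 isT.
      have h2 := side_init sd Dz; have h3 := side_near sd z kn; have h4 := pen_ge0 z.
      have h5 : k%:R * lam * C <= 2 * rho * C by rewrite ler_wpM2r.
      have h6 := hC; lra.
    have h1 := pen_out nD; have h2 := le_trans (ler_norm _) (hB z sT' kn); have h3 := B0; lra.
  - move=> k z s kn Dz /andP[rs sT] mx.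
    have sT' : 0 < s <= T by rewrite (lt_le_trans rho0 rs).
    have := @viscosity_interior R N sigma T s02 N0 F f v P c b (k.+1%:R * lam) delta (10 * e) s (w k.+1) z
      st (side_trig sd kn) b0 sT' _.
    have mx' (q : V) (r0 : R) : 0 <= r0 <= T ->
      v (q, r0) - w k.+1 q - (r0 - k.+1%:R * lam) ^+ 2 / delta - c * penal b q - 10 * e * r0 <=
      v (z, s) - w k.+1 z - (s - k.+1%:R * lam) ^+ 2 / delta - c * penal b z - 10 * e * s.
      by move=> /(mx q); rewrite addr0.
    move=> /(_ mx') h1.
    have h2 := F_pen (fracLap sigma (w k.+1) z) (fracLap_pen z) hpen pcp.
    lra.
  - have [x [s [k [h1 h2 h3]]]] := @viscosity_exact_max R N T v P B c b lam delta (10 * e) w n (ltW T0) (ltW lam0)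
      lamT cv (side_trig sd) (ltW P0) b0 c0 (mulr_ge0 (ler0n _ 10) (ltW e0)) delta0 hB pen_out.
    by exists x, s, k; split => // z q i; rewrite addr0; exact: h3.
lra.
Qed.

Lemma side_scheme (h tau : R) : 0 < h -> 0 < tau ->
  tau <= 1 / (LF * Csigma N sigma) * h `^ sigma -> explicit_scheme sigma T F f u0 h tau v ->
  tau <= rho -> tau / delta <= e ->
  (forall k x, (k <= n)%N -> LF * `|dfracLap sigma h (w k) x - fracLap sigma (w k) x| <= e) ->
  (forall x, dfracLap sigma h w0 x <= C0) ->
  forall y (r : R) j, 0 <= r <= T -> (j <= n)%N -> gapv j y r <= 5 * e.
Proof.
move=> h0 tau0 cfl sch taurho taudelta cons hC0 y r j rT jn.
have e0' := e0; have hF := side_lip sd.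
(* The slack gets divided by [lam] in the doubling argument and by [tau] in the explicit step, and
   it also enters the final bound undivided. *)
pose gam := Num.min (e * lam) (Num.min (e * tau) e).
have g0 : 0 < gam by rewrite !lt_min !mulr_gt0.
have g1 : gam / lam <= e by rewrite ler_pdivrMr// ge_min lexx.
have g2 : gam / tau <= e by rewrite ler_pdivrMr// !ge_min lexx orbT.
have g3 : gam <= e by rewrite !ge_min lexx !orbT.
have bpen : bdd (fun z : V => c * penal b z) by apply: bddZ; exact: bdd_penal.
have bw0 : bdd w0 := bdd_trig (side_trig0 sd).
have : gapv j y r <= 4 * e + gam.
  apply: side_doubling => //; first exact: ltW.
  - move=> z s k /andP[s0 sr] sT kn kl; have sT' : 0 <= s <= T by rewrite s0.
    (* The barrier lies above [u0] inside the box by [side_init] and outside by the penalty. The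
       [4 * e] are its own [e], its growth up to time [rho], and two from [side_near]. *)
    have bphi : bdd (fun q => (w0 q + c * penal b q) + e).
      by apply: bddD; [exact: bddD|exact: bdd_cst].
    have := explicit_barrier s02 LF0 hF h0 tau0 cfl sch bphi K0 _ _ z sT'.
    have i1 x : u0 x <= w0 x + c * penal b x + e.
      have [Dx|nD] := pselect (box P x).
        by have := side_init sd Dx; have := pen_ge0 x; lra.
      by have := pen_out nD; have := side_out sd x; have := B0; lra.
    have i2 x (q : R) : 0 <= q <= T -> F (dfracLap sigma h (fun q => (w0 q + c * penal b q) + e) x) + f (x, q) <= K.
      move=> qT; apply: le_trans (side_growth sd x qT); rewrite lerD2r.
      apply: (lipmono_le (ltW LF0) hF).
      rewrite dfracLapD//; [|exact: bddD|exact: bdd_cst].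
      rewrite dfracLap_cst// addr0 dfracLapD// dfracLapZ//; last exact: bdd_penal.
      by rewrite lerD// dfracLap_pen.
    move=> /(_ i1 i2) h1.
    have h3 := side_near sd z kn.
    have h5 : k%:R * lam * C <= 2 * rho * C by rewrite ler_wpM2r.
    have h6 := hC; have h7 : K * s <= K * rho by rewrite ler_wpM2l.
    have h8 := hK; lra.
  - move=> k z s kn Dz /andP[rs sT] mx.
    have sT' : tau <= s <= T by rewrite (le_trans taurho rs).
    have bw : bdd (w k.+1) := bdd_trig (side_trig sd kn).
    have := explicit_interior s02 LF0 hF h0 tau0 cfl sch bw bpen delta0 sT' mx.
    rewrite dfracLapZ//; last exact: bdd_penal.
    have s0 : 0 <= s by rewrite (le_trans (ltW rho0) rs).
    (* The [5 * e] are the operator on the penalty, the consistency on [w k.+1], the shift of [f] by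
       [tau], [tau / delta] and [gam / tau]. *)
    have h1 := F_pen (dfracLap sigma h (w k.+1) z) (dfracLap_pen z h0) hpen pcp.
    have h2 := le_trans (le_trans (ler_norm _) (lipmono_norm (dfracLap sigma h (w k.+1) z) (fracLap sigma (w k.+1) z) (ltW LF0) hF)) (cons k.+1 z kn).
    have m1 : 0 <= s - tau <= T.
      by rewrite subr_ge0 (le_trans taurho rs)/= (le_trans _ sT)// gerBl ltW.
    have m2 : `|s - tau - s| <= rho by rewrite addrAC subrr add0r normrN gtr0_norm.
    have sT2 : 0 <= s <= T by rewrite s0.
    have h3 := side_mod sd Dz m1 sT2 m2.
    lra.
  - apply: (@near_max_exists R V T (B + 0) gam gapv n 0 (ltW T0) g0) => z q k qT kn.
    rewrite addr0 /gap.
    have h1 := le_trans (ler_norm _) (hB z qT kn); have h2 := pen_ge0 z.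
    have h3 : 0 <= (q - k%:R * lam) ^+ 2 / delta by rewrite divr_ge0 ?sqr_ge0// ltW.
    have h4 : 0 <= 10 * e * q by rewrite !mulr_ge0 ?(ltW e0)//; have /andP[] := qT.
    lra.
lra.
Qed.

End side_lemmas.
End one_sided.

(** * Convergence *)

Section uniform_bounds.
Context {R : realType} {N : nat}.
Local Notation V := 'rV[R]_N.
Implicit Types (f u v U : V * R -> R).

Lemma cyl_modulus (T P e : R) v : {within strip T, continuous v} -> 0 < e ->
  exists2 r, 0 < r & forall x (s t : R), box P x -> 0 <= s <= T -> 0 <= t <= T -> `|s - t| <= r ->
    `|v (x, s) - v (x, t)| <= e.
Proof.
move=> cv e0; have cw := continuous_subspaceW (@cyl_strip R N T P) cv.
have [r r0 hr] := compact_unif_cont (@compact_cyl R N T P) cw e0.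
exists (r / 2); first by rewrite divr_gt0.
move=> x s t bx sT tT st; apply: hr; [by split => //=; rewrite in_itv|by split => //=; rewrite in_itv|].
split => /=; first exact: ballxx.
by rewrite /ball/= (le_lt_trans st)// ltr_pdivrMr// ltr_pMr// ltr1n.
Qed.

Lemma slice_continuous (T t : R) f : {within strip T, continuous f} -> 0 <= t <= T ->
  continuous (fun x => f (x, t)).
Proof.
move=> /subspace_continuousP cf tT x.
move=> A nA; have : within (strip T) (nbhs (x, t)) (f @^-1` A) := cf (x, t) tT A nA.
move=> [[D E]/= [nD nE] hDE].
apply: (@filterS V (nbhs x) (nbhs_filter x) _ _ _ nD) => y Dy.
by apply: (hDE (y, t)) => //; split => //=; exact: nbhs_singleton.
Qed.

Lemma compact_box_bound (K : set (V * R)) : compact K -> exists2 r, 0 <= r & forall p, K p -> box r p.1.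
Proof.
move=> /compact_bounded[M [_ hM]]; exists (`|M| + 1); first by rewrite addr_ge0.
move=> p Kp i; have := hM (`|M| + 1) _ p Kp; rewrite (le_lt_trans (ler_norm M)) ?ltrDl//.
move=> /(_ isT); apply: le_trans; rewrite prod_normE/= le_max; apply/orP; left.
rewrite /Num.norm/= mx_normrE.
exact: (le_bigmax _ (fun ij : 'I_1 * 'I_N => `|p.1 ij.1 ij.2|) (0, i)).
Qed.

(** With [b = P ^- 2] a large [P] makes the operators on the penalty small everywhere and, through
    the second bound, the penalty itself small on a given compact set. *)
Lemma small_penalty (sigma A D e : R) : 0 < sigma -> 0 <= A -> 0 <= D -> 0 < e ->
  exists2 P, 1 <= P & A * ((P ^+ 2)^-1) `^ (sigma / 2) <= e /\ D * (P ^+ 2)^-1 <= e.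
Proof.
move=> s0 A0 D0 e0.
have A1 : 0 < A + 1 by rewrite ltr_wpDl.
have D1 : 0 < D + 1 by rewrite ltr_wpDl.
pose q := e / (A + 1); have q0 : 0 < q by rewrite divr_gt0.
pose beta := Num.min (q `^ (2 / sigma)) (e / (D + 1)).
have be0 : 0 < beta by rewrite lt_min powR_gt0//= divr_gt0.
exists (1 + beta^-1); first by rewrite lerDl invr_ge0 ltW.
set P := 1 + _; have P1 : 1 <= P by rewrite lerDl invr_ge0 ltW.
have P0 : 0 < P by exact: lt_le_trans P1.
have b0 : 0 <= (P ^+ 2)^-1 by rewrite invr_ge0 sqr_ge0.
have bb : (P ^+ 2)^-1 <= beta.
  rewrite -[leRHS]invrK lef_pV2 ?posrE ?exprn_gt0 ?invr_gt0//.
  apply: (@le_trans _ _ P); first by rewrite lerDr.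
  by rewrite expr2 ler_peMr// ltW.
split.
  apply: (@le_trans _ _ (A * q)); last by rewrite /q mulrCA ler_piMr ?(ltW e0)// ler_pdivrMr// mul1r lerDl.
  rewrite ler_wpM2l//; apply: (@le_trans _ _ ((q `^ (2 / sigma)) `^ (sigma / 2))).
    apply: ge0_ler_powR; rewrite ?nnegrE ?powR_ge0//; first by rewrite divr_ge0// ltW.
    by apply: (le_trans bb); rewrite ge_min lexx.
  rewrite -powRrM (_ : 2 / sigma * (sigma / 2) = 1) ?powRr1 ?(ltW q0)//.
  by field; rewrite gt_eqF.
apply: (@le_trans _ _ (D * (e / (D + 1)))).
  by rewrite ler_wpM2l// (le_trans bb)// ge_min lexx orbT.
by rewrite mulrCA ler_piMr ?(ltW e0)// ler_pdivrMr// mul1r lerDl.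
Qed.

Lemma grid_time (T lam r : R) n : 0 < lam -> n%:R * lam = T -> 0 <= r <= T ->
  exists2 j, (j <= n)%N & (r - j%:R * lam) ^+ 2 <= lam ^+ 2.
Proof.
move=> l0 nT /andP[r0 rT]; have rl : 0 <= r / lam by rewrite divr_ge0// ltW.
have /andP[h1 h2] := truncn_itv rl; set j := Num.truncn _ in h1 h2; exists j.
  rewrite -(ler_nat R); apply: (le_trans h1); rewrite ler_pdivrMr// nT//.
move: h1 h2; rewrite ler_pdivlMr// ltr_pdivrMr// -nat1r mulrDl mul1r => h1 h2.
apply: lerXn2r; rewrite ?nnegrE ?subr_ge0 ?(ltW l0)//; lra.
Qed.

Variables (sigma T LF : R) (F : R -> R).
Hypothesis s02 : 0 < sigma < 2.
Hypothesis LF0 : 0 < LF.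
Hypothesis hF : lipmono F LF.

Lemma explicit_scheme_opp f (u0 : V -> R) h tau U : 0 < h -> 0 < tau ->
  explicit_scheme sigma T F f u0 h tau U ->
  explicit_scheme sigma T (fun s => - F (- s)) (fun p => - f p) (fun x => - u0 x) h tau (fun p => - U p).
Proof.
move=> h0 t0 [/bounded_onP[B hB] e1 e2]; split.
- by apply/bounded_onP; exists B => p sp; rewrite normrN; exact: hB.
- by move=> x t tt; rewrite e1.
- move=> x t tt; rewrite e2//.
  rewrite (_ : (fun y => - U (y, t - tau)) = fun y => -1 * U (y, t - tau)); last first.
    by apply/funext => y; rewrite mulN1r.
  rewrite dfracLapZ//; first by rewrite mulN1r opprK; ring.
  exists B => y; apply: hB; have /andP[t1 t2] := tt.
  by rewrite /strip/= subr_ge0 t1 (le_trans _ t2)// gerBl ltW.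
Qed.

Lemma explicit_ub f (u0 : V -> R) h tau U (B Bf : R) : 0 < h -> 0 < tau ->
  tau <= 1 / (LF * Csigma N sigma) * h `^ sigma ->
  explicit_scheme sigma T F f u0 h tau U -> 0 <= Bf ->
  (forall x, u0 x <= B) -> (forall p, strip T p -> f p <= Bf) ->
  forall x (s : R), 0 <= s <= T -> U (x, s) <= B + T * (Bf + `|F 0|).
Proof.
move=> h0 t0 cfl sch Bf0 hu hf x s sT.
have K0 : 0 <= Bf + `|F 0| by rewrite addr_ge0.
have gr (y : V) (r : R) : 0 <= r <= T -> F (dfracLap sigma h (fun=> B) y) + f (y, r) <= Bf + `|F 0|.
  by move=> rT; rewrite dfracLap_cst// addrC lerD ?ler_norm//; exact: hf.
have := explicit_barrier s02 LF0 hF h0 t0 cfl sch (bdd_cst B) K0 hu gr x sT.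
move=> /le_trans; apply; rewrite lerD2l mulrC ler_wpM2r//; by case/andP: sT.
Qed.

End uniform_bounds.

Lemma sandwich (R : realType) (a b w X : R) :
  a - w <= X -> w - a <= X -> b - w <= X -> w - b <= X -> `|a - b| <= 2 * X.
Proof. by move=> *; rewrite ler_norml; apply/andP; split; lra. Qed.

Lemma div_succ_le (R : realType) (a r e : R) : 0 <= a -> 0 <= r -> r <= e / (a + 1) -> a * r <= e.
Proof.
move=> a0 r0; rewrite ler_pdivlMr ?ltr_wpDl// mulrDr mulr1 mulrC; apply: le_trans.
by rewrite lerDl.
Qed.

Lemma le_gap (R : realType) (v w q p z e Te : R) : v - w - q - p - z <= 5 * e ->
  q <= e -> p <= e -> z <= Te -> v - w <= 7 * e + Te.
Proof. move=> *; lra. Qed.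

Theorem theorem3p9 (R : realType) (N : nat) (sigma T L_F : R) (F : R -> R)
    (f : 'rV[R]_N * R -> R) (u0 : 'rV[R]_N -> R) (M : R -> nat)
    (u : 'rV[R]_N * R -> R) (U : R -> 'rV[R]_N * R -> R) :
  (0 < N)%N ->
  0 < sigma < 2 ->
  0 < T ->
  0 < L_F ->
  (forall l1 l2, F l1 - F l2 <= L_F * Num.max 0 (l1 - l2)) ->
  {within strip T, continuous f} ->
  [bounded f p | p in strip T] ->
  continuous u0 ->
  [bounded u0 x | x in [set: 'rV[R]_N]] ->
  (forall h, 0 < h -> (0 < M h)%N) ->
  T / (M h)%:R @[h --> 0^'+] --> 0 ->
  (forall h, 0 < h -> T / (M h)%:R <= 1 / (L_F * Csigma N sigma) * h `^ sigma) ->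
  viscosity_solution sigma T F f u0 u ->
  (forall h, 0 < h -> explicit_scheme sigma T F f u0 h (T / (M h)%:R) (U h)) ->
  forall K : set ('rV[R]_N * R), compact K -> K `<=` strip T ->
    {uniform K, U @ 0^'+ --> u}.
Proof.
move=> N0 s02 T0 LF0 hF cf /bounded_onP[Bf0 hf0] cu0 /bounded_onP[B00 hu00] M0 tau_cvg cfl
  [usub usuper] sch K cK KT.
have s0 : 0 < sigma by have /andP[] := s02.
have st0 : strip T (0 : 'rV[R]_N, 0 : R) by rewrite /strip/= lexx ltW.
have [/bounded_onP[Bu hu] uusc uini _] := usub; have [_ ulsc uini' _] := usuper.
have Bu0 : 0 <= Bu := le_trans (normr_ge0 _) (hu _ st0).
pose Bf := Bf0; have hf p : strip T p -> `|f p| <= Bf by exact: hf0.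
have Bf_ge0 : 0 <= Bf := le_trans (normr_ge0 _) (hf _ st0).
pose B0 := B00; have hu0 x : `|u0 x| <= B0 by exact: hu00.
have B0_ge0 : 0 <= B0 := le_trans (normr_ge0 _) (hu0 0).
have cu : {within strip T, continuous u} := semicontinuous_continuous uusc ulsc.
have cuN : {within strip T, continuous (fun p => - u p)} by move=> p; apply: cvgN; exact: cu.
pose B1 := B0 + T * (Bf + `|F 0|).
have B01 : B0 <= B1 by rewrite lerDl mulr_ge0 ?(ltW T0)// addr_ge0.
(* Both [u] and the [U h] are bounded by [Bu + B1], and the approximate solutions by [B1]. *)
pose B := Bu + 2 * B1.
have B1_ge0 : 0 <= B1 := le_trans B0_ge0 B01.
have B_ge0 : 0 <= B by rewrite addr_ge0// mulr_ge0.
pose c := 4 * B; have c_ge0 : 0 <= c by rewrite mulr_ge0.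
have [RK RK0 hRK] := compact_box_bound cK.
suff main (eps : R) : 0 < eps -> \forall h \near 0^'+, forall p, K p -> `|u p - U h p| < eps.
  move=> Q /uniform_nbhs[E [entE subQ]].
  have [eps /= eps0 hE] : exists2 eps : R, 0 < eps & [set xy : R * R | `|xy.1 - xy.2| < eps] `<=` E.
    by move: entE; rewrite -entourage_ballE => -[eps/= e0 he]; exists eps => // -[a b] ab; apply: he.
  apply: filterS (main eps eps0) => h hh; apply: subQ => p Kp; apply: hE; exact: hh.
move=> eps0.
(* Each of [u] and [U h] will be within [7 e + 10 e T] of the same [w j]: [5 e] from the comparison,
   [e] for rounding the time to the grid, [e] for the penalty on [K], and the slope in time. The two
   distances add up to [X0 * e]. *)
pose X0 : R := 14 + 20 * T; have X00 : 0 < X0 by rewrite ltr_wpDr// mulr_ge0// ltW.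
pose e := eps / (2 * X0).
have e0 : 0 < e by rewrite divr_gt0// mulr_gt0.
have eX : X0 * e < eps.
  have -> : X0 * e = eps / 2 by rewrite /e; field; rewrite gt_eqF.
  by rewrite ltr_pdivrMr// ltr_pMr// ltr1n.
have [P P1 [hpen hK]] := @small_penalty R sigma (L_F * (c * (6 * N%:R))) (c * (N%:R * RK ^+ 2)) e s0
  (mulr_ge0 (ltW LF0) (mulr_ge0 c_ge0 (mulr_ge0 (ler0n _ 6) (ler0n _ N))))
  (mulr_ge0 c_ge0 (mulr_ge0 (ler0n _ N) (sqr_ge0 _))) e0.
pose b := (P ^+ 2)^-1; have b0 : 0 <= b by rewrite invr_ge0 sqr_ge0.
pose CP := 6 * N%:R * b `^ (sigma / 2).
have hpen' : L_F * (c * CP) <= e by rewrite /CP !mulrA in hpen *.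
have cg t : 0 <= t <= T -> continuous (fun x => f (x, t)) := slice_continuous cf.
have hg t x : 0 <= t <= T -> `|f (x, t)| <= Bf by move=> tT; exact: hf.
have [w0 [C [tw0 hw0 aw0 C_ge0 hrun]]] :=
  approx_family (g := fun t x => f (x, t)) s02 N0 T0 LF0 hF cg hg cu0 hu0 P1 e0.
have [C0' hC0'] := fracLap_trig_bdd s02 N0 tw0.
pose C0 := C0' + 1.
pose K1 := `|F (C0 + c * CP)| + `|F (- (C0 + c * CP))| + Bf.
have K1_ge0 : 0 <= K1 by rewrite !addr_ge0.
have [ru ru0 hru] := cyl_modulus P cu e0; have [rf rf0 hrf] := cyl_modulus P cf e0.
have C1 : 0 < 2 * C + 1 by rewrite ltr_wpDl// mulr_ge0.
have K2 : 0 < K1 + 1 by rewrite ltr_wpDl.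
(* The four bounds are the moduli in time of [u] and [f] on the cylinder, the drift of the
   approximate solutions in the initial layer, and the growth of the barrier for the scheme. *)
pose rho := Num.min (Num.min ru rf) (Num.min (e / (2 * C + 1)) (e / (K1 + 1))).
have rho0 : 0 < rho by rewrite !lt_min ru0 rf0/=; apply/andP; split; rewrite divr_gt0.
have rhou : rho <= ru by rewrite !ge_min lexx.
have rhof : rho <= rf by rewrite !ge_min lexx orbT.
have rhoC : 2 * rho * C <= e.
  have : rho <= e / (2 * C + 1) by rewrite !ge_min lexx !orbT.
  by move=> /(div_succ_le (mulr_ge0 (ler0n _ 2) C_ge0) (ltW rho0)); rewrite mulrAC.
have rhoK : K1 * rho <= e.
  have : rho <= e / (K1 + 1) by rewrite !ge_min lexx !orbT.
  exact: div_succ_le (ltW rho0).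
have Bp : 0 < B + 1 by rewrite ltr_wpDl.
(* Two times at distance [rho] or more then cost at least [B + 1], more than [v - w] can ever
   gain. *)
pose delta := rho ^+ 2 / (B + 1).
have delta0 : 0 < delta by rewrite divr_gt0// exprn_gt0.
have hdelta : delta * B <= rho ^+ 2.
  by rewrite /delta mulrAC ler_pdivrMr// ler_wpM2l ?sqr_ge0// lerDl.
(* The bound by 1 makes [lam ^+ 2 / delta], the cost of rounding a time down to the grid, no larger
   than [lam / delta]. *)
have ml0 : 0 < Num.min (e * delta) 1 by rewrite lt_min ltr01 mulr_gt0.
have [n0 hn0] := archi_nat T ml0.
pose n := n0.+1; pose lam := T / n%:R.
have nR : 0 < n%:R :> R by rewrite ltr0n.
have lam0 : 0 < lam by rewrite divr_gt0.
have lamT : n%:R * lam = T by rewrite /lam mulrC divfK// gt_eqF.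
have lamm : lam <= Num.min (e * delta) 1 by rewrite ler_pdivrMr.
have lam1 : lam <= 1 by apply: (le_trans lamm); rewrite ge_min lexx orbT.
have lamd : lam / delta <= e by rewrite ler_pdivrMr// (le_trans lamm)// ge_min lexx.
have lamd2 : lam ^+ 2 / delta <= e.
  by rewrite expr2 -mulrA (le_trans _ lamd)// ler_piMl// divr_ge0// ltW.
have [w hw] := hrun n isT.
have tw k : (k <= n)%N -> trig P (w k) by move=> kn; have [] := hw k kn.
have bw k x : (k <= n)%N -> `|w k x| <= B1 by move=> kn; have [_ + _ _] := hw k kn; apply.
have [d0 d00 hd0] := dfracLap_trig s02 N0 tw0 ltr01.
have eL : 0 < e / L_F by rewrite divr_gt0.
have /choice[df hdf] : forall k, exists d, 0 < d /\ ((k <= n)%N -> forall h, 0 < h < d -> forall x,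
    `|dfracLap sigma h (w k) x - fracLap sigma (w k) x| <= e / L_F).
  move=> k; have [kn|] := boolP (k <= n)%N; last by exists 1.
  by have [d x1 x2] := dfracLap_trig s02 N0 (tw k kn) eL; exists d.
have [d1 d10 hd1] := finite_min n (fun k => (hdf k).1).
have grow (x : 'rV[R]_N) (s : R) : 0 <= s <= T ->
    `|F (C0 + c * CP)| + `|F (- (C0 + c * CP))| + `|f (x, s)| <= K1.
  by move=> sT; rewrite lerD2l; exact: hf.
have [side_p side_m] : side sigma T L_F P e C rho lam B c K1 C0 n F f u0 w0 w /\
    side sigma T L_F P e C rho lam B c K1 C0 n (fun s => - F (- s)) (fun p => - f p)
      (fun x => - u0 x) (fun x => -1 * w0 x) (fun k x => -1 * w k x).
  apply: side_both => //.
  - by move=> k x kn; have [_ _ + _] := hw k kn; apply.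
  - by move=> k x kn bx; have [_ _ _ +] := hw k.+1 kn; apply.
  - move=> x; apply: (le_trans (ler_normB _ _)); rewrite /B mulr_natl mulr2n addrA.
    apply: lerD; last exact: le_trans (hw0 x) B01.
    by apply: (le_trans (hu0 x)); apply: (le_trans B01); rewrite lerDr.
  - by move=> x s t bx sT tT st; apply: hrf => //; exact: le_trans st rhof.
have Bdiff v k y r : (forall p, strip T p -> `|v p| <= Bu + B1) -> 0 <= r <= T -> (k <= n)%N -> `|v (y, r) - w k y| <= B.
  move=> hv rT kn; apply: (le_trans (ler_normB _ _)).
  rewrite /B mulr_natl mulr2n addrA lerD//; [exact: hv|exact: bw].
have BdiffN v k y r : (forall p, strip T p -> `|v p| <= Bu + B1) -> 0 <= r <= T -> (k <= n)%N -> `|- v (y, r) - -1 * w k y| <= B.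
  by move=> hv rT kn; rewrite mulN1r -opprD normrN; exact: Bdiff.
have huB p : strip T p -> `|u p| <= Bu + B1 by move=> sp; apply: (le_trans (hu p sp)); rewrite lerDl.
have gap_u := side_viscosity s02 N0 T0 LF0 P1 e0 rho0 delta0 lam0 lamT B_ge0 (erefl c) C_ge0
  rhoC hdelta lamd hpen' side_p (fun y r k => @Bdiff u k y r huB) (sub_test_sub usub) cu.
have gap_u' := side_viscosity s02 N0 T0 LF0 P1 e0 rho0 delta0 lam0 lamT B_ge0 (erefl c) C_ge0
  rhoC hdelta lamd hpen' side_m (fun y r k => @BdiffN u k y r huB) (sub_test_super s02 N0 usuper) cuN.
have tau_small : \forall h \near 0^'+, T / (M h)%:R <= Num.min rho (e * delta).
  have m0 : 0 < Num.min rho (e * delta) by rewrite lt_min rho0 mulr_gt0.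
  move/cvgr0Pnorm_le: tau_cvg => /(_ _ m0); apply: filterS => h; exact: (le_trans (ler_norm _)).
(* Everything chosen so far is independent of [h], which only has to make the consistency errors and
   [tau] small. *)
near=> h => p Kp.
have h0 : 0 < h by near: h; exact: nbhs_right_gt.
have hd0' : h < d0 by near: h; exact: nbhs_right_lt.
have hd1' : h < d1 by near: h; exact: nbhs_right_lt.
pose tau := T / (M h)%:R.
have : tau <= Num.min rho (e * delta) by rewrite /tau; near: h.
rewrite le_min => /andP[taurho taud].
have tau0 : 0 < tau by rewrite divr_gt0// ltr0n M0.
have taud' : tau / delta <= e by rewrite ler_pdivrMr.
have schU := sch h h0; have schN := explicit_scheme_opp s02 h0 tau0 schU.
have cflU := cfl h h0.
have hUB q : strip T q -> `|U h q| <= Bu + B1.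
  case: q => x s sT; apply: (@le_trans _ _ B1); last by rewrite lerDr.
  have k1 := explicit_ub s02 LF0 hF h0 tau0 cflU schU Bf_ge0 (fun x => le_trans (ler_norm _) (hu0 x))
    (fun q sq => le_trans (ler_norm _) (hf q sq)) x sT.
  have l1 y : - u0 y <= B0 by rewrite (le_trans (ler_norm _))// normrN.
  have l2 q : strip T q -> - f q <= Bf by move=> sq; rewrite (le_trans (ler_norm _))// normrN hf.
  have k2 := explicit_ub s02 LF0 (lipmono_opp hF) h0 tau0 cflU schN Bf_ge0 l1 l2 x sT.
  rewrite oppr0 normrN in k2.
  by rewrite ler_norml lerNl k1 k2.
have cons k x : (k <= n)%N -> L_F * `|dfracLap sigma h (w k) x - fracLap sigma (w k) x| <= e.
  move=> kn; rewrite -ler_pdivlMl// mulrC; apply: (hdf k).2 => //.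
  by rewrite h0 (lt_le_trans hd1')// hd1.
have consN k x : (k <= n)%N -> L_F * `|dfracLap sigma h (fun y => -1 * w k y) x - fracLap sigma (fun y => -1 * w k y) x| <= e.
  move=> kn; rewrite dfracLapZ//; last exact: bdd_trig (tw k kn).
  rewrite fracLapZ//; last exact: nice_trig (tw k kn).
  by rewrite -mulrBr mulN1r normrN; exact: cons.
have Aw0 x : `|dfracLap sigma h w0 x| <= C0.
  have h1 : `|dfracLap sigma h w0 x - fracLap sigma w0 x| <= 1 by apply: hd0; rewrite h0.
  have h2 := hC0' x; rewrite -[dfracLap _ _ _ _](subrK (fracLap sigma w0 x)).
  by rewrite (le_trans (ler_normD _ _))// addrC lerD.
have a1 x : dfracLap sigma h w0 x <= C0 := le_trans (ler_norm _) (Aw0 x).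
have a2 x : dfracLap sigma h (fun y => -1 * w0 y) x <= C0.
  rewrite dfracLapZ//; last exact: bdd_trig tw0.
  by rewrite mulN1r (le_trans (ler_norm _))// normrN.
have iu x (s : R) : box P x -> 0 <= s <= rho -> s <= T -> u (x, s) <= u0 x + e.
  move=> bx /andP[z1 z2] sT; have sT' : 0 <= s <= T by rewrite z1.
  have oT : (0 : R) <= 0 <= T by rewrite lexx ltW.
  have m1 : `|s - 0| <= ru by rewrite subr0 ger0_norm// (le_trans z2).
  have := hru x s 0 bx sT' oT m1; rewrite ler_norml => /andP[_].
  by rewrite lerBlDl => /le_trans; apply; rewrite lerD2r.
have iu' x (s : R) : box P x -> 0 <= s <= rho -> s <= T -> - u (x, s) <= - u0 x + e.
  move=> bx /andP[z1 z2] sT; have sT' : 0 <= s <= T by rewrite z1.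
  have oT : (0 : R) <= 0 <= T by rewrite lexx ltW.
  have m1 : `|s - 0| <= ru by rewrite subr0 ger0_norm// (le_trans z2).
  have := hru x s 0 bx sT' oT m1; rewrite ler_norml => /andP[+ _].
  by rewrite lerBrDl lerNl opprD opprK; apply: le_trans; rewrite lerD2r.
have gap_U := side_scheme s02 T0 LF0 P1 e0 rho0 delta0 lam0 lamT B_ge0 (erefl c) C_ge0
  rhoC rhoK K1_ge0 hdelta lamd hpen' side_p (fun y r k => @Bdiff (U h) k y r hUB) h0 tau0 cflU schU
  taurho taud' (fun k x => @cons k x) a1.
have gap_U' := side_scheme s02 T0 LF0 P1 e0 rho0 delta0 lam0 lamT B_ge0 (erefl c) C_ge0
  rhoC rhoK K1_ge0 hdelta lamd hpen' side_m (fun y r k => @BdiffN (U h) k y r hUB) h0 tau0 cflU schN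
  taurho taud' (fun k x => @consN k x) a2.
case: p Kp => x t Kp.
have tT : 0 <= t <= T by have := KT _ Kp.
have [j jn hj] := grid_time lam0 lamT tT.
have hj' : (t - j%:R * lam) ^+ 2 / delta <= e.
  by rewrite (le_trans _ lamd2)// ler_wpM2r// invr_ge0 ltW.
have pb : c * penal b x <= e.
  apply: le_trans hK; have -> : c * (N%:R * RK ^+ 2) * b = c * (N%:R * (b * RK ^+ 2)) by ring.
  by rewrite ler_wpM2l// (penal_le_sqr b0 (hRK _ Kp)).
have et : 10 * e * t <= 10 * e * T.
  have /andP[_ tT2] := tT; apply: ler_wpM2l tT2; exact: mulr_ge0 (ler0n _ 10) (ltW e0).
have g1 := gap_u iu x t j tT jn; have g2 := gap_u' iu' x t j tT jn.
have g3 := gap_U x t j tT jn; have g4 := gap_U' x t j tT jn.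
rewrite /gap -/b in g1 g2 g3 g4.
apply: le_lt_trans eX.
rewrite (_ : X0 * e = 2 * ((7 + 10 * T) * e)); last by rewrite /X0; ring.
rewrite (_ : (7 + 10 * T) * e = 7 * e + 10 * e * T); last by ring.
have k1 := le_gap g1 hj' pb et; have k2 := le_gap g2 hj' pb et.
have k3 := le_gap g3 hj' pb et; have k4 := le_gap g4 hj' pb et.
apply: (@sandwich _ _ _ (w j x)) => //.
  by move: k2; rewrite mulN1r opprK addrC.
by move: k4; rewrite mulN1r opprK addrC.
Unshelve. all: by end_near. Qed.
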